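(* Let $n\in\mathbb{N}$, let $\alpha,\beta\in(0,1]$ with $\beta<\alpha$, and let $p,q\in[1,+\infty]$ be such that $p\le q<\frac{n}{n+\beta-\alpha}$. Then $BV^{\alpha,p}(\mathbb{R}^n)\subset S^{\beta,q}(\mathbb{R}^n)$ with continuous inclusion.
   Context: For $\gamma\in(0,1)$ let $\mu_{n,\gamma}=2^{\gamma}\pi^{-n/2}\Gamma\left(\frac{n+\gamma+1}{2}\right)/\Gamma\left(\frac{1-\gamma}{2}\right)$ and, for $\varphi\in C^\infty_c(\mathbb{R}^n;\mathbb{R}^n)$, $\operatorname{div}^\gamma\varphi(x)=\mu_{n,\gamma}\int_{\mathbb{R}^n}\frac{(y-x)\cdot(\varphi(y)-\varphi(x))}{|y-x|^{n+\gamma+1}}\,dy$; $\operatorname{div}^1$ is the classical divergence. For $\gamma\in(0,1]$ and $p\in[1,+\infty]$, $BV^{\gamma,p}(\mathbb{R}^n)$ is the set of $f\in L^p(\mathbb{R}^n)$ with $|D^\gamma f|(\mathbb{R}^n):=\sup\{\int f\operatorname{div}^\gamma\varphi\,dx:\varphi\in C^\infty_c(\mathbb{R}^n;\mathbb{R}^n),\ \|\varphi\|_{L^\infty}\le1\}<+\infty$, normed by $\|f\|_{L^p}+|D^\gamma f|(\mathbb{R}^n)$ (for $\gamma=1$ this is $L^p$ with finite total variation). For $\beta\in(0,1)$ and $q\in[1,+\infty]$, $S^{\beta,q}(\mathbb{R}^n)$ is the space of $f\in L^q(\mathbb{R}^n)$ for which there is $\nabla^\beta f\in L^q(\mathbb{R}^n;\mathbb{R}^n)$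 (weak fractional gradient) with $\int f\operatorname{div}^\beta\varphi\,dx=-\int\nabla^\beta f\cdot\varphi\,dx$ for all $\varphi\in C^\infty_c(\mathbb{R}^n;\mathbb{R}^n)$, normed by $\|f\|_{L^q}+\|\nabla^\beta f\|_{L^q}$. *)

(* Defs.v *)
From HB Require Import structures.
From mathcomp Require Import all_boot all_order all_algebra.
From mathcomp Require Import all_classical all_reals all_analysis.
Set Implicit Arguments. Unset Strict Implicit. Unset Printing Implicit Defensive.
Import Order.TTheory GRing.Theory Num.Theory.
Import numFieldNormedType.Exports.
Local Open Scope classical_set_scope.
Local Open Scope ring_scope.

Notation Rn R n := (g_sigma_algebraType (@open 'rV[R]_n)).

Section Defs.
Variable R : realType.

Definition dotv n (x y : 'rV[R]_n) : R := \sum_(i < n) x 0 i * y 0 i.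
Definition enorm n (x : 'rV[R]_n) : R := Num.sqrt (dotv x x).

(* mu is (Borel) Lebesgue measure on R^n: it gives every closed box its volume
   (this characterises Lebesgue measure uniquely on the Borel sets) *)
Definition is_lebesgue n (mu : {measure set (Rn R n) -> \bar R}) : Prop :=
  forall a b : 'rV[R]_n, (forall i, a 0 i <= b 0 i) ->
    mu [set x : Rn R n | forall i, a 0 i <= x 0 i <= b 0 i] =
    (\prod_(i < n) (b 0 i - a 0 i))%:E.

(* Euler's Gamma function (used only at positive arguments) *)
Definition Gamma (s : R) : R :=
  Rintegral lebesgue_measure `]0, +oo[%classic
    (fun t => powR t (s - 1) * expR (- t)).

Fixpoint Ck (V W : normedModType R) (k : nat) (f : V -> W) : Prop :=
  match k with
  | 0 => continuous f
  | k.+1 => (forall x v, derivable f x v) /\ (forall v, Ck k ('D_v f))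
  end.
Definition smooth (V W : normedModType R) (f : V -> W) := forall k, Ck k f.

Definition test_field n (phi : 'rV[R]_n -> 'rV[R]_n) : Prop :=
  smooth phi /\ compact (closure [set x | phi x != 0]).
Definition unit_test_field n (phi : 'rV[R]_n -> 'rV[R]_n) : Prop :=
  test_field phi /\ forall x, enorm (phi x) <= 1.

Definition mu_const n (g : R) : R :=
  powR 2 g * powR pi (- (n%:R / 2)) * Gamma ((n%:R + g + 1) / 2)
  / Gamma ((1 - g) / 2).

Definition frac_div n (mu : {measure set (Rn R n) -> \bar R}) (g : R)
  (phi : 'rV[R]_n -> 'rV[R]_n) (x : 'rV[R]_n) : R :=
  mu_const n g * Rintegral mu [set: Rn R n]
    (fun y : Rn R n => dotv (y - x) (phi y - phi x) /
                     powR (enorm (y - x)) (n%:R + g + 1)).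

Definition classical_div n (phi : 'rV[R]_n -> 'rV[R]_n) (x : 'rV[R]_n) : R :=
  \sum_(i < n) 'D_(delta_mx 0 i : 'rV[R]_n) (fun y => phi y 0 i) x.

Definition divg n (mu : {measure set (Rn R n) -> \bar R}) (g : R)
  (phi : 'rV[R]_n -> 'rV[R]_n) : 'rV[R]_n -> R :=
  if g == 1 then classical_div phi else frac_div mu g phi.

Definition Lpnorm n (mu : {measure set (Rn R n) -> \bar R}) (p : \bar R)
  (f : 'rV[R]_n -> R) : \bar R := Lnorm mu p (fun x : Rn R n => (f x)%:E).

Definition inLp n (mu : {measure set (Rn R n) -> \bar R}) (p : \bar R)
  (f : 'rV[R]_n -> R) : Prop :=
  measurable_fun [set: Rn R n] (f : Rn R n -> R) /\ (Lpnorm mu p f < +oo)%E.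

Definition frac_var n (mu : {measure set (Rn R n) -> \bar R}) (g : R)
  (f : 'rV[R]_n -> R) : \bar R :=
  ereal_sup [set (Rintegral mu [set: Rn R n]
                    (fun x : Rn R n => f x * divg mu g phi x))%:E
            | phi in [set phi | unit_test_field phi]].

Definition inBV n (mu : {measure set (Rn R n) -> \bar R}) (g : R) (p : \bar R)
  (f : 'rV[R]_n -> R) : Prop :=
  inLp mu p f /\ (frac_var mu g f < +oo)%E.
Definition BVnorm n (mu : {measure set (Rn R n) -> \bar R}) (g : R) (p : \bar R)
  (f : 'rV[R]_n -> R) : \bar R :=
  (Lpnorm mu p f + frac_var mu g f)%E.

Definition weak_frac_grad n (mu : {measure set (Rn R n) -> \bar R}) (g : R)
  (q : \bar R) (f : 'rV[R]_n -> R) (G : 'rV[R]_n -> 'rV[R]_n) : Prop :=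
  (forall i, measurable_fun [set: Rn R n] (fun x : Rn R n => G x 0 i)) /\
  (Lpnorm mu q (fun x => enorm (G x)) < +oo)%E /\
  forall phi, test_field phi ->
    Rintegral mu [set: Rn R n] (fun x : Rn R n => f x * divg mu g phi x) =
    - Rintegral mu [set: Rn R n] (fun x : Rn R n => dotv (G x) (phi x)).

(* S^{beta,q}(R^n) norm of f computed with the weak gradient G *)
Definition Snorm n (mu : {measure set (Rn R n) -> \bar R}) (q : \bar R)
  (f : 'rV[R]_n -> R) (G : 'rV[R]_n -> 'rV[R]_n) : \bar R :=
  (Lpnorm mu q f + Lpnorm mu q (fun x => enorm (G x)))%E.

End Defs.

(* Main.v *)
Require Import Defs.
From HB Require Import structures.
From mathcomp Require Import all_boot all_order all_algebra.
From mathcomp Require Import all_classical all_reals all_analysis.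
From mathcomp Require Import measurable_realfun ess_sup_inf ring lra.
Import Order.TTheory GRing.Theory Num.Theory.
Import numFieldNormedType.Exports.
Set Implicit Arguments. Unset Strict Implicit. Unset Printing Implicit Defensive.
Local Open Scope classical_set_scope.
Local Open Scope ring_scope.

(* The kernel |z|^-(n+gamma+1) z of div^gamma is a superposition of dilated Gaussian
   gradients, so the beta-gradient of f is a superposition, with a power weight in the
   time variable, of convolutions of f with Gaussian gradients at scale t. The bound on
   the alpha-variation, tested by duality against the inverse superposition, controls
   each piece in L^1 and, through the sup norm of the kernel, in L^oo with powers of t;
   Jensen's inequality interpolates to L^q, and q < n / (n + beta - alpha) makes the
   weight integrable at t = 0. At t = oo the L^p norm of f is used instead. The same
   scheme with the heat flow, which joins f at time 0 to 0 at infinity, bounds f in L^q. *)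

(** Time scales like length squared, so the gradient of order gamma carries the weight
    t^((1-gamma)/2-1). On the half-line the Beta integral shows that r^((alpha-beta)/2-1) convolved
    with t^((1-alpha)/2-1) is a multiple of v^((1-beta)/2-1): the beta-gradient is thus a
    superposition in [r] of alpha-gradients of [f] smoothed at scale [r]. Those have L^1 norm O(1)
    and sup norm O(r^(-n/2)), hence L^q norm O(r^(-(n/2)(1-1/q))), and r^((alpha-beta)/2-1) absorbs
    this at 0 exactly when q(n+beta-alpha) < n. For alpha = 1 the inner weight degenerates to a
    Dirac mass at 0, which is why weights enter through an abstract interface. Two obstacles shape
    the rest. The variation tests [f] only with smooth compactly supported fields, while Gaussian
    kernels have full support: signs are truncated and mollified, and the mollifier is removed by a
    uniform approximation. And [f] is merely in L^p: the identity that recovers it from the heat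
    flow is proved weakly, then read almost everywhere. *)

Definition L1 d (T : measurableType d) (R : realType)
  (m : {measure set T -> \bar R}) (f : T -> R) := m.-integrable setT (EFin \o f).

Lemma le_abs_fine (R : realType) (x : \bar R) : (`|fine x|%:E <= `|x|)%E.
Proof. by case: x => [r| |]; rewrite /= ?lexx// leey. Qed.

(** * Real-valued integrals of integrable functions *)

Section L1_theory.
Context d (T : measurableType d) (R : realType) (m : {measure set T -> \bar R}).
Implicit Types f g : T -> R.

Lemma L1_measurable f : L1 m f -> measurable_fun setT f.
Proof. by move=> /measurable_int /measurable_EFinP. Qed.

Lemma L1_dom f g : measurable_fun setT f -> L1 m g ->
  (forall x, `|f x| <= g x) -> L1 m f.
Proof.
move=> mf Lg fg; apply: (le_integrable _ _ _ Lg) => //; first exact/measurable_EFinP.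
by move=> x _ /=; rewrite lee_fin (le_trans (fg x))// ler_norm.
Qed.

Lemma L1_norm f : L1 m f -> L1 m (fun x => `|f x|).
Proof. exact: integrable_norm. Qed.

Lemma L1_norm_inv f : measurable_fun setT f -> L1 m (fun x => `|f x|) -> L1 m f.
Proof. by move=> mf Lf; apply: (L1_dom mf Lf). Qed.

Lemma L1D f g : L1 m f -> L1 m g -> L1 m (fun x => f x + g x).
Proof. by move=> Lf Lg; apply: (integrableD _ Lf Lg). Qed.

Lemma L1Zl k f : L1 m f -> L1 m (fun x => k * f x).
Proof. by move=> Lf; apply: (integrableZl _ k Lf). Qed.

Lemma L1Zr k f : L1 m f -> L1 m (fun x => f x * k).
Proof.
by move=> /(@L1Zl k); congr (L1 m _); apply/funext => x; rewrite mulrC.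
Qed.

Lemma L1N f : L1 m f -> L1 m (fun x => - f x).
Proof. by move=> /(@L1Zl (-1)); congr (L1 m _); apply/funext => x; rewrite mulN1r. Qed.

Lemma L1B f g : L1 m f -> L1 m g -> L1 m (fun x => f x - g x).
Proof. by move=> Lf Lg; exact: L1D Lf (L1N Lg). Qed.

Lemma L10 : L1 m (fun=> 0 : R).
Proof. exact: integrable0. Qed.

Lemma L1_sum I (s : seq I) (h : I -> T -> R) : (forall i, L1 m (h i)) ->
  L1 m (fun x => \sum_(i <- s) h i x).
Proof.
move=> Lh; elim: s => [|i s IH].
  by under eq_fun do rewrite big_nil; exact: L10.
by under eq_fun do rewrite big_cons; exact: L1D.
Qed.

Lemma L1M_bounded f g (M : R) : L1 m f -> measurable_fun setT g ->
  (forall x, `|g x| <= M) -> L1 m (fun x => f x * g x).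
Proof.
move=> Lf mg gM; apply: (L1_dom (g := fun x => M * `|f x|)).
- by apply: measurable_funM => //; exact: L1_measurable.
- exact/L1Zl/L1_norm.
- by move=> x; rewrite normrM mulrC ler_wpM2r.
Qed.

Lemma EFin_Rint f : L1 m f -> (\int[m]_x f x)%:E = (\int[m]_x (f x)%:E)%E.
Proof. by move=> Lf; rewrite /Rintegral fineK//; exact: (integrable_fin_num _ Lf). Qed.

Lemma Rint_le f g : L1 m f -> L1 m g -> (forall x, f x <= g x) ->
  \int[m]_x f x <= \int[m]_x g x.
Proof. by move=> Lf Lg fg; apply: le_Rintegral. Qed.

Lemma Rint_norm f : L1 m f -> `|\int[m]_x f x| <= \int[m]_x `|f x|.
Proof. by move=> Lf; apply: le_normr_Rintegral. Qed.

Lemma Rint_norm_le f g : measurable_fun setT f -> L1 m g ->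
  (forall x, `|f x| <= g x) -> `|\int[m]_x f x| <= \int[m]_x g x.
Proof.
move=> mf Lg fg; have Lf := L1_dom mf Lg fg.
by rewrite (le_trans (Rint_norm Lf))// Rint_le//; exact: L1_norm.
Qed.

Lemma RintD f g : L1 m f -> L1 m g ->
  \int[m]_x (f x + g x) = \int[m]_x f x + \int[m]_x g x.
Proof. by move=> Lf Lg; rewrite RintegralD. Qed.

Lemma RintB f g : L1 m f -> L1 m g ->
  \int[m]_x (f x - g x) = \int[m]_x f x - \int[m]_x g x.
Proof. by move=> Lf Lg; rewrite RintegralB. Qed.

Lemma RintZl k f : L1 m f -> \int[m]_x (k * f x) = k * \int[m]_x f x.
Proof. by move=> Lf; rewrite RintegralZl. Qed.

Lemma RintZr k f : L1 m f -> \int[m]_x (f x * k) = \int[m]_x f x * k.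
Proof. by move=> Lf; rewrite RintegralZr. Qed.

Lemma RintN f : L1 m f -> \int[m]_x (- f x) = - \int[m]_x f x.
Proof.
move=> Lf; rewrite -mulN1r -RintZl//.
by congr Rintegral; apply/funext => x; rewrite mulN1r.
Qed.

Lemma Rint0 : \int[m]_x (0 : R) = 0.
Proof. by rewrite /Rintegral integral0. Qed.

Lemma Rint_sum I (s : seq I) (h : I -> T -> R) : (forall i, L1 m (h i)) ->
  \int[m]_x (\sum_(i <- s) h i x) = \sum_(i <- s) \int[m]_x h i x.
Proof.
move=> Lh; elim: s => [|i s IH].
  by under eq_Rintegral do rewrite big_nil; rewrite Rint0 big_nil.
under eq_Rintegral do rewrite big_cons.
by rewrite RintD ?IH ?big_cons//; exact: L1_sum.
Qed.

Lemma eq_Rint f g : (forall x, f x = g x) -> \int[m]_x f x = \int[m]_x g x.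
Proof. by move=> /funext ->. Qed.

Lemma eq_L1 f g : (forall x, f x = g x) -> L1 m f -> L1 m g.
Proof. by move=> /funext ->. Qed.

Lemma L1_bound f (M : R) : measurable_fun setT f -> (forall x, 0 <= f x) ->
  (\int[m]_x (f x)%:E <= M%:E)%E -> L1 m f /\ \int[m]_x f x <= M.
Proof.
move=> mf f0 fM.
have Lf : L1 m f.
  apply/integrableP; split; first exact/measurable_EFinP.
  apply: le_lt_trans (ltry M); apply: le_trans fM.
  by under eq_integral do rewrite /= ger0_norm//.
by split => //; rewrite -lee_fin EFin_Rint.
Qed.

Lemma L1_abs_bound f (M : R) : measurable_fun setT f ->
  (\int[m]_x `|f x|%:E <= M%:E)%E -> L1 m f /\ \int[m]_x `|f x| <= M.
Proof.
move=> mf fM; have [|//|/= Lf fM'] := @L1_bound (fun x => `|f x|) M _ _ fM.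
  exact: measurableT_comp.
by split => //; apply: L1_norm_inv.
Qed.

Lemma ae_eq_Rint f g : measurable_fun setT f -> measurable_fun setT g ->
  ae_eq m setT f g -> \int[m]_x f x = \int[m]_x g x.
Proof.
move=> mf mg fg; rewrite /Rintegral; congr fine.
apply: ae_eq_integral => //; [exact/measurable_EFinP|exact/measurable_EFinP|].
by apply: filterS fg => x /= h D; rewrite h.
Qed.

End L1_theory.

(** * Fubini and Tonelli for real-valued integrals *)

Section fubini_L1.
Context d1 d2 (T1 : measurableType d1) (T2 : measurableType d2) (R : realType).
Variables (m1 : {sigma_finite_measure set T1 -> \bar R}).
Variables (m2 : {sigma_finite_measure set T2 -> \bar R}).
Implicit Types f : T1 -> T2 -> R.

Lemma measurable_sec1 f x : measurable_fun setT (fun z => f z.1 z.2) ->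
  measurable_fun setT (f x).
Proof. by move=> mf; exact: (measurableT_comp mf (measurable_pair1 x)). Qed.

Lemma measurable_sec2 f y : measurable_fun setT (fun z => f z.1 z.2) ->
  measurable_fun setT (f^~ y).
Proof. by move=> mf; exact: (measurableT_comp mf (measurable_pair2 y)). Qed.

(** The inner integral may diverge for some [x]. Tonelli applies to the positive and negative parts
    separately, and [fine] is measurable on the infinite values as well. *)
Lemma measurable_Rint2 f : measurable_fun setT (fun z => f z.1 z.2) ->
  measurable_fun setT (fun x => \int[m2]_y f x y).
Proof.
move=> mf; apply: measurableT_comp => //.
pose F := EFin \o (fun z : T1 * T2 => f z.1 z.2).
have mF : measurable_fun setT F by exact/measurable_EFinP.
rewrite (_ : (fun x => _) = (fun x => \int[m2]_y F^\+ (x, y) - \int[m2]_y F^\- (x, y))%E); last first.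
  apply/funext => x; rewrite [LHS]integralE.
  congr (_ - _)%E; apply: eq_integral => y _.
    by rewrite !funeposE.
  by rewrite !funenegE.
apply: emeasurable_funB.
  by apply: (measurable_fun_fubini_tonelli_F (F^\+)%E) => //; exact: measurable_funepos.
by apply: (measurable_fun_fubini_tonelli_F (F^\-)%E) => //; exact: measurable_funeneg.
Qed.

Lemma measurable_uncurry_swap f : measurable_fun setT (fun z => f z.1 z.2) ->
  measurable_fun setT (fun z : T2 * T1 => f z.2 z.1).
Proof.
move=> mf; have ms : measurable_fun setT (fun z : T2 * T1 => (z.2, z.1)).
  by apply: measurable_fun_pair.
exact: (measurableT_comp mf ms).
Qed.

Lemma tonelli_swap (f : T1 -> T2 -> \bar R) :
  measurable_fun setT (fun z => f z.1 z.2) -> (forall x y, (0 <= f x y)%E) ->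
  (\int[m1]_x \int[m2]_y f x y = \int[m2]_y \int[m1]_x f x y)%E.
Proof. by move=> mf f0; exact: (fubini_tonelli (fun z => f z.1 z.2)). Qed.

Lemma tonelli_prod (f : T1 -> T2 -> \bar R) :
  measurable_fun setT (fun z => f z.1 z.2) -> (forall x y, (0 <= f x y)%E) ->
  (\int[(m1 \x m2)]_z f z.1 z.2 = \int[m1]_x \int[m2]_y f x y)%E.
Proof. by move=> mf f0; exact: (fubini_tonelli1 (fun z => f z.1 z.2)). Qed.

Lemma measurable_int_sec1 (f : T1 -> T2 -> \bar R) :
  measurable_fun setT (fun z => f z.1 z.2) -> (forall x y, (0 <= f x y)%E) ->
  measurable_fun setT (fun x => \int[m2]_y f x y)%E.
Proof. by move=> mf f0; exact: (measurable_fun_fubini_tonelli_F (fun z => f z.1 z.2)). Qed.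

Lemma L1_prod f (b : T1 -> R) : measurable_fun setT (fun z => f z.1 z.2) ->
  (forall x, L1 m2 (f x)) -> L1 m1 b -> (forall x, \int[m2]_y `|f x y| <= b x) ->
  L1 (m1 \x m2)%E (fun z => f z.1 z.2).
Proof.
move=> mf Lf Lb fb; apply/integrable12ltyP; first exact/measurable_EFinP.
have [_ /=] := integrableP _ _ _ Lb; apply: le_lt_trans.
apply: ge0_le_integral => //=.
- by move=> x _; apply: integral_ge0.
- apply: (measurable_fun_fubini_tonelli_F (fun z => `|(f z.1 z.2)%:E|%E)) => //.
  by apply: measurableT_comp => //; apply/measurable_EFinP.
- by do 2 apply: measurableT_comp => //; exact: L1_measurable Lb.
- move=> x _; rewrite -(EFin_Rint (L1_norm (Lf x))) lee_fin.
  by rewrite (le_trans (fb x))// ler_norm.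
Qed.

Variable f : T1 -> T2 -> R.
Hypothesis Lf : L1 (m1 \x m2)%E (fun z => f z.1 z.2).

Let F := fubini_F m2 (EFin \o (fun z : T1 * T2 => f z.1 z.2)).
Let G := fubini_G m1 (EFin \o (fun z : T1 * T2 => f z.1 z.2)).

Lemma L1_Rint1 : L1 m1 (fun x => \int[m2]_y f x y).
Proof.
have LF := integrable_fubini_F Lf; have [mF LFy] := integrableP _ _ _ LF.
apply/integrableP; split.
  by apply/measurable_EFinP; apply: measurableT_comp.
apply: le_lt_trans LFy; apply: ge0_le_integral => //=.
- by do 2 apply: measurableT_comp => //; apply: measurableT_comp.
- exact: measurableT_comp.
- by move=> x _; exact: (le_abs_fine (F x)).
Qed.

Lemma Rint_fubini1 : \int[m1]_x \int[m2]_y f x y = \int[(m1 \x m2)%E]_z f z.1 z.2.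
Proof.
rewrite [RHS]/Rintegral -[X in fine X](integral12_prod_meas1 Lf) [LHS]/Rintegral.
congr fine; apply: ae_eq_integral => //.
- exact: (measurable_int _ L1_Rint1).
- exact: measurable_int (integrable_fubini_F Lf).
(* Only on integrable sections do the real-valued and the extended integral agree; Fubini makes
   almost every section integrable. *)
- apply: filterS (ae_integrable1 Lf) => x Lx _ /=.
  by rewrite [LHS]EFin_Rint.
Qed.

Lemma L1_Rint2 : L1 m2 (fun y => \int[m1]_x f x y).
Proof.
have mf := L1_measurable Lf.
apply/integrableP; split.
  apply/measurable_EFinP.
  have := measurable_fubini_G Lf.
  by move=> mG; apply: (measurableT_comp _ mG).
have mF : measurable_fun setT (EFin \o (fun z : T1 * T2 => f z.1 z.2)).
  exact/measurable_EFinP.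
have Ly := (integrable21ltyP m1 m2 mF).1 Lf.
apply: le_lt_trans Ly; apply: ge0_le_integral => //=.
- do 2 apply: measurableT_comp => //.
  have mG := measurable_fubini_G Lf.
  by apply: (measurableT_comp _ mG).
- apply: (measurable_fun_fubini_tonelli_G (fun z => `|(f z.1 z.2)%:E|%E)) => //.
  by apply: measurableT_comp => //; apply/measurable_EFinP.
- move=> y _; apply: (@le_trans _ _ `|\int[m1]_x (f x y)%:E|%E).
    exact: le_abs_fine.
  apply: le_abse_integral => //; apply/measurable_EFinP.
  exact: (measurable_sec2 y mf).
Qed.

Lemma Rint_fubini2 : \int[m2]_y \int[m1]_x f x y = \int[(m1 \x m2)%E]_z f z.1 z.2.
Proof.
rewrite [RHS]/Rintegral -[X in fine X](integral21_prod_meas1 Lf) [LHS]/Rintegral.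
congr fine; apply: ae_eq_integral => //.
- exact: (measurable_int _ L1_Rint2).
- exact: (measurable_fubini_G Lf).
- apply: filterS (ae_integrable2 Lf) => x Lx _ /=.
  by rewrite [LHS]EFin_Rint.
Qed.

Lemma Rint_fubini : \int[m1]_x \int[m2]_y f x y = \int[m2]_y \int[m1]_x f x y.
Proof. by rewrite Rint_fubini1 Rint_fubini2. Qed.

End fubini_L1.

(** * Maps that rescale a measure *)

Section change_of_variable.
Context d (X : measurableType d) (R : realType) (m : {measure set X -> \bar R}).
Variables (T : X -> X) (k : R).
Hypothesis mT : measurable_fun setT T.
Hypothesis k0 : 0 <= k.

(** The image of [m] under [T] is [k] times [m], expressed through non-negative integrals so that it
    can be rewritten with directly. *)
Definition scales_measure := forall F : X -> \bar R, measurable_fun setT F ->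
  (forall x, (0 <= F x)%E) -> (\int[m]_x F (T x) = k%:E * \int[m]_x F x)%E.

(** [m'] mediates between the pushforward and the scaled measure, so that either of them can be the
    one on which a uniqueness theorem is invoked. *)
Lemma scales_measureP (m' : {measure set X -> \bar R}) :
  (forall A, measurable A -> m' A = pushforward m T A) ->
  (forall A, measurable A -> m' A = k%:E * m A)%E ->
  scales_measure.
Proof.
move=> m'T m'k F mF F0.
pose kk := NngNum k0.
transitivity (\int[pushforward m T]_x F x)%E.
  by rewrite ge0_integral_pushforward.
transitivity (\int[m']_x F x)%E.
  by apply: eq_measure_integral => A mA _; rewrite m'T.
rewrite -(ge0_integral_mscale m measurableT kk)//.
by apply: eq_measure_integral => A mA _; rewrite m'k.
Qed.

Hypothesis H : scales_measure.

Lemma scales_L1 f : L1 m f -> L1 m (fun x => f (T x)).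
Proof.
move=> Lf; have [mf fy] := integrableP _ _ _ Lf.
apply/integrableP; split; first exact: (measurableT_comp mf mT).
have -> := H (measurableT_comp (@abse_measurable R setT) mf) (fun x => abse_ge0 _).
have := EFin_Rint (L1_norm Lf) => /= <-.
by rewrite -EFinM ltry.
Qed.

(** Integrability is not assumed: when an integral is infinite, [fine] gives 0 on both sides. *)
Lemma scales_Rint f : measurable_fun setT f ->
  \int[m]_x f (T x) = k * \int[m]_x f x.
Proof.
move=> mf; have mF : measurable_fun setT (EFin \o f) by exact/measurable_EFinP.
rewrite /Rintegral.
have Ep : (\int[m]_x ((EFin \o f \o T)^\+ x) = k%:E * \int[m]_x ((EFin \o f)^\+ x))%E.
  rewrite -H; last 2 first.
  - exact: measurable_funepos.
  - by move=> x; exact: funepos_ge0.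
  by apply: eq_integral => x _; rewrite !funeposE.
have En : (\int[m]_x ((EFin \o f \o T)^\- x) = k%:E * \int[m]_x ((EFin \o f)^\- x))%E.
  rewrite -H; last 2 first.
  - exact: measurable_funeneg.
  - by move=> x; exact: funeneg_ge0.
  by apply: eq_integral => x _; rewrite !funenegE.
rewrite integralE [in RHS]integralE Ep En.
move: k0; rewrite le_eqVlt => /predU1P[<-|kp]; first by rewrite !mul0e sube0/= mul0r.
case: (integral m setT _) => [r| |]; case: (integral m setT _) => [s| |] /=;
  by rewrite ?gt0_muley ?gt0_muleNy ?lte_fin//= ?mulr0 ?mulrBr.
Qed.

End change_of_variable.

(** * Borel sets of R^n are generated by closed boxes *)

Section Rn_measurable.
Variables (R : realType) (n : nat).
Implicit Types (a b : 'rV[R]_n) (x : Rn R n).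

Definition cbox a b : set (Rn R n) := [set x | forall i, a 0 i <= x 0 i <= b 0 i].

Lemma open_measurable_Rn (O : set 'rV[R]_n) : open O -> measurable (O : set (Rn R n)).
Proof. by move=> oO; apply: sub_sigma_algebra. Qed.

Lemma continuous_measurable_Rn (f : 'rV[R]_n -> R) : continuous f ->
  measurable_fun setT (f : Rn R n -> R).
Proof.
move=> /continuousP cf; apply: (measurability _ (RGenOpens.measurableE R)).
move=> _ [_ [a [b ->] <-]]; rewrite setTI; apply: open_measurable_Rn.
exact/cf/interval_open.
Qed.

Lemma measurable_coord i : measurable_fun setT (fun x : Rn R n => x 0 i).
Proof. by apply: continuous_measurable_Rn => x; exact: coord_continuous. Qed.

Lemma cboxE a b : cbox a b =
  \big[setI/setT]_(i < n) ((fun x : Rn R n => x 0 i) @^-1` `[a 0 i, b 0 i]%classic).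
Proof.
rewrite -bigcap_seq; apply/seteqP; split => x /=.
  by move=> h i _ /=; rewrite in_itv/= h.
by move=> h i; have := h i (mem_index_enum i); rewrite /= in_itv.
Qed.

Lemma measurable_cbox a b : measurable (cbox a b).
Proof.
rewrite cboxE; apply: bigsetI_measurable => i _.
by rewrite -[X in measurable X]setTI; apply: measurable_coord.
Qed.

Let lo (k : {ffun 'I_n -> rat * rat}) : 'rV[R]_n := \row_i ratr (k i).1.
Let hi (k : {ffun 'I_n -> rat * rat}) : 'rV[R]_n := \row_i ratr (k i).2.

(** Around each point of [O] a box with rational corners fits inside [O]; countably many such boxes
    exist, which brings open sets into the sigma-algebra of boxes. *)
Lemma open_bigcup_cbox (O : set 'rV[R]_n) : open O ->
  O = \bigcup_(k in [set k | cbox (lo k) (hi k) `<=` O]) cbox (lo k) (hi k).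
Proof.
move=> oO; apply/seteqP; split => [x Ox|x [k /= kO /kO]//].
have [P xP PO] : nbhs x O by exact: open_nbhs_nbhs.
have /choice[e he] i : exists e : R, 0 < e /\ forall y, `|x 0 i - y| < e -> P 0 i y.
  by have /nbhs_ballP[e /= e0 he] := xP 0 i; exists e; split => // y; exact: he.
have /choice[k hk] i : exists k : rat * rat, x 0 i - e i < ratr k.1 < x 0 i /\
    x 0 i < ratr k.2 < x 0 i + e i.
  have [e0 _] := he i.
  have [|q1 q1P] := @rat_in_itvoo R (x 0 i - e i) (x 0 i); first by rewrite ltrBlDr ltrDl.
  have [|q2 q2P] := @rat_in_itvoo R (x 0 i) (x 0 i + e i); first by rewrite ltrDl.
  by exists (q1, q2); move: q1P q2P; rewrite !in_itv.
exists [ffun i => k i] => /=; last first.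
  by move=> i; rewrite !mxE ffunE; have [/andP[_ /ltW ->] /andP[/ltW ->]] := hk i.
move=> y yk; apply: PO => i j; rewrite ord1.
have [e0] := he j; apply; rewrite ltr_distlC.
have [/andP[h1 _] /andP[_ h2]] := hk j.
have := yk j; rewrite !mxE ffunE => /andP[h3 h4].
by rewrite (lt_le_trans h1 h3) (le_lt_trans h4 h2).
Qed.

(** Lebesgue measure is specified on boxes only, so boxes must generate the Borel sets before
    uniqueness of measures can be used. *)
Lemma measurable_RnE : @measurable _ (Rn R n) =
  <<s [set A | exists a b, A = cbox a b] >>.
Proof.
set G := [set A | _]; apply/seteqP; split.
  apply: smallest_sub; first exact: smallest_sigma_algebra.
  move=> O oO; rewrite (open_bigcup_cbox oO) bigcup_mkcond.
  pose GT : measurableType _ := g_sigma_algebraType G.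
  apply: (@countable_bigcupT_measurable _ GT) => // k.
  case: ifPn => [_|_]; last exact: (@measurable0 _ GT).
  by apply: sub_sigma_algebra; exists (lo k), (hi k).
apply: smallest_sub; first exact: sigma_algebra_measurable.
by move=> _ [a [b ->]]; exact: measurable_cbox.
Qed.

Lemma measurable_fun_Rn d (T : measurableType d) (h : T -> Rn R n) :
  (forall i, measurable_fun setT (fun t => h t 0 i)) -> measurable_fun setT h.
Proof.
move=> mh; apply: (measurability _ measurable_RnE).
move=> _ [_ [a [b ->]] <-]; rewrite setTI cboxE.
rewrite (_ : _ @^-1` _ = \big[setI/setT]_(i < n)
   ((fun t => h t 0 i) @^-1` `[a 0 i, b 0 i]%classic)).
  by apply: bigsetI_measurable => i _; rewrite -[X in measurable X]setTI; apply: mh.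
by rewrite -!bigcap_seq; apply/seteqP; split => x /=; apply.
Qed.

Lemma setI_closed_cbox : setI_closed [set A | exists a b, A = cbox a b].
Proof.
move=> _ _ [a [b ->]] [c [d' ->]].
exists (\row_i Num.max (a 0 i) (c 0 i)), (\row_i Num.min (b 0 i) (d' 0 i)).
apply/seteqP; split => [x [h1 h2] i|x h].
  rewrite !mxE ge_max le_min.
  by have /andP[h11 h12] := h1 i; have /andP[h21 h22] := h2 i; rewrite h11 h12 h21 h22.
by split => i; have := h i; rewrite !mxE ge_max le_min => /andP[/andP[h1 h2] /andP[h3 h4]];
  rewrite ?h1 ?h2 ?h3 ?h4.
Qed.

Definition cubeN (k : nat) := cbox (const_mx (- k%:R)) (const_mx k%:R).

Lemma cubeN_cover : \bigcup_k cubeN k = setT.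
Proof.
rewrite -subTset => x _; pose M := \sum_i `|x 0 i|.
have xM i : `|x 0 i| <= M by rewrite /M (bigD1 i)//= lerDl sumr_ge0.
exists (Num.truncn M).+1 => // i; rewrite !mxE -ler_norml.
by rewrite (le_trans (xM i))// ltW// truncnS_gt.
Qed.

End Rn_measurable.

(** * Uniqueness and affine invariance of Lebesgue measure *)

Section lebesgue_Rn.
Variables (R : realType) (n : nat).

Lemma cbox_lebesgue_finite (mu : {measure set (Rn R n) -> \bar R}) k :
  is_lebesgue mu -> (mu (@cubeN R n k) < +oo)%E.
Proof.
by move=> Hmu; rewrite Hmu ?ltry// => i; rewrite !mxE (@le_trans _ _ 0)// oppr_le0.
Qed.

Lemma cbox_empty (a b : 'rV[R]_n) i : b 0 i < a 0 i -> cbox a b = set0.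
Proof.
by move=> h; apply/seteqP; split => x //= /(_ i); lra.
Qed.

(** Boxes form a generating pi-system and the cubes exhaust the space with finite measure. A box
    with a reversed side is empty, so ordered corners suffice. *)
Lemma cbox_measure_unique (mu nu : {measure set (Rn R n) -> \bar R}) :
  (forall k, (mu (@cubeN R n k) < +oo)%E) ->
  (forall a b : 'rV[R]_n, (forall i, a 0 i <= b 0 i) -> mu (cbox a b) = nu (cbox a b)) ->
  forall A, measurable A -> mu A = nu A.
Proof.
move=> muf munu A mA.
apply: (measure_unique _ (@cubeN R n) (@measurable_RnE R n)) => //.
- exact: setI_closed_cbox.
- by move=> k; exists (const_mx (- k%:R)), (const_mx k%:R).
- exact: cubeN_cover.
- move=> _ [a [b ->]].
  have [ab|] := pselect (forall i, a 0 i <= b 0 i); first exact: munu.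
  by move=> /existsNP[i /negP]; rewrite -ltNge => /cbox_empty ->; rewrite !measure0.
Qed.

Variables (mu : {measure set (Rn R n) -> \bar R}) (Hmu : is_lebesgue mu).

Lemma lebesgue_sigma_finite : sigma_finite setT mu.
Proof.
exists (@cubeN R n) => [|k]; first by rewrite cubeN_cover.
by split; [exact: measurable_cbox|exact: cbox_lebesgue_finite].
Qed.

Lemma lebesgue_scales (T : Rn R n -> Rn R n) (k : R) : measurable_fun setT T ->
  0 <= k ->
  (forall a b : 'rV[R]_n, (forall i, a 0 i <= b 0 i) ->
    mu (T @^-1` cbox a b) = (k * \prod_(i < n) (b 0 i - a 0 i))%:E) ->
  scales_measure mu T k.
Proof.
move=> mT k0 HT.
pose mixT := isMeasurableFun.Build _ _ _ _ T mT.
pose Tm : {mfun Rn R n >-> Rn R n} := HB.pack T mixT.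
pose kk := NngNum k0.
apply: (@scales_measureP _ _ _ mu T k mT k0 (mscale kk mu)) => // A mA.
apply: (@cbox_measure_unique (mscale kk mu) (pushforward mu Tm)) => //.
  by move=> i; rewrite /= /mscale /= Hmu ?ltry// => j; rewrite !mxE (@le_trans _ _ 0)// oppr_le0.
by move=> a b ab; rewrite /= /mscale /= /pushforward HT// Hmu// EFinM.
Qed.

Lemma measurable_affine (c : R) (v : 'rV[R]_n) :
  measurable_fun setT ((fun x => c *: x + v) : Rn R n -> Rn R n).
Proof.
apply: measurable_fun_Rn => i; under eq_fun do rewrite !mxE.
by apply: measurable_funD => //; apply: measurable_funM => //; exact: measurable_coord.
Qed.

Lemma lebesgue_affine (c : R) (v : 'rV[R]_n) : c != 0 ->
  scales_measure mu (fun x => c *: x + v) (`|c| ^- n).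
Proof.
move=> c0; apply: lebesgue_scales; first exact: measurable_affine.
  by rewrite invr_ge0 exprn_ge0.
move=> a b ab.
have cE : `|c| ^- n = \prod_(i < n) `|c|^-1 by rewrite prodr_const card_ord exprVn.
have [cp|cn] := ltP 0 c.
  rewrite (_ : _ @^-1` _ = cbox (\row_i ((a 0 i - v 0 i) / c)) (\row_i ((b 0 i - v 0 i) / c))).
    rewrite Hmu; last by move=> i; rewrite !mxE ler_pM2r ?invr_gt0// lerD2r.
    congr EFin; rewrite cE -big_split/=.
    by apply: eq_bigr => i _; rewrite !mxE gtr0_norm//; field.
  apply/seteqP; split => x /= h i; have := h i; rewrite !mxE.
    by rewrite ler_pdivrMr// ler_pdivlMr//; lra.
  by rewrite ler_pdivrMr// ler_pdivlMr//; lra.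
(* A negative factor exchanges the two corners of the preimage box. *)
have {}cn : c < 0 by rewrite lt_neqAle c0.
rewrite (_ : _ @^-1` _ = cbox (\row_i ((b 0 i - v 0 i) / c)) (\row_i ((a 0 i - v 0 i) / c))).
  rewrite Hmu; last by move=> i; rewrite !mxE ler_nM2r ?invr_lt0// lerD2r.
  congr EFin; rewrite cE -big_split/=.
  by apply: eq_bigr => i _; rewrite !mxE ltr0_norm//; field.
apply/seteqP; split => x /= h i; have := h i; rewrite !mxE.
  by rewrite ler_ndivrMr// ler_ndivlMr//; lra.
by rewrite ler_ndivrMr// ler_ndivlMr//; lra.
Qed.

End lebesgue_Rn.

(** * Power weights on the half-line *)

Section power_weight.
Variable R : realType.
Local Notation leb := (@lebesgue_measure R).
Local Notation RR := (measurableTypeR R).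
Implicit Types a b c s t : R.

Lemma lebesgue_affine1 c v : c != 0 -> scales_measure leb (fun x => c * x + v) (`|c|^-1).
Proof.
move=> c0.
have mT : measurable_fun setT ((fun x => c * x + v) : measurableTypeR R -> measurableTypeR R).
  by apply: measurable_funD => //; apply: measurable_funM.
have k0 : 0 <= `|c| by [].
have kV0 : 0 <= `|c|^-1 by rewrite invr_ge0.
pose kk := NngNum k0.
pose mixT := isMeasurableFun.Build _ _ _ _ _ mT.
pose Tm : {mfun measurableTypeR R >-> measurableTypeR R} :=
  HB.pack (fun x => c * x + v : R) mixT.
(* One-dimensional Lebesgue measure is characterised on half-open intervals, so the relation is
   first shown with the factor |c| on the side of the image measure and inverted afterwards. *)
have E A : measurable A -> leb A = mscale kk (pushforward leb Tm) A.
  apply: lebesgue_measure_unique => _ [[a b] _ <-] /=.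
  rewrite /mscale /= /pushforward /= lebesgue_measure_itv /= lte_fin.
  have [cp|cn] := ltP 0 c.
    rewrite (_ : _ @^-1` _ = `](a - v) / c, (b - v) / c]%classic); last first.
      apply/seteqP; split => x /=; rewrite !in_itv/= ltr_pdivrMr// ler_pdivlMr//; lra.
    rewrite lebesgue_measure_itv /= lte_fin ltr_pM2r ?invr_gt0// ltrD2r.
    case: ifPn => // _; last by rewrite mule0.
    by rewrite -EFinM gtr0_norm// -EFinB; congr EFin; field.
  have {}cn : c < 0 by rewrite lt_neqAle c0.
  rewrite (_ : _ @^-1` _ = `[(b - v) / c, (a - v) / c[%classic); last first.
    apply/seteqP; split => x /=; rewrite !in_itv/= ler_ndivrMr// ltr_ndivlMr//; lra.
  rewrite lebesgue_measure_itv /= lte_fin ltr_nM2r ?invr_lt0// ltrD2r.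
  case: ifPn => // _; last by rewrite mule0.
  by rewrite -EFinM ltr0_norm// -EFinB; congr EFin; field.
apply: (@scales_measureP _ _ _ leb _ _ mT kV0 (pushforward leb Tm)) => // A mA.
have := E mT A mA; rewrite /mscale /= => EA.
rewrite [X in (_ * X)%E]EA muleA -EFinM mulVf ?mul1e//.
by rewrite normr_eq0.
Qed.

(** The weight of the Gamma and Beta integrals. The cut-off at t <= 0 turns integrals over the
    half-line into integrals over R, to which affine substitutions apply. *)
Definition pw a t : R := if 0 < t then t `^ (a - 1) else 0.

Lemma pw_ge0 a t : 0 <= pw a t.
Proof. by rewrite /pw; case: ifP => // _; exact: powR_ge0. Qed.

Lemma pw_gt0 a t : 0 < t -> 0 < pw a t.
Proof. by move=> t0; rewrite /pw t0 powR_gt0. Qed.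

Lemma pwE a t : 0 < t -> pw a t = t `^ (a - 1).
Proof. by rewrite /pw => ->. Qed.

Lemma pw_le0 a t : t <= 0 -> pw a t = 0.
Proof. by rewrite /pw leNgt => /negbTE ->. Qed.

Lemma measurable_pw a : measurable_fun setT (pw a : RR -> R).
Proof.
by apply: measurable_fun_ifT => //; exact: measurable_fun_ltr.
Qed.

Lemma pwM a c t : 0 < c -> pw a (c * t) = c `^ (a - 1) * pw a t.
Proof.
move=> c0; rewrite /pw pmulr_rgt0//; case: ifPn => t0; last by rewrite mulr0.
by rewrite powRM// ltW.
Qed.

Lemma powRD_gt0 t a b : 0 < t -> t `^ (a + b) = t `^ a * t `^ b.
Proof. by move=> t0; rewrite powRD// (gt_eqF t0) implybT. Qed.

Lemma powR_le (x y r : R) : 0 <= r -> 0 <= x -> x <= y -> x `^ r <= y `^ r.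
Proof. by move=> r0 x0 xy; rewrite ge0_ler_powR ?nnegrE// (le_trans x0). Qed.

Lemma powR_leN (x y r : R) : r <= 0 -> 0 < x -> x <= y -> y `^ r <= x `^ r.
Proof.
move=> r0 x0 xy; have y0 := lt_le_trans x0 xy.
rewrite -[r]opprK (powRN y) (powRN x) lef_pV2 ?posrE ?powR_gt0//.
by apply: powR_le; rewrite ?oppr_ge0// ltW.
Qed.

Lemma powR_1 (r : R) : 1 `^ r = 1 :> R.
Proof. by rewrite powR1. Qed.

Lemma pwMpowR a b t : pw a t * t `^ b = pw (a + b) t.
Proof.
rewrite /pw; case: ifPn => t0; last by rewrite mul0r.
by rewrite -powRD_gt0//; congr (_ `^ _); ring.
Qed.

Let powR_derivable a x : 0 < x -> derivable (fun t => t `^ a) x 1.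
Proof. by move=> x0; apply: derivable_powR; rewrite in_itv/= x0. Qed.

Lemma powR_continuous a x : 0 < x -> {for x, continuous (fun t => t `^ a)}.
Proof.
by move=> x0; apply: differentiable_continuous; exact/derivable1_diffP/powR_derivable.
Qed.

Lemma integral_powR a x y : 0 < x -> x < y -> a != 0 ->
  (\int[leb]_(t in `[x, y]) (t `^ (a - 1))%:E = ((y `^ a - x `^ a) / a)%:E)%E.
Proof.
move=> x0 xy a0.
have y0 := lt_trans x0 xy.
have dF t : 0 < t -> derivable (fun t => a^-1 * t `^ a) t 1.
  by move=> t0; apply: derivableM => //; exact: powR_derivable.
have cF t : 0 < t -> {for t, continuous (fun t => a^-1 * t `^ a)}.
  by move=> t0; apply: differentiable_continuous; exact/derivable1_diffP/dF.
rewrite (@continuous_FTC2 _ (fun t => t `^ (a - 1)) (fun t => a^-1 * t `^ a))//.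
- by rewrite -EFinB; congr EFin; ring.
- apply: continuous_in_subspaceT => t; rewrite inE/= in_itv/= => /andP[xt _].
  by apply: powR_continuous; exact: lt_le_trans xt.
- split.
  + by move=> t; rewrite in_itv/= => /andP[xt _]; apply: dF; exact: lt_trans xt.
  + by apply: cvg_at_right_filter; exact: cF.
  + by apply: cvg_at_left_filter; exact: cF.
- move=> t; rewrite in_itv/= => /andP[xt _].
  have t0 := lt_trans x0 xt.
  rewrite derive1E deriveZ /=; last exact: powR_derivable.
  rewrite -derive1E powR_derive1 ?in_itv/= ?t0//.
  by rewrite /GRing.scale/= mulrA mulVf// mul1r.
Qed.

Lemma integral_bigcup_le d (T : measurableType d) (m : {measure set T -> \bar R})
    (F : (set T)^nat) (f : T -> \bar R) (M : \bar R) :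
  nondecreasing_seq F -> (forall i, measurable (F i)) -> measurable_fun setT f ->
  (forall x, 0 <= f x)%E -> (forall k, \int[m]_(x in F k) f x <= M)%E ->
  (\int[m]_(x in \bigcup_k F k) f x <= M)%E.
Proof.
move=> nd mF mf f0 FM.
have h : (\int[m]_(x in F i) f x @[i --> \oo] --> \int[m]_(x in \bigcup_i F i) f x)%E.
  by apply: ge0_nondecreasing_set_cvg_integral => // i; exact: measurable_funTS.
rewrite -(cvg_lim _ h)//; apply: lime_le; first by apply/cvg_ex; exists (\int[m]_(x in \bigcup_k F k) f x)%E.
by apply: nearW.
Qed.

Lemma L1_pw_near0 a : 0 < a -> L1 leb (fun t => pw a t * (t <= 1)%R%:R).
Proof.
move=> a0.
have mle : measurable_fun setT (fun t : R => (t <= 1)%R%:R : R).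
  rewrite (_ : (fun t => _) = (fun t => if t <= 1 then 1 else 0)).
    by apply: measurable_fun_ifT => //; exact: measurable_fun_ler.
  by apply/funext => t; case: ifP.
have mpw := measurable_pw a.
suff : (\int[leb]_t (pw a t * (t <= 1)%R%:R)%:E <= (a^-1)%:E)%E.
  move=> h; apply: (L1_bound _ _ h).1; first exact: measurable_funM.
  by move=> x; rewrite mulr_ge0 ?pw_ge0.
pose F (k : nat) := `[(k.+2%:R)^-1 : R, 1]%classic.
rewrite (_ : (\int[leb]_x _ = \int[leb]_(x in \bigcup_k F k) (pw a x)%:E)%E); last first.
  rewrite [RHS]integral_mkcond/=; apply: eq_integral => t _; rewrite patchE.
  case: ifPn; rewrite ?inE ?notin_setE => h.
    by case: h => k _; rewrite /F /= in_itv/= => /andP[_ ->]; rewrite mulr1.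
  have [t0|t0] := leP t 0; first by rewrite pw_le0// mul0r.
  case: leP => t1; last by rewrite mulr0.
  exfalso; apply: h; exists (Num.truncn t^-1) => //; rewrite /F /= in_itv/= t1 andbT.
  rewrite invf_ple ?posrE//.
  by rewrite (le_trans (ltW (truncnS_gt _)))// ler_nat.
apply: integral_bigcup_le => //.
- move=> i j ij; apply/subsetPset => t; rewrite /F /= !in_itv/= => /andP[h ->].
  by rewrite andbT (le_trans _ h)// lef_pV2 ?posrE// ler_nat.
- by move=> i; exact: measurable_itv.
- exact/measurable_EFinP.
- by move=> x; rewrite lee_fin pw_ge0.
move=> k; rewrite (_ : (\int[leb]_(x in F k) _ = \int[leb]_(t in F k) (t `^ (a - 1))%:E)%E).
  rewrite integral_powR ?gt_eqF// ?invf_lt1//; last by rewrite ltr1n.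
  rewrite lee_fin powR1 -[leRHS]mul1r ler_pM2r ?invr_gt0// gerBl powR_ge0//.
apply: eq_integral => t; rewrite inE /F/= in_itv/= => /andP[h _].
by rewrite pwE// (lt_le_trans _ h).
Qed.

Lemma L1_pw_far a : a < 0 -> L1 leb (fun t => pw a t * (1 < t)%R%:R).
Proof.
move=> a0.
have mle : measurable_fun setT (fun t : R => (1 < t)%R%:R : R).
  rewrite (_ : (fun t => _) = (fun t => if 1 < t then 1 else 0)).
    by apply: measurable_fun_ifT => //; exact: measurable_fun_ltr.
  by apply/funext => t; case: ifP.
have mpw := measurable_pw a.
suff : (\int[leb]_t (pw a t * (1 < t)%R%:R)%:E <= ((- a^-1))%:E)%E.
  move=> h; apply: (L1_bound _ _ h).1; first exact: measurable_funM.
  by move=> x; rewrite mulr_ge0 ?pw_ge0.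
pose F (k : nat) := `[1 : R, k.+2%:R]%classic.
apply: (@le_trans _ _ (\int[leb]_(x in \bigcup_k F k) (pw a x)%:E)%E).
  rewrite [leRHS]integral_mkcond/=; apply: ge0_le_integral => //.
  - by move=> t _; rewrite lee_fin mulr_ge0 ?pw_ge0.
  - by apply/measurable_EFinP; exact: measurable_funM.
  - apply/(measurable_restrictT (fun x => (pw a x)%:E)).
      by apply: bigcupT_measurable => k; exact: measurable_itv.
    by apply: measurable_funTS; exact/measurable_EFinP.
  move=> t _; rewrite patchE; case: ifPn; rewrite ?inE ?notin_setE => h.
    by rewrite lee_fin ler_piMr ?pw_ge0// lern1 leq_b1.
  case: ltP => t1; last by rewrite mulr0.
  exfalso; apply: h; exists (Num.truncn t) => //; rewrite /F /= in_itv/= ltW//=.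
  by rewrite (le_trans (ltW (truncnS_gt _)))// ler_nat.
apply: integral_bigcup_le => //.
- move=> i j ij; apply/subsetPset => t; rewrite /F /= !in_itv/= => /andP[-> h].
  by rewrite (le_trans h)// ler_nat.
- by move=> i; exact: measurable_itv.
- exact/measurable_EFinP.
- by move=> x; rewrite lee_fin pw_ge0.
move=> k; rewrite (_ : (\int[leb]_(x in F k) _ = \int[leb]_(t in F k) (t `^ (a - 1))%:E)%E).
  rewrite integral_powR ?lt_eqF// ?ltr1n//.
  have aV : a^-1 <= 0 by rewrite invr_le0 ltW.
  have := powR_ge0 (k.+2%:R : R) a; rewrite lee_fin powR1; nra.
apply: eq_integral => t; rewrite inE /F/= in_itv/= => /andP[h _].
by rewrite pwE// (lt_le_trans _ h).
Qed.

(* The two ends [t <= 1] and [1 < t] are governed by different exponents. *)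
Lemma L1_pw_dom a b (A B : R) (f : RR -> R) : 0 < a -> b < 0 -> measurable_fun setT f ->
  (forall t, t <= 0 -> f t = 0) ->
  (forall t, 0 < t -> t <= 1 -> `|f t| <= A * pw a t) ->
  (forall t, 1 < t -> `|f t| <= B * pw b t) -> L1 leb f.
Proof.
move=> a0 b0 mf f0 fA fB.
have Lg : L1 leb (fun t => A * (pw a t * (t <= 1)%R%:R) + B * (pw b t * (1 < t)%R%:R)).
  by apply: L1D; apply: L1Zl; [exact: L1_pw_near0|exact: L1_pw_far].
apply: (L1_dom mf Lg).
move=> t; case: (leP t 1) => t1; rewrite ?mulr0 ?mulr1 ?addr0 ?add0r; last exact: fB.
have [t0|t0] := ltP 0 t; first exact: fA.
by rewrite f0// normr0 pw_le0// mulr0.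
Qed.

End power_weight.

(** * Gamma integrals and the abstract time weight *)

Section weights.
Variable R : realType.
Local Notation leb := (@lebesgue_measure R).
Local Notation RR := (measurableTypeR R).
Implicit Types a b c s t : R.

Lemma Rint_gt0 d (T : measurableType d) (m : {measure set T -> \bar R}) (f : T -> R) c A :
  L1 m f -> (forall x, 0 <= f x) -> 0 < c -> measurable A -> (0 < m A)%E ->
  (forall x, A x -> c <= f x) -> 0 < \int[m]_x f x.
Proof.
move=> Lf f0 c0 mA A0 cf; rewrite -lte_fin EFin_Rint//.
apply: (@lt_le_trans _ _ (c%:E * m A)%E); first by rewrite mule_gt0.
rewrite -integral_cst// integral_mkcond; apply: ge0_le_integral => //.
- by move=> x _; rewrite patchE; case: ifP => // _; rewrite lee_fin ltW.
- by apply/(measurable_restrictT (fun=> c%:E)) => //; exact: measurable_cst.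
- by apply/measurable_EFinP; exact: L1_measurable Lf.
- move=> x _; rewrite patchE; case: ifPn => [|_]; last by rewrite lee_fin.
  by rewrite inE => /cf; rewrite lee_fin.
Qed.

Lemma measurable_invR : measurable_fun setT (fun x : R => x^-1).
Proof.
rewrite (_ : (fun x => _) = (fun x => if 0 < x then x `^ (-1) else
   if x < 0 then - ((- x) `^ (-1)) else 0)).
  apply: measurable_fun_ifT => //; first exact: measurable_fun_ltr.
  apply: measurable_fun_ifT => //; first exact: measurable_fun_ltr.
  apply: measurable_funN.
  by apply: (measurableT_comp (@measurable_powR R (-1))); exact: measurable_funN.
apply/funext => x; case: (ltgtP 0 x) => [x0|x0|<-]; last by rewrite invr0.
  by rewrite powR_inv1 ?ltW.
by rewrite powR_inv1 ?oppr_ge0 ?ltW// invrN opprK.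
Qed.

Lemma measurable_funV d (T : measurableType d) (f : T -> R) :
  measurable_fun setT f -> measurable_fun setT (fun x => (f x)^-1).
Proof. by move=> mf; exact: (measurableT_comp measurable_invR mf). Qed.

(** The single term t^(k+1)/(k+1)! of the exponential series, with k+1 > |a|, already dominates t^a
    on t >= 1. *)
Lemma powR_expR_bounded a : exists C, 0 <= C /\
  forall t, 1 <= t -> t `^ a * expR (- t) <= C.
Proof.
pose k := (Num.truncn `|a|).
exists (k.+1`!%:R); split => // t t1; have t0 : 0 < t by apply: lt_le_trans t1.
have := @expR_ge1Dxn _ t k (ltW t0).
rewrite expRN ler_pdivrMr ?expR_gt0// => h.
apply: (@le_trans _ _ (t ^+ k.+1)).
  rewrite -(powR_mulrn _ (ltW t0)); apply: (ler_powR t1).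
  by rewrite (le_trans (ler_norm a))// ltW// truncnS_gt.
have kf : (0 : R) < k.+1`!%:R by rewrite ltr0n fact_gt0.
have h2 : t ^+ k.+1 / k.+1`!%:R <= expR t by apply: le_trans h; rewrite lerDr.
by move: h2; rewrite ler_pdivrMr// mulrC.
Qed.

Lemma lebesgue_itv01 (x y : R) : x < y -> (0 < leb `[x, y]%classic)%E.
Proof. by move=> xy; rewrite lebesgue_measure_itv/= lte_fin xy -EFinB lte_fin subr_gt0. Qed.

Lemma L1_gamma s : 0 < s -> L1 leb (fun t => pw s t * expR (- t)).
Proof.
move=> s0; have [C [C0 HC]] := powR_expR_bounded (s + 1).
have mf : measurable_fun setT (fun t : RR => pw s t * expR (- t)).
  by apply: measurable_funM; [exact: measurable_pw|exact: measurableT_comp].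
apply: (@L1_pw_dom R s (-1) 1 C) => //.
- by move=> t t0; rewrite pw_le0// mul0r.
- move=> t t0 _; rewrite ger0_norm; last by rewrite mulr_ge0 ?pw_ge0 ?expR_ge0.
  by rewrite mul1r ler_piMr ?pw_ge0// expR_le1 oppr_le0 ltW.
- move=> t t1; have t0 : 0 < t by apply: lt_trans t1.
  rewrite ger0_norm; last by rewrite mulr_ge0 ?pw_ge0 ?expR_ge0.
  rewrite !pwE// -ler_pdivrMr ?powR_gt0// -powRN mulrAC -powRD_gt0//.
  rewrite (_ : s - 1 + - (-1 - 1) = s + 1); last by ring.
  exact/HC/ltW.
Qed.

(** Makes [mu_const] positive, so that duality may divide by the constant of the fractional
    divergence. *)
Lemma Gamma_gt0 s : 0 < s -> 0 < Gamma s.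
Proof.
move=> s0.
have -> : Gamma s = \int[leb]_t (pw s t * expR (- t)).
  rewrite /Gamma Rintegral_mkcond; apply: eq_Rint => t; rewrite patchE /pw.
  case: ifPn; rewrite ?inE ?notin_setE /= in_itv/= andbT; first by move=> ->.
  by move=> /negP /negbTE ->; rewrite mul0r.
have e0 := expR_gt0 (-2 : R).
(* The minimum covers both monotonicities of t^(s-1), increasing for s >= 1 and decreasing for s <
   1. *)
apply: (@Rint_gt0 _ RR _ _ (Num.min (pw s 1) (pw s 2) * expR (-2)) `[1, 2]%classic).
- exact: L1_gamma.
- by move=> x; rewrite mulr_ge0 ?pw_ge0 ?expR_ge0.
- by rewrite mulr_gt0// lt_min !pw_gt0.
- by [].
- by apply: lebesgue_itv01; lra.
- move=> x /=; rewrite in_itv/= => /andP[x1 x2]; have x0 : 0 < x by apply: lt_le_trans x1.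
  apply: ler_pM; [|exact: ltW| |by rewrite ler_expR lerN2].
    by rewrite le_min !pw_ge0.
  rewrite !pwE// ge_min; apply/orP; case: (leP 1 s) => s1; [left|right].
    by apply: powR_le => //; rewrite subr_ge0.
  by apply: powR_leN => //; rewrite subr_le0 ltW.
Qed.

Lemma measurable_gauss_power k x :
  measurable_fun setT (fun s : RR => pw (- k) s * expR (- (x / s))).
Proof.
apply: measurable_funM; first exact: measurable_pw.
apply: measurableT_comp => //; apply: measurable_funN; apply: measurable_funM => //.
exact: measurable_invR.
Qed.

Lemma L1_gauss_power1 k : 0 < k -> L1 leb (fun s => pw (- k) s * expR (- (1 / s))).
Proof.
move=> k0; have [C [C0 HC]] := powR_expR_bounded (k + 1).
apply: (@L1_pw_dom R 1 (- k) C 1) => //.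
- lra.
- exact: measurable_gauss_power.
- by move=> t t0; rewrite pw_le0// mul0r.
- move=> t t0 t1; rewrite ger0_norm; last by rewrite mulr_ge0 ?pw_ge0 ?expR_ge0.
  rewrite !pwE// subrr powRr0 mulr1 div1r.
  rewrite (_ : t `^ _ = t^-1 `^ (k + 1)).
    by apply: HC; rewrite invf_ge1.
  rewrite -powR_inv1 ?ltW// -powRrM; congr (_ `^ _); ring.
- move=> t t1; have t0 : 0 < t by apply: lt_trans t1.
  rewrite ger0_norm; last by rewrite mulr_ge0 ?pw_ge0 ?expR_ge0.
  by rewrite [leRHS]mul1r ler_piMr ?pw_ge0// expR_le1 oppr_le0 divr_ge0// ltW.
Qed.

(** This is Gamma(k), as the substitution u = 1/s shows. *)
Definition gpc k := \int[leb]_s (pw (- k) s * expR (- (1 / s))).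

Lemma gpc_gt0 k : 0 < k -> 0 < gpc k.
Proof.
move=> k0.
apply: (@Rint_gt0 _ RR _ _ (pw (- k) 2 * expR (-1)) `[1, 2]%classic).
- exact: L1_gauss_power1.
- by move=> x; rewrite mulr_ge0 ?pw_ge0 ?expR_ge0.
- by rewrite mulr_gt0 ?pw_gt0 ?expR_gt0.
- by [].
- by apply: lebesgue_itv01; lra.
- move=> x /=; rewrite in_itv/= => /andP[x1 x2]; have x0 : 0 < x by apply: lt_le_trans x1.
  apply: ler_pM; [exact: pw_ge0|exact: expR_ge0| |].
    by rewrite !pwE//; apply: powR_leN => //; lra.
  by rewrite ler_expR lerN2 ler_pdivrMr// mul1r.
Qed.

(* Substituting [s = x * u]: negative powers are superpositions of Gaussians. *)
Lemma gauss_power k x : 0 < k -> 0 < x ->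
  L1 leb (fun s => pw (- k) s * expR (- (x / s))) /\
  \int[leb]_s (pw (- k) s * expR (- (x / s))) = gpc k * x `^ (- k).
Proof.
move=> k0 x0.
have xV0 : x^-1 != 0 by rewrite invr_eq0 gt_eqF.
have S := lebesgue_affine1 0 xV0.
have mT : measurable_fun setT ((fun s => x^-1 * s + 0) : RR -> RR).
  by apply: measurable_funD => //; apply: measurable_funM.
have E s : pw (- k) (x^-1 * s + 0) * expR (- (1 / (x^-1 * s + 0))) =
    x `^ (k + 1) * (pw (- k) s * expR (- (x / s))).
  rewrite addr0 pwM ?invr_gt0// -mulrA; congr (_ * (_ * expR _)).
    by rewrite -powR_inv1 ?ltW// -powRrM; congr (_ `^ _); ring.
  by rewrite invfM invrK mul1r.
have L0 := L1_gauss_power1 k0.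
have xk : x `^ (k + 1) != 0 by rewrite gt_eqF ?powR_gt0.
have L : L1 leb (fun s => pw (- k) s * expR (- (x / s))).
  have /(L1Zl (x `^ (k + 1))^-1) := scales_L1 mT S L0.
  by apply: eq_L1 => s; rewrite E mulKf.
have h0 : 0 <= `|x^-1|^-1 by rewrite invr_ge0.
split => //.
have h : x `^ (k + 1) * \int[leb]_s (pw (- k) s * expR (- (x / s))) = `|x^-1|^-1 * gpc k.
  rewrite -(scales_Rint h0 S (measurable_gauss_power k 1)) -RintZl//.
  by apply: eq_Rint => s; exact: (esym (E s)).
apply: (mulfI xk); rewrite h normfV invrK gtr0_norm// mulrCA -powRD_gt0// mulrC; congr (_ * _).
by rewrite (_ : k + 1 - k = 1) ?powRr1 ?ltW//; ring.
Qed.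

(** Common interface of the weight t^(b-1) dt and of its limit at b = 0, the Dirac mass, so that
    fractional and classical variation (alpha = 1 - 2b) share one proof. The last two clauses are a
    potential estimate and the composition law: r^(a-1) combined with [om] yields v^(a+b-1). *)
Definition is_weight b (lam : {sigma_finite_measure set RR -> \bar R}) (om : RR -> R) : Prop :=
  [/\ measurable_fun setT om, forall t, 0 <= om t, forall t, t < 0 -> om t = 0,
   forall k, b < k -> exists C, 0 <= C /\ forall r, 0 < r ->
     (\int[lam]_t (om t * (r + t) `^ (- k))%:E <= (C * r `^ (b - k))%:E)%E &
   forall a, 0 < a -> exists B, 0 < B /\
     forall F : RR -> \bar R, measurable_fun setT F -> (forall x, (0 <= F x)%E) ->
     (\int[leb]_r \int[lam]_t ((pw a r * om t)%:E * F (r + t)%R) =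
      B%:E * \int[leb]_v ((pw (a + b) v)%:E * F v))%E].

(** The case alpha = 1. The density is the indicator of t >= 0 instead of the constant 1, because a
    weight has to vanish at negative times. *)
Lemma weight_dirac : @is_weight 0 (\d_(0 : RR)) (fun t => (0 <= t)%R%:R).
Proof.
have mle : measurable_fun setT (fun t : RR => (0 <= t)%R%:R : R).
  rewrite (_ : (fun t => _) = (fun t => if 0 <= t then 1 else 0)).
    by apply: measurable_fun_ifT => //; exact: measurable_fun_ler.
  by apply/funext => t; case: ifP.
split => //.
- by move=> t; rewrite ltNge => /negbTE ->.
- move=> k k0; exists 1; split => // r r0; rewrite integral_dirac//.
    by rewrite diracT mul1e lexx mul1r addr0 mul1r sub0r.
  apply/measurable_EFinP; apply: measurable_funM => //.
  by apply: (measurableT_comp (@measurable_powR R (- k))); exact: measurable_funD.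
- move=> a a0; exists 1; split => // F mF F0; rewrite mul1e addr0.
  apply: eq_integral => r _; rewrite integral_dirac//.
    by rewrite diracT mul1e lexx mulr1 addr0.
  apply: emeasurable_funM; first by apply/measurable_EFinP; exact: measurable_funM.
  apply: (measurableT_comp mF); exact: measurable_funD.
Qed.

End weights.

(** * The Beta integral and the composition of power weights *)

Section beta.
Variable R : realType.
Local Notation leb := (@lebesgue_measure R).
Local Notation RR := (measurableTypeR R).
Implicit Types a b c s t : R.

Lemma measurable_le01 (f g : RR -> R) : measurable_fun setT f -> measurable_fun setT g ->
  measurable_fun setT (fun t => (f t <= g t)%R%:R : R).
Proof.
move=> mf mg; rewrite (_ : (fun t => _) = (fun t => if f t <= g t then 1 else 0)).
  by apply: measurable_fun_ifT => //; exact: measurable_fun_ler.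
by apply/funext => t; case: ifP.
Qed.

Lemma pw_comparison a (x : R) : 2^-1 <= x -> x <= 1 -> pw a x <= 1 + 2^-1 `^ (a - 1).
Proof.
move=> x1 x2; have x0 : 0 < x by lra.
have h : (0 : R) <= 2^-1 `^ (a - 1) by exact: powR_ge0.
rewrite pwE//; have [a1|a1] := leP 1 a.
  have : x `^ (a - 1) <= 1 `^ (a - 1) by apply: powR_le; lra.
  rewrite powR_1; lra.
have : x `^ (a - 1) <= 2^-1 `^ (a - 1) by apply: powR_leN; lra.
lra.
Qed.

Lemma measurable_beta a b v : measurable_fun setT (fun t : RR => pw a (v - t) * pw b t).
Proof.
apply: measurable_funM; last exact: measurable_pw.
by apply: (measurableT_comp (measurable_pw a)); exact: measurable_funB.
Qed.

(** Each factor is singular at one endpoint only: on either side of 1/2 the other factor is bounded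
    by [pw_comparison]. *)
Lemma L1_beta a b : 0 < a -> 0 < b -> L1 leb (fun t => pw a (1 - t) * pw b t).
Proof.
move=> a0 b0.
pose Ca := 1 + (2^-1 : R) `^ (a - 1); pose Cb := 1 + (2^-1 : R) `^ (b - 1).
have m1 : (-1 : R) != 0 by rewrite oppr_eq0 oner_eq0.
have Lb : L1 leb (fun t => pw b t * (t <= 1)%R%:R) by exact: L1_pw_near0.
have mT : measurable_fun setT ((fun s => -1 * s + 1) : RR -> RR).
  by apply: measurable_funD => //; apply: measurable_funM.
have La := scales_L1 mT (lebesgue_affine1 1 m1) (L1_pw_near0 a0).
have Lg := L1D (L1Zl Ca Lb) (L1Zl Cb La).
apply: (L1_dom (measurable_beta a b 1) Lg) => t.
rewrite ger0_norm; last by rewrite mulr_ge0 ?pw_ge0.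
have E : -1 * t + 1 = 1 - t by ring.
rewrite E.
have Ca0 : 0 <= Ca by rewrite addr_ge0 ?powR_ge0.
have Cb0 : 0 <= Cb by rewrite addr_ge0 ?powR_ge0.
have pa := pw_ge0 a (1 - t); have pb := pw_ge0 b t.
have [t0|t0] := leP t 0; first by rewrite (@pw_le0 _ b)// mulr0 mul0r mulr0 add0r !mulr_ge0.
have [t1|t1] := leP 1 t.
  have -> : pw a (1 - t) = 0 by apply: pw_le0; lra.
  by rewrite !mul0r mulr0 addr0 !mulr_ge0.
have -> : (t <= 1) = true by apply/idP; lra.
have -> : (1 - t <= 1) = true by apply/idP; lra.
rewrite !mulr1; have [h|h] := leP t 2^-1.
  have := @pw_comparison a (1 - t); rewrite -/Ca => /(_ _ _)h1.
  have {}h1 : pw a (1 - t) <= Ca by apply: h1; lra.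
  nra.
have := @pw_comparison b t; rewrite -/Cb => h1.
have {}h1 : pw b t <= Cb by apply: h1; lra.
nra.
Qed.

Definition betac a b := \int[leb]_t (pw a (1 - t) * pw b t).

Lemma betac_gt0 a b : 0 < a -> 0 < b -> 0 < betac a b.
Proof.
move=> a0 b0; pose c := Num.min (pw a (4^-1)) (Num.min (pw a 1) (Num.min (pw b 4^-1) (pw b 1))).
have c0 : 0 < c by rewrite !lt_min !pw_gt0//; lra.
have cP x d : 4^-1 <= x -> x <= 1 -> Num.min (pw d (4^-1)) (pw d 1) <= pw d x.
  move=> x4 x1; rewrite ge_min !pwE; try lra.
  apply/orP; have [d1|d1] := leP 1 d; [left; apply: powR_le; lra|].
  by right; apply: powR_leN; lra.
apply: (@Rint_gt0 _ _ RR _ _ (c * c) `[4^-1, 2^-1]%classic).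
- exact: L1_beta.
- by move=> x; rewrite mulr_ge0 ?pw_ge0.
- exact: mulr_gt0.
- by [].
- by apply: lebesgue_itv01; lra.
- move=> x /=; rewrite in_itv/= => /andP[x1 x2].
  apply: ler_pM; [exact: ltW|exact: ltW| |].
    apply: (@le_trans _ _ (Num.min (pw a (4^-1)) (pw a 1))); last by apply: cP; lra.
    by rewrite /c minA ge_min lexx.
  apply: (@le_trans _ _ (Num.min (pw b (4^-1)) (pw b 1))); last by apply: cP; lra.
  by rewrite /c minA ge_min lexx orbT.
Qed.

(** The substitution t = v s reduces to v = 1; the power a+b-1 of v collects those of the two
    weights and of dt. *)
Lemma betaE a b v : 0 < a -> 0 < b ->
  (\int[leb]_t (pw a (v - t) * pw b t)%:E = (betac a b * pw (a + b) v)%:E)%E.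
Proof.
move=> a0 b0; have [v0|v0] := leP v 0.
  rewrite (pw_le0 _ v0) mulr0 -[RHS](@integral0 _ _ _ leb setT).
  apply: eq_integral => t _; have [t0|t0] := leP t 0; first by rewrite (@pw_le0 _ b)// mulr0.
  by rewrite pw_le0 ?mul0r//; lra.
have v1 : v != 0 by rewrite gt_eqF.
have := lebesgue_affine1 0 v1 (F := fun t => (pw a (v - t) * pw b t)%:E).
move=> /(_ _ _) S.
have {}S : (\int[leb]_x (pw a (v - (v * x + 0)) * pw b (v * x + 0))%:E =
   (`|v|^-1)%:E * \int[leb]_x (pw a (v - x) * pw b x)%:E)%E.
  apply: S; first by apply/measurable_EFinP; exact: measurable_beta.
  by move=> x; rewrite lee_fin mulr_ge0 ?pw_ge0.
have {}S : ((v `^ (a + b - 2) * betac a b)%:E =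
   (`|v|^-1)%:E * \int[leb]_x (pw a (v - x) * pw b x)%:E)%E.
  rewrite -S /betac -RintZl; last exact: L1_beta.
  rewrite EFin_Rint; last exact/L1Zl/L1_beta.
  apply: eq_integral => x _; rewrite addr0 -{2}[v]mulr1 -mulrBr !pwM//.
  rewrite (_ : a + b - 2 = (a - 1) + (b - 1)); last by ring.
  by rewrite powRD_gt0//; congr EFin; ring.
have := congr1 (fun x => v%:E * x)%E S.
rewrite muleA -!EFinM gtr0_norm// divff// mul1e => <-.
rewrite pwE// mulrA -{1}(powRr1 (ltW v0)) -powRD_gt0// mulrC; congr (_ * _ `^ _)%:E; ring.
Qed.

Lemma weight_pw b : 0 < b -> @is_weight R b leb (pw b).
Proof.
move=> b0; split.
- exact: measurable_pw.
- exact: pw_ge0.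
- by move=> t t0; rewrite pw_le0// ltW.
- move=> k bk.
  have mf r : measurable_fun setT (fun t : RR => pw b t * (r + t) `^ (- k)).
    apply: measurable_funM; first exact: measurable_pw.
    by apply: (measurableT_comp (@measurable_powR R (- k))); exact: measurable_funD.
  have L : L1 leb (fun t => pw b t * (1 + t) `^ (- k)).
    (* Near 0 the factor (1 + t)^(-k) is at most 1; at infinity it is at most t^(-k), and b < k
       gives decay. *)
    apply: (@L1_pw_dom R b (b - k) 1 1) => //; first lra.
    + by move=> t t0; rewrite pw_le0// mul0r.
    + move=> t t0 _; rewrite ger0_norm ?mulr_ge0 ?pw_ge0 ?powR_ge0// mul1r.
      rewrite ler_piMr ?pw_ge0// -[leRHS](powR_1 (- k)); apply: powR_leN; lra.
    + move=> t t1; rewrite ger0_norm ?mulr_ge0 ?pw_ge0 ?powR_ge0// mul1r.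
      rewrite -pwMpowR ler_wpM2l ?pw_ge0//; apply: powR_leN; lra.
  exists (\int[leb]_t (pw b t * (1 + t) `^ (- k))); split.
    by apply: Rintegral_ge0 => t _; rewrite mulr_ge0 ?pw_ge0 ?powR_ge0.
  move=> r r0; have r1 : r != 0 by rewrite gt_eqF.
  have S := lebesgue_affine1 0 r1 (F := fun t => (pw b t * (r + t) `^ (- k))%:E).
  have {}S : (\int[leb]_x (pw b (r * x + 0) * (r + (r * x + 0)) `^ (- k))%:E =
     (`|r|^-1)%:E * \int[leb]_t (pw b t * (r + t) `^ (- k))%:E)%E.
    apply: S; first exact/measurable_EFinP.
    by move=> x; rewrite lee_fin mulr_ge0 ?pw_ge0 ?powR_ge0.
  have {}S : ((r `^ (b - 1 - k) * \int[leb]_t (pw b t * (1 + t) `^ (- k)))%:E =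
     (`|r|^-1)%:E * \int[leb]_t (pw b t * (r + t) `^ (- k))%:E)%E.
    rewrite -S -RintZl// EFin_Rint; last exact/L1Zl.
    apply: eq_integral => x _; rewrite addr0 pwM//; congr EFin.
    have [x0|x0] := leP x 0; first by rewrite pw_le0// !mulr0 !mul0r mulr0.
    have -> : r + r * x = r * (1 + x) by ring.
    rewrite powRM; [|exact: ltW|by lra].
    by rewrite powRD_gt0//; ring.
  have := congr1 (fun x => r%:E * x)%E S.
  rewrite muleA -!EFinM gtr0_norm// divff// mul1e => <-.
  rewrite lee_fin mulrA -{1}(powRr1 (ltW r0)) -powRD_gt0// mulrC.
  rewrite (_ : 1 + (b - 1 - k) = b - k)//; ring.
- move=> a a0; exists (betac a b); split; first exact: betac_gt0.
  move=> F mF F0.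
  have mpa : measurable_fun setT (fun z : RR * RR => pw a (z.1 - z.2)).
    by apply: (measurableT_comp (measurable_pw a)); exact: measurable_funB.
  have mp1 : measurable_fun setT (fun z : RR * RR => pw a z.1).
    exact: (measurableT_comp (measurable_pw a)).
  have mp2 : measurable_fun setT (fun z : RR * RR => pw b z.2).
    exact: (measurableT_comp (measurable_pw b)).
  have mFD : measurable_fun setT (fun z : RR * RR => F (z.1 + z.2)).
    by apply: (measurableT_comp mF); exact: measurable_funD.
  have mF1 : measurable_fun setT (fun z : RR * RR => F z.1) by exact: (measurableT_comp mF).
  rewrite (tonelli_swap _ _ (f := fun r t : RR => ((pw a r * pw b t)%:E * F (r + t)%R)%E)); last 2 first.
  - by apply: emeasurable_funM => //; apply/measurable_EFinP; exact: measurable_funM.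
  - by move=> ? ?; rewrite mule_ge0// lee_fin mulr_ge0 ?pw_ge0.
  (* With v = r + t and the order of integration exchanged, the inner integral becomes the one
     evaluated by [betaE]. *)
  transitivity (\int[leb]_t \int[leb]_v ((pw a (v - t) * pw b t)%:E * F v))%E.
    apply: eq_integral => t _ /=.
    have := lebesgue_affine1 t (oner_neq0 R) (F := fun v => ((pw a (v - t) * pw b t)%:E * F v)%E).
    move=> S; transitivity (\int[leb]_x ((pw a (1 * x + t - t) * pw b t)%:E * F (1 * x + t)%R))%E.
      by apply: eq_integral => r _; rewrite mul1r addrK.
    rewrite S ?normr1 ?invr1 ?mul1e//.
    - apply: emeasurable_funM => //; apply/measurable_EFinP; apply: measurable_funM => //.
      by apply: (measurableT_comp (measurable_pw a)); exact: measurable_funB.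
    - by move=> v; rewrite mule_ge0// lee_fin mulr_ge0 ?pw_ge0.
  rewrite -(tonelli_swap _ _ (f := fun v t : RR => ((pw a (v - t) * pw b t)%:E * F v)%E)); last 2 first.
  - by apply: emeasurable_funM => //; apply/measurable_EFinP; exact: measurable_funM.
  - by move=> ? ?; rewrite mule_ge0// lee_fin mulr_ge0 ?pw_ge0.
  rewrite -ge0_integralZl//; last 3 first.
  - by apply: emeasurable_funM => //; apply/measurable_EFinP; exact: measurable_pw.
  - by move=> v _; rewrite mule_ge0// lee_fin pw_ge0.
  - by rewrite lee_fin ltW// betac_gt0.
  apply: eq_integral => v _ /=; rewrite ge0_integralZr//; last 2 first.
  - by apply/measurable_EFinP; exact: measurable_beta.
  - by move=> t _; rewrite lee_fin mulr_ge0 ?pw_ge0.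
  by rewrite betaE// EFinM muleA.
Qed.

End beta.

(** * Consequences of the weight interface *)

Section weight_theory.
Variable R : realType.
Local Notation leb := (@lebesgue_measure R).
Local Notation RR := (measurableTypeR R).
Variables (b : R) (lam : {sigma_finite_measure set RR -> \bar R}) (om : RR -> R).
Hypothesis Hw : is_weight b lam om.

Lemma om_measurable : measurable_fun setT om. Proof. by case: Hw. Qed.
Lemma om_ge0 t : 0 <= om t. Proof. by case: Hw. Qed.
Lemma om_lt0 t : t < 0 -> om t = 0. Proof. by case: Hw => _ _ h _ _; exact: h. Qed.

Lemma om_power k : b < k -> exists C, 0 <= C /\ forall r, 0 < r ->
  L1 lam (fun t => om t * (r + t) `^ (- k)) /\
  \int[lam]_t (om t * (r + t) `^ (- k)) <= C * r `^ (b - k).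
Proof.
case: Hw => mo o0 _ h _ bk; have [C [C0 HC]] := h k bk.
exists C; split => // r r0; apply: L1_bound; last exact: HC.
  apply: measurable_funM => //.
  by apply: (measurableT_comp (@measurable_powR R (- k))); exact: measurable_funD.
by move=> t; rewrite mulr_ge0 ?powR_ge0.
Qed.

(** The composition law passes from non-negative to signed [F] through positive and negative parts;
    Tonelli supplies the joint integrability. *)
Lemma om_beta a : 0 < a -> exists B, 0 < B /\ forall F : RR -> R,
  L1 leb (fun v => pw (a + b) v * F v) -> measurable_fun setT F ->
  L1 (leb \x lam)%E (fun z => pw a z.1 * om z.2 * F (z.1 + z.2)) /\
  \int[leb]_r \int[lam]_t (pw a r * om t * F (r + t)) = B * \int[leb]_v (pw (a + b) v * F v).
Proof.
case: Hw => mo o0 _ _ h a0; have [B [B0 HB]] := h a a0.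
exists B; split => // F LF mF.
have mG (G : RR -> R) : measurable_fun setT G ->
    measurable_fun setT (fun z : RR * RR => pw a z.1 * om z.2 * G (z.1 + z.2)).
  move=> mG; apply: measurable_funM.
    by apply: measurable_funM; [exact: (measurableT_comp (measurable_pw a))|exact: (measurableT_comp mo)].
  by apply: (measurableT_comp mG); exact: measurable_funD.
have pos (G : RR -> R) : measurable_fun setT G -> (forall x, 0 <= G x) ->
    L1 leb (fun v => pw (a + b) v * G v) ->
    L1 (leb \x lam)%E (fun z => pw a z.1 * om z.2 * G (z.1 + z.2)) /\
    \int[leb]_r \int[lam]_t (pw a r * om t * G (r + t)) = B * \int[leb]_v (pw (a + b) v * G v).
  move=> mG' G0 LG.
  have E := HB (EFin \o G) _ _.
  have {}E : (\int[leb]_r \int[lam]_t (pw a r * om t * G (r + t))%:E =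
    B%:E * \int[leb]_v (pw (a + b) v * G v)%:E)%E by apply: E => //; exact/measurable_EFinP.
  rewrite -(EFin_Rint LG) -EFinM in E.
  have L : L1 (leb \x lam)%E (fun z => pw a z.1 * om z.2 * G (z.1 + z.2)).
    apply/integrable12ltyP; first by apply/measurable_EFinP; exact: mG.
    rewrite (_ : (\int[_]_x _) = (B * \int[leb]_v (pw (a + b) v * G v))%:E)%E ?ltry//.
    rewrite -E; apply: eq_integral => r _; apply: eq_integral => t _ /=.
    by rewrite ger0_norm// !mulr_ge0 ?pw_ge0.
  split => //; rewrite (Rint_fubini1 (f := fun r t : RR => pw a r * om t * G (r + t)) L) /Rintegral.
  rewrite (tonelli_prod _ _ (f := fun r t : RR => (pw a r * om t * G (r + t))%:E)); first by rewrite E.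
    by apply/measurable_EFinP; exact: mG.
  by move=> ? ?; rewrite lee_fin !mulr_ge0 ?pw_ge0.
have mFp : measurable_fun setT (fun x => Num.max (F x) 0) by exact: measurable_maxr.
have mFn : measurable_fun setT (fun x => Num.max (- F x) 0).
  by apply: measurable_maxr => //; exact: measurable_funN.
have Fpn x : F x = Num.max (F x) 0 - Num.max (- F x) 0.
  by have [h1|h1] := leP 0 (F x); [rewrite max_r ?subr0//; lra|rewrite max_l ?sub0r ?opprK//; lra].
have Labs (G : RR -> R) : measurable_fun setT G -> (forall x, 0 <= G x <= `|F x|) ->
    L1 leb (fun v => pw (a + b) v * G v).
  move=> mG' GF; apply: (L1_dom _ (L1_norm LF)).
    by apply: measurable_funM => //; exact: measurable_pw.
  move=> v; have /andP[h1 h2] := GF v.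
  by rewrite !normrM ler_wpM2l// ger0_norm.
have Lp : L1 leb (fun v => pw (a + b) v * Num.max (F v) 0).
  by apply: Labs => // x; rewrite le_max lexx orbT/= ge_max normr_ge0 ler_norm.
have Ln : L1 leb (fun v => pw (a + b) v * Num.max (- F v) 0).
  by apply: Labs => // x; rewrite le_max lexx orbT/= ge_max normr_ge0 -normrN ler_norm.
have Fp0 x : 0 <= Num.max (F x) 0 by rewrite le_max lexx orbT.
have Fn0 x : 0 <= Num.max (- F x) 0 by rewrite le_max lexx orbT.
have [Lp2 Ep] := pos _ mFp Fp0 Lp.
have [Ln2 En] := pos _ mFn Fn0 Ln.
have L : L1 (leb \x lam)%E (fun z => pw a z.1 * om z.2 * F (z.1 + z.2)).
  by apply: (eq_L1 _ (L1B Lp2 Ln2)) => z; rewrite -mulrBr -Fpn.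
split => //.
rewrite (Rint_fubini1 (f := fun r t : RR => pw a r * om t * F (r + t)) L).
transitivity (\int[leb]_r \int[lam]_t (pw a r * om t * Num.max (F (r + t)) 0) -
  \int[leb]_r \int[lam]_t (pw a r * om t * Num.max (- F (r + t)) 0)).
  rewrite (Rint_fubini1 (f := fun r t : RR => pw a r * om t * Num.max (F (r + t)) 0) Lp2).
  rewrite (Rint_fubini1 (f := fun r t : RR => pw a r * om t * Num.max (- F (r + t)) 0) Ln2).
  by rewrite -RintB//; apply: eq_Rint => z; rewrite -mulrBr -Fpn.
rewrite Ep En -mulrBr -RintB//; congr (_ * _); apply: eq_Rint => v.
by rewrite -mulrBr -Fpn.
Qed.

End weight_theory.

(** * Integrability of Gaussians; tame functions *)

Section gaussian_profiles.
Variables (R : realType) (n : nat).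
Variable mu : {sigma_finite_measure set (Rn R n) -> \bar R}.
Hypothesis Hmu : is_lebesgue mu.
Local Notation leb := (@lebesgue_measure R).
Local Notation RR := (measurableTypeR R).
Local Notation X := (Rn R n).
Implicit Types (x y z w : 'rV[R]_n) (a b c s t : R).

Definition sqn z : R := dotv z z.
(** The l^1 norm, used for lengths of increments because these are estimated one coordinate at a
    time. *)
Definition nrm z : R := \sum_(i < n) `|z 0 i|.

Lemma measurable_lt01 d (T : measurableType d) (f g : T -> R) : measurable_fun setT f ->
  measurable_fun setT g -> measurable_fun setT (fun u => (f u < g u)%R%:R : R).
Proof.
move=> mf mg; rewrite (_ : (fun u => _) = (fun u => if f u < g u then 1 else 0)).
  by apply: measurable_fun_ifT => //; exact: measurable_fun_ltr.
by apply/funext => u; case: ifP.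
Qed.

Lemma sqnE z : sqn z = \sum_(i < n) z 0 i ^+ 2.
Proof. by apply: eq_bigr => i _; rewrite expr2. Qed.

Lemma sqn_ge0 z : 0 <= sqn z.
Proof. by rewrite sqnE sumr_ge0// => i _; rewrite sqr_ge0. Qed.

Lemma nrm_ge0 z : 0 <= nrm z.
Proof. by rewrite sumr_ge0. Qed.

Lemma coord_le_nrm z i : `|z 0 i| <= nrm z.
Proof. by rewrite /nrm (bigD1 i)//= lerDl sumr_ge0. Qed.

Lemma nrmD x y : nrm (x + y) <= nrm x + nrm y.
Proof. by rewrite -big_split/= ler_sum// => i _; rewrite mxE ler_normD. Qed.

Lemma nrmN z : nrm (- z) = nrm z.
Proof. by apply: eq_bigr => i _; rewrite mxE normrN. Qed.

Lemma nrmZ c z : nrm (c *: z) = `|c| * nrm z.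
Proof. by rewrite /nrm mulr_sumr; apply: eq_bigr => i _; rewrite mxE normrM. Qed.

Lemma sqnN z : sqn (- z) = sqn z.
Proof. by rewrite !sqnE; apply: eq_bigr => i _; rewrite mxE sqrrN. Qed.

Lemma sqnZ c z : sqn (c *: z) = c ^+ 2 * sqn z.
Proof. by rewrite !sqnE mulr_sumr; apply: eq_bigr => i _; rewrite mxE exprMn. Qed.

Lemma coord2_le_sqn z i : z 0 i ^+ 2 <= sqn z.
Proof. by rewrite sqnE (bigD1 i)//= lerDl sumr_ge0// => j _; rewrite sqr_ge0. Qed.

Lemma sqn_eq0 z : sqn z = 0 -> z = 0.
Proof.
move=> z0; apply/rowP => i; rewrite mxE; have := coord2_le_sqn z i.
rewrite z0 => h; apply/eqP; rewrite -sqrf_eq0; apply/eqP/le_anti.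
by rewrite h sqr_ge0.
Qed.

(** Cauchy-Schwarz, from 2ab <= a^2 + b^2 summed over all pairs of coordinates. *)
Lemma nrm2_le_sqn z : nrm z ^+ 2 <= n%:R * sqn z.
Proof.
rewrite expr2 {1}/nrm mulr_suml.
apply: (@le_trans _ _ (\sum_(i < n) \sum_(j < n) (z 0 i ^+ 2 + z 0 j ^+ 2) / 2)).
  apply: ler_sum => i _; rewrite /nrm mulr_sumr; apply: ler_sum => j _.
  have := sqr_ge0 (`|z 0 i| - `|z 0 j|).
  rewrite -(real_normK (num_real (z 0 i))) -(real_normK (num_real (z 0 j))); nra.
under eq_bigr do rewrite -mulr_suml big_split/= sumr_const card_ord -sqnE.
rewrite -mulr_suml big_split/= sumr_const card_ord.
under eq_bigr do rewrite -mulr_natl.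
rewrite -mulr_sumr -sqnE -mulr_natl; lra.
Qed.

Lemma sqn_diff x z : `|sqn (x + z) - sqn x| <= nrm z * (nrm x + nrm (x + z)).
Proof.
rewrite !sqnE -sumrB; apply: (le_trans (ler_norm_sum _ _ _)).
rewrite {1}/nrm mulr_suml; apply: ler_sum => i _.
rewrite (_ : _ - _ = z 0 i * (x 0 i + (x + z) 0 i)); last by rewrite !mxE; ring.
rewrite normrM ler_wpM2l// (le_trans (ler_normD _ _))//.
by rewrite lerD// coord_le_nrm.
Qed.

Lemma measurable_coordX d (T : measurableType d) (h : T -> X) i :
  measurable_fun setT h -> measurable_fun setT (fun u => h u 0 i).
Proof. by move=> mh; exact: (measurableT_comp (@measurable_coord R n i) mh). Qed.

Lemma measurable_sqn : measurable_fun setT (sqn : X -> R).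
Proof.
apply: measurable_sum => i; apply: measurable_funM; exact: measurable_coord.
Qed.

Lemma measurable_nrm : measurable_fun setT (nrm : X -> R).
Proof.
by apply: measurable_sum => i; apply: measurableT_comp => //; exact: measurable_coord.
Qed.

Lemma measurable_subX d (T : measurableType d) (h k : T -> X) :
  measurable_fun setT h -> measurable_fun setT k -> measurable_fun setT (fun u => h u - k u : X).
Proof.
move=> mh mk; apply: measurable_fun_Rn => i; under eq_fun do rewrite !mxE.
by apply: measurable_funB; apply: measurable_coordX.
Qed.

Lemma measurable_scaleX d (T : measurableType d) (c : T -> R) (h : T -> X) :
  measurable_fun setT c -> measurable_fun setT h -> measurable_fun setT (fun u => c u *: h u : X).
Proof.
move=> mc mh; apply: measurable_fun_Rn => i; under eq_fun do rewrite !mxE.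
by apply: measurable_funM => //; apply: measurable_coordX.
Qed.

Lemma L1_shift (f : X -> R) v : L1 mu f -> L1 mu (fun x => f (x + v)).
Proof.
move=> Lf; have := scales_L1 (@measurable_affine R n 1 v) (lebesgue_affine Hmu v (oner_neq0 R)) Lf.
by apply: eq_L1 => x; rewrite scale1r.
Qed.

Lemma Rint_shift (f : X -> R) v : measurable_fun setT f ->
  \int[mu]_x f (x + v) = \int[mu]_x f x.
Proof.
move=> mf; have := scales_Rint _ (lebesgue_affine Hmu v (oner_neq0 R)) mf.
rewrite normr1 expr1n invr1 mul1r => <-//.
by apply: eq_Rint => x; rewrite scale1r.
Qed.

Lemma N1_neq0 : (-1 : R) != 0. Proof. by rewrite oppr_eq0 oner_eq0. Qed.

Lemma L1_refl (f : X -> R) v : L1 mu f -> L1 mu (fun x => f (v - x)).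
Proof.
move=> Lf; have := scales_L1 (@measurable_affine R n (-1) v) (lebesgue_affine Hmu v N1_neq0) Lf.
by apply: eq_L1 => x; rewrite scaleN1r addrC.
Qed.

Lemma Rint_refl (f : X -> R) v : measurable_fun setT f ->
  \int[mu]_x f (v - x) = \int[mu]_x f x.
Proof.
move=> mf; have := scales_Rint _ (lebesgue_affine Hmu v N1_neq0) mf.
rewrite normrN1 expr1n invr1 mul1r => <-//.
by apply: eq_Rint => x; rewrite scaleN1r addrC.
Qed.

Lemma L1_dil (f : X -> R) c v : 0 < c -> L1 mu f -> L1 mu (fun x => f (c *: x + v)).
Proof.
move=> c0 Lf; have cn0 : c != 0 by rewrite gt_eqF.
exact: (scales_L1 (@measurable_affine R n c v) (lebesgue_affine Hmu v cn0) Lf).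
Qed.

Lemma Rint_dil (f : X -> R) c v : 0 < c -> measurable_fun setT f ->
  \int[mu]_x f (c *: x + v) = c ^- n * \int[mu]_x f x.
Proof.
move=> c0 mf; have cn0 : c != 0 by rewrite gt_eqF.
have := scales_Rint _ (lebesgue_affine Hmu v cn0) mf.
by rewrite gtr0_norm// => ->//; rewrite invr_ge0 exprn_ge0// ltW.
Qed.

Lemma eq_RintX (f g : X -> R) : (forall x : X, f x = g x) -> \int[mu]_x f x = \int[mu]_x g x.
Proof. exact: eq_Rint. Qed.

Definition ge z : R := expR (- sqn z).

Lemma measurable_ge : measurable_fun setT (ge : X -> R).
Proof.
by apply: measurableT_comp => //; apply: measurable_funN; exact: measurable_sqn.
Qed.

(** A layer-cake bound: on []a, a + 1]] the integrand exp(1 - s) is at least exp(-a), and this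
    window has length 1. *)
Lemma expR_layer a : 0 <= a ->
  ((expR (- a))%:E <= \int[leb]_s ((expR 1 * expR (- s) * (a < s)%R%:R)%:E))%E.
Proof.
move=> a0.
have -> : (expR (- a))%:E = (\int[leb]_(s in `]a, (a + 1)%R]) (cst (expR (- a))%:E) s)%E.
  have L : leb (`]a, a + 1]%classic : set R) = 1%E.
    by rewrite lebesgue_measure_itv/= lte_fin ltrDl ltr01 -EFinB addrAC subrr add0r.
  by rewrite integral_cst//; move: L => /= ->; rewrite mule1.
rewrite integral_mkcond; apply: ge0_le_integral => //.
- by move=> s _; rewrite patchE; case: ifP => // _; rewrite lee_fin expR_ge0.
- by apply/(measurable_restrictT (cst (expR (- a))%:E)) => //; exact: measurable_cst.
- apply/measurable_EFinP; apply: measurable_funM.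
    by apply: measurable_funM => //; apply: measurableT_comp => //; exact: measurable_funN.
  exact: measurable_lt01.
- move=> s _; rewrite patchE; case: ifPn; last by rewrite lee_fin !mulr_ge0 ?expR_ge0.
  rewrite inE/= in_itv/= => /andP[h1 h2]; rewrite h1 mulr1 -expRD lee_fin ler_expR; lra.
Qed.

Lemma sqn_lt_cbox s : [set x : X | sqn x < s] `<=`
  cbox (const_mx (- Num.sqrt s)) (const_mx (Num.sqrt s)).
Proof.
move=> x /= xs i; rewrite !mxE -ler_norml -sqrtr_sqr ler_wsqrtr//.
exact: le_trans (coord2_le_sqn x i) (ltW xs).
Qed.

(** As [mu] is given on boxes, integrability comes from layers and not from a product of
    one-dimensional integrals: a ball of squared radius s lies in a cube of volume (2 sqrt s)^n,
    which leaves the integral defining Gamma(n/2 + 1). *)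
Lemma L1_ge : L1 mu ge.
Proof.
pose C := expR 1 * 2 ^+ n * \int[leb]_s (pw (n%:R / 2 + 1) s * expR (- s)).
have Lg : L1 leb (fun s => pw (n%:R / 2 + 1) s * expR (- s)).
  by apply: L1_gamma; rewrite ltr_wpDl// divr_ge0.
suff h : (\int[mu]_x (ge x)%:E <= C%:E)%E.
  by apply: (L1_bound measurable_ge _ h).1 => x; exact: expR_ge0.
have mF : measurable_fun setT (fun z : X * RR =>
    (expR 1 * expR (- z.2) * (sqn z.1 < z.2)%R%:R)%:E).
  apply/measurable_EFinP; apply: measurable_funM.
    by apply: measurable_funM => //; apply: measurableT_comp => //; exact: measurable_funN.
  by apply: measurable_lt01 => //; exact: (measurableT_comp measurable_sqn).
have F0 (x : X) (s : RR) : (0 <= (expR 1 * expR (- s) * (sqn x < s)%R%:R)%:E)%E.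
  by rewrite lee_fin !mulr_ge0 ?expR_ge0.
apply: (@le_trans _ _ (\int[mu]_x \int[leb]_s ((expR 1 * expR (- s) * (sqn x < s)%R%:R)%:E))%E).
  apply: ge0_le_integral => //.
  - by move=> x _; rewrite lee_fin expR_ge0.
  - by apply/measurable_EFinP; exact: measurable_ge.
  - by apply: (measurable_int_sec1 _ (f := fun (x : X) (s : RR) => (expR 1 * expR (- s) * (sqn x < s)%R%:R)%:E)).
  - by move=> x _; apply: expR_layer; exact: sqn_ge0.
rewrite (tonelli_swap _ _ (f := fun (x : X) (s : RR) => (expR 1 * expR (- s) * (sqn x < s)%R%:R)%:E))//.
rewrite /C -RintZl// EFin_Rint; last exact: L1Zl.
apply: ge0_le_integral => //.
- by move=> s _; apply: integral_ge0.
- apply: (measurable_int_sec1 _ (f := fun (s : RR) (x : X) => (expR 1 * expR (- s) * (sqn x < s)%R%:R)%:E)) => //.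
  apply/measurable_EFinP.
  apply: (measurable_uncurry_swap (f := fun (x : X) (s : RR) => (expR 1 * expR (- s) * (sqn x < s)%R%:R))).
  exact/measurable_EFinP.
- by apply/measurable_EFinP; exact: L1_measurable (L1Zl _ Lg).
move=> s _; have [s0|s0] := leP s 0.
  rewrite pw_le0// mul0r mulr0 integral0_eq// => x _.
  by rewrite ltNge (le_trans s0 (sqn_ge0 x))/= mulr0.
have es := expR_ge0 (- s); have e1 := expR_ge0 (1 : R).
pose B := cbox (const_mx (- Num.sqrt s)) (const_mx (Num.sqrt s)) : set X.
have mB : measurable B by exact: measurable_cbox.
apply: (@le_trans _ _ (\int[mu]_x ((expR 1 * expR (- s))%:E * (\1_B x)%:E))%E).
  apply: ge0_le_integral => //.
  - apply/measurable_EFinP; apply: measurable_funM => //.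
    by apply: measurable_lt01 => //; exact: measurable_sqn.
  - by apply/measurable_EFinP; apply: measurable_funM.
  - move=> x _; rewrite lee_fin ler_wpM2l ?mulr_ge0// indicE.
    case: ltP => // xs; rewrite mem_set//; exact: sqn_lt_cbox.
rewrite ge0_integralZl//; try (by rewrite lee_fin mulr_ge0); try exact/measurable_EFinP.
rewrite integral_indic// setIT Hmu; last first.
  by move=> i; rewrite !mxE (@le_trans _ _ 0) ?oppr_le0 ?sqrtr_ge0.
rewrite -EFinM lee_fin; under eq_bigr do rewrite !mxE opprK.
rewrite prodr_const card_ord pwE// addrK.
have -> : Num.sqrt s + Num.sqrt s = 2 * s `^ 2^-1.
  by rewrite (powR12_sqrt (ltW s0)); ring.
rewrite exprMn -(powR_mulrn n (powR_ge0 _ _)) -powRrM [2^-1 * _]mulrC le_eqVlt; apply/orP; left; apply/eqP; ring.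
Qed.

Lemma ge_ge0 z : 0 <= ge z. Proof. exact: expR_ge0. Qed.
Definition gI := \int[mu]_x ge x.

Lemma gI_gt0 : 0 < gI.
Proof.
pose B := cbox (const_mx 0) (const_mx 1) : set X.
apply: (@Rint_gt0 _ _ _ _ _ (expR (- n%:R)) B).
- exact: L1_ge.
- by move=> x; exact: ge_ge0.
- exact: expR_gt0.
- exact: measurable_cbox.
- rewrite Hmu; last by move=> i; rewrite !mxE.
  by rewrite lte_fin prodr_gt0// => i _; rewrite !mxE subr0.
- move=> x xB; rewrite ler_expR lerN2 sqnE.
  rewrite -[leRHS](_ : \sum_(i < n) 1 = _); last by rewrite sumr_const card_ord.
  apply: ler_sum => i _; have := xB i; rewrite !mxE => /andP[h1 h2]; nra.
Qed.

Lemma L1_ge2 : L1 mu (fun x => expR (- (sqn x / 2))).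
Proof.
have s2 : 0 < Num.sqrt (2^-1 : R) by rewrite sqrtr_gt0 invr_gt0.
apply: (eq_L1 _ (L1_dil 0 s2 L1_ge)) => x.
by rewrite /ge addr0 sqnZ sqr_sqrtr ?invr_ge0// mulrC.
Qed.

(** Half of the Gaussian exponent absorbs the polynomial, the other half stays as an integrable
    bound. *)
Lemma poly_gauss m : exists C, 0 <= C /\ forall x,
  (1 + nrm x) ^+ m * ge x <= C * expR (- (sqn x / 2)).
Proof.
(* The inequality 1 + v <= exp v at v = u / (2(k+1)), raised to the power k+1. *)
have key k (u : R) : 0 <= u -> (1 + u) ^+ k.+1 <= (2 * k.+1%:R) ^+ k.+1 * expR (u / 2).
  move=> u0; pose v := u / (2 * k.+1%:R).
  have k0 : (0 : R) < 2 * k.+1%:R by rewrite mulr_gt0.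
  have v0 : 0 <= v by rewrite divr_ge0// ltW.
  have -> : expR (u / 2) = expR v ^+ k.+1.
    rewrite -expRM_natl; congr expR; rewrite /v; field.
    by rewrite gt_eqF// (@lt_le_trans _ _ 1)// lerDl.
  rewrite -exprMn; apply: lerXn2r; rewrite ?nnegrE; [lra|by rewrite mulr_ge0 ?expR_ge0// ltW|].
  apply: (@le_trans _ _ (2 * k.+1%:R * (1 + v))); last by rewrite ler_pM2l// expR_ge1Dx.
  have -> : 2 * k.+1%:R * (1 + v) = 2 * k.+1%:R + u.
    by rewrite mulrDr mulr1 [_ * v]mulrC /v divfK// gt_eqF.
  have : (1 : R) <= k.+1%:R by rewrite ler1n.
  lra.
pose C := (2 + 2 * n%:R) ^+ m * (2 * m.+1%:R) ^+ m.+1 : R.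
exists C; split => [|x]; first by rewrite mulr_ge0// exprn_ge0.
have N0 := nrm_ge0 x; have S0 := sqn_ge0 x.
have h1 : 1 + nrm x <= (2 + 2 * n%:R) * (1 + sqn x).
  have := nrm2_le_sqn x; have n0 : (0 : R) <= n%:R by [].
  have := sqr_ge0 (nrm x - 1); nra.
have h2 : (1 + nrm x) ^+ m <= (2 + 2 * n%:R) ^+ m * (1 + sqn x) ^+ m.+1.
  apply: (@le_trans _ _ ((2 + 2 * n%:R) ^+ m * (1 + sqn x) ^+ m)).
    by rewrite -exprMn lerXn2r ?nnegrE ?addr_ge0 ?mulr_ge0 ?addr_ge0.
  rewrite ler_wpM2l ?exprn_ge0// ?addr_ge0// exprS ler_peMl ?exprn_ge0 ?addr_ge0//; lra.
have h3 := key m _ S0.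
apply: (@le_trans _ _ (C * expR (sqn x / 2) * ge x)).
  rewrite ler_wpM2r ?ge_ge0// (le_trans h2)// /C -mulrA ler_wpM2l// exprn_ge0//.
rewrite -mulrA /ge -expRD; apply: ler_wpM2l; first by rewrite mulr_ge0// exprn_ge0.
by rewrite ler_expR; lra.
Qed.

Lemma measurable_polyge m : measurable_fun setT (fun x : X => (1 + nrm x) ^+ m * ge x).
Proof.
apply: measurable_funM; last exact: measurable_ge.
by apply: measurable_funX; apply: measurable_funD => //; exact: measurable_nrm.
Qed.

Lemma polyge_ge0 m x : 0 <= (1 + nrm x) ^+ m * ge x.
Proof. by rewrite mulr_ge0 ?ge_ge0// exprn_ge0// addr_ge0 ?nrm_ge0. Qed.

Lemma L1_polyge m : L1 mu (fun x => (1 + nrm x) ^+ m * ge x).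
Proof.
have [C [C0 HC]] := poly_gauss m.
apply: (L1_dom (measurable_polyge m) (L1Zl C L1_ge2)) => x.
by rewrite ger0_norm ?polyge_ge0.
Qed.

Lemma polyge_bounded m : exists C, 0 <= C /\ forall x, (1 + nrm x) ^+ m * ge x <= C.
Proof.
have [C [C0 HC]] := poly_gauss m; exists C; split => // x.
rewrite (le_trans (HC x))// ler_piMr// expR_le1 oppr_le0 divr_ge0 ?sqn_ge0//.
Qed.

(** For a <= b everything follows from 1 - d <= exp(-d) with d = b - a. *)
Lemma expR_diff a b : `|expR (- a) - expR (- b)| <= `|a - b| * (expR (- a) + expR (- b)).
Proof.
wlog ab : a b / a <= b.
  move=> h; have [|/ltW] := leP a b; first exact: h.
  by move=> /h; rewrite distrC [`|b - a|]distrC [expR (- b) + _]addrC.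
have e1 := expR_ge0 (- a).
rewrite [`|a - b|]distrC !ger0_norm ?subr_ge0 ?ler_expR ?lerN2//.
have : 1 - (b - a) <= expR (- (b - a)) by rewrite expR_ge1Dx.
have -> : expR (- b) = expR (- a) * expR (- (b - a)) by rewrite -expRD; congr expR; ring.
have e3 := expR_ge0 (- (b - a)).
move: (expR (- a)) (expR (- (b - a))) e1 e3 => E q E0 q0 h.
have h1 : E * (1 - q) <= E * (b - a) by rewrite ler_wpM2l//; lra.
have h2 : 0 <= (b - a) * (E * q) by rewrite mulr_ge0 ?mulr_ge0 ?subr_ge0.
lra.
Qed.

(* The class of kernels and test functions whose translation differences are controlled. *)
Definition tame (K H : X -> R) (M : R) : Prop :=
  [/\ measurable_fun setT K /\ measurable_fun setT H, forall x, `|K x| <= H x,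
   forall x z, `|K (x + z) - K x| <= Num.min 1 (nrm z) * (H x + H (x + z)),
   forall x, H x <= M & L1 mu H].

(** The kernels are polynomials of degree at most 2 times [ge]; an increment of the exponent |x|^2
    costs one further degree. The constant 18 = 6 + 12 adds the two contributions at the point x + z
    in [tame_polyge]. *)
Definition gdom x : R := 18 * ((1 + nrm x) ^+ 3 * ge x).

Lemma gdom_ge0 x : 0 <= gdom x.
Proof. by rewrite mulr_ge0// polyge_ge0. Qed.

Lemma tame_polyge (P : X -> R) : measurable_fun setT P ->
  (forall x, `|P x| <= (1 + nrm x) ^+ 2) ->
  (forall x z, `|P (x + z) - P x| <= 2 * nrm z * (2 + nrm x + nrm (x + z))) ->
  exists M, tame (fun x => P x * ge x) gdom M.
Proof.
move=> mP P2 PL; have [C [C0 HC]] := polyge_bounded 3.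
exists (18 * C); split.
- split; first by apply: measurable_funM => //; exact: measurable_ge.
  by apply: measurable_funM => //; exact: measurable_polyge.
- move=> x; rewrite normrM [`|ge x|]ger0_norm ?ge_ge0// /gdom mulrA ler_wpM2r ?ge_ge0//.
  rewrite (le_trans (P2 x))//; have := nrm_ge0 x; nra.
- move=> x z; set y := x + z.
  have gx := ge_ge0 x; have gy := ge_ge0 y; have nz := nrm_ge0 z.
  have nx := nrm_ge0 x; have ny := nrm_ge0 y.
  have Px := P2 x; have Py := P2 y.
  (* A long step needs no cancellation. For a short one the factors 1 + |x| and 1 + |x + z| differ
     by at most a factor 2, and the product rule for differences applies. *)
  have [z1|z1] := leP 1 (nrm z).
    rewrite mul1r (le_trans (ler_normB _ _))// addrC !normrM !(ger0_norm (ge_ge0 _)).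
    by apply: lerD; rewrite /gdom mulrA ler_wpM2r//; nra.
  have xy : nrm x <= nrm y + 1.
    have := nrmD y (- z); rewrite nrmN /y addrK; lra.
  have yx : nrm y <= nrm x + 1 by have := nrmD x z; rewrite -/y; lra.
  have D := expR_diff (sqn y) (sqn x); rewrite -/(ge y) -/(ge x) in D.
  have S := sqn_diff x z; rewrite -/y in S.
  have DP := PL x z; rewrite -/y in DP.
  rewrite (_ : _ - _ = (P y - P x) * ge y + P x * (ge y - ge x)); last by ring.
  rewrite (le_trans (ler_normD _ _))// !normrM (ger0_norm gy).
  set A := 1 + nrm x in Px xy yx *; set B := 1 + nrm y in Py xy yx *.
  have A1 : 1 <= A by rewrite /A; lra.
  have B1 : 1 <= B by rewrite /B; lra.
  have AB : A <= 2 * B by rewrite /A /B in A1 B1 *; lra.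
  have BA : B <= 2 * A by rewrite /A /B in A1 B1 *; lra.
  have h1 : `|P y - P x| * ge y <= nrm z * (6 * B ^+ 3 * ge y).
    rewrite mulrA ler_wpM2r// (le_trans DP)//.
    have -> : 2 + nrm x + nrm y = A + B by rewrite /A /B; ring.
    have B3 : B <= B ^+ 3 by rewrite -{1}[B]expr1; apply: ler_weXn2l.
    have : nrm z * (A + B) <= nrm z * (3 * B ^+ 3) by rewrite ler_wpM2l//; lra.
    lra.
  have h2 : `|ge y - ge x| <= nrm z * (A + B) * (ge y + ge x).
    rewrite (le_trans D)// ler_wpM2r ?addr_ge0// (le_trans S)//.
    by rewrite ler_wpM2l// /A /B; lra.
  have h3 : `|P x| * `|ge y - ge x| <= nrm z * (A ^+ 2 * (A + B) * (ge y + ge x)).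
    rewrite (_ : nrm z * _ = A ^+ 2 * (nrm z * (A + B) * (ge y + ge x))); last by ring.
    by apply: ler_pM.
  have h4 : A ^+ 2 * (A + B) <= 3 * A ^+ 3.
    rewrite (_ : 3 * A ^+ 3 = A ^+ 2 * (3 * A)); last by ring.
    rewrite ler_wpM2l ?sqr_ge0//; lra.
  have h5 : A ^+ 2 * (A + B) <= 12 * B ^+ 3.
    rewrite (_ : 12 * B ^+ 3 = (2 * B) ^+ 2 * (3 * B)); last by ring.
    apply: ler_pM; rewrite ?sqr_ge0//; [lra| |lra].
    by rewrite lerXn2r ?nnegrE//; lra.
  rewrite (le_trans (lerD h1 h3))// -mulrDr ler_wpM2l// /gdom -/A -/B.
  have A3 : 0 <= A ^+ 3 by rewrite exprn_ge0//; lra.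
  have h6 : A ^+ 2 * (A + B) * ge y <= 12 * B ^+ 3 * ge y by rewrite ler_wpM2r.
  have h7 : A ^+ 2 * (A + B) * ge x <= 3 * A ^+ 3 * ge x by rewrite ler_wpM2r.
  have h8 : 0 <= A ^+ 3 * ge x by rewrite mulr_ge0.
  lra.
- by move=> x; rewrite ler_wpM2l.
- exact/L1Zl/L1_polyge.
Qed.

Lemma L1_nrm_gdom : L1 mu (fun x => nrm x * gdom x).
Proof.
apply: (L1_dom _ (L1Zl 18 (L1_polyge 4))).
  apply: measurable_funM; first exact: measurable_nrm.
  by apply: measurable_funM => //; exact: measurable_polyge.
move=> x; rewrite ger0_norm; last by rewrite mulr_ge0 ?nrm_ge0 ?gdom_ge0.
have := polyge_ge0 3 x; rewrite /gdom exprS; have := nrm_ge0 x; nra.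
Qed.

End gaussian_profiles.

(** * The Gaussian, its gradient and its Laplacian as dilated kernels *)

Section gaussian_kernels.
Variables (R : realType) (n : nat).
Variable mu : {sigma_finite_measure set (Rn R n) -> \bar R}.
Hypothesis Hmu : is_lebesgue mu.
Local Notation leb := (@lebesgue_measure R).
Local Notation RR := (measurableTypeR R).
Local Notation X := (Rn R n).
Local Notation gI := (gI mu).
Local Notation tame := (tame mu).
Implicit Types (x y z w : 'rV[R]_n) (a b c d s t : R).

Lemma tame_ge0 K H M : tame K H M -> forall x, 0 <= H x.
Proof. by case=> _ KH _ _ _ x; rewrite (le_trans _ (KH x)). Qed.

Lemma tame_bound K H M : tame K H M -> forall x, `|K x| <= M.
Proof. by case=> _ KH _ HM _ x; rewrite (le_trans (KH x)). Qed.

Lemma tame_L1 K H M : tame K H M -> L1 mu K.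
Proof. by case=> [[mK _] KH _ _ LH]; exact: (L1_dom mK LH). Qed.

Lemma tame_measurable K H M : tame K H M -> measurable_fun setT K.
Proof. by case=> [[]]. Qed.

Lemma tameZ c K H M : tame K H M -> tame (fun x => c * K x) (fun x => `|c| * H x) (`|c| * M).
Proof.
case=> [[mK mH] KH KL HM LH]; split.
- by split; apply: measurable_funM.
- by move=> x; rewrite normrM ler_wpM2l.
- by move=> x z; rewrite -mulrBr -mulrDr normrM mulrCA ler_wpM2l.
- by move=> x; rewrite ler_wpM2l.
- exact: L1Zl.
Qed.

Lemma tameD K H M K' H' M' : tame K H M -> tame K' H' M' ->
  tame (fun x => K x + K' x) (fun x => H x + H' x) (M + M').
Proof.
case=> [[mK mH] KH KL HM LH] [[mK' mH'] KH' KL' HM' LH']; split.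
- by split; apply: measurable_funD.
- by move=> x; rewrite (le_trans (ler_normD _ _))// lerD.
- move=> x z; rewrite (_ : _ - _ = (K (x + z) - K x) + (K' (x + z) - K' x)); last by ring.
  rewrite (le_trans (ler_normD _ _))// (le_trans (lerD (KL x z) (KL' x z)))//.
  by rewrite -mulrDr le_eqVlt; apply/orP; left; apply/eqP; congr (_ * _); ring.
- by move=> x; rewrite lerD.
- exact: L1D.
Qed.

(** Tameness plus a first moment: the moment is what converts cancellation into a gain of t^(1/2)
    after dilation. *)
Definition profile (K : X -> R) := exists H M, tame K H M /\ L1 mu (fun z => nrm z * H z).

Lemma profileZ c K : profile K -> profile (fun x => c * K x).
Proof.
move=> [H [M [tK L]]]; exists (fun x => `|c| * H x), (`|c| * M); split; first exact: tameZ.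
by apply: (eq_L1 _ (L1Zl `|c| L)) => x; ring.
Qed.

Lemma profileD K K' : profile K -> profile K' -> profile (fun x => K x + K' x).
Proof.
move=> [H [M [tK L]]] [H' [M' [tK' L']]].
exists (fun x => H x + H' x), (M + M'); split; first exact: tameD.
by apply: (eq_L1 _ (L1D L L')) => x; ring.
Qed.

Lemma profile_polyge (P : X -> R) : measurable_fun setT P ->
  (forall x, `|P x| <= (1 + nrm x) ^+ 2) ->
  (forall x z, `|P (x + z) - P x| <= 2 * nrm z * (2 + nrm x + nrm (x + z))) ->
  profile (fun x => P x * ge x).
Proof.
move=> mP h1 h2; have [M HM] := tame_polyge Hmu mP h1 h2.
by exists (@gdom R n), M; split => //; exact: L1_nrm_gdom.
Qed.

Lemma sqn_le_nrm2 x : sqn x <= nrm x ^+ 2.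
Proof.
rewrite sqnE expr2 {1}/nrm mulr_suml; apply: ler_sum => i _.
by rewrite -real_normK ?num_real// expr2 ler_wpM2l// coord_le_nrm.
Qed.

(** The Gaussian of total mass 1. The kernels [gker i] and [lker] that follow are its i-th partial
    derivative and its Laplacian. *)
Definition g0 z : R := gI^-1 * ge z.
Definition gker i z : R := - (2 / gI) * (z 0 i * ge z).
Definition lker z : R := 4 / gI * (sqn z * ge z) + - (2 * n%:R / gI) * (1 * ge z).

Lemma profile_ge : profile (fun x => 1 * ge x).
Proof.
apply: (profile_polyge (P := fun=> 1)) => //.
- by move=> x; rewrite normr1; have := nrm_ge0 x; nra.
- move=> x z; rewrite subrr normr0 !mulr_ge0 ?nrm_ge0// !addr_ge0 ?nrm_ge0//.
Qed.

Lemma profile_g0 : profile g0.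
Proof.
have := profileZ gI^-1 profile_ge.
by congr profile; apply/funext => x; rewrite mul1r.
Qed.

Lemma profile_gker i : profile (gker i).
Proof.
apply: profileZ; apply: (profile_polyge (P := fun x : X => x 0 i)).
- exact: measurable_coord.
- by move=> x; have := coord_le_nrm x i; have := nrm_ge0 x; nra.
- move=> x z; rewrite mxE addrAC subrr add0r; have := coord_le_nrm z i.
  have := nrm_ge0 x; have := nrm_ge0 (x + z); have := nrm_ge0 z; nra.
Qed.

Lemma profile_lker : profile lker.
Proof.
apply: profileD; apply: profileZ; last exact: profile_ge.
apply: profile_polyge; first exact: measurable_sqn.
- move=> x; rewrite ger0_norm ?sqn_ge0//; have := sqn_le_nrm2 x; have := nrm_ge0 x; nra.
- move=> x z; have := sqn_diff x z.
  have := nrm_ge0 x; have := nrm_ge0 (x + z); have := nrm_ge0 z; nra.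
Qed.

Lemma Rint_odd (f : X -> R) : L1 mu f -> (forall x, f (- x) = - f x) -> \int[mu]_x f x = 0.
Proof.
move=> Lf fo; have := Rint_refl Hmu 0 (L1_measurable Lf).
rewrite (@eq_RintX _ _ mu (fun x => f (0 - x)) (fun x => - f x)); last by move=> x; rewrite sub0r fo.
by rewrite RintN//; lra.
Qed.

Lemma ge_even x : ge (- x) = ge x. Proof. by rewrite /ge sqnN. Qed.

Lemma L1_polyge1 (P : X -> R) m : measurable_fun setT P ->
  (forall x, `|P x| <= (1 + nrm x) ^+ m) -> L1 mu (fun x => P x * ge x).
Proof.
move=> mP h; apply: (L1_dom _ (L1_polyge Hmu m)).
  by apply: measurable_funM => //; exact: measurable_ge.
by move=> x; rewrite normrM [`|ge x|]ger0_norm ?ge_ge0// ler_wpM2r ?ge_ge0.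
Qed.

Lemma L1_coord_ge i : L1 mu (fun x => x 0 i * ge x).
Proof.
apply: (@L1_polyge1 (fun x : X => x 0 i) 1); first exact: measurable_coord.
by move=> x; have := coord_le_nrm x i; rewrite expr1; lra.
Qed.

Lemma Rint_coord_ge i : \int[mu]_x (x 0 i * ge x) = 0.
Proof.
apply: Rint_odd; first exact: L1_coord_ge.
by move=> x; rewrite ge_even mxE mulNr.
Qed.

Lemma L1_sqn_ge : L1 mu (fun x => sqn x * ge x).
Proof.
apply: (@L1_polyge1 (fun x : X => sqn x) 2); first exact: measurable_sqn.
move=> x; rewrite ger0_norm ?sqn_ge0//; have := sqn_le_nrm2 x; have := nrm_ge0 x; nra.
Qed.

Lemma powR_half_sq c : 0 < c -> (c `^ 2^-1) ^+ 2 = c.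
Proof. by move=> c0; rewrite powR12_sqrt ?ltW// sqr_sqrtr// ltW. Qed.

(* The scaled total mass [c ^ (- n / 2) gI] dominates its tangent at [c = 1]. *)
Lemma Rint_sqn_ge : \int[mu]_x (sqn x * ge x) = n%:R / 2 * gI.
Proof.
set M2 := \int[mu]_x _.
pose f c := gI * c `^ (- (n%:R / 2)) + M2 * (c - 1).
have fmin c : 0 < c -> gI <= f c.
  move=> c0; pose k := c `^ 2^-1.
  have k0 : 0 < k by exact: powR_gt0.
  have mg := @measurable_ge R n.
  have E1 : \int[mu]_x ge (k *: x + 0) = c `^ (- (n%:R / 2)) * gI.
    rewrite (Rint_dil Hmu 0 k0 mg) -/gI; congr (_ * _).
    rewrite /k -(powR_mulrn n (ltW k0)) -powRN -powRrM; congr (_ `^ _); ring.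
  have L1k := L1_dil Hmu 0 k0 (L1_ge Hmu).
  have : \int[mu]_x (ge x + - (c - 1) * (sqn x * ge x)) <= \int[mu]_x ge (k *: x + 0).
    apply: Rint_le => //; first by apply: L1D; [exact: L1_ge|exact/L1Zl/L1_sqn_ge].
    move=> x; rewrite addr0 [X in _ <= X]/ge sqnZ powR_half_sq//.
    have -> : - (c * sqn x) = - sqn x + - ((c - 1) * sqn x) by ring.
    rewrite expRD -/(ge x); have := expR_ge1Dx (- ((c - 1) * sqn x)).
    by have := ge_ge0 x; nra.
  rewrite RintD; [|exact: L1_ge|exact/L1Zl/L1_sqn_ge].
  rewrite RintZl; last exact: L1_sqn_ge.
  rewrite E1 -/gI -/M2 /f [gI * _]mulrC; lra.
have f1 : f 1 = gI by rewrite /f powR_1 subrr mulr0 addr0 mulr1.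
have df (c : R) : 0 < c -> is_derive c 1 f (- (n%:R / 2) * c `^ (- (n%:R / 2) - 1) * gI + M2).
  move=> c0.
  have d1 : is_derive c 1 (fun c => c `^ (- (n%:R / 2))) (- (n%:R / 2) * c `^ (- (n%:R / 2) - 1)).
    apply: DeriveDef; first by apply: derivable_powR; rewrite in_itv/= c0.
    by rewrite -derive1E powR_derive1// in_itv/= c0.
  have dz := is_deriveD (is_deriveZ gI d1) (is_deriveZ M2 (is_deriveB (is_derive_id c 1) (is_derive_cst (1 : R) c 1))).
  apply: (is_derive_eq dz).
  rewrite /GRing.scale/=; ring.
have c1 : (1 : R) \in `]2^-1, 2[%R by rewrite in_itv/=; apply/andP; split; lra.
(* An interior minimum at c = 1 forces f'(1) = M2 - (n/2) gI to vanish. *)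
have h : is_derive (1 : R) 1 f 0.
  apply: (@derive1_at_min _ f 2^-1 2 1) => //; first by lra.
  - move=> c; rewrite in_itv/= => /andP[h1 _]; have c0 : 0 < c by lra.
    by case: (df c c0).
  - by move=> c; rewrite in_itv/= => /andP[h1 _]; rewrite f1; apply: fmin; lra.
have h2 := df 1 ltr01.
have e1 : 'D_1 f (1 : R) = 0 by case: h.
by case: h2 => _; rewrite e1 powR_1; lra.
Qed.

Lemma Rint_g0 : \int[mu]_x g0 x = 1.
Proof.
rewrite RintZl; last exact: L1_ge.
by rewrite mulVf// gt_eqF// gI_gt0.
Qed.

Lemma Rint_gker i : \int[mu]_x gker i x = 0.
Proof. by rewrite RintZl ?Rint_coord_ge ?mulr0//; exact: L1_coord_ge. Qed.

(** The second moment n/2 of the Gaussian exactly balances the constant term 2n of the Laplacian. *)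
Lemma Rint_lker : \int[mu]_x lker x = 0.
Proof.
have L0 : L1 mu (fun x => 1 * ge x) by apply: (eq_L1 _ (L1_ge Hmu)) => x; rewrite mul1r.
rewrite RintD; [|exact/L1Zl/L1_sqn_ge|exact/L1Zl].
rewrite !RintZl//; [|exact: L1_ge|exact: L1_sqn_ge].
rewrite Rint_sqn_ge mul1r -/gI.
by field; rewrite gt_eqF// gI_gt0.
Qed.

Definition dil d (K : X -> R) t z : R := t `^ (- (d + n%:R / 2)) * K (t `^ (- 2^-1) *: z).

Lemma measurable_dil d K : measurable_fun setT K ->
  measurable_fun setT (fun u : RR * X => dil d K u.1 u.2).
Proof.
move=> mK; apply: measurable_funM.
  by apply: (measurableT_comp (@measurable_powR R _)).
apply: (measurableT_comp mK); apply: measurable_scaleX => //.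
by apply: (measurableT_comp (@measurable_powR R _)).
Qed.

Lemma measurable_dil1 d K t : measurable_fun setT K -> measurable_fun setT (dil d K t : X -> R).
Proof. by move=> /(measurable_dil d) /(measurable_sec1 (f := fun (t : RR) (z : X) => dil d K t z) t). Qed.

Lemma dil_L1 d K t : 0 < t -> L1 mu K -> L1 mu (dil d K t).
Proof.
move=> t0 LK; apply: L1Zl; have c0 : 0 < t `^ (- 2^-1) by exact: powR_gt0.
by apply: (eq_L1 _ (L1_dil Hmu 0 c0 LK)) => x; rewrite addr0.
Qed.

Lemma dil_int d K t : 0 < t -> L1 mu K -> \int[mu]_z dil d K t z = t `^ (- d) * \int[mu]_z K z.
Proof.
move=> t0 LK; have c0 : 0 < t `^ (- 2^-1) by exact: powR_gt0.
have L := L1_dil Hmu 0 c0 LK.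
have E : forall z, dil d K t z = t `^ (- (d + n%:R / 2)) * K (t `^ (- 2^-1) *: z + 0).
  by move=> z; rewrite addr0.
rewrite (eq_RintX mu E) RintZl// (Rint_dil Hmu 0 c0 (L1_measurable LK)) mulrA; congr (_ * _).
rewrite -(powR_mulrn n (ltW c0)) -powRN -powRrM -powRD_gt0//; congr (_ `^ _); by field.
Qed.

Lemma dil_norm d K t z : `|dil d K t z| = dil d (fun z => `|K z|) t z.
Proof. by rewrite normrM ger0_norm// powR_ge0. Qed.

Lemma dil_nrm d K t z : 0 < t -> nrm z * dil d K t z = dil (d - 2^-1) (fun z => nrm z * K z) t z.
Proof.
move=> t0; rewrite /dil nrmZ ger0_norm ?powR_ge0//.
rewrite (_ : - (d - 2^-1 + n%:R / 2) = - (d + n%:R / 2) + 2^-1); last by ring.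
have E : t `^ 2^-1 * t `^ (- 2^-1) = 1 by rewrite -powRD_gt0// subrr powRr0.
rewrite powRD_gt0//.
transitivity (t `^ 2^-1 * t `^ (- 2^-1) * (nrm z * (t `^ (- (d + n%:R / 2)) * K (t `^ (- 2^-1) *: z)))).
  by rewrite E mul1r.
ring.
Qed.

(** Dilation multiplies increments by t^(-1/2); the factor 1 + t^(-1/2) also covers the regime where
    the minimum is 1. *)
Lemma tame_dil d K H M t : 0 < t -> tame K H M ->
  tame (dil d K t) (fun z => (1 + t `^ (- 2^-1)) * dil d H t z)
    ((1 + t `^ (- 2^-1)) * (t `^ (- (d + n%:R / 2)) * M)).
Proof.
move=> t0 tK; have H0 := tame_ge0 tK; have [[mK mH] KH KL HM LH] := tK.
have c0 : 0 < t `^ (- 2^-1) by exact: powR_gt0.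
set c := t `^ (- 2^-1) in c0 *.
have e0 : 0 <= t `^ (- (d + n%:R / 2)) by exact: powR_ge0.
split.
- by split; [|apply: measurable_funM => //]; exact: measurable_dil1.
- move=> x; rewrite dil_norm /dil -/c; have h1 := KH (c *: x); have h2 := H0 (c *: x).
  rewrite (@le_trans _ _ (t `^ (- (d + n%:R / 2)) * H (c *: x)))// ?ler_wpM2l//.
  by rewrite ler_peMl ?mulr_ge0// lerDl ltW.
- move=> x z; rewrite /dil -/c -mulrBr normrM (ger0_norm e0) scalerDr.
  set e := t `^ _ in e0 *; set Hx := H _; set Hy := H _.
  rewrite (_ : Num.min 1 (nrm z) * _ = e * (Num.min 1 (nrm z) * (1 + c) * (Hx + Hy))); last by ring.
  rewrite ler_wpM2l// (le_trans (KL _ _))// ler_wpM2r ?addr_ge0 ?H0//.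
  rewrite nrmZ (ger0_norm (ltW c0)); have nz := nrm_ge0 z.
  have [z1|z1] := leP 1 (nrm z).
    by rewrite mul1r ge_min; apply/orP; left; lra.
  by rewrite ge_min; apply/orP; right; nra.
- by move=> x; rewrite !ler_wpM2l// addr_ge0// ltW.
- exact/L1Zl/dil_L1.
Qed.

Lemma g0E t z : 0 < t -> dil 0 g0 t z = gI^-1 * t `^ (- (n%:R / 2)) * expR (- (sqn z / t)).
Proof.
move=> t0; rewrite /dil /g0 add0r mulrCA -mulrA /ge sqnZ; congr (_ * (_ * expR _)).
by rewrite (powRN t 2^-1) exprVn powR_half_sq// mulrC.
Qed.

Lemma gkerE i t z : 0 < t -> dil 2^-1 (gker i) t z = - (2 * z 0 i / t) * dil 0 g0 t z.
Proof.
move=> t0; rewrite /dil /gker /g0 add0r mxE opprD powRD_gt0//.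
have -> : t^-1 = t `^ (- 2^-1) * t `^ (- 2^-1).
  by rewrite -powRD_gt0// -powR_inv1 ?ltW//; congr (_ `^ _); lra.
ring.
Qed.

Lemma lkerE t z : 0 < t ->
  dil 1 lker t z = (4 * sqn z / t ^+ 2 - 2 * n%:R / t) * dil 0 g0 t z.
Proof.
move=> t0; rewrite /dil /lker /g0 add0r sqnZ (powRN t 2^-1) exprVn powR_half_sq// opprD powRD_gt0//.
rewrite powR_inv1 ?ltW// expr2 invfM; ring.
Qed.

Section semigroup.
Variables (s m : R) (y : 'rV[R]_n).
Hypotheses (s0 : 0 < s) (m0 : 0 < m).
Let c : R := Num.sqrt ((s + m) / (s * m)).
Let th : R := m / (s + m).

Let c0 : 0 < c. Proof. by rewrite sqrtr_gt0 divr_gt0 ?addr_gt0 ?mulr_gt0. Qed.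
Let c2 : c ^+ 2 = (s + m) / (s * m).
Proof. by rewrite sqr_sqrtr// divr_ge0 ?addr_ge0 ?mulr_ge0// ltW. Qed.

(** The affine change of variable that centres the product of two Gaussians and brings it to unit
    width. *)
Let W x : 'rV[R]_n := c *: x + (- (c * th)) *: y.

Let xE x i : x 0 i = th * y 0 i + W x 0 i / c.
Proof. by rewrite !mxE; field; rewrite gt_eqF. Qed.

(* completing the square *)
Let gauss_prod x : dil 0 g0 s (y - x) * dil 0 g0 m x =
  c ^+ n * gI^-1 * dil 0 g0 (s + m) y * ge (W x).
Proof.
have sm : 0 < s + m by exact: addr_gt0.
rewrite !g0E//.
have E : expR (- (sqn (y - x) / s)) * expR (- (sqn x / m)) =
    expR (- (sqn y / (s + m))) * ge (W x).
  rewrite /ge -!expRD; congr expR; rewrite !sqnE -!opprD; congr (- _).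
  rewrite !mulr_suml -!big_split/=; apply: eq_bigr => i _; rewrite !mxE.
  rewrite (_ : (c * x 0 i + - (c * th) * y 0 i) ^+ 2 = c ^+ 2 * (x 0 i - th * y 0 i) ^+ 2); last by ring.
  by rewrite c2 /th; field; rewrite !gt_eqF.
have P : s `^ (- (n%:R / 2)) * m `^ (- (n%:R / 2)) = c ^+ n * (s + m) `^ (- (n%:R / 2)).
  have smi : 0 <= (s * m)^-1 by rewrite invr_ge0 mulr_ge0// ltW.
  rewrite -(@powRM _ s m) ?(ltW s0) ?(ltW m0)// -(powR_mulrn _ (ltW c0)).
  rewrite (_ : c = ((s + m) * (s * m)^-1) `^ 2^-1); last first.
    by rewrite powR12_sqrt// divr_ge0 ?addr_ge0 ?mulr_ge0// ltW.
  rewrite -powRrM (@powRM _ (s + m) (s * m)^-1) ?(ltW sm)//.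
  rewrite (_ : 2^-1 * n%:R = n%:R / 2); last by ring.
  rewrite [RHS]mulrAC -powRD_gt0// subrr powRr0 mul1r -[(s * m)^-1]powR_inv1; last by rewrite mulr_ge0// ltW.
  by rewrite -powRrM mulN1r.
transitivity (gI^-1 * gI^-1 * (s `^ (- (n%:R / 2)) * m `^ (- (n%:R / 2))) *
  (expR (- (sqn (y - x) / s)) * expR (- (sqn x / m)))); first by ring.
rewrite P E; ring.
Qed.

Let Rint_W (F : X -> R) : measurable_fun setT F ->
  \int[mu]_x F (W x) = c ^- n * \int[mu]_x F x.
Proof. by move=> mF; exact: Rint_dil. Qed.

Let cn : c ^+ n * c ^- n = 1.
Proof. by rewrite divff// gt_eqF// exprn_gt0. Qed.

(** The heat semigroup with a derivative on one factor. In the variable [W x] the integrand is a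
    polynomial of degree 1 times [ge], and its linear part is odd. *)
Lemma conv_gker_g0 i :
  \int[mu]_x (dil 2^-1 (gker i) s (y - x) * dil 0 g0 m x) = dil 2^-1 (gker i) (s + m) y.
Proof.
have sm : 0 < s + m by exact: addr_gt0.
pose A := c ^+ n * gI^-1 * dil 0 g0 (s + m) y.
pose F w : R := A * (- (2 * (1 - th) * y 0 i / s) * ge w + 2 / (s * c) * (w 0 i * ge w)).
have LF : L1 mu (fun w => - (2 * (1 - th) * y 0 i / s) * ge w + 2 / (s * c) * (w 0 i * ge w)).
  by apply: L1D; apply: L1Zl; [exact: L1_ge|exact: L1_coord_ge].
have E x : dil 2^-1 (gker i) s (y - x) * dil 0 g0 m x = F (W x).
  transitivity (- (2 * (y - x) 0 i / s) * (dil 0 g0 s (y - x) * dil 0 g0 m x)).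
    by rewrite gkerE//; ring.
  rewrite gauss_prod -/A /F.
  have -> : (y - x) 0 i = (1 - th) * y 0 i - W x 0 i / c by rewrite [in LHS]mxE [(- x) 0 i]mxE (xE x); ring.
  field; rewrite !gt_eqF//.
rewrite (eq_RintX mu E) Rint_W; last exact: L1_measurable (L1Zl A LF).
rewrite RintZl// RintD; [|exact/L1Zl/L1_ge|exact/L1Zl/L1_coord_ge].
rewrite !RintZl; [|exact: L1_coord_ge|exact: L1_ge].
rewrite Rint_coord_ge mulr0 addr0 -/gI gkerE// /A.
have I0 : gI != 0 by rewrite gt_eqF// gI_gt0.
transitivity (c ^+ n * c ^- n * (gI^-1 * gI) * (- (2 * (1 - th) * y 0 i / s) * dil 0 g0 (s + m) y)); first by ring.
rewrite cn mulVf// !mul1r; congr (_ * _); rewrite /th; field; rewrite !gt_eqF//.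
Qed.

(** The Laplacian as the divergence of a gradient, with one derivative on each factor of the
    semigroup. Linear terms vanish by parity; the quadratic ones add up to the second moment. *)
Lemma conv_gker_gker :
  \sum_(i < n) \int[mu]_x (dil 2^-1 (gker i) s (y - x) * dil 2^-1 (gker i) m x) =
  dil 1 lker (s + m) y.
Proof.
have sm : 0 < s + m by exact: addr_gt0.
pose A := c ^+ n * gI^-1 * dil 0 g0 (s + m) y.
pose F i w : R := A * (4 / (s * m)) * (((1 - th) * th * y 0 i ^+ 2) * ge w +
   ((1 - 2 * th) * y 0 i / c * (w 0 i * ge w) + - (c ^- 2) * (w 0 i ^+ 2 * ge w))).
have L2 i : L1 mu (fun w => w 0 i ^+ 2 * ge w).
  apply: (@L1_polyge1 (fun x : X => x 0 i ^+ 2) 2).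
    by apply: measurable_funX; exact: measurable_coord.
  move=> x; rewrite ger0_norm ?sqr_ge0// -real_normK ?num_real//.
  by have := coord_le_nrm x i; have := nrm_ge0 x; have := normr_ge0 (x 0 i); nra.
have LF i : L1 mu (fun w => ((1 - th) * th * y 0 i ^+ 2) * ge w +
   ((1 - 2 * th) * y 0 i / c * (w 0 i * ge w) + - (c ^- 2) * (w 0 i ^+ 2 * ge w))).
  apply: L1D; first exact/L1Zl/L1_ge.
  by apply: L1D; apply: L1Zl => //; exact: L1_coord_ge.
have E i x : dil 2^-1 (gker i) s (y - x) * dil 2^-1 (gker i) m x = F i (W x).
  rewrite !gkerE//.
  transitivity (4 / (s * m) * (y - x) 0 i * x 0 i * (dil 0 g0 s (y - x) * dil 0 g0 m x)).
    by field; rewrite !gt_eqF.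
  rewrite gauss_prod -/A /F.
  have -> : (y - x) 0 i = (1 - th) * y 0 i - W x 0 i / c by rewrite [in LHS]mxE [(- x) 0 i]mxE (xE x); ring.
  by rewrite (xE x); field; rewrite !gt_eqF.
have I0 : gI != 0 by rewrite gt_eqF// gI_gt0.
under eq_bigr => i _.
  rewrite (eq_RintX mu (E i)) Rint_W; last exact: L1_measurable (L1Zl _ (LF i)).
  rewrite RintZl// RintD; [|exact/L1Zl/L1_ge|by apply: L1D; apply: L1Zl => //; exact: L1_coord_ge].
  rewrite RintD; [|exact/L1Zl/L1_coord_ge|exact/L1Zl].
  rewrite !RintZl//; [|exact: L1_coord_ge|exact: L1_ge].
  rewrite Rint_coord_ge mulr0 add0r -/gI.
  over.
rewrite -!mulr_sumr big_split/= -mulr_suml -!mulr_sumr -sqnE -Rint_sum//.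
rewrite (@eq_RintX _ _ mu _ (fun x => sqn x * ge x)); last by move=> x; rewrite sqnE mulr_suml.
rewrite Rint_sqn_ge lkerE// /A.
transitivity (c ^+ n * c ^- n * (gI^-1 * gI) * (4 / (s * m) * ((1 - th) * th * sqn y - c ^- 2 * (n%:R / 2))
  * dil 0 g0 (s + m) y)); first by ring.
rewrite cn mulVf// !mul1r; congr (_ * _); rewrite c2 /th; field; rewrite !gt_eqF//.
Qed.

End semigroup.

(** The heat equation in this normalisation: for t^(-n/2) exp(-|z|^2/t) the Laplacian is 4 times the
    time derivative, the origin of every later factor 4. *)
Lemma gauss_FTC z s t : 0 < s -> s < t ->
  (\int[leb]_(r in `[s, t]) (dil 1 lker r z)%:E = (4 * dil 0 g0 t z - 4 * dil 0 g0 s z)%:E)%E.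
Proof.
move=> s0 st; set u := sqn z; set N := n%:R / 2 : R.
pose h (r : R) := - (N * ln r) + - (u * r^-1).
pose F r := 4 * gI^-1 * expR (h r).
have FE r : 0 < r -> 4 * dil 0 g0 r z = F r.
  move=> r0; rewrite g0E// /F -!mulrA; congr (_ * (_ * _)).
  by rewrite expRD /powR gt_eqF// mulNr.
have dF (r : R) : 0 < r -> is_derive r 1 F (dil 1 lker r z).
  move=> r0; have dl := is_derive1_ln r0.
  have rn0 : r != 0 by rewrite gt_eqF.
  have dv : is_derive r 1 (fun r => r^-1) (- (r ^- 2)).
    have := @is_deriveV R id r 1 1 rn0 (is_derive_id r 1).
    by move=> H; apply: is_derive_eq; rewrite /GRing.scale/= mulr1.
  have dg : is_derive r 1 h (- (N * r^-1) + - (u * - (r ^- 2))).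
    exact: is_deriveD (is_deriveN (is_deriveZ N dl)) (is_deriveN (is_deriveZ u dv)).
  have dc := @is_derive1_comp R expR h r _ _ (is_derive_expR _) dg.
  have dz := is_deriveZ (4 * gI^-1) dc.
  apply: (is_derive_eq dz).
  rewrite lkerE//; have := FE r r0; rewrite /F => FEr.
  have -> : dil 0 g0 r z = 4^-1 * (4 * gI^-1 * expR (h r)) by rewrite -FEr mulKf// pnatr_eq0.
  by rewrite /GRing.scale/= -/u /N; field; rewrite rn0 gt_eqF// gI_gt0.
have cF (r : R) : 0 < r -> {for r, continuous F}.
  by move=> r0; apply: differentiable_continuous; apply/derivable1_diffP; case: (dF r r0).
rewrite (@continuous_FTC2 _ (fun r => dil 1 lker r z) F)//.
- by rewrite -EFinB -!FE// (lt_trans s0).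
- apply: continuous_in_subspaceT => r; rewrite inE/= in_itv/= => /andP[sr _].
  have r0 : 0 < r by exact: lt_le_trans sr.
  have cp : {for r, continuous (fun r : R => (r `^ (- 2^-1)) ^+ 2 * u)}.
    apply: cvgM; last exact: cvg_cst.
    have pc := @powR_continuous R (- 2^-1) r r0.
    exact: (cvgM pc pc).
  have ce v : {for v, continuous (fun v : R => expR (- v))}.
    by apply: (@continuous_comp _ _ _ -%R expR); [exact: opp_continuous|exact: continuous_expR].
  have cl v : {for v, continuous (fun v : R => 4 / gI * (v * expR (- v)) +
      - (2 * n%:R / gI) * (1 * expR (- v)))}.
    apply: cvgD; apply: cvgM; try exact: cvg_cst.
      by apply: cvgM; [exact: cvg_id|exact: ce].
    by apply: cvgM; [exact: cvg_cst|exact: ce].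
  apply: (@cvgM _ _ _ _ (fun r : R => r `^ (- (1 + n%:R / 2))) (fun r : R => lker (r `^ (- 2^-1) *: z))).
    exact: powR_continuous.
  have E : (fun r : R => lker (r `^ (- 2^-1) *: z)) = (fun v => 4 / gI * (v * expR (- v)) +
      - (2 * n%:R / gI) * (1 * expR (- v))) \o (fun r => (r `^ (- 2^-1)) ^+ 2 * u).
    by apply/funext => r'; rewrite /= /lker /ge sqnZ.
  have := continuous_comp cp (cl _).
  by rewrite -E.
- split.
  + by move=> r; rewrite in_itv/= => /andP[sr _]; case: (dF r (lt_trans s0 sr)).
  + by apply: cvg_at_right_filter; exact: cF.
  + by apply: cvg_at_left_filter; apply: cF; exact: lt_trans st.
- move=> r; rewrite in_itv/= => /andP[sr _].
  by rewrite derive1E; case: (dF r (lt_trans s0 sr)).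
Qed.

End gaussian_kernels.

(** * Convolution, its adjoint, and cancellation estimates *)

Section convolution.
Variables (R : realType) (n : nat).
Variable mu : {sigma_finite_measure set (Rn R n) -> \bar R}.
Hypothesis Hmu : is_lebesgue mu.
Local Notation X := (Rn R n).
Implicit Types (x y z w : 'rV[R]_n) (f h k F : X -> R).

Definition conv k h y : R := \int[mu]_x (k (y - x) * h x).
(** The adjoint of convolution by [k]: this form moves kernels from the test function onto [f]. *)
Definition corr k f x : R := \int[mu]_y (f y * k (y - x)).

(** Membership in L^oo + L^1 with an explicit majorant. Every [f] in L^p qualifies through F =
    |f|^p, so pairings with bounded integrable kernels avoid conjugate exponents. *)
Definition sum_dom f F := [/\ measurable_fun setT f, L1 mu F & forall x, `|f x| <= 1 + F x].

Lemma measurable_sub21 k : measurable_fun setT k ->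
  measurable_fun setT (fun u : X * X => k (u.2 - u.1)).
Proof. by move=> mk; apply: (measurableT_comp mk); exact: measurable_subX. Qed.

Lemma measurable_corr k f : measurable_fun setT k -> measurable_fun setT f ->
  measurable_fun setT (corr k f : X -> R).
Proof.
move=> mk mf; apply: (measurable_Rint2 mu (f := fun x y : X => f y * k (y - x))).
by apply: measurable_funM; [exact: (measurableT_comp mf)|exact: measurable_sub21].
Qed.

Lemma L1_sub k x : L1 mu k -> L1 mu (fun y => k (y - x)).
Proof. exact: L1_shift. Qed.

Lemma Rint_sub k x : measurable_fun setT k -> \int[mu]_y k (y - x) = \int[mu]_y k y.
Proof. exact: Rint_shift. Qed.

Lemma sum_dom_mul f F k M : sum_dom f F -> L1 mu k -> (forall x, `|k x| <= M) ->
  L1 mu (fun y => f y * k y) /\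
  \int[mu]_y `|f y * k y| <= \int[mu]_y `|k y| + M * \int[mu]_y `|F y|.
Proof.
move=> [mf LF fF] Lk kM.
have L2 : L1 mu (fun y => `|k y| + M * `|F y|).
  by apply: L1D; [exact: L1_norm|exact/L1Zl/L1_norm].
have D y : `|f y * k y| <= `|k y| + M * `|F y|.
  rewrite normrM; have h1 := fF y; have h2 := kM y; have h3 := ler_norm (F y).
  have h4 := normr_ge0 (k y); have h5 := normr_ge0 (F y).
  have : `|f y| * `|k y| <= (1 + `|F y|) * `|k y| by rewrite ler_wpM2r//; lra.
  have : `|F y| * `|k y| <= `|F y| * M by rewrite ler_wpM2l.
  lra.
have mfk : measurable_fun setT (fun y : X => f y * k y).
  by apply: measurable_funM => //; exact: L1_measurable Lk.
have Lfk := L1_dom mfk L2 D.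
split => //; rewrite -RintZl; last exact: L1_norm.
rewrite -RintD; [|exact: L1_norm|exact/L1Zl/L1_norm].
by apply: Rint_le => //; exact: L1_norm.
Qed.

Lemma corr_bound f F k M x : sum_dom f F -> L1 mu k -> (forall x, `|k x| <= M) ->
  L1 mu (fun y => f y * k (y - x)) /\
  `|corr k f x| <= \int[mu]_y `|k y| + M * \int[mu]_y `|F y|.
Proof.
move=> fF Lk kM; have Lks := L1_sub x Lk.
have [L B] := sum_dom_mul fF Lks (fun y => kM (y - x)).
split => //; rewrite (le_trans (Rint_norm L))// (le_trans B)//.
rewrite (Rint_sub (k := fun y => `|k y|))//.
by apply: measurableT_comp => //; exact: L1_measurable Lk.
Qed.

Lemma L1_corr_prod f F k M h : sum_dom f F -> L1 mu k -> (forall x, `|k x| <= M) -> L1 mu h ->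
  L1 (mu \x mu)%E (fun u => f u.2 * k (u.2 - u.1) * h u.1).
Proof.
move=> fF Lk kM Lh; pose C := \int[mu]_y `|k y| + M * \int[mu]_y `|F y|.
have [mf _ _] := fF; have mk := L1_measurable Lk; have mh := L1_measurable Lh.
apply: (L1_prod (f := fun x y : X => f y * k (y - x) * h x) (b := fun x => C * `|h x|)).
- apply: measurable_funM; last exact: (measurableT_comp mh).
  by apply: measurable_funM; [exact: (measurableT_comp mf)|exact: measurable_sub21].
- by move=> x; apply: L1Zr; exact: (corr_bound x fF Lk kM).1.
- exact/L1Zl/L1_norm.
- move=> x; have [L _] := corr_bound x fF Lk kM.
  rewrite (@eq_RintX _ _ mu _ (fun y => `|f y * k (y - x)| * `|h x|)); last by move=> y; rewrite normrM.
  rewrite RintZr; last exact: L1_norm.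
  rewrite ler_wpM2r//.
  have [_ B] := sum_dom_mul fF (L1_sub x Lk) (fun y => kM (y - x)).
  rewrite (le_trans B)// (Rint_sub (k := fun y => `|k y|))//.
  by apply: measurableT_comp.
Qed.

Lemma corr_adjoint f F k M h : sum_dom f F -> L1 mu k -> (forall x, `|k x| <= M) -> L1 mu h ->
  [/\ L1 mu (fun x => corr k f x * h x), L1 mu (fun y => f y * conv k h y) &
   \int[mu]_x (corr k f x * h x) = \int[mu]_y (f y * conv k h y)].
Proof.
move=> fF Lk kM Lh; have L := L1_corr_prod fF Lk kM Lh.
have E1 x : \int[mu]_y (f y * k (y - x) * h x) = corr k f x * h x.
  by rewrite RintZr//; exact: (corr_bound x fF Lk kM).1.
have Lkh y : L1 mu (fun x => k (y - x) * h x).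
  apply: (L1_dom _ (L1Zl M (L1_norm Lh))).
    apply: measurable_funM; last exact: L1_measurable Lh.
    exact: L1_measurable (L1_refl Hmu y Lk).
  by move=> x; rewrite normrM ler_wpM2r.
have E2 y : \int[mu]_x (f y * k (y - x) * h x) = f y * conv k h y.
  rewrite -RintZl//; apply: eq_RintX => x; by rewrite mulrA.
split.
- by apply: (eq_L1 _ (L1_Rint1 (f := fun x y : X => f y * k (y - x) * h x) L)) => x; rewrite E1.
- by apply: (eq_L1 _ (L1_Rint2 (f := fun x y : X => f y * k (y - x) * h x) L)) => x; rewrite E2.
- rewrite -(eq_RintX mu E1) (Rint_fubini (f := fun x y : X => f y * k (y - x) * h x) L).
  exact: eq_RintX.
Qed.

Lemma sum_dom1 : sum_dom (fun=> 1) (fun=> 0).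
Proof. by split; [|exact: L10|by move=> x; rewrite normr1 addr0]. Qed.

Lemma L1_convol k M h : L1 mu k -> (forall x, `|k x| <= M) -> L1 mu h -> L1 mu (conv k h).
Proof.
move=> Lk kM Lh; have [_ L _] := corr_adjoint sum_dom1 Lk kM Lh.
by apply: (eq_L1 _ L) => y; rewrite mul1r.
Qed.

Lemma L1_conv_int k M h y : L1 mu k -> (forall x, `|k x| <= M) -> L1 mu h ->
  L1 mu (fun x => k (y - x) * h x).
Proof.
move=> Lk kM Lh; apply: (L1_dom _ (L1Zl M (L1_norm Lh))).
  apply: measurable_funM; last exact: L1_measurable Lh.
  exact: L1_measurable (L1_refl Hmu y Lk).
by move=> x; rewrite normrM ler_wpM2r.
Qed.

Lemma conv_bound k M h y : L1 mu k -> (forall x, `|k x| <= M) -> L1 mu h ->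
  `|conv k h y| <= M * \int[mu]_x `|h x|.
Proof.
move=> Lk kM Lh; rewrite -RintZl; last exact: L1_norm.
apply: Rint_norm_le; [exact: L1_measurable (L1_conv_int y Lk kM Lh)|exact/L1Zl/L1_norm|].
by move=> x; rewrite normrM ler_wpM2r.
Qed.

Lemma convC k h y : measurable_fun setT k -> measurable_fun setT h -> conv k h y = conv h k y.
Proof.
move=> mk mh; rewrite /conv -(Rint_refl Hmu y (f := fun x => k (y - x) * h x)).
  by apply: eq_RintX => x; rewrite opprB addrC subrK mulrC.
apply: measurable_funM => //; apply: (measurableT_comp mk).
by apply: measurable_subX.
Qed.

(** Associativity, read off from adjointness with the translate of [k1] as test function. *)
Lemma corr_corr f F k1 M1 k2 M2 x : sum_dom f F -> L1 mu k1 -> (forall x, `|k1 x| <= M1) ->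
  L1 mu k2 -> (forall x, `|k2 x| <= M2) -> corr k1 (corr k2 f) x = corr (conv k2 k1) f x.
Proof.
move=> fF L1' kM1 L2 kM2.
transitivity (\int[mu]_y (f y * conv k2 (fun z => k1 (z - x)) y)).
  by have [_ _ h] := corr_adjoint fF L2 kM2 (L1_sub x L1'); exact: h.
apply: eq_RintX => y; congr (_ * _); rewrite /conv.
rewrite -[RHS](Rint_sub x (k := fun z => k2 (y - x - z) * k1 z)).
  by apply: eq_RintX => z; rewrite opprB addrA subrK.
apply: measurable_funM; last exact: L1_measurable L1'.
exact: L1_measurable (L1_refl Hmu (y - x) L2).
Qed.

(** Regularity is inherited from the kernel alone: [f] has none. *)
Lemma corr_tame f F K H M x z : sum_dom f F -> tame mu K H M ->
  `|corr K f (x + z) - corr K f x| <=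
  Num.min 1 (nrm z) * (2 * (\int[mu]_y H y + M * \int[mu]_y `|F y|)).
Proof.
move=> fF tK; have LK := tame_L1 tK; have KM := tame_bound tK.
have H0 := tame_ge0 tK; have [[mK mH] KH KL HM LH] := tK; have [mf _ _] := fF.
have HM' y : `|H y| <= M by rewrite ger0_norm.
have B v := sum_dom_mul fF (L1_sub v LH) (fun y => HM' (y - v)).
rewrite /corr -RintB; [|exact: (corr_bound _ fF LK KM).1|exact: (corr_bound _ fF LK KM).1].
have m0 : 0 <= Num.min 1 (nrm z) by rewrite le_min ler01 nrm_ge0.
have D y : `|f y * K (y - (x + z)) - f y * K (y - x)| <=
    Num.min 1 (nrm z) * (`|f y * H (y - x)| + `|f y * H (y - (x + z))|).
  rewrite -mulrBr !normrM !(ger0_norm (H0 _)) -mulrDr mulrCA ler_wpM2l//.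
  by have := KL (y - x) (- z); rewrite nrmN opprD addrA.
have L v : L1 mu (fun y => `|f y * H (y - v)|) by apply: L1_norm; exact: (B v).1.
apply: (le_trans (Rint_norm_le _ (L1Zl _ (L1D (L x) (L (x + z)))) D)).
  apply: measurable_funB; apply: measurable_funM => //.
    exact: L1_measurable (L1_sub (x + z) LK).
  exact: L1_measurable (L1_sub x LK).
rewrite RintZl; last exact: L1D.
rewrite RintD// ler_wpM2l//.
have E v : \int[mu]_y `|f y * H (y - v)| <= \int[mu]_y H y + M * \int[mu]_y `|F y|.
  have [_ b] := B v; rewrite (le_trans b)//.
  rewrite (Rint_sub (k := fun y => `|H y|))//; last exact: measurableT_comp.
  by rewrite (@eq_RintX _ _ mu (fun y => `|H y|) H)// => y; rewrite ger0_norm.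
have := E x; have := E (x + z); lra.
Qed.

(** The difference is the integral of K(z) (h(y - z) - h(y)), so the first moment of [K] pays for
    the increments of [h]. Both norms are bounded because the result will be paired with a function
    in L^oo + L^1. *)
Lemma conv_approx K h H M : L1 mu K -> (exists M, forall x, `|K x| <= M) ->
  L1 mu (fun z => nrm z * K z) -> tame mu h H M ->
  (forall y, `|conv K h y - \int[mu]_z K z * h y| <= 2 * M * \int[mu]_z (nrm z * `|K z|)) /\
  \int[mu]_y `|conv K h y - \int[mu]_z K z * h y| <= 2 * \int[mu]_y H y * \int[mu]_z (nrm z * `|K z|).
Proof.
move=> LK [MK KM] LnK tH; have Lh := tame_L1 tH; have hM := tame_bound tH.
have H0 := tame_ge0 tH; have [[mh mH] hH hL HM LH] := tH.
have mK := L1_measurable LK.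
have LnK' : L1 mu (fun z => nrm z * `|K z|).
  by apply: (eq_L1 _ (L1_norm LnK)) => z; rewrite normrM (ger0_norm (nrm_ge0 z)).
have nK0 z : 0 <= nrm z * `|K z| by rewrite mulr_ge0 ?nrm_ge0.
have mhy y : measurable_fun setT (fun z : X => h (y - z)).
  exact: L1_measurable (L1_refl Hmu y Lh).
have LKh y : L1 mu (fun z => K z * h (y - z)).
  by apply: (L1M_bounded (M := M) LK (mhy y)) => z; exact: hM.
have E y : conv K h y - \int[mu]_z K z * h y = \int[mu]_z (K z * (h (y - z) - h y)).
  rewrite -(RintZr (h y) LK) (_ : conv K h y = \int[mu]_z (K z * h (y - z))); last first.
    by rewrite convC// /conv; apply: eq_RintX => z; exact: mulrC.
  rewrite -RintB//; last exact: L1Zr.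
  by apply: eq_RintX => z; rewrite mulrBr.
have D y z : `|K z * (h (y - z) - h y)| <= nrm z * `|K z| * (H y + H (y - z)).
  rewrite normrM mulrC mulrAC ler_wpM2r//.
  have := hL y (- z); rewrite nrmN => h1; apply: (le_trans h1).
  by rewrite ler_wpM2r ?addr_ge0// ge_min lexx orbT.
have md y : measurable_fun setT (fun z : X => K z * (h (y - z) - h y)).
  by apply: measurable_funM => //; exact: measurable_funB.
have mHy y : measurable_fun setT (fun z : X => H (y - z)).
  exact: L1_measurable (L1_refl Hmu y LH).
split.
- move=> y; rewrite E [leRHS]mulrC -RintZr//.
  apply: Rint_norm_le => //; first exact: L1Zr.
  by move=> z; rewrite (le_trans (D y z))// ler_wpM2l// mulr_natl mulr2n lerD.
- pose G := fun y z : X => nrm z * `|K z| * (H y + H (y - z)).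
  have mG : measurable_fun setT (fun u : X * X => G u.1 u.2).
    apply: measurable_funM.
      apply: measurable_funM; first exact: (measurableT_comp (@measurable_nrm R n)).
      by apply: measurableT_comp => //; exact: (measurableT_comp mK).
    apply: measurable_funD; first exact: (measurableT_comp mH).
    by apply: (measurableT_comp mH); exact: measurable_subX.
  have LHz z : L1 mu (fun y => H (y - z)) by exact: L1_sub.
  have G0 y z : 0 <= G y z by rewrite mulr_ge0// addr_ge0.
  have Gz z : \int[mu]_y G y z = nrm z * `|K z| * (2 * \int[mu]_y H y).
    rewrite /G RintZl; last exact: L1D.
    rewrite RintD// (Rint_sub (k := H))//; congr (_ * _); ring.
  have LG : L1 (mu \x mu)%E (fun u => G u.2 u.1).
    apply: (L1_prod (f := fun z y : X => G y z) (b := fun z => nrm z * `|K z| * (2 * \int[mu]_y H y))).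
    - exact: (measurable_uncurry_swap (f := G)).
    - by move=> z; apply: L1Zl; exact: L1D.
    - exact: L1Zr.
    - by move=> z; rewrite -Gz (@eq_RintX _ _ mu (fun y => `|G y z|) (G^~ z))// => y; rewrite ger0_norm.
  have LGy := L1_Rint2 (f := fun z y : X => G y z) LG.
  apply: (@le_trans _ _ (\int[mu]_y \int[mu]_z G y z)).
    apply: Rint_le => //; first by apply: L1_norm; apply: L1B; [exact: L1_convol LK KM Lh|exact: L1Zl].
    move=> y; rewrite E; apply: Rint_norm_le => //.
    have L' : L1 mu (fun z : X => nrm z * `|K z| * H y + nrm z * `|K z| * H (y - z)).
      apply: L1D; first exact: L1Zr.
      by apply: (L1M_bounded (M := M) LnK' (mHy y)) => z; rewrite ger0_norm.
    by apply: (eq_L1 _ L') => z; rewrite -mulrDr.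
  rewrite -(Rint_fubini (f := fun z y : X => G y z) LG) (eq_RintX mu Gz) RintZr//.
  by rewrite mulrC.
Qed.

(* A mean-zero kernel sees only the translation differences of a tame function. *)
Lemma conv_cancel K h H M : L1 mu K -> (exists M, forall x, `|K x| <= M) ->
  L1 mu (fun z => nrm z * K z) -> \int[mu]_z K z = 0 -> tame mu h H M ->
  (forall y, `|conv K h y| <= 2 * M * \int[mu]_z (nrm z * `|K z|)) /\
  \int[mu]_y `|conv K h y| <= 2 * \int[mu]_y H y * \int[mu]_z (nrm z * `|K z|).
Proof.
move=> LK KM LnK K0 tH; have [B1 B2] := conv_approx LK KM LnK tH.
have E y : conv K h y - \int[mu]_z K z * h y = conv K h y by rewrite K0 mul0r subr0.
split=> [y|]; first by rewrite -E.
by rewrite -(@eq_RintX _ _ mu _ _ (fun y => congr1 Num.norm (E y))).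
Qed.

End convolution.

(** * Jensen's inequality for powers *)

Section jensen.
Variable R : realType.
Implicit Types a b c p : R.

(** Convexity at [c]. Homogeneity reduces it to c = 1, where it is Young's inequality for the pair
    y, 1. *)
Lemma powR_tangent p (x c : R) : 1 <= p -> 0 <= x -> 0 < c ->
  c `^ p + p * c `^ (p - 1) * (x - c) <= x `^ p.
Proof.
move=> p1 x0 c0; have p0 : 0 < p by lra.
have cE : c `^ p = c * c `^ (p - 1) by rewrite mulr_powRB1// ltW.
have e0 : 0 <= c `^ (p - 1) by exact: powR_ge0.
suff h : p * (x / c) <= (x / c) `^ p + (p - 1).
  have xE : x = c * (x / c) by rewrite mulrC divfK// gt_eqF.
  have y0 : 0 <= x / c by rewrite divr_ge0// ltW.
  rewrite [in leRHS]xE powRM ?(ltW c0)//.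
  have : c `^ p * (p * (x / c)) <= c `^ p * ((x / c) `^ p + (p - 1)) by rewrite ler_wpM2l ?powR_ge0.
  rewrite cE [in X in _ * X * (_ - _)]/= => h2.
  have -> : p * c `^ (p - 1) * (x - c) = c * c `^ (p - 1) * (p * (x / c)) - p * (c * c `^ (p - 1)).
    by field; rewrite gt_eqF.
  lra.
have y0 : 0 <= x / c by rewrite divr_ge0// ltW.
move: (x / c) y0 => y y0.
have [->|pn1] := eqVneq p 1; first by rewrite powRr1//; lra.
have p1' : 1 < p by rewrite lt_neqAle eq_sym pn1.
have q0 : 0 < p / (p - 1) by rewrite divr_gt0//; lra.
have := @conjugate_powR R y 1 p (p / (p - 1)) y0 ler01 p0 q0.
rewrite powR_1 mulr1 => h.
have {}h : y <= y `^ p / p + 1 / (p / (p - 1)).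
  by apply: h; field; rewrite !gt_eqF//; lra.
have : p * y <= p * (y `^ p / p + 1 / (p / (p - 1))) by rewrite ler_wpM2l// ltW.
have -> : p * (y `^ p / p + 1 / (p / (p - 1))) = y `^ p + (p - 1).
  by field; rewrite !gt_eqF//; lra.
by [].
Qed.

(** The tangent inequality is integrated at c = S / A. Any A > 0 above the mass of [k] is allowed,
    so no normalisation by a possibly zero mass occurs. *)
Lemma jensen_powR d (T : measurableType d) (m : {measure set T -> \bar R})
    (k F : T -> R) p A : 1 <= p -> 0 < A ->
  L1 m k -> (forall x, 0 <= k x) -> \int[m]_x k x <= A ->
  measurable_fun setT F -> (forall x, 0 <= F x) -> L1 m (fun x => k x * F x `^ p) ->
  L1 m (fun x => k x * F x) /\
  (\int[m]_x (k x * F x)) `^ p <= A `^ (p - 1) * \int[m]_x (k x * F x `^ p).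
Proof.
move=> p1 A0 Lk k0 kA mF F0 LkF; have p0 : 0 < p by lra.
have L : L1 m (fun x => k x * F x).
  apply: (L1_dom _ (L1D Lk LkF)); first by apply: measurable_funM => //; exact: L1_measurable Lk.
  move=> x; rewrite ger0_norm ?mulr_ge0//.
  rewrite -[X in _ <= X + _]mulr1 -mulrDr ler_wpM2l//.
  have [F1|F1] := leP 1 (F x); last by have := powR_ge0 (F x) p; lra.
  by have := le1r_powR F1 p1; lra.
split => //; set S := \int[m]_x _; set B := \int[m]_x _.
have S0 : 0 <= S by apply: Rintegral_ge0 => x _; rewrite mulr_ge0.
have B0 : 0 <= B by apply: Rintegral_ge0 => x _; rewrite mulr_ge0 ?powR_ge0.
have [SE|Sn] := eqVneq S 0.
  by rewrite SE powR0 ?gt_eqF// mulr_ge0 ?powR_ge0.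
have Sp : 0 < S by rewrite lt0r Sn.
pose c := S / A; have c0 : 0 < c by rewrite divr_gt0.
pose I := \int[m]_x k x.
have I0 : 0 <= I by apply: Rintegral_ge0.
have cE : c `^ p = c * c `^ (p - 1) by rewrite mulr_powRB1// ltW.
have e0 : 0 <= c `^ (p - 1) by exact: powR_ge0.
have h : (c `^ p - p * c `^ (p - 1) * c) * I + p * c `^ (p - 1) * S <= B.
  rewrite -!RintZl// -RintD; [|exact: L1Zl|exact: L1Zl].
  apply: Rint_le => //; first by apply: L1D; exact: L1Zl.
  move=> x; have := powR_tangent p1 (F0 x) c0 => t1.
  have : k x * (c `^ p + p * c `^ (p - 1) * (F x - c)) <= k x * F x `^ p by rewrite ler_wpM2l.
  lra.
have SA : S = c * A by rewrite /c divfK// gt_eqF.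
have h2 : c `^ p * A <= B.
  rewrite SA cE in h *.
  have : c * c `^ (p - 1) * I <= c * c `^ (p - 1) * A by rewrite ler_wpM2l// mulr_ge0// ltW.
  have : (p - 1) * (c * c `^ (p - 1) * I) <= (p - 1) * (c * c `^ (p - 1) * A).
    by rewrite ler_wpM2l; [|lra|]; rewrite ?ler_wpM2l// mulr_ge0// ltW.
  lra.
rewrite SA powRM ?(ltW c0) ?(ltW A0)// -[A `^ p](mulr_powRB1 (ltW A0) p0).
rewrite mulrA mulrC ler_wpM2l ?powR_ge0//.
Qed.

End jensen.

(** * Young's inequality, decay in time, and superpositions in L^q *)

Section Lp_estimates.
Variables (R : realType) (n : nat).
Variable mu : {sigma_finite_measure set (Rn R n) -> \bar R}.
Hypothesis Hmu : is_lebesgue mu.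
Local Notation X := (Rn R n).
Local Notation leb := (@lebesgue_measure R).
Local Notation RR := (measurableTypeR R).
Local Notation corr := (corr mu).
Implicit Types (x y z w : 'rV[R]_n) (f h k F : X -> R).

Lemma corr_L1 f k : L1 mu f -> L1 mu k ->
  L1 mu (corr k f) /\ \int[mu]_x `|corr k f x| <= \int[mu]_y `|k y| * \int[mu]_y `|f y|.
Proof.
move=> Lf Lk; have mf := L1_measurable Lf; have mk := L1_measurable Lk.
pose G := fun y x : X => f y * k (y - x).
have Lx y : L1 mu (G y) by apply: L1Zl; exact: (L1_refl Hmu y Lk).
have mn : measurable_fun setT (fun x : X => `|k x|) by exact: measurableT_comp.
have Ex y : \int[mu]_x `|G y x| = \int[mu]_y `|k y| * `|f y|.
  rewrite (@eq_RintX _ _ mu _ (fun x => `|f y| * `|k (y - x)|)); last by move=> x; rewrite normrM.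
  rewrite RintZl; last exact: (L1_refl Hmu y (L1_norm Lk)).
  by rewrite (Rint_refl Hmu y mn) mulrC.
have LG : L1 (mu \x mu)%E (fun u => G u.1 u.2).
  apply: (L1_prod (f := G) (b := fun y => \int[mu]_y `|k y| * `|f y|)) => //.
  - apply: measurable_funM; first exact: (measurableT_comp mf).
    by apply: (measurableT_comp mk); exact: measurable_subX.
  - exact/L1Zl/L1_norm.
  - by move=> y; rewrite Ex.
split; first exact: (L1_Rint2 (f := G) LG).
have LG' : L1 (mu \x mu)%E (fun u => `|G u.1 u.2|) by exact: L1_norm.
apply: (@le_trans _ _ (\int[mu]_x \int[mu]_y `|G y x|)).
  apply: Rint_le; [exact/L1_norm/(L1_Rint2 (f := G) LG)|exact: (L1_Rint2 (f := fun y x : X => `|G y x|) LG')|].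
  move=> x; rewrite /corr.
  have [Ly|Ly] := pselect (L1 mu (G^~ x)); first exact: Rint_norm.
  (* On a section that is not integrable the extended integral is infinite, so its real value is the
     default 0. *)
  rewrite (_ : Rintegral _ _ _ = 0) ?normr0; first by apply: Rintegral_ge0.
  rewrite /Rintegral; case E : (\int[mu]_y _)%E => [v| |] //=.
  exfalso; apply: Ly; apply/integrableP; split.
    apply/measurable_EFinP; apply: measurable_funM => //.
    by apply: (measurableT_comp mk); exact: measurable_subX.
  apply/abse_integralP => //; last by rewrite E ltry.
  apply/measurable_EFinP; apply: measurable_funM => //.
  by apply: (measurableT_comp mk); exact: measurable_subX.
rewrite -(Rint_fubini (f := fun y x : X => `|G y x|) LG') (eq_RintX mu Ex) RintZl//.
exact: L1_norm.
Qed.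

Lemma le1D_powR (y p : R) : 1 <= p -> 0 <= y -> y <= 1 + y `^ p.
Proof.
move=> p1 y0; have [y1|y1] := leP 1 y; last by have := powR_ge0 y p; lra.
by have := le1r_powR y1 p1; lra.
Qed.

(** Jensen with the weight |k(y - x)| bounds the p-th power by a correlation of |f|^p, to which the
    L^1 estimate applies. *)
Lemma young f k p A M : 1 <= p -> 0 < A -> measurable_fun setT f ->
  L1 mu (fun x => `|f x| `^ p) -> L1 mu k -> (forall x, `|k x| <= M) -> \int[mu]_y `|k y| <= A ->
  L1 mu (fun x => `|corr k f x| `^ p) /\
  \int[mu]_x `|corr k f x| `^ p <= A `^ p * \int[mu]_x `|f x| `^ p.
Proof.
move=> p1 A0 mf Lf Lk kM kA; have p0 : 0 < p by lra.
have mk := L1_measurable Lk.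
have mn : measurable_fun setT (fun x : X => `|k x|) by exact: measurableT_comp.
have [LG BG] := corr_L1 Lf (L1_norm Lk).
have G0 x : 0 <= corr (fun y => `|k y|) (fun y => `|f y| `^ p) x.
  by apply: Rintegral_ge0 => y _; rewrite mulr_ge0 ?powR_ge0.
have J x : `|corr k f x| `^ p <= A `^ (p - 1) * corr (fun y => `|k y|) (fun y => `|f y| `^ p) x.
  have Lks : L1 mu (fun y : X => `|k (y - x)|) by apply: L1_norm; exact: L1_sub.
  have kAx : \int[mu]_y `|k (y - x)| <= A by rewrite (Rint_sub Hmu x mn).
  have mfn : measurable_fun setT (fun y : X => `|f y|) by exact: measurableT_comp.
  have Lkf : L1 mu (fun y : X => `|k (y - x)| * `|f y| `^ p).
    apply: (eq_L1 _ (L1M_bounded (M := M) Lf (L1_measurable Lks) _)) => y; first by rewrite mulrC.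
    by rewrite normr_id.
  have [L1kf J] := jensen_powR p1 A0 Lks (fun y => normr_ge0 _) kAx mfn (fun y => normr_ge0 _) Lkf.
  apply: (@le_trans _ _ ((\int[mu]_y (`|k (y - x)| * `|f y|)) `^ p)).
    apply: powR_le => //; first exact: ltW.
    apply: Rint_norm_le => //.
      by apply: measurable_funM => //; exact: L1_measurable (L1_sub Hmu x Lk).
    by move=> y; rewrite normrM mulrC.
  rewrite (le_trans J)// ler_wpM2l ?powR_ge0// le_eqVlt; apply/orP; left; apply/eqP.
  by apply: eq_RintX => y; rewrite mulrC.
have mc : measurable_fun setT (fun x : X => `|corr k f x| `^ p).
  apply: (measurableT_comp (@measurable_powR R p)); apply: measurableT_comp => //.
  exact: measurable_corr.
have L : L1 mu (fun x => `|corr k f x| `^ p).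
  apply: (L1_dom mc (L1Zl (A `^ (p - 1)) LG)) => x.
  by rewrite ger0_norm ?powR_ge0.
split => //.
apply: (le_trans (Rint_le L (L1Zl (A `^ (p - 1)) LG) J)); rewrite RintZl//.
rewrite -[A `^ p](mulr_powRB1 (ltW A0) p0) [A * _]mulrC -mulrA ler_wpM2l ?powR_ge0//.
have -> : \int[mu]_x corr (fun y => `|k y|) (fun y => `|f y| `^ p) x =
    \int[mu]_x `|corr (fun y => `|k y|) (fun y => `|f y| `^ p) x|.
  by apply: eq_RintX => x; rewrite ger0_norm.
apply: (le_trans BG).
have E1 : \int[mu]_y `| `|k y| | = \int[mu]_y `|k y| by apply: eq_RintX => y; rewrite normr_id.
have E2 : \int[mu]_y `| `|f y| `^ p| = \int[mu]_y `|f y| `^ p.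
  by apply: eq_RintX => y; rewrite ger0_norm ?powR_ge0.
by rewrite E1 E2 ler_wpM2r// Rintegral_ge0// => y _; exact: powR_ge0.
Qed.

Lemma Lp_sum_dom f p : 1 <= p -> measurable_fun setT f -> L1 mu (fun x => `|f x| `^ p) ->
  sum_dom mu f (fun x => `|f x| `^ p).
Proof. by move=> p1 mf Lf; split => // x; exact: le1D_powR. Qed.

(** Replaces Hölder's inequality. Dividing [f] by dl = t^(-n/(2p)) makes the bounded and the
    integrable part of |f| <= 1 + |f|^p contribute equally. *)
Lemma corr_decay f k p A e t x : 1 <= p -> measurable_fun setT f ->
  L1 mu (fun x => `|f x| `^ p) -> \int[mu]_x `|f x| `^ p <= 1 ->
  0 <= A -> 0 < t -> L1 mu k -> \int[mu]_y `|k y| <= A * t `^ e ->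
  (forall y, `|k y| <= A * t `^ (e - n%:R / 2)) ->
  `|corr k f x| <= 2 * A * t `^ (e - n%:R / (2 * p)).
Proof.
move=> p1 mf Lf f1 A0 t0 Lk kA kM; have p0 : 0 < p by lra.
pose dl := t `^ (- (n%:R / (2 * p))); have dl0 : 0 < dl by exact: powR_gt0.
have mfd : measurable_fun setT (fun x : X => dl^-1 * f x) by exact: measurable_funM.
have E y : `|dl^-1 * f y| `^ p = t `^ (n%:R / 2) * `|f y| `^ p.
  rewrite normrM ger0_norm ?invr_ge0 ?(ltW dl0)// powRM ?invr_ge0 ?(ltW dl0)//; congr (_ * _).
  rewrite /dl -powRN -powRrM opprK; congr (_ `^ _); field; by rewrite gt_eqF.
have Lfd : L1 mu (fun x => `|dl^-1 * f x| `^ p).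
  by apply: (eq_L1 _ (L1Zl (t `^ (n%:R / 2)) Lf)) => y; rewrite E.
have sd := Lp_sum_dom p1 mfd Lfd.
have [Lc B] := corr_bound Hmu x sd Lk kM.
have cE : corr k (fun x => dl^-1 * f x) x = dl^-1 * corr k f x.
  rewrite /corr -RintZl.
    by apply: eq_RintX => y; rewrite mulrA.
  apply: (eq_L1 _ (L1Zl dl Lc)) => y; rewrite !mulrA divff ?mul1r// gt_eqF//.
rewrite cE normrM ger0_norm ?invr_ge0 ?(ltW dl0)// in B.
have I1 : \int[mu]_y `| `|dl^-1 * f y| `^ p| <= t `^ (n%:R / 2).
  rewrite (@eq_RintX _ _ mu _ (fun y => t `^ (n%:R / 2) * `|f y| `^ p)).
    by rewrite RintZl// ler_piMr ?powR_ge0.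
  by move=> y; rewrite ger0_norm ?powR_ge0// E.
have {}B : dl^-1 * `|corr k f x| <= 2 * A * t `^ e.
  apply: (le_trans B).
  have : A * t `^ (e - n%:R / 2) * \int[mu]_y `| `|dl^-1 * f y| `^ p| <=
      A * t `^ (e - n%:R / 2) * t `^ (n%:R / 2) by rewrite ler_wpM2l// mulr_ge0 ?powR_ge0.
  rewrite -[in leRHS]mulrA -powRD_gt0// subrK; lra.
rewrite ler_pdivrMl// in B; apply: (le_trans B).
rewrite powRD_gt0// -/dl le_eqVlt; apply/orP; left; apply/eqP; ring.
Qed.

Section superposition.
Variables (a q s0 s1 C : R).
Hypotheses (a0 : 0 < a) (q1 : 1 <= q) (C0 : 0 <= C) (h0 : 0 < a * q + s0) (h1 : a * q + s1 < 0).

Let q0 : 0 < q. Proof. have := q1; lra. Qed.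
(** Jensen with the integrable density [kap], of powers r^(dl-1) near 0 and r^(-dl-1) at infinity,
    stands in for Minkowski's integral inequality. The margin [dl] is small enough for [e0] and [e1]
    to keep the signs of a q + s0 and a q + s1. *)
Let dl : R := Num.min (a * q + s0) (- (a * q + s1)) / (2 * q).
Let dl0 : 0 < dl.
Proof. by rewrite /dl divr_gt0 ?mulr_gt0// lt_min h0 oppr_gt0 h1. Qed.
Let dlq : dl * (2 * q) = Num.min (a * q + s0) (- (a * q + s1)).
Proof. by rewrite /dl divfK// gt_eqF// mulr_gt0. Qed.
Let kap (r : R) : R := if r <= 1 then pw dl r else pw (- dl) r.
Let e0 := dl + (a - dl) * q + s0.
Let e1 := - dl + (a + dl) * q + s1.
Let e0_gt0 : 0 < e0.
Proof.
have : dl * (2 * q) <= a * q + s0 by rewrite dlq ge_min lexx.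
rewrite /e0; have := dl0; have := h0; have := q1; nra.
Qed.
Let e1_lt0 : e1 < 0.
Proof.
have : dl * (2 * q) <= - (a * q + s1) by rewrite dlq ge_min lexx orbT.
rewrite /e1; have := dl0; have := h1; have := q1; nra.
Qed.
Let bb (r : R) : R := if r <= 1 then C * pw e0 r else C * pw e1 r.

Let mkap : measurable_fun setT (kap : RR -> R).
Proof.
by apply: measurable_fun_ifT; [exact: measurable_fun_ler|exact: measurable_pw|exact: measurable_pw].
Qed.

Let mbb : measurable_fun setT (bb : RR -> R).
Proof.
apply: measurable_fun_ifT; first exact: measurable_fun_ler.
  by apply: measurable_funM => //; exact: measurable_pw.
by apply: measurable_funM => //; exact: measurable_pw.
Qed.

Let kap_ge0 r : 0 <= kap r.
Proof. by rewrite /kap; case: ifP => _; exact: pw_ge0. Qed.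
Let kap_gt0 r : 0 < r -> 0 < kap r.
Proof. by move=> r0; rewrite /kap; case: ifP => _; exact: pw_gt0. Qed.
Let kap_le0 r : r <= 0 -> kap r = 0.
Proof. by move=> r0; rewrite /kap; case: ifP => _; exact: pw_le0. Qed.

Let Lkap : L1 leb kap.
Proof.
apply: (@L1_pw_dom R dl (- dl) 1 1) => //; first by rewrite oppr_lt0.
- by move=> t t0 t1; rewrite ger0_norm// /kap t1 mul1r.
- by move=> t t1; rewrite ger0_norm// /kap ifN ?mul1r// -ltNge.
Qed.

Let bb_ge0 r : 0 <= bb r.
Proof. by rewrite /bb; case: ifP => _; rewrite mulr_ge0 ?pw_ge0. Qed.

Let Lbb : L1 leb bb.
Proof.
apply: (@L1_pw_dom R e0 e1 C C) => //.
- by move=> t t0; rewrite /bb; case: ifP => _; rewrite pw_le0// mulr0.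
- by move=> t t0 t1; rewrite ger0_norm// /bb t1.
- by move=> t t1; rewrite ger0_norm// /bb ifN// -ltNge.
Qed.

Let A0 := \int[leb]_r kap r + 1.
Let A0_gt0 : 0 < A0. Proof. by rewrite ltr_wpDl// Rintegral_ge0. Qed.

Definition superpose_cst := A0 `^ (q - 1) * \int[leb]_r bb r.

Lemma superpose_cst_ge0 : 0 <= superpose_cst.
Proof. by rewrite mulr_ge0 ?powR_ge0// Rintegral_ge0. Qed.

Variable g : RR -> X -> R.
Hypothesis mg : measurable_fun setT (fun u => g u.1 u.2).
Hypothesis g_small : forall r, 0 < r -> r <= 1 ->
  L1 mu (fun x => `|g r x| `^ q) /\ \int[mu]_x `|g r x| `^ q <= C * r `^ s0.
Hypothesis g_large : forall r, 1 < r ->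
  L1 mu (fun x => `|g r x| `^ q) /\ \int[mu]_x `|g r x| `^ q <= C * r `^ s1.

Definition superpose x : R := \int[leb]_r (pw a r * g r x).

(** The integrand divided by the density [kap]; [Phi] is then the Jensen majorant, whose integral in
    x is at most [bb r]. *)
Let G (r : RR) (x : X) : R := pw a r * `|g r x| / kap r.
Let Phi (r : RR) (x : X) : R := kap r * G r x `^ q.

Let G_ge0 r x : 0 <= G r x.
Proof. by rewrite !mulr_ge0 ?pw_ge0 ?invr_ge0. Qed.
Let Phi_ge0 r x : 0 <= Phi r x.
Proof. by rewrite mulr_ge0 ?powR_ge0. Qed.

Let mG : measurable_fun setT (fun u : RR * X => G u.1 u.2).
Proof.
apply: measurable_funM; last by apply: measurable_funV; exact: (measurableT_comp mkap).
apply: measurable_funM; first exact: (measurableT_comp (measurable_pw a)).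
exact: measurableT_comp.
Qed.

Let mPhi : measurable_fun setT (fun u : RR * X => Phi u.1 u.2).
Proof.
apply: measurable_funM; first exact: (measurableT_comp mkap).
exact: (measurableT_comp (@measurable_powR R q) mG).
Qed.

Let PhiE r x : Phi r x = kap r * (pw a r / kap r) `^ q * `|g r x| `^ q.
Proof.
rewrite /Phi /G mulrAC (@powRM _ (pw a r / kap r) `|g r x|) ?mulrA//.
by rewrite mulr_ge0 ?pw_ge0 ?invr_ge0.
Qed.

Let wE0 r : 0 < r -> r <= 1 -> kap r * (pw a r / kap r) `^ q * (C * r `^ s0) = bb r.
Proof.
move=> r0 r1; rewrite /kap /bb r1 !pwE// -powRB ?(gt_eqF r0) ?implybT// -powRrM.
rewrite (_ : _ * (C * _) = C * (r `^ (dl - 1) * r `^ ((a - 1 - (dl - 1)) * q) * r `^ s0)); last by ring.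
by rewrite -!powRD_gt0//; congr (_ * _ `^ _); rewrite /e0; ring.
Qed.

Let wE1 r : 1 < r -> kap r * (pw a r / kap r) `^ q * (C * r `^ s1) = bb r.
Proof.
move=> r1; have r0 : 0 < r by lra.
rewrite /kap /bb leNgt r1/= !pwE// -powRB ?(gt_eqF r0) ?implybT// -powRrM.
rewrite (_ : _ * (C * _) = C * (r `^ (- dl - 1) * r `^ ((a - 1 - (- dl - 1)) * q) * r `^ s1)); last by ring.
by rewrite -!powRD_gt0//; congr (_ * _ `^ _); rewrite /e1; ring.
Qed.

Let LPhi_r r : L1 mu (Phi r) /\ \int[mu]_x `|Phi r x| <= bb r.
Proof.
have w0 : 0 <= kap r * (pw a r / kap r) `^ q by rewrite mulr_ge0 ?powR_ge0.
have nE x : `|Phi r x| = kap r * (pw a r / kap r) `^ q * `|g r x| `^ q.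
  by rewrite ger0_norm// PhiE.
have aux B : L1 mu (fun x => `|g r x| `^ q) -> \int[mu]_x `|g r x| `^ q <= B ->
    kap r * (pw a r / kap r) `^ q * B = bb r -> L1 mu (Phi r) /\ \int[mu]_x `|Phi r x| <= bb r.
  move=> L I <-; split; first by apply: (eq_L1 _ (L1Zl (kap r * (pw a r / kap r) `^ q) L)) => x; rewrite PhiE.
  by rewrite (@eq_Rint _ _ _ mu _ _ nE) RintZl// ler_wpM2l.
have [rn|rp] := leP r 0.
  have z x : Phi r x = 0 by rewrite /Phi kap_le0// mul0r.
  split; first by apply: (eq_L1 _ (L10 mu)) => x; rewrite z.
  by rewrite (@eq_Rint _ _ _ mu _ (fun=> 0)) ?Rint0// => x; rewrite z normr0.
have [r1|r1] := leP r 1.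
  by have [L I] := g_small rp r1; apply: aux L I _; exact: wE0.
by have [L I] := g_large r1; apply: aux L I _; exact: wE1.
Qed.

Let LPhi : L1 (leb \x mu)%E (fun u => Phi u.1 u.2).
Proof.
apply: (L1_prod (f := Phi) (b := bb)) => //.
- by move=> r; have [] := LPhi_r r.
- by move=> r; have [] := LPhi_r r.
Qed.

Let kG r x : kap r * G r x = pw a r * `|g r x|.
Proof.
have [rn|rp] := leP r 0; first by rewrite kap_le0// pw_le0// !mul0r.
by rewrite /G mulrC divfK// gt_eqF// kap_gt0.
Qed.

Let J (x : X) : L1 leb (Phi^~ x) -> L1 leb (fun r => pw a r * g r x) /\
  `|superpose x| `^ q <= A0 `^ (q - 1) * \int[leb]_r Phi r x.
Proof.
move=> L; have kA : \int[leb]_r kap r <= A0 by rewrite lerDl.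
have mGx := measurable_sec2 x mG.
have [L1' J] := jensen_powR q1 A0_gt0 Lkap kap_ge0 kA mGx (fun r => G_ge0 r x) L.
have mpg : measurable_fun setT (fun r : RR => pw a r * g r x).
  by apply: measurable_funM; [exact: measurable_pw|exact: (measurable_sec2 x mg)].
have D r : `|pw a r * g r x| <= kap r * G r x by rewrite kG normrM ger0_norm ?pw_ge0.
split; first exact: (L1_dom mpg L1' D).
apply: (le_trans _ J); apply: powR_le => //; first exact: ltW.
exact: (Rint_norm_le mpg L1' D).
Qed.

Lemma measurable_superpose : measurable_fun setT (superpose : X -> R).
Proof.
apply: (measurable_Rint2 leb (f := fun (x : X) (r : RR) => pw a r * g r x)).
apply: (measurable_uncurry_swap (f := fun (r : RR) (x : X) => pw a r * g r x)).
by apply: measurable_funM => //; exact: (measurableT_comp (measurable_pw a)).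
Qed.

Let aePhi : {ae mu, forall x, L1 leb (Phi^~ x)}.
Proof. exact: (ae_integrable2 LPhi). Qed.

Lemma superpose_Lq : L1 mu (fun x => `|superpose x| `^ q) /\
  \int[mu]_x `|superpose x| `^ q <= superpose_cst.
Proof.
have ms := measurable_superpose.
have LP := L1_Rint2 (f := Phi) LPhi.
apply: L1_bound.
- by apply: (measurableT_comp (@measurable_powR R q)); exact: measurableT_comp.
- by move=> x; exact: powR_ge0.
- apply: (@le_trans _ _ (\int[mu]_x (A0 `^ (q - 1) * \int[leb]_r Phi r x)%:E)%E).
    apply: ae_ge0_le_integral => //.
    + apply/measurable_EFinP.
      by apply: (measurableT_comp (@measurable_powR R q)); exact: measurableT_comp.
    + by move=> x _; rewrite lee_fin mulr_ge0 ?powR_ge0// Rintegral_ge0.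
    + apply/measurable_EFinP; exact: L1_measurable (L1Zl _ LP).
    (* The Jensen bound holds where [Phi] is integrable in [r], that is, almost everywhere. *)
    + have [N [mN N0 sN]] := aePhi; exists N; split => // x /= nP; apply: sN => /= L.
      by apply: nP => _; rewrite lee_fin; exact: (J L).2.
  rewrite -(EFin_Rint (L1Zl _ LP)) lee_fin RintZl// /superpose_cst ler_wpM2l ?powR_ge0//.
  rewrite -(Rint_fubini (f := Phi) LPhi); apply: (Rint_le (L1_Rint1 (f := Phi) LPhi) Lbb).
  move=> r; have [LPr Br] := LPhi_r r; apply: le_trans Br.
  by apply: (Rint_le LPr (L1_norm LPr)) => x; exact: ler_norm.
Qed.

(** Fubini is justified by s <= 1 + s^q applied to [G]: the first term is paid by kap |h|, the
    second by M Phi. *)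
Lemma superpose_pair h M : L1 mu h -> (forall x, `|h x| <= M) ->
  L1 mu (fun x => superpose x * h x) /\
  \int[mu]_x (superpose x * h x) = \int[leb]_r (pw a r * \int[mu]_x (g r x * h x)).
Proof.
move=> Lh hM; have ms := measurable_superpose; have mh := L1_measurable Lh.
have [LS _] := superpose_Lq.
have LSh : L1 mu (fun x => superpose x * h x).
  apply: (L1_dom _ (L1D (L1_norm Lh) (L1Zl M LS))); first exact: measurable_funM.
  move=> x; rewrite normrM; have := le1D_powR q1 (normr_ge0 (superpose x)).
  have := hM x; have := normr_ge0 (h x); have := powR_ge0 `|superpose x| q.
  move: `|superpose x| `|h x| (`|superpose x| `^ q) => s v P P0 v0 vM sP.
  have : s * v <= (1 + P) * v by rewrite ler_wpM2r.
  have : P * v <= P * M by rewrite ler_wpM2l.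
  lra.
split => //.
pose Q (r : RR) (x : X) := pw a r * g r x * h x.
have mQ : measurable_fun setT (fun u => Q u.1 u.2).
  apply: measurable_funM; last exact: (measurableT_comp mh).
  by apply: measurable_funM => //; exact: (measurableT_comp (measurable_pw a)).
have Lkh : L1 (leb \x mu)%E (fun u => kap u.1 * `|h u.2|).
  apply: (L1_prod (f := fun (r : RR) (x : X) => kap r * `|h x|) (b := fun r => kap r * \int[mu]_x `|h x|)).
  - apply: measurable_funM; first exact: (measurableT_comp mkap).
    by apply: measurableT_comp => //; exact: (measurableT_comp mh).
  - by move=> r; exact/L1Zl/L1_norm.
  - exact: L1Zr.
  - move=> r; rewrite -RintZl; last exact: L1_norm.
    rewrite le_eqVlt; apply/orP; left; apply/eqP.
    by apply: eq_Rint => x; rewrite ger0_norm// mulr_ge0.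
have LQ : L1 (leb \x mu)%E (fun u => Q u.1 u.2).
  apply: (L1_dom mQ (L1D Lkh (L1Zl M LPhi))) => -[r x] /=.
  rewrite /Q !normrM (ger0_norm (pw_ge0 _ _)) -kG.
  have G0 := G_ge0 r x; have k0 := kap_ge0 r.
  have := le1D_powR q1 G0; have := hM x; have := normr_ge0 (h x).
  rewrite /Phi; have := powR_ge0 (G r x) q.
  move: G0 k0; move: (G r x) (kap r) `|h x| (G r x `^ q) => s v u P s0' v0 P0 u0 uM sP.
  have h2 : v * s * u <= v * (1 + P) * u by rewrite ler_wpM2r// ler_wpM2l.
  have h3 : v * P * u <= v * P * M by rewrite ler_wpM2l// mulr_ge0.
  lra.
transitivity (\int[mu]_x \int[leb]_r Q r x).
  apply: ae_eq_Rint.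
  - exact: measurable_funM.
  - exact: L1_measurable (L1_Rint2 (f := Q) LQ).
  - have [N [mN N0 sN]] := aePhi; exists N; split => // x /= nP; apply: sN => /= L.
    by apply: nP => _; rewrite /Q RintZr//; exact: (J L).1.
rewrite -(Rint_fubini (f := Q) LQ).
have aeQ := ae_integrable1 LQ.
apply: ae_eq_Rint.
- exact: L1_measurable (L1_Rint1 (f := Q) LQ).
- apply: measurable_funM; first exact: measurable_pw.
  apply: (measurable_Rint2 mu (f := fun (r : RR) (x : X) => g r x * h x)).
  by apply: measurable_funM => //; exact: (measurableT_comp mh).
- have [N [mN N0 sN]] := aeQ; exists N; split => // r /= nP; apply: sN => /= L.
  apply: nP => _.
  have [rn|rp] := leP r 0.
    by rewrite pw_le0// mul0r (@eq_Rint _ _ _ mu _ (fun=> 0)) ?Rint0// => x; rewrite /Q pw_le0// !mul0r.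
  have pn0 : pw a r != 0 by rewrite gt_eqF// pw_gt0.
  rewrite -RintZl.
    by apply: eq_Rint => x; rewrite /Q mulrA.
  apply: (eq_L1 _ (L1Zl (pw a r)^-1 (L : L1 mu (Q r)))) => x.
  by rewrite /Q -mulrA mulKf.
Qed.

End superposition.
End Lp_estimates.

(** * Kernels superposed in time *)

Section super_kernel.
Variables (R : realType) (n : nat).
Variable mu : {sigma_finite_measure set (Rn R n) -> \bar R}.
Hypothesis Hmu : is_lebesgue mu.
Local Notation X := (Rn R n).
Local Notation leb := (@lebesgue_measure R).
Local Notation RR := (measurableTypeR R).
Local Notation corr := (corr mu).
Implicit Types (x y z w : 'rV[R]_n) (f h k F K H : X -> R).

(** For [gker i] and the power weight this is, up to a constant, a component of the fractional
    gradient of the Gaussian at time [r]. *)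
Definition superk (lam : {measure set RR -> \bar R}) (om : RR -> R) d r K z : R :=
  \int[lam]_t (om t * dil d K (r + t) z).

Variables (lam : {sigma_finite_measure set RR -> \bar R}) (om : RR -> R) (d : R).
Hypotheses (mom : measurable_fun setT om) (om0 : forall t, 0 <= om t).

Lemma measurable_superk3 K : measurable_fun setT K ->
  measurable_fun setT (fun u : (RR * X) * RR => om u.2 * dil d K (u.1.1 + u.2) u.1.2).
Proof.
move=> mK.
have m1 : measurable_fun setT (fun u : (RR * X) * RR => u.1.1 + u.2 : R).
  by apply: measurable_funD => //; exact: (measurableT_comp measurable_fst measurable_fst).
apply: measurable_funM; first exact: (measurableT_comp mom).
apply: measurable_funM; first by apply: (measurableT_comp (@measurable_powR R _)).
apply: (measurableT_comp mK); apply: measurable_scaleX => //.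
  by apply: (measurableT_comp (@measurable_powR R _)).
exact: (measurableT_comp measurable_snd measurable_fst).
Qed.

Lemma measurable_superk2 K : measurable_fun setT K ->
  measurable_fun setT (fun u : RR * X => superk lam om d u.1 K u.2).
Proof.
move=> mK; exact: (measurable_Rint2 lam (f := fun (u : RR * X) (t : RR) =>
  om t * dil d K (u.1 + t) u.2) (measurable_superk3 mK)).
Qed.

Lemma measurable_kernel_corr (k2 : RR -> X -> R) f : measurable_fun setT f ->
  measurable_fun setT (fun u => k2 u.1 u.2) ->
  measurable_fun setT (fun u : RR * X => corr (k2 u.1) f u.2).
Proof.
move=> mf mk; apply: (measurable_Rint2 mu (f := fun (u : RR * X) (y : X) => f y * k2 u.1 (y - u.2))).
apply: measurable_funM; first exact: (measurableT_comp mf).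
apply: (measurableT_comp mk (g := fun u : (RR * X) * X => (u.1.1, u.2 - u.1.2 : X))).
apply: measurable_fun_pair; first exact: (measurableT_comp measurable_fst measurable_fst).
by apply: measurable_subX => //; exact: (measurableT_comp measurable_snd measurable_fst).
Qed.

Section fixed_r.
Variable r : R.
Hypothesis omr : forall t, om t != 0 -> 0 < r + t.
Hypothesis Lo : L1 lam (fun t => om t * (r + t) `^ (- d)).
Hypothesis Lo' : L1 lam (fun t => om t * (r + t) `^ (- (d + n%:R / 2))).
Local Notation Ks := (superk lam om d r).
Let I := \int[lam]_t (om t * (r + t) `^ (- d)).
Let I' := \int[lam]_t (om t * (r + t) `^ (- (d + n%:R / 2))).

Let mker K : measurable_fun setT K ->
  measurable_fun setT (fun u : RR * X => om u.1 * dil d K (r + u.1) u.2).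
Proof.
move=> mK; apply: (measurableT_comp (measurable_superk3 mK)
  (g := fun u : RR * X => ((r, u.2), u.1))).
by apply: measurable_fun_pair => //; exact: measurable_fun_pair.
Qed.

(** Where the weight vanishes, r + t may be non-positive and the dilation is then uncontrolled;
    hence the case distinction on [om t], which recurs below. *)
Let Lker K t : L1 mu K -> L1 mu (fun z => om t * dil d K (r + t) z).
Proof.
move=> LK; have [z0|zN] := eqVneq (om t) 0.
  by apply: (eq_L1 _ (L10 mu)) => z; rewrite z0 mul0r.
by apply: L1Zl; apply: dil_L1 => //; exact: omr.
Qed.

Let Iker K t : L1 mu K ->
  \int[mu]_z `|om t * dil d K (r + t) z| = om t * (r + t) `^ (- d) * \int[mu]_z `|K z|.
Proof.
move=> LK; have [z0|zN] := eqVneq (om t) 0.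
  by rewrite z0 !mul0r (@eq_RintX _ _ mu _ (fun=> 0)) ?Rint0// => z; rewrite mul0r normr0.
rewrite (@eq_RintX _ _ mu _ (fun z => om t * dil d (fun z => `|K z|) (r + t) z)).
  by rewrite RintZl ?dil_int ?mulrA//; [exact: omr|exact: L1_norm|apply: dil_L1; [|exact: omr|exact: L1_norm]].
by move=> z; rewrite normrM dil_norm ger0_norm.
Qed.

Let Lprod K : L1 mu K -> L1 (lam \x mu)%E (fun u => om u.1 * dil d K (r + u.1) u.2).
Proof.
move=> LK; apply: (L1_prod (f := fun (t : RR) (z : X) => om t * dil d K (r + t) z)
  (b := fun t => om t * (r + t) `^ (- d) * \int[mu]_z `|K z|)).
- by apply: mker; exact: L1_measurable LK.
- by move=> t; exact: Lker.
- exact: L1Zr.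
- by move=> t; rewrite Iker.
Qed.

Lemma superk_L1 K : L1 mu K -> L1 mu (Ks K) /\ \int[mu]_z `|Ks K z| <= I * \int[mu]_z `|K z|.
Proof.
move=> LK; have L := Lprod LK.
have LKs := L1_Rint2 (f := fun (t : RR) (z : X) => om t * dil d K (r + t) z) L.
split => //.
have Ln : L1 (lam \x mu)%E (fun u => `|om u.1 * dil d K (r + u.1) u.2|) by exact: L1_norm.
have Lnz := L1_Rint2 (f := fun (t : RR) (z : X) => `|om t * dil d K (r + t) z|) Ln.
apply: (@le_trans _ _ (\int[mu]_z \int[lam]_t `|om t * dil d K (r + t) z|)).
  apply: (Rint_le (L1_norm LKs) Lnz) => z.
  have mz := measurable_sec2 (z : X) (f := fun (t : RR) (z : X) => om t * dil d K (r + t) z)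
    (mker (L1_measurable LK)).
  have [Lz|Lz] := pselect (L1 lam (fun t => om t * dil d K (r + t) z)); first exact: Rint_norm.
  rewrite (_ : Rintegral _ _ _ = 0) ?normr0; first by apply: Rintegral_ge0.
  rewrite /Rintegral; case E : (\int[lam]_t _)%E => [v| |] //=.
  exfalso; apply: Lz; apply/integrableP; split; first exact/measurable_EFinP.
  by apply/abse_integralP => //; [exact/measurable_EFinP|rewrite E ltry].
rewrite -(Rint_fubini (f := fun (t : RR) (z : X) => `|om t * dil d K (r + t) z|) Ln).
rewrite (@eq_Rint _ _ _ lam _ _ (fun t => Iker t LK)).
by rewrite RintZr.
Qed.

Let ker_le K M t z : (forall z, `|K z| <= M) ->
  `|om t * dil d K (r + t) z| <= om t * (r + t) `^ (- (d + n%:R / 2)) * M.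
Proof.
by move=> KM; rewrite !normrM ger0_norm// (ger0_norm (powR_ge0 _ _)) mulrA ler_wpM2l// mulr_ge0 ?powR_ge0.
Qed.

Lemma superk_int K M z : measurable_fun setT K -> (forall z, `|K z| <= M) ->
  L1 lam (fun t => om t * dil d K (r + t) z).
Proof.
move=> mK KM; have mz := measurable_sec2 (z : X)
  (f := fun (t : RR) (z : X) => om t * dil d K (r + t) z) (mker mK).
by apply: (L1_dom mz (L1Zr M Lo')) => t; exact: ker_le.
Qed.

Lemma superk_bound K M z : measurable_fun setT K -> (forall z, `|K z| <= M) ->
  `|Ks K z| <= I' * M.
Proof.
move=> mK KM; rewrite /superk /I' -RintZr//; apply: Rint_norm_le.
- exact: (L1_measurable (superk_int z mK KM)).
- exact: L1Zr.
- by move=> t; exact: ker_le.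
Qed.

(** On the support of the weight all dilations share the Lipschitz factor [c], so tameness survives
    the integration in time. *)
Lemma superk_tame K H M c : tame mu K H M -> 0 <= c ->
  (forall t, om t != 0 -> (r + t) `^ (- 2^-1) <= c) ->
  tame mu (Ks K) (fun z => (1 + c) * Ks H z) ((1 + c) * (I' * M)).
Proof.
move=> tK c0 hc; have H0 := tame_ge0 tK; have KM := tame_bound tK.
have [[mK mH] KH KL HM LH] := tK.
have HM' z : `|H z| <= M by rewrite ger0_norm.
have mKs (L : X -> R) : measurable_fun setT L -> measurable_fun setT (Ks L : X -> R).
  by move=> mL; exact: (measurable_sec1 r (f := fun (r : RR) (z : X) => superk lam om d r L z) (measurable_superk2 mL)).
have dH t z : 0 <= om t * dil d H (r + t) z by rewrite mulr_ge0 ?mulr_ge0 ?powR_ge0.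
have KsH z : 0 <= Ks H z by apply: Rintegral_ge0.
split.
- by split; [exact: mKs|apply: measurable_funM => //; exact: mKs].
- move=> z; apply: (@le_trans _ _ (Ks H z)); last by rewrite ler_peMl// lerDl.
  apply: Rint_norm_le; [exact: (L1_measurable (superk_int z mK KM))|exact: (superk_int z mH HM')|].
  by move=> t; rewrite normrM ger0_norm// ler_wpM2l// dil_norm ler_wpM2l ?powR_ge0.
- move=> x z; rewrite /superk -RintB; [|exact: superk_int mK KM|exact: superk_int mK KM].
  have m0 : 0 <= Num.min 1 (nrm z) by rewrite le_min ler01 nrm_ge0.
  rewrite -mulrDr mulrA -RintD; [|exact: superk_int mH HM'|exact: superk_int mH HM'].
  rewrite -RintZl; last by apply: L1D; exact: superk_int mH HM'.
  apply: Rint_norm_le.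
  + by apply: measurable_funB; [exact: (L1_measurable (superk_int (x + z) mK KM))|exact: (L1_measurable (superk_int x mK KM))].
  + by apply: L1Zl; apply: L1D; exact: superk_int mH HM'.
  + move=> t; have [z0|zN] := eqVneq (om t) 0; first by rewrite z0 !mul0r subrr normr0 addr0 mulr0.
    have t0 := omr zN; have [_ _ L _ _] := tame_dil Hmu d t0 tK.
    rewrite -mulrBr -mulrDr normrM (ger0_norm (om0 t)) mulrCA ler_wpM2l//.
    apply: (le_trans (L x z)); rewrite -mulrDr -!mulrA ler_wpM2l//.
    rewrite ler_wpM2r ?addr_ge0 ?mulr_ge0 ?powR_ge0// lerD2l.
    exact: hc.
- move=> z; rewrite ler_wpM2l ?addr_ge0//.
  by rewrite -[Ks H z]ger0_norm//; exact: superk_bound.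
- by apply: L1Zl; exact: (superk_L1 LH).1.
Qed.

Section pairing.
Variables (f F K : X -> R) (M : R).
Hypotheses (fF : sum_dom mu f F) (LK : L1 mu K) (KM : forall z, `|K z| <= M).
Let A (t : R) := om t * (r + t) `^ (- d) * \int[mu]_z `|K z| +
  om t * (r + t) `^ (- (d + n%:R / 2)) * M * \int[mu]_z `|F z|.
Let LA : L1 lam A.
Proof. by apply: L1D; apply: L1Zr => //; exact: L1Zr. Qed.

Let L2 x : L1 (lam \x mu)%E (fun u => f u.2 * (om u.1 * dil d K (r + u.1) (u.2 - x))).
Proof.
have [mf _ _] := fF.
apply: (L1_prod (f := fun (t : RR) (y : X) => f y * (om t * dil d K (r + t) (y - x))) (b := A)) => //.
- apply: measurable_funM; first exact: (measurableT_comp mf).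
  apply: (measurableT_comp (mker (L1_measurable LK)) (g := fun u : RR * X => (u.1, u.2 - x : X))).
  by apply: measurable_fun_pair => //; apply: measurable_subX.
- move=> t; have [L _] := corr_bound Hmu x fF (Lker t LK) (ker_le t ^~ KM); exact: L.
- move=> t; have Lt := Lker t LK.
  have [_ B] := sum_dom_mul fF (L1_sub Hmu x Lt) (fun y => ker_le t (y - x) KM).
  apply: (le_trans B); rewrite (Rint_sub Hmu x (k := fun z => `|om t * dil d K (r + t) z|)).
    by rewrite Iker.
  by apply: measurableT_comp => //; exact: L1_measurable Lt.
Qed.

Lemma corr_superk x : L1 lam (fun t => om t * corr (dil d K (r + t)) f x) /\
  corr (Ks K) f x = \int[lam]_t (om t * corr (dil d K (r + t)) f x).
Proof.
have E t : \int[mu]_y (f y * (om t * dil d K (r + t) (y - x))) = om t * corr (dil d K (r + t)) f x.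
  have [z0|zN] := eqVneq (om t) 0.
    by rewrite z0 mul0r (@eq_RintX _ _ mu _ (fun=> 0)) ?Rint0// => y; rewrite mul0r mulr0.
  have t0 := omr zN.
  rewrite /corr -RintZl; first by apply: eq_RintX => y; rewrite mulrCA.
  have KMt z : `|dil d K (r + t) z| <= (r + t) `^ (- (d + n%:R / 2)) * M.
    by rewrite normrM ger0_norm ?powR_ge0// ler_wpM2l ?powR_ge0.
  exact: (corr_bound Hmu x fF (dil_L1 Hmu d t0 LK) KMt).1.
split.
  apply: (eq_L1 _ (L1_Rint1 (f := fun (t : RR) (y : X) => f y * (om t * dil d K (r + t) (y - x))) (L2 x))).
  by move=> t; rewrite E.
rewrite -(@eq_Rint _ _ _ lam _ _ E).
rewrite (Rint_fubini (f := fun (t : RR) (y : X) => f y * (om t * dil d K (r + t) (y - x))) (L2 x)).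
apply: eq_RintX => y; rewrite /superk -RintZl//.
exact: superk_int (L1_measurable LK) KM.
Qed.

(** Two applications of Fubini bring the weight out of the kernel, then out of the pairing with
    [h]. *)
Lemma superk_pair h : L1 mu h ->
  L1 lam (fun t => om t * \int[mu]_x (corr (dil d K (r + t)) f x * h x)) /\
  \int[mu]_x (corr (Ks K) f x * h x) =
  \int[lam]_t (om t * \int[mu]_x (corr (dil d K (r + t)) f x * h x)).
Proof.
move=> Lh; have mh := L1_measurable Lh; have [mf _ _] := fF.
pose G (t : RR) (x : X) := om t * corr (dil d K (r + t)) f x * h x.
have Gb t x : `|om t * corr (dil d K (r + t)) f x| <= A t.
  have [z0|zN] := eqVneq (om t) 0; first by rewrite /A z0 !mul0r normr0 addr0.
  have t0 := omr zN.
  have KMt z : `|dil d K (r + t) z| <= (r + t) `^ (- (d + n%:R / 2)) * M.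
    by rewrite normrM ger0_norm ?powR_ge0// ler_wpM2l ?powR_ge0.
  have [_ B] := corr_bound Hmu x fF (dil_L1 Hmu d t0 LK) KMt.
  rewrite normrM ger0_norm// /A -!mulrA -mulrDr ler_wpM2l// (le_trans B)// -mulrA lerD2r.
  rewrite (eq_RintX mu (dil_norm d K (r + t))) dil_int//; exact: L1_norm.
have mG0 : measurable_fun setT (fun u : RR * X => om u.1 * corr (dil d K (r + u.1)) f u.2).
  apply: measurable_funM; first exact: (measurableT_comp mom).
  apply: (@measurable_kernel_corr (fun (t : RR) (z : X) => dil d K (r + t) z)) => //.
  apply: (measurableT_comp (measurable_dil d (L1_measurable LK)) (g := fun u : RR * X => (r + u.1 : RR, u.2))).
  by apply: measurable_fun_pair => //; exact: measurable_funD.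
have mG : measurable_fun setT (fun u => G u.1 u.2).
  by apply: measurable_funM => //; exact: (measurableT_comp mh).
have LGt t : L1 mu (G t).
  apply: (L1_dom (measurable_sec1 t (f := G) mG) (L1Zl (A t) (L1_norm Lh))) => x.
  by rewrite normrM ler_wpM2r.
have LG : L1 (lam \x mu)%E (fun u => G u.1 u.2).
  apply: (L1_prod (f := G) (b := fun t => A t * \int[mu]_x `|h x|)) => //.
    exact: L1Zr.
  move=> t; rewrite -RintZl; last exact: L1_norm.
  apply: (Rint_le (L1_norm (LGt t)) (L1Zl (A t) (L1_norm Lh))) => x.
  by rewrite normrM ler_wpM2r.
have E t : \int[mu]_x G t x = om t * \int[mu]_x (corr (dil d K (r + t)) f x * h x).
  have [z0|zN] := eqVneq (om t) 0.
    by rewrite z0 mul0r (@eq_RintX _ _ mu _ (fun=> 0)) ?Rint0// => x; rewrite /G z0 !mul0r.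
  rewrite -RintZl; first by apply: eq_RintX => x; rewrite mulrA.
  by apply: (eq_L1 _ (L1Zl (om t)^-1 (LGt t))) => x; rewrite /G -mulrA mulKf.
split; first by apply: (eq_L1 _ (L1_Rint1 (f := G) LG)) => t; rewrite E.
rewrite -(@eq_Rint _ _ _ lam _ _ E) (Rint_fubini (f := G) LG).
apply: eq_RintX => x; rewrite /G RintZr; first by rewrite (corr_superk x).2.
exact: (corr_superk x).1.
Qed.

End pairing.
End fixed_r.
End super_kernel.

(** * Superpositions of correlations with a dilated kernel *)

Section superposed_family.
Variables (R : realType) (n : nat).
Variable mu : {sigma_finite_measure set (Rn R n) -> \bar R}.
Hypothesis Hmu : is_lebesgue mu.
Local Notation X := (Rn R n).
Local Notation leb := (@lebesgue_measure R).
Local Notation RR := (measurableTypeR R).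
Local Notation corr := (corr mu).
Local Notation conv := (conv mu).
Variables (b : R) (lam : {sigma_finite_measure set RR -> \bar R}) (om : RR -> R).
Hypothesis Hw : is_weight b lam om.
Implicit Types (x y z w : 'rV[R]_n) (f h k F K H : X -> R).

Lemma om_pos r t : 0 < r -> om t != 0 -> r <= r + t.
Proof.
move=> r0 oN; rewrite lerDl leNgt; apply/negP => t0.
by move: oN; rewrite (om_lt0 Hw t0) eqxx.
Qed.

Lemma superk_est d K M : b < d -> L1 mu K -> (forall z, `|K z| <= M) ->
  exists C, 0 < C /\ forall r, 0 < r ->
  [/\ L1 mu (superk lam om d r K), \int[mu]_z `|superk lam om d r K z| <= C * r `^ (b - d) &
   forall z, `|superk lam om d r K z| <= C * r `^ (b - d - n%:R / 2)].
Proof.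
move=> bd LK KM; have n0 : 0 <= n%:R / 2 :> R by rewrite divr_ge0.
have M0 : 0 <= M by exact: le_trans (KM 0).
have [C1 [C10 H1]] := om_power Hw bd.
have bd' : b < d + n%:R / 2 by exact: ltr_wpDr.
have [C2 [C20 H2]] := om_power Hw bd'.
have I0 : 0 <= \int[mu]_z `|K z| by exact: Rintegral_ge0.
(* The 1 makes the constant strictly positive, as Young's inequality requires later. *)
exists (C1 * \int[mu]_z `|K z| + C2 * M + 1); split.
  by rewrite ltr_wpDl// addr_ge0// mulr_ge0.
move=> r r0; have [Lo B1] := H1 r r0; have [Lo' B2] := H2 r r0.
have omr t : om t != 0 -> 0 < r + t by move=> oN; exact: lt_le_trans (om_pos r0 oN).
have [L B] := superk_L1 Hmu (om_measurable Hw) (om_ge0 Hw) omr Lo LK.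
split => //.
  apply: (le_trans B); apply: (@le_trans _ _ (C1 * r `^ (b - d) * \int[mu]_z `|K z|)).
    by rewrite ler_wpM2r.
  by rewrite mulrAC ler_wpM2r ?powR_ge0// -addrA lerDl addr_ge0 ?ler01// mulr_ge0.
move=> z; apply: (le_trans (superk_bound (om_measurable Hw) (om_ge0 Hw) Lo' z (L1_measurable LK) KM)).
apply: (@le_trans _ _ (C2 * r `^ (b - (d + n%:R / 2)) * M)); first by rewrite ler_wpM2r.
rewrite mulrAC (_ : b - (d + n%:R / 2) = b - d - n%:R / 2); last by ring.
by rewrite ler_wpM2r ?powR_ge0// -addrA [C2 * M + 1]addrC addrA lerDr addr_ge0 ?ler01// mulr_ge0.
Qed.

Lemma superk_is_tame d K H M r : b < d -> 0 < r -> tame mu K H M ->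
  exists H' M', tame mu (superk lam om d r K) H' M'.
Proof.
move=> bd r0 tK; have n0 : 0 <= n%:R / 2 :> R by rewrite divr_ge0.
have [C1 [C10 H1]] := om_power Hw bd.
have bd' : b < d + n%:R / 2 by exact: ltr_wpDr.
have [C2 [C20 H2]] := om_power Hw bd'.
have [Lo _] := H1 r r0; have [Lo' _] := H2 r r0.
have omr t : om t != 0 -> 0 < r + t by move=> oN; exact: lt_le_trans (om_pos r0 oN).
eexists; eexists.
apply: (superk_tame Hmu (om_measurable Hw) (om_ge0 Hw) omr Lo Lo' tK (c := r `^ (- 2^-1))).
  exact: powR_ge0.
by move=> t oN; apply: powR_leN => //; exact: om_pos.
Qed.

(** The contribution of a single time. Integrated against a power of t, it represents the weak
    fractional gradient for [gker] and [f] itself for [lker]. *)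
Definition psi d K f h (t : R) : R := \int[mu]_x (corr (dil d K t) f x * h x).

Lemma measurable_psi d K f h : measurable_fun setT K -> measurable_fun setT f ->
  measurable_fun setT h -> measurable_fun setT (psi d K f h : RR -> R).
Proof.
move=> mK mf mh.
apply: (measurable_Rint2 mu (f := fun (t : RR) (x : X) => corr (dil d K t) f x * h x)).
apply: measurable_funM; last exact: (measurableT_comp mh).
by apply: (@measurable_kernel_corr _ _ mu (fun (t : RR) (z : X) => dil d K t z)) => //; exact: measurable_dil.
Qed.

Lemma dil_bound d K M t z : (forall z, `|K z| <= M) ->
  `|dil d K t z| <= t `^ (- (d + n%:R / 2)) * M.
Proof. by move=> KM; rewrite normrM ger0_norm ?powR_ge0// ler_wpM2l ?powR_ge0. Qed.

Lemma dil_int_norm d K t : 0 < t -> L1 mu K ->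
  \int[mu]_z `|dil d K t z| = t `^ (- d) * \int[mu]_z `|K z|.
Proof.
by move=> t0 LK; rewrite (eq_RintX mu (dil_norm d K t)) dil_int//; exact: L1_norm.
Qed.

(* Cancellation of the kernel against a tame function gains t^(1/2). *)
Lemma conv_dil_small d K H M h Hh Mh : tame mu K H M -> L1 mu (fun z => nrm z * H z) ->
  \int[mu]_z K z = 0 -> tame mu h Hh Mh -> exists C, 0 <= C /\ forall t, 0 < t ->
  (forall y, `|conv (dil d K t) h y| <= C * t `^ (2^-1 - d)) /\
  \int[mu]_y `|conv (dil d K t) h y| <= C * t `^ (2^-1 - d).
Proof.
move=> tK LnH K0 th; have LK := tame_L1 tK; have KM := tame_bound tK.
have LnK : L1 mu (fun z => nrm z * K z).
  apply: (L1_dom _ LnH); first by apply: measurable_funM; [exact: measurable_nrm|exact: L1_measurable LK].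
  move=> z; rewrite normrM (ger0_norm (nrm_ge0 z)) ler_wpM2l ?nrm_ge0//.
  by have [_ KH _ _ _] := tK.
have Mh0 : 0 <= Mh by exact: le_trans (normr_ge0 _) (tame_bound th 0).
have Hh0 := tame_ge0 th.
have IH0 : 0 <= \int[mu]_y Hh y by exact: Rintegral_ge0.
pose J := \int[mu]_z (nrm z * `|K z|).
have J0 : 0 <= J by apply: Rintegral_ge0 => z _; rewrite mulr_ge0 ?nrm_ge0.
exists (2 * (Mh + \int[mu]_y Hh y) * J); split; first by rewrite !mulr_ge0 ?addr_ge0.
move=> t t0; have E z : nrm z * dil d K t z = dil (d - 2^-1) (fun z => nrm z * K z) t z by exact: dil_nrm.
have L1' : L1 mu (fun z => nrm z * dil d K t z).
  by apply: (eq_L1 _ (dil_L1 Hmu (d - 2^-1) t0 LnK)) => z; rewrite E.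
have D0 : \int[mu]_z dil d K t z = 0 by rewrite dil_int// K0 mulr0.
have JE : \int[mu]_z (nrm z * `|dil d K t z|) = t `^ (2^-1 - d) * J.
  have -> : 2^-1 - d = - (d - 2^-1) by ring.
  have En z : nrm z * `|dil d K t z| = `|dil (d - 2^-1) (fun z => nrm z * K z) t z|.
    by rewrite -E [in RHS]normrM (ger0_norm (nrm_ge0 z)).
  rewrite (eq_RintX mu En) dil_int_norm//; congr (_ * _).
  by apply: eq_RintX => z; rewrite normrM (ger0_norm (nrm_ge0 z)).
have Eb : exists M, forall x, `|dil d K t x| <= M.
  by exists (t `^ (- (d + n%:R / 2)) * M) => x; exact: dil_bound.
have [B1 B2] := conv_cancel Hmu (dil_L1 Hmu d t0 LK) Eb L1' D0 th.
have e0 : 0 <= t `^ (2^-1 - d) * J by rewrite mulr_ge0 ?powR_ge0.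
split=> [y|]; [apply: (le_trans (B1 y))|apply: (le_trans B2)]; rewrite JE -[leRHS]mulrA [J * _]mulrC.
  by rewrite ler_wpM2r//; lra.
by rewrite ler_wpM2r//; lra.
Qed.

(** Without cancellation: the sup bound uses the mass of the kernel and the bound of [h], the L^1
    bound the two masses. *)
Lemma conv_dil_large d K H M h Hh Mh : tame mu K H M -> tame mu h Hh Mh ->
  exists C, 0 <= C /\ forall t, 0 < t ->
  (forall y, `|conv (dil d K t) h y| <= C * t `^ (- d)) /\
  \int[mu]_y `|conv (dil d K t) h y| <= C * t `^ (- d).
Proof.
move=> tK th; have LK := tame_L1 tK; have KM := tame_bound tK.
have Lh := tame_L1 th; have hM := tame_bound th.
have Mh0 : 0 <= Mh by exact: le_trans (normr_ge0 _) (hM 0).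
have I0 : 0 <= \int[mu]_z `|K z| by exact: Rintegral_ge0.
have Ih0 : 0 <= \int[mu]_z `|h z| by exact: Rintegral_ge0.
exists ((Mh + \int[mu]_z `|h z|) * \int[mu]_z `|K z|); split; first by rewrite mulr_ge0 ?addr_ge0.
move=> t t0; have Ld := dil_L1 Hmu d t0 LK; have dM z := dil_bound d t z KM.
have md := L1_measurable Ld; have mh := L1_measurable Lh.
have e0 : 0 <= \int[mu]_z `|K z| * t `^ (- d) by rewrite mulr_ge0 ?powR_ge0.
split=> [y|].
  rewrite convC//; apply: (le_trans (conv_bound Hmu y Lh hM Ld)).
  by rewrite dil_int_norm// -[leRHS]mulrA [t `^ _ * _]mulrC ler_wpM2r//; lra.
have E y : conv (dil d K t) h y = corr (fun z => dil d K t (- z)) h y.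
  by apply: eq_RintX => x; rewrite opprB mulrC.
have Ldn : L1 mu (fun z => dil d K t (- z)).
  by apply: (eq_L1 _ (L1_refl Hmu 0 Ld)) => z; rewrite add0r.
have [_ B] := corr_L1 Hmu Lh Ldn.
rewrite (@eq_RintX _ _ mu _ (fun y => `|corr (fun z => dil d K t (- z)) h y|)); last by move=> y; rewrite E.
apply: (le_trans B).
have En z : `|dil d K t (- z)| = (fun z : X => `|dil d K t z|) (0 - z) by rewrite add0r.
rewrite (eq_RintX mu En) (Rint_refl Hmu 0 (f := fun z => `|dil d K t z|)); last exact: measurableT_comp.
rewrite dil_int_norm// -[leRHS]mulrA mulrC [t `^ _ * _]mulrC ler_wpM2r//; lra.
Qed.

Section family.
Variables (d a p q e1 e2 C1 : R) (K H : X -> R) (M : R).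
Hypotheses (bd : b < d) (a0 : 0 < a) (p1 : 1 <= p) (pq : p <= q) (C10 : 0 <= C1).
Hypotheses (tK : tame mu K H M) (LnH : L1 mu (fun z => nrm z * H z)) (K0 : \int[mu]_z K z = 0).
(** [c1] and [c2] make r^(a-1) integrable against the L^q norms of the pieces, at 0 and at infinity;
    [c3] and [c4] do the same for v^(a+b-1) against [psi]. *)
Hypothesis c1 : 0 < a * q + (e2 * (q - 1) + e1).
Hypothesis c2 : a * q + ((b - d) * q - n%:R / (2 * p) * (q - p)) < 0.
Hypothesis c3 : 0 < a + b + (2^-1 - d).
Hypothesis c4 : a + b + (- d - n%:R / (2 * p)) < 0.

Let LK := tame_L1 tK.
Let KM := tame_bound tK.

Definition fam f (r : RR) (x : X) : R := corr (superk lam om d r K) f x.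

(** Small times rely on the mean-zero kernel against the tame [h], large times on the L^p bound of
    [f]. *)
Lemma psi_L1 f h Hh Mh : measurable_fun setT f -> L1 mu (fun x => `|f x| `^ p) ->
  \int[mu]_x `|f x| `^ p <= 1 -> tame mu h Hh Mh ->
  L1 leb (fun v => pw (a + b) v * psi d K f h v).
Proof.
move=> mf Lf f1 th; have sd := Lp_sum_dom p1 mf Lf.
have Lh := tame_L1 th.
have [C [C0 HC]] := conv_dil_small d tK LnH K0 th.
have mps := measurable_psi d (L1_measurable LK) mf (L1_measurable Lh).
have IK0 : 0 <= \int[mu]_z `|K z| by exact: Rintegral_ge0.
have Ih0 : 0 <= \int[mu]_z `|h z| by exact: Rintegral_ge0.
have M0 : 0 <= M by exact: le_trans (normr_ge0 _) (KM 0).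
have IF : \int[mu]_y `| `|f y| `^ p| <= 1.
  by rewrite (@eq_RintX _ _ mu _ (fun y => `|f y| `^ p))// => y; rewrite ger0_norm ?powR_ge0.
pose A := \int[mu]_z `|K z| + M.
apply: (@L1_pw_dom R (a + b + (2^-1 - d)) (a + b + (- d - n%:R / (2 * p))) (2 * C) (2 * A * \int[mu]_x `|h x|)) => //.
- by apply: measurable_funM => //; exact: measurable_pw.
- by move=> t t0; rewrite pw_le0// mul0r.
- move=> t t0 _; rewrite normrM (ger0_norm (pw_ge0 _ _)) -(pwMpowR (a + b) (2^-1 - d)) mulrCA ler_wpM2l ?pw_ge0//.
  have [B1 B2] := HC t t0; have dM z := dil_bound d t z KM; have Ld := dil_L1 Hmu d t0 LK.
  rewrite /psi; have [_ _ ->] := corr_adjoint Hmu sd Ld dM Lh.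
  have Lc := L1_convol Hmu Ld dM Lh.
  have [Lfc B] := sum_dom_mul sd Lc B1.
  apply: (le_trans (Rint_norm Lfc)); apply: (le_trans B).
  have : C * t `^ (2^-1 - d) * \int[mu]_y `| `|f y| `^ p| <= C * t `^ (2^-1 - d) * 1.
    by rewrite ler_wpM2l// mulr_ge0 ?powR_ge0.
  lra.
- move=> t t1; have t0 : 0 < t by lra.
  rewrite normrM (ger0_norm (pw_ge0 _ _)) -(pwMpowR (a + b) (- d - n%:R / (2 * p))) mulrCA ler_wpM2l ?pw_ge0//.
  have dM z := dil_bound d t z KM; have Ld := dil_L1 Hmu d t0 LK.
  have [Lc _ _] := corr_adjoint Hmu sd Ld dM Lh.
  rewrite mulrAC -RintZl; last exact: L1_norm.
  apply: Rint_norm_le; [exact: L1_measurable Lc|exact/L1Zl/L1_norm|].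
  move=> x; rewrite normrM ler_wpM2r//.
  apply: (corr_decay Hmu x p1 mf Lf f1 _ t0 Ld).
  + by rewrite addr_ge0.
  + by rewrite dil_int_norm// mulrC ler_wpM2r ?powR_ge0// lerDl.
  + move=> y; rewrite (le_trans (dM y))// mulrC (_ : - (d + n%:R / 2) = - d - n%:R / 2); last by ring.
    by rewrite ler_wpM2r ?powR_ge0// lerDr.
Qed.

Lemma fam_pair f h r : measurable_fun setT f -> L1 mu (fun x => `|f x| `^ p) -> L1 mu h ->
  pw a r * \int[mu]_x (fam f r x * h x) =
  \int[lam]_t (pw a r * om t * psi d K f h (r + t)).
Proof.
move=> mf Lf Lh; have [rn|r0] := leP r 0.
  transitivity (\int[lam]_t (0 : R)); first by rewrite Rint0 pw_le0// mul0r.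
  by apply: eq_Rint => t; rewrite pw_le0// !mul0r.
have n0 : 0 <= n%:R / 2 :> R by rewrite divr_ge0.
have [A1 [_ H1]] := om_power Hw bd.
have bd' : b < d + n%:R / 2 by exact: ltr_wpDr.
have [A2 [_ H2]] := om_power Hw bd'.
have omr t : om t != 0 -> 0 < r + t by move=> oN; exact: lt_le_trans (om_pos r0 oN).
have [Lt Et] := superk_pair Hmu (om_measurable Hw) (om_ge0 Hw) omr (H1 r r0).1 (H2 r r0).1
  (Lp_sum_dom p1 mf Lf) LK KM Lh.
rewrite [X in _ * X]Et -RintZl//; apply: eq_Rint => t; by rewrite mulrA.
Qed.

(* Interpolation of the L^1, L^oo and L^p bounds on the pieces of the superposition. *)
Lemma superposed_family : exists C B, [/\ 0 <= C, 0 < B & forall f,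
  measurable_fun setT f -> L1 mu (fun x => `|f x| `^ p) -> \int[mu]_x `|f x| `^ p <= 1 ->
  (forall r, 0 < r -> [/\ L1 mu (fam f r), \int[mu]_x `|fam f r x| <= C1 * r `^ e1 &
     forall x, `|fam f r x| <= C1 * r `^ e2]) ->
  let Fa := superpose a (fam f) in
  [/\ measurable_fun setT (Fa : X -> R), L1 mu (fun x => `|Fa x| `^ q),
   \int[mu]_x `|Fa x| `^ q <= C & forall h Hh Mh, tame mu h Hh Mh ->
   [/\ L1 mu (fun x => Fa x * h x), L1 leb (fun v => pw (a + b) v * psi d K f h v) &
    \int[mu]_x (Fa x * h x) = B * \int[leb]_v (pw (a + b) v * psi d K f h v)]]].
Proof.
have q1 : 1 <= q by exact: le_trans pq.
have p0 : 0 < p by have := p1; lra.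
have [A [A0 HA]] := superk_est bd LK KM.
have [B [B0 HB]] := om_beta Hw a0.
(* Exponents for the q-th power of the L^q norm: [s0] interpolates between L^1 and L^oo, [s1]
   between L^p and L^oo. *)
pose s0 := e2 * (q - 1) + e1; pose s1 := (b - d) * q - n%:R / (2 * p) * (q - p).
pose CC := C1 `^ (q - 1) * C1 + (2 * A) `^ (q - p) * A `^ p.
have CC1 : C1 `^ (q - 1) * C1 <= CC by rewrite lerDl mulr_ge0 ?powR_ge0.
have CC2 : (2 * A) `^ (q - p) * A `^ p <= CC by rewrite lerDr mulr_ge0 ?powR_ge0.
have CC0 : 0 <= CC by rewrite addr_ge0 ?mulr_ge0 ?powR_ge0.
exists (superpose_cst a q s0 s1 CC), B; split => //; first exact: superpose_cst_ge0.
move=> f mf Lf f1 Hf Fa.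
have mK := L1_measurable LK.
have mg : measurable_fun setT (fun u => fam f u.1 u.2).
  apply: (@measurable_kernel_corr _ _ mu (fun (r : RR) (z : X) => superk lam om d r K z)) => //.
  by apply: measurable_superk2 => //; exact: om_measurable Hw.
have gm r : measurable_fun setT (fam f r) by exact: (measurable_sec1 r (f := fam f)).
have gn r : measurable_fun setT (fun x : X => `|fam f r x|).
  by move: (fam f r) (gm r) => g mgr; exact: measurableT_comp.
(* Writing |g|^q = |g|^(q-P) |g|^P; used with P = 1 at small times and P = p at large times. *)
have split_pow (P : R) r S : 0 < P -> P <= q -> (forall x, `|fam f r x| <= S) ->
    L1 mu (fun x => `|fam f r x| `^ P) ->
    L1 mu (fun x => `|fam f r x| `^ q) /\
    \int[mu]_x `|fam f r x| `^ q <= S `^ (q - P) * \int[mu]_x `|fam f r x| `^ P.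
  move=> P0 Pq gS LP.
  have D x : `|fam f r x| `^ q <= S `^ (q - P) * `|fam f r x| `^ P.
    have -> : `|fam f r x| `^ q = `|fam f r x| `^ (q - P) * `|fam f r x| `^ P.
      rewrite -powRD ?subrK// gt_eqF//=; exact: lt_le_trans Pq.
    by rewrite ler_wpM2r ?powR_ge0// powR_le// subr_ge0.
  have L : L1 mu (fun x => `|fam f r x| `^ q).
    apply: (L1_dom _ (L1Zl (S `^ (q - P)) LP)) => [|x]; last by rewrite ger0_norm ?powR_ge0.
    exact: (measurableT_comp (@measurable_powR R q) (gn r)).
  by split => //; rewrite -RintZl//; exact: (Rint_le L (L1Zl _ LP)).
have small r : 0 < r -> r <= 1 -> L1 mu (fun x => `|fam f r x| `^ q) /\
    \int[mu]_x `|fam f r x| `^ q <= CC * r `^ s0.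
  move=> r0 _; have [Lg g1 gs] := Hf r r0.
  have L1' : L1 mu (fun x => `|fam f r x| `^ 1) by apply: (eq_L1 _ (L1_norm Lg)) => x; rewrite powRr1.
  have [L Bd] := split_pow 1 r _ ltr01 q1 gs L1'; split => //; apply: (le_trans Bd).
  rewrite (@eq_RintX _ _ mu _ (fun x => `|fam f r x|)); last by move=> x; rewrite powRr1.
  rewrite powRM ?powR_ge0// -powRrM.
  apply: (@le_trans _ _ (C1 `^ (q - 1) * r `^ (e2 * (q - 1)) * (C1 * r `^ e1))).
    by rewrite ler_wpM2l// mulr_ge0 ?powR_ge0.
  rewrite (_ : _ * (C1 * _) = C1 `^ (q - 1) * C1 * (r `^ (e2 * (q - 1)) * r `^ e1)); last by ring.
  by rewrite -powRD_gt0// ler_wpM2r ?powR_ge0.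
have large r : 1 < r -> L1 mu (fun x => `|fam f r x| `^ q) /\
    \int[mu]_x `|fam f r x| `^ q <= CC * r `^ s1.
  move=> r1; have r0 : 0 < r by lra.
  have [LKs K1 K2] := HA r r0.
  have rp0 : 0 < A * r `^ (b - d) by rewrite mulr_gt0 ?powR_gt0.
  have [Lp Bp] := young Hmu p1 rp0 mf Lf LKs K2 K1.
  have gs x : `|fam f r x| <= 2 * A * r `^ (b - d - n%:R / (2 * p)).
    exact: (corr_decay Hmu x p1 mf Lf f1 (ltW A0) r0 LKs K1 K2).
  have [L Bd] := split_pow p r _ p0 pq gs Lp; split => //; apply: (le_trans Bd).
  rewrite powRM ?powR_ge0 ?mulr_ge0 ?(ltW A0)// -powRrM.
  apply: (@le_trans _ _ ((2 * A) `^ (q - p) * r `^ ((b - d - n%:R / (2 * p)) * (q - p)) * (A `^ p * r `^ ((b - d) * p)))).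
    rewrite ler_wpM2l ?mulr_ge0 ?powR_ge0//; apply: (le_trans Bp).
    rewrite powRM ?powR_ge0 ?(ltW A0)// -powRrM ler_piMr ?mulr_ge0 ?powR_ge0//.
  rewrite (_ : _ * (A `^ p * _) = (2 * A) `^ (q - p) * A `^ p *
    (r `^ ((b - d - n%:R / (2 * p)) * (q - p)) * r `^ ((b - d) * p))); last by ring.
  rewrite -powRD_gt0// (_ : (b - d - n%:R / (2 * p)) * (q - p) + (b - d) * p = s1); last by rewrite /s1; ring.
  by rewrite ler_wpM2r ?powR_ge0.
have [LF BF] := superpose_Lq q1 CC0 c1 c2 mg small large.
split => //; first exact: measurable_superpose.
move=> h Hh Mh th; have Lh := tame_L1 th; have hM := tame_bound th.
have [LFh EFh] := superpose_pair q1 CC0 c1 c2 mg small large Lh hM.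
have LP := psi_L1 mf Lf f1 th.
have mps := measurable_psi d mK mf (L1_measurable Lh).
(* The composition law merges the outer power r^(a-1) and the inner weight into v^(a+b-1). *)
have [_ EB] := HB _ LP mps.
split => //; rewrite EFh -EB; apply: eq_Rint => r; exact: fam_pair mf Lf Lh.
Qed.

End family.
End superposed_family.

(** * Directional derivatives and smooth functions *)

Section directional_derivatives.
Variables (R : realType) (V : normedModType R).
Implicit Types (x v : V) (f g : V -> R).

(** Quadratic remainders are what the flat function at 0 and convolutions provide, and they
    determine the derivative without any further limit. *)
Lemma is_derive_bound f x v df C :
  (forall t, `|f (t *: v + x) - f x - t * df| <= C * t ^+ 2) -> is_derive x v f df.
Proof.
move=> B; have C0 : 0 <= C by have := B 1; rewrite expr1n mulr1; exact: le_trans.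
have H : (fun h => h^-1 *: (f (h *: v + x) - f x)) @ (0 : R)^' --> df.
  apply/cvgrPdist_le => e e0; near=> h.
  have hn : h != 0 by near: h; exact: nbhs_dnbhs_neq.
  have he : `|h| <= e / (C + 1) by near: h; apply: dnbhs0_le; rewrite divr_gt0// ltr_wpDl.
  have -> : df - h^-1 *: (f (h *: v + x) - f x) = - (h^-1 * (f (h *: v + x) - f x - h * df)).
    rewrite /GRing.scale /=; by field.
  rewrite normrN normrM normfV ler_pdivrMl ?normr_gt0//; apply: (le_trans (B h)).
  rewrite -real_normK ?num_real// expr2 [`|h| * _ in leRHS]mulrC mulrA ler_wpM2r//.
  apply: (@le_trans _ _ (C * (e / (C + 1)))); first by rewrite ler_wpM2l.
  rewrite mulrCA ler_piMr ?(ltW e0)// ler_pdivrMr ?mul1r ?lerDl// ltr_wpDl//.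
by apply: DeriveDef; [exact: cvgP H|exact: cvg_lim H].
Unshelve. all: by end_near. Qed.

(** Reduces directional derivatives to one variable, where the chain rule and the mean value theorem
    live. *)
Lemma is_derive_line f x v t df :
  is_derive (t *: v + x) v f df <-> is_derive t 1 (fun s : R => f (s *: v + x)) df.
Proof.
have E : (fun h => h^-1 *: (f (h *: v + (t *: v + x)) - f (t *: v + x))) =
    (fun h => h^-1 *: ((fun s : R => f (s *: v + x)) (h *: (1 : R) + t) - f (t *: v + x))).
  by apply/funext => h; rewrite /= addrA -scalerDl; congr (_ *: (f (_ *: _ + _) - _)); rewrite /GRing.scale/= mulr1.
by split; case; rewrite /derivable /derive ?E => d1 d2; apply: DeriveDef; rewrite /derivable /derive ?E.
Qed.

Lemma is_derive_line0 f x v df :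
  is_derive (0 : R) 1 (fun s : R => f (s *: v + x)) df -> is_derive x v f df.
Proof. by move/is_derive_line; rewrite scale0r add0r. Qed.

Lemma mvt_line f df x v t : (forall x, is_derive x v f (df x)) ->
  exists c, `|c| <= `|t| /\ f (t *: v + x) - f x = t * df (c *: v + x).
Proof.
move=> D; pose g (s : R) := f (s *: v + x).
have Dg (s : R) : is_derive s 1 g (df (s *: v + x)) by exact/is_derive_line.
have cg : continuous g.
  by move=> s; apply: differentiable_continuous; apply/derivable1_diffP; case: (Dg s).
have [t0|t0] := leP 0 t.
  have [c] := MVT_segment t0 (fun s _ => Dg s) (continuous_subspaceT cg).
  rewrite in_itv/= /g scale0r add0r subr0 => /andP[c0 ct] ->.
  by exists c; rewrite mulrC !ger0_norm.
have [c] := MVT_segment (ltW t0) (fun s _ => Dg s) (continuous_subspaceT cg).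
rewrite in_itv/= /g scale0r add0r sub0r => /andP[c0 ct] E.
exists c; split; first by rewrite !ler0_norm ?(ltW t0)// lerN2.
by rewrite -opprB E mulrN opprK mulrC.
Qed.

Lemma is_derive_derivable f x v : derivable f x v -> is_derive x v f ('D_v f x).
Proof. by move=> d; exact: DeriveDef. Qed.

Lemma CkD k f g : Ck k f -> Ck k g -> Ck k (fun x => f x + g x).
Proof.
elim: k f g => [|k IH] f g /=; first by move=> cf cg x; exact: (cvgD (cf x) (cg x)).
move=> [df kf] [dg kg]; split=> [x v|v]; first exact: derivableD.
rewrite (_ : 'D_v _ = fun x => 'D_v f x + 'D_v g x); first exact: IH.
by apply/funext => x; exact: deriveD.
Qed.

Lemma smoothD f g : smooth f -> smooth g -> smooth (fun x => f x + g x).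
Proof. by move=> sf sg k; exact: CkD. Qed.

Lemma smooth_deriv f v : smooth f -> smooth ('D_v f).
Proof. by move=> sf k; case: (sf k.+1) => _; exact. Qed.

Lemma smooth_derivable f x v : smooth f -> derivable f x v.
Proof. by move=> sf; case: (sf 1). Qed.

Lemma smooth_continuous f : smooth f -> continuous f.
Proof. by move=> sf; exact: (sf 0). Qed.

Lemma smooth_cst (c : R) : smooth (fun _ : V => c).
Proof.
move=> k; elim: k c => [|k IH] c /=; first by move=> x; exact: cvg_cst.
split=> [x v|v]; first exact: derivable_cst.
rewrite (_ : 'D_v _ = fun=> 0); first exact: IH.
by apply/funext => x; exact: derive_cst.
Qed.

Lemma smoothM f g : smooth f -> smooth g -> smooth (fun x => f x * g x).
Proof.
move=> sf sg k; elim: k f g sf sg => [|k IH] f g sf sg /=.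
  by move=> x; refine (@cvgM _ _ _ _ f g (f x) (g x) _ _); exact: smooth_continuous.
split=> [x v|v]; first by apply: derivableM; exact: smooth_derivable.
rewrite (_ : 'D_v _ = fun x => f x * 'D_v g x + g x * 'D_v f x).
  by apply: CkD; apply: IH => //; exact: smooth_deriv.
by apply/funext => x; rewrite deriveM//; exact: smooth_derivable.
Qed.

Lemma smooth_sum (I : Type) (s : seq I) (F : I -> V -> R) : (forall i, smooth (F i)) ->
  smooth (fun x => \sum_(i <- s) F i x).
Proof.
move=> sF; elim: s => [|i s IH].
  rewrite (_ : (fun _ => _) = fun=> 0); first exact: smooth_cst.
  by apply/funext => x; rewrite big_nil.
rewrite (_ : (fun _ => _) = fun x => F i x + \sum_(i <- s) F i x); first exact: smoothD.
by apply/funext => x; rewrite big_cons.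
Qed.

End directional_derivatives.

(** * A flat function and its derivatives *)

Section flat_function.
Variable R : realType.

(** The factor t^(-k) is included because the derivatives of exp(-1/t) are combinations of exactly
    these functions. *)
Definition eta (k : nat) (t : R) : R := if 0 < t then t ^- k * expR (- t^-1) else 0.

Lemma eta_ge0 k t : 0 <= eta k t.
Proof.
by rewrite /eta; case: ifP => // t0; rewrite mulr_ge0 ?expR_ge0// invr_ge0 exprn_ge0// ltW.
Qed.

(** The term of order k+2 of the exponential series at 1/t beats t^(-k) with two powers of t to
    spare. *)
Lemma eta_flat k : exists C, forall t, `|eta k t| <= C * t ^+ 2.
Proof.
exists (k.+2`!%:R) => t; rewrite ger0_norm ?eta_ge0// /eta; case: ifP => t0; last first.
  by rewrite mulr_ge0// sqr_ge0.
have y0 : 0 <= t^-1 by rewrite invr_ge0 ltW.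
have := @expR_ge1Dxn _ t^-1 k.+1 y0 => h.
have kf : (0 : R) < k.+2`!%:R by rewrite ltr0n fact_gt0.
have h2 : t^-1 ^+ k.+2 <= k.+2`!%:R * expR t^-1.
  by rewrite mulrC -ler_pdivrMr//; apply: le_trans h; rewrite lerDr.
rewrite expRN ler_pdivrMr ?expR_gt0//.
have -> : t ^- k = t^-1 ^+ k.+2 * t ^+ 2.
  by rewrite -addn2 exprD -mulrA -exprMn mulVf ?expr1n ?mulr1 ?exprVn// gt_eqF.
by rewrite [leRHS]mulrAC ler_wpM2r// sqr_ge0.
Qed.

Lemma is_derive_eta k (t : R) : is_derive t 1 (eta k) (- k%:R * eta k.+1 t + eta k.+2 t).
Proof.
have [t0|t0|t0] := ltgtP 0 t.
- apply: (@near_eq_is_derive _ _ _ (fun s : R => s ^- k * expR (- s^-1))).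
    near=> s; have s0 : 0 < s by near: s; exact: lt_nbhsr.
    by rewrite /eta s0.
  have tn : t != 0 by rewrite gt_eqF.
  have DV : is_derive t 1 (fun s : R => s^-1) (- t ^- 2 *: 1) by apply: is_deriveV.
  have DX : is_derive t 1 (fun s : R => s^-1 ^+ k) (k%:R * t^-1 ^+ k.-1 * (- t ^- 2)).
    rewrite (_ : (fun s : R => s^-1 ^+ k) = (fun s : R => s^-1) ^+ k); last first.
      by apply/funext => s; rewrite exprfctE.
    by apply: (is_derive_eq (is_deriveX k DV)); rewrite /GRing.scale/= mulr1.
  have DE : is_derive t 1 (fun s : R => expR (- s^-1)) (expR (- t^-1) * (t ^- 2)).
    have DN : is_derive t 1 (fun s : R => - s^-1) (t ^- 2).
      by apply: (is_derive_eq (is_deriveN DV)); rewrite /GRing.scale/= mulr1 opprK.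
    exact: (@is_derive1_comp _ expR (fun s : R => - s^-1) t _ _ (is_derive_expR _) DN).
  have := is_deriveM DX DE; rewrite (_ : (fun s => s^-1 ^+ k) * _ = fun s : R => s ^- k * expR (- s^-1)); last first.
    by apply/funext => s; rewrite /GRing.mul/= exprVn.
  move=> D; apply: (is_derive_eq D); rewrite /eta t0 /GRing.scale/= -!exprVn.
  move: (expR _) => e; case: (k) => [|j] /=; first by rewrite mulr0n expr0; ring.
  rewrite !exprS; ring.
- apply: (@near_eq_is_derive _ _ _ (fun s : R => 0)).
    near=> s; have s0 : s < 0 by near: s; exact: lt_nbhsl.
    by rewrite /eta ltNge (ltW s0).
  by apply: (is_derive_eq (is_derive_cst (0 : R) t 1)); rewrite /eta ltNge (ltW t0)/= mulr0 addr0.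
- rewrite -t0; have [C HC] := eta_flat k; apply: (@is_derive_bound _ _ _ _ _ _ C) => s.
  have z j : eta j 0 = 0 by rewrite /eta ltxx.
  have E : eta k (s *: (1 : R) + 0) - eta k 0 - s * (- k%:R * eta k.+1 0 + eta k.+2 0) = eta k s.
    by rewrite !z mulr0 !addr0 mulr0 !subr0 /GRing.scale/= mulr1.
  by have := HC s; rewrite -E.
Unshelve. all: by end_near. Qed.

(** One differentiation gives three terms of the same shape with new prefactors and indices, so [p]
    and [k] vary along the induction. *)
Lemma smooth_eta (V : normedModType R) k (p s : V -> R) : smooth p -> smooth s ->
  smooth (fun x => p x * eta k (s x)).
Proof.
move=> sp ss j; elim: j k p sp => [|j IH] k p sp /=.
  move=> x; refine (@cvgM _ _ _ _ p (fun x => eta k (s x)) (p x) _ _ _); first exact: smooth_continuous.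
  apply: (@continuous_comp _ _ _ s (eta k) x); first exact: smooth_continuous.
  by apply: differentiable_continuous; apply/derivable1_diffP; case: (is_derive_eta k (s x)).
have De x v : is_derive x v (fun x => eta k (s x))
    ((- k%:R * eta k.+1 (s x) + eta k.+2 (s x)) * 'D_v s x).
  apply: is_derive_line0.
  apply: (@is_derive1_comp _ (eta k) (fun t : R => s (t *: v + x)) 0).
    by rewrite scale0r add0r; exact: is_derive_eta.
  have Ds : is_derive (0 *: v + x) v s ('D_v s x).
    by rewrite scale0r add0r; apply: is_derive_derivable; exact: smooth_derivable.
  exact: (proj1 (is_derive_line s x v 0 ('D_v s x)) Ds).
split=> [x v|v].
  by apply: derivableM; [exact: smooth_derivable|case: (De x v)].
rewrite (_ : 'D_v _ = fun x => 'D_v p x * eta k (s x) +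
    ((- k%:R * p x * 'D_v s x) * eta k.+1 (s x) + (p x * 'D_v s x) * eta k.+2 (s x))); last first.
  apply/funext => x; rewrite deriveM; [|exact: smooth_derivable|by case: (De x v)].
  rewrite (@derive_val _ _ _ _ _ _ _ (De x v)) /GRing.scale/=; ring.
apply: CkD; first by apply: IH; exact: smooth_deriv.
apply: CkD; apply: IH; apply: smoothM => //; last exact: smooth_deriv.
  by apply: smoothM => //; exact: smooth_cst.
exact: smooth_deriv.
Qed.

End flat_function.

(** * Smooth compactly supported functions and test fields *)

Section compactly_supported.
Variables (R : realType) (n : nat).
Local Notation X := (Rn R n).
Local Notation V := 'rV[R]_n.
Implicit Types (x y z v w : V).

(** Support is expressed by a cube instead of a compact closure, a form that passes easily through
    derivatives and convolutions; it is matched with [test_field] below. *)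
Definition Cc (f : V -> R) := smooth f /\ exists N, forall x i, N < `|x 0 i| -> f x = 0.

Lemma smooth_coord i : smooth (fun x : V => x 0 i).
Proof.
case=> [|k] /=; first by move=> x; exact: coord_continuous.
have D (x v : V) : is_derive x v (fun x : V => x 0 i) (v 0 i).
  apply: is_derive_bound => t; rewrite !mxE addrK subrr normr0.
  by instantiate (1 := 0); rewrite mul0r.
split=> [x v|v]; first by case: (D x v).
rewrite (_ : 'D_v _ = fun=> v 0 i); first exact: smooth_cst.
by apply/funext => x; rewrite (@derive_val _ _ _ _ _ _ _ (D x v)).
Qed.

Lemma smooth_sqn : smooth (fun x : V => sqn x).
Proof.
rewrite (_ : (fun _ => _) = fun x : V => \sum_(i < n) x 0 i * x 0 i).
  by apply: smooth_sum => i; apply: smoothM; exact: smooth_coord.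
by apply/funext => x; rewrite sqnE; apply: eq_bigr => i _; rewrite expr2.
Qed.

Lemma Cc_deriv f v : Cc f -> Cc ('D_v f).
Proof.
move=> [sf [N HN]]; split; first exact: smooth_deriv.
exists N => x i xN.
have D : is_derive x v f 0.
  have z : is_derive x v (fun _ : V => 0 : R) 0 by exact: (is_derive_cst (0 : R) x v).
  apply: (near_eq_is_derive _ z).
  apply/nbhs_ballP; exists (`|x 0 i| - N); first by rewrite /= subr_gt0.
  move=> y [_ By]; rewrite (HN y i)//; have := By 0 i; rewrite /ball/= => h.
  by have := lerB_dist (x 0 i) (y 0 i); lra.
exact: (@derive_val _ _ _ _ _ _ _ D).
Qed.

Lemma Cc_bounded f : Cc f -> exists M, forall x, `|f x| <= M.
Proof.
move=> [sf [N HN]].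
have cK : compact [set v : V | forall i, `[- N, N]%classic (v ord0 i)].
  by apply: (@rV_compact _ n (fun=> `[- N, N]%classic)) => i; exact: segment_compact.
have := compact_bounded (continuous_compact (continuous_subspaceT (smooth_continuous sf)) cK).
move=> [M [_ /(_ (M + 1))]]; rewrite ltrDl ltr01 => /(_ isT) HM; exists (Num.max (M + 1) 0) => x.
have [xK|/existsNP [i xi]] := pselect (forall i, `[- N, N]%classic (x ord0 i)).
  by rewrite le_max HM//; exists x.
rewrite (HN x i) ?normr0 ?le_max ?lexx ?orbT//.
by rewrite ltNge ler_norml; apply/negP => h; apply: xi; rewrite /= in_itv/=.
Qed.

(** The path from x to x + z is followed one coordinate at a time. *)
Lemma lipschitz_coord (f : V -> R) L :
  (forall x i (s : R), `|f (s *: delta_mx 0 i + x) - f x| <= L * `|s|) ->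
  forall x z, `|f (x + z) - f x| <= L * nrm z.
Proof.
move=> H x z.
have S (s : seq 'I_n) : `|f (x + \sum_(i <- s) z 0 i *: delta_mx 0 i) - f x| <=
    L * \sum_(i <- s) `|z 0 i|.
  elim: s => [|i s IH]; first by rewrite !big_nil addr0 subrr normr0 mulr0.
  rewrite !big_cons mulrDr addrCA; set w := x + _ in IH *.
  rewrite (_ : f _ - f x = (f (z 0 i *: delta_mx 0 i + w) - f w) + (f w - f x)); last by ring.
  by rewrite (le_trans (ler_normD _ _))// lerD.
have := S (index_enum 'I_n); rewrite -(_ : z = \sum_(i <- index_enum 'I_n) z 0 i *: delta_mx 0 i)//.
exact: row_sum_delta.
Qed.

Lemma lipschitz_continuous (f : V -> R) L : (forall x z, `|f (x + z) - f x| <= L * nrm z) ->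
  continuous f.
Proof.
move=> H x U /= /(nbhs_ballP (f x)) [e e0 eU].
pose d := e / (`|L| * n%:R + 1).
have d0 : 0 < d by rewrite divr_gt0// ltr_wpDl// mulr_ge0.
apply/nbhs_ballP; exists d => //= y [_ By].
apply: eU; rewrite /ball/=.
have := H x (y - x); rewrite [x + _]addrC subrK distrC => h; apply: (le_lt_trans h).
have N : nrm (y - x) <= n%:R * d.
  rewrite -[n in n%:R]card_ord -sum1_card natr_sum mulr_suml; apply: ler_sum => i _.
  rewrite mul1r !mxE distrC ltW//; exact: (By 0 i).
apply: (@le_lt_trans _ _ (`|L| * (n%:R * d))).
  apply: (@le_trans _ _ (`|L| * nrm (y - x))); first by rewrite ler_wpM2r ?nrm_ge0// ler_norm.
  by rewrite ler_wpM2l.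
have dE : d * (`|L| * n%:R + 1) = e by rewrite /d divfK// gt_eqF// ltr_wpDl// mulr_ge0.
by rewrite -[ltRHS]dE mulrDr mulr1 mulrA [X in X < _]mulrC ltrDl.
Qed.

Lemma Cc_lipschitz f : Cc f -> exists L, 0 <= L /\ forall x z, `|f (x + z) - f x| <= L * nrm z.
Proof.
move=> Cf; have [sf _] := Cf.
have B i : {M | forall x, `|'D_(delta_mx 0 i) f x| <= M}.
  by apply: cid; apply: Cc_bounded; exact: Cc_deriv.
have M0 i : 0 <= sval (B i) by case: (B i) => M /= h; exact: le_trans (h 0).
exists (\sum_i sval (B i)); split; first exact: sumr_ge0.
apply: lipschitz_coord => x i s.
have [|c [_ ->]] := @mvt_line _ _ f ('D_(delta_mx 0 i) f) x (delta_mx 0 i) s.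
  by move=> y; apply: is_derive_derivable; exact: smooth_derivable.
rewrite normrM mulrC ler_wpM2r//; case: (B i) (M0) => M /= h _.
apply: (@le_trans _ _ (sval (B i))); first by case: (B i) => M' /= h'; exact: h'.
by rewrite (bigD1 i)//= lerDl sumr_ge0.
Qed.

Variable mu : {sigma_finite_measure set X -> \bar R}.
Hypothesis Hmu : is_lebesgue mu.

Lemma L1_cube k : L1 mu (\1_(@cubeN R n k) : X -> R).
Proof.
have := cbox_lebesgue_finite k Hmu => fin.
apply: (L1_bound (M := fine (mu (@cubeN R n k))) _ _ _).1.
- by apply: measurable_indic; exact: measurable_cbox.
- by move=> x.
- rewrite integral_indic//; last exact: measurable_cbox.
  by rewrite setIT fineK// ge0_fin_numE.
Qed.

(** A multiple of the indicator of the supporting cube dominates: an increment is non-zero only if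
    one of its two endpoints lies in the cube. *)
Lemma tame_lipschitz (f : X -> R) k M L : measurable_fun setT f ->
  (forall x, ~ cubeN k x -> f x = 0) -> (forall x, `|f x| <= M) -> 0 <= L ->
  (forall x z, `|f (x + z) - f x| <= L * nrm z) ->
  exists H M', tame mu f H M'.
Proof.
move=> mf f0 fM L0 fL; have M0 : 0 <= M by exact: le_trans (fM 0).
pose c := 2 * M + L; have c0 : 0 <= c by rewrite addr_ge0 ?mulr_ge0.
exists (fun x => c * \1_(@cubeN R n k) x), c.
have mi : measurable_fun setT (\1_(@cubeN R n k) : X -> R).
  by apply: measurable_indic; exact: measurable_cbox.
have i0 x : 0 <= (\1_(@cubeN R n k) x : R) by [].
split.
- by split => //; exact: measurable_funM.
- move=> x; rewrite indicE; case: (boolP (x \in cubeN k)) => xk.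
    by rewrite mulr1 (le_trans (fM x))// /c; have := L0; have := M0; lra.
  by rewrite f0 ?normr0 ?mulr0//; move/negP: xk => h h'; apply: h; rewrite inE.
- move=> x z.
  have m0 : 0 <= Num.min 1 (nrm z) by rewrite le_min ler01 nrm_ge0.
  have key : `|f (x + z) - f x| <= Num.min 1 (nrm z) * c.
    have [z1|z1] := leP 1 (nrm z).
      rewrite mul1r (le_trans (ler_normB _ _))//.
      by have := fM x; have := fM (x + z); have := L0; rewrite /c; lra.
    rewrite (le_trans (fL x z))// mulrC ler_wpM2l ?nrm_ge0// /c.
    by have := M0; lra.
  rewrite -mulrDr !indicE; case: (boolP (x \in cubeN k)) => xk.
    rewrite (le_trans key)// ler_wpM2l// ler_peMr//.
    by case: (_ \in _); rewrite ?mulr1n ?mulr0n; lra.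
  case: (boolP (x + z \in cubeN k)) => xzk; first by rewrite add0r mulr1.
  have nx y : y \notin cubeN k -> f y = 0.
    by move=> /negP h; apply: f0 => h'; apply: h; rewrite inE.
  by rewrite !nx// subrr normr0 addr0 !mulr0.
- by move=> x; rewrite indicE; case: (_ \in _); rewrite ?mulr1 ?mulr0.
- by apply: L1Zl; exact: L1_cube.
Qed.

Lemma Cc_tame (f : X -> R) : Cc f -> exists H M, tame mu f H M.
Proof.
move=> Cf; have [sf [N HN]] := Cf; have [M fM] := Cc_bounded Cf.
have [L [L0 fL]] := Cc_lipschitz Cf.
apply: (@tame_lipschitz f (Num.truncn `|N|).+1 M L) => //.
  by apply: continuous_measurable_Rn; exact: smooth_continuous.
move=> x /existsNP [i xi]; apply: (HN x i); rewrite ltNge; apply/negP => h; apply: xi.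
rewrite !mxE -ler_norml (le_trans h)// (le_trans (ler_norm _))// ltW// truncnS_gt//.
Qed.

(** The mean value theorem and the Lipschitz bound on [Du] give a quadratic remainder under the
    integral, which takes the place of dominated convergence. *)
Lemma is_derive_conv (u Du : X -> R) L M h x v :
  (forall x, is_derive x v u (Du x)) -> L1 mu u -> L1 mu Du -> (forall x, `|u x| <= M) ->
  (forall x, `|Du x| <= M) -> (forall x z, `|Du (x + z) - Du x| <= L * nrm z) -> 0 <= L ->
  L1 mu h -> is_derive x v (conv mu u h) (conv mu Du h x).
Proof.
move=> D Lu LD uM DM DL L0 Lh.
have I0 : 0 <= \int[mu]_y `|h y| by exact: Rintegral_ge0.
apply: (@is_derive_bound _ _ _ _ _ _ (L * nrm v * \int[mu]_y `|h y|)) => t.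
have Lc w := L1_conv_int Hmu w Lu uM Lh.
have LcD := L1_conv_int Hmu x LD DM Lh.
rewrite (_ : _ - _ - _ = \int[mu]_y (u (t *: v + x - y) * h y - u (x - y) * h y - t * (Du (x - y) * h y))); last first.
  rewrite RintB; [|exact: (L1B (Lc (t *: v + x)) (Lc x))|exact: L1Zl].
  by rewrite RintZl// (RintB (Lc (t *: v + x)) (Lc x)).
rewrite mulrAC -RintZl; last exact: L1_norm.
apply: Rint_norm_le; [exact: L1_measurable (L1B (L1B (Lc (t *: v + x)) (Lc x)) (L1Zl t LcD))|exact/L1Zl/L1_norm|].
move=> y; rewrite mulrA -!mulrBl normrM ler_wpM2r//.
have [c [ct]] := @mvt_line _ _ u Du (x - y) v t D.
rewrite addrA => ->; rewrite -mulrBr normrM [c *: v + _]addrC.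
have h1 := DL (x - y) (c *: v); rewrite nrmZ in h1.
have h2 : L * (`|c| * nrm v) <= L * (`|t| * nrm v) by rewrite ler_wpM2l// ler_wpM2r ?nrm_ge0.
apply: (@le_trans _ _ (`|t| * (L * (`|t| * nrm v)))); first by rewrite ler_wpM2l// (le_trans h1).
by rewrite -[t ^+ 2]real_normK ?num_real// le_eqVlt; apply/orP; left; apply/eqP; ring.
Qed.

Lemma Cc_conv_derive f h x v : Cc f -> L1 mu h ->
  is_derive x v (conv mu f h) (conv mu ('D_v f) h x).
Proof.
move=> Cf Lh; have CD := Cc_deriv v Cf.
have [H [M tf]] := Cc_tame Cf; have [H' [M' tD]] := Cc_tame CD.
have [L [L0 DL]] := Cc_lipschitz CD; have [sf _] := Cf.
apply: (@is_derive_conv f ('D_v f) L (Num.max M M')) => //.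
- by move=> y; apply: is_derive_derivable; exact: smooth_derivable.
- exact: tame_L1 tf.
- exact: tame_L1 tD.
- by move=> y; rewrite le_max (tame_bound tf).
- by move=> y; rewrite le_max (tame_bound tD) orbT.
Qed.

Lemma Cc_conv f h N : Cc f -> L1 mu h -> (forall x i, N < `|x 0 i| -> h x = 0) ->
  Cc (conv mu f h).
Proof.
move=> Cf Lh h0; split.
  move=> k; elim: k f Cf => [|k IH] f Cf /=.
    move=> x; have [L [L0 fL]] := Cc_lipschitz Cf; have [H [M tf]] := Cc_tame Cf.
    have LF := tame_L1 tf; have fM := tame_bound tf.
    apply: (@lipschitz_continuous _ (L * \int[mu]_y `|h y|)) => {}x z.
    have Lc w := L1_conv_int Hmu w LF fM Lh.
    rewrite /conv -(RintB (Lc _) (Lc _)) mulrAC -RintZl; last exact: L1_norm.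
    apply: Rint_norm_le; [exact: L1_measurable (L1B (Lc (x + z)) (Lc x))|exact/L1Zl/L1_norm|].
    by move=> y; rewrite -mulrBl normrM ler_wpM2r// addrAC.
  split=> [x v|v]; first by case: (Cc_conv_derive x v Cf Lh).
  rewrite (_ : 'D_v _ = conv mu ('D_v f) h); first by apply: IH; exact: Cc_deriv.
  by apply/funext => x; rewrite (@derive_val _ _ _ _ _ _ _ (Cc_conv_derive x v Cf Lh)).
have [_ [N' f0]] := Cf; exists (N + N') => x i xN.
rewrite /conv (@eq_RintX _ _ mu _ (fun=> 0)) ?Rint0// => y.
have [yN|yN] := leP `|y 0 i| N; last by rewrite (h0 y i)// mulr0.
rewrite (f0 (x - y) i) ?mul0r// !mxE.
by have := lerB_dist (x 0 i) (y 0 i); lra.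
Qed.

Lemma bump_exists (e : R) : 0 < e -> exists rho : V -> R,
  [/\ Cc rho, forall x, 0 <= rho x, forall x i, e < `|x 0 i| -> rho x = 0 &
   \int[mu]_x rho x = 1].
Proof.
(* 1 - |x|^2/e^2 is positive exactly in the ball of radius e, so composing it with [eta 0] gives a
   smooth function supported there. *)
move=> e0; pose s (x : V) : R := 1 + - e ^- 2 * sqn x.
have ss : smooth s.
  apply: smoothD; first exact: smooth_cst.
  by apply: smoothM; [exact: smooth_cst|exact: smooth_sqn].
pose r0 (x : V) : R := eta 0 (s x).
have e2 : 0 < e ^- 2 by rewrite invr_gt0 exprn_gt0.
have r00 x : 0 <= r0 x by exact: eta_ge0.
have supp x i : e < `|x 0 i| -> r0 x = 0.
  move=> h; rewrite /r0 /eta ifF//; apply/negbTE; rewrite -leNgt /s.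
  have h2 : e ^+ 2 <= sqn x.
    by rewrite (le_trans _ (coord2_le_sqn x i))// -[leRHS]real_normK ?num_real// ler_sqr ?nnegrE ?(ltW h)// ltW.
  have : e ^- 2 * e ^+ 2 <= e ^- 2 * sqn x by rewrite ler_wpM2l// ltW.
  by rewrite mulVf ?gt_eqF ?exprn_gt0//; lra.
have Cr : Cc r0.
  split; last by exists e.
  rewrite (_ : r0 = fun x => 1 * eta 0 (s x)); first exact: (smooth_eta 0 (@smooth_cst R V 1) ss).
  by apply/funext => x; rewrite mul1r.
have [H [M tr]] := Cc_tame Cr; have Lr := tame_L1 tr.
have I0 : 0 < \int[mu]_x r0 x.
  (* On the cube of half-side [d] one has |x|^2/e^2 <= n/(4(n+1)^2) <= 1/2, hence r0 >= exp(-2). *)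
  pose d := e / (2 * n.+1%:R); have d0 : 0 < d by rewrite divr_gt0// mulr_gt0.
  apply: (@Rint_gt0 _ _ _ mu r0 (expR (- 2)) (cbox (const_mx (- d)) (const_mx d))) => //.
  - exact: measurable_cbox.
  - rewrite Hmu; first by rewrite lte_fin prodr_gt0// => i _; rewrite !mxE; lra.
    by move=> i; rewrite !mxE; lra.
  - move=> x /= xb.
    have sx : sqn x <= n%:R * d ^+ 2.
      rewrite sqnE -[n in n%:R]card_ord -sum1_card natr_sum mulr_suml; apply: ler_sum => i _.
      rewrite mul1r -[leLHS]real_normK ?num_real// ler_sqr ?nnegrE ?(ltW d0)//.
      by rewrite ler_norml; have := xb i; rewrite !mxE.
    have s2 : 2^-1 <= s x.
      rewrite /s mulNr.
      have : e ^- 2 * sqn x <= e ^- 2 * (n%:R * d ^+ 2) by rewrite ler_wpM2l// ltW.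
      have -> : e ^- 2 * (n%:R * d ^+ 2) = n%:R / (4 * n.+1%:R ^+ 2).
        by rewrite /d; field; rewrite !gt_eqF.
      have : n%:R / (4 * n.+1%:R ^+ 2) <= 2^-1 :> R.
        rewrite ler_pdivrMr ?mulr_gt0 ?exprn_gt0// -(natr1 n).
        by have : 0 <= n%:R :> R by []; move: (n%:R : R) => N N0; nra.
      move=> h1 h2; have := le_trans h2 h1; move: (e ^- 2 * sqn x) => B; lra.
    have s0 : 0 < s x by apply: lt_le_trans s2; rewrite invr_gt0.
    rewrite /r0 /eta s0 expr0 invr1 mul1r ler_expR lerN2.
    by rewrite -[leRHS]invrK lef_pV2 ?posrE ?invr_gt0.
exists (fun x => (\int[mu]_x r0 x)^-1 * r0 x); split.
- have [sr [N HN]] := Cr; split; first by apply: smoothM => //; exact: smooth_cst.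
  by exists N => x i h; rewrite (HN x i)// mulr0.
- by move=> x; rewrite mulr_ge0// invr_ge0 ltW.
- by move=> x i h; rewrite (supp x i)// mulr0.
- by rewrite RintZl// mulVf// gt_eqF.
Qed.

Lemma Ck_component k (phi : V -> V) i : Ck k phi -> Ck k (fun x => phi x 0 i).
Proof.
elim: k phi => [|k IH] phi /=.
  move=> c x; apply: (@continuous_comp _ _ _ phi (fun y : V => y 0 i) x); first exact: c.
  exact: coord_continuous.
move=> [d kd]; split=> [x v|v]; first by have /derivable_mxP := d x v; exact.
rewrite (_ : 'D_v _ = fun x => 'D_v phi x 0 i); first exact: IH.
by apply/funext => x; rewrite derive_mx// mxE.
Qed.

Lemma test_field_component (phi : V -> V) i : test_field phi -> Cc (fun x => phi x 0 i).
Proof.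
move=> [sp cp]; split; first by move=> k; exact: Ck_component.
have B j : exists N, forall x, phi x != 0 -> `|x 0 j| <= N.
  have cj : {within closure [set x | phi x != 0], continuous (fun x : V => x 0 j)}.
    by apply: continuous_subspaceT => x; exact: coord_continuous.
  have [N [_ /(_ (N + 1))]] := compact_bounded (continuous_compact cj cp).
  rewrite ltrDl ltr01 => /(_ isT) HN.
  by exists (N + 1) => x px; apply: HN; exists x => //; exact: subset_closure.
have B' j := cid (B j).
exists (\sum_j `|sval (B' j)|) => x j xN.
have [->|px] := eqVneq (phi x) 0; first by rewrite mxE.
have := proj2_sig (B' j) x px => h; exfalso; move: xN; apply/negP; rewrite -leNgt (le_trans h)//.
by rewrite (le_trans (ler_norm _))// (bigD1 j)//= lerDl sumr_ge0.
Qed.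

Lemma Ck_scale k (c : V -> R) (w : V) : Ck k c -> Ck k (fun x => c x *: w).
Proof.
elim: k c => [|k IH] c /=; first by move=> cc x; exact: (cvgZr_tmp (cc x)).
have E (i : 'I_1) j : (fun x => (c x *: w) i j) = (w i j \*: c).
  by apply/funext => x; rewrite mxE mulrC.
move=> [d kd].
have dw x v : derivable (fun x => c x *: w) x v.
  by apply/derivable_mxP => i j; rewrite E; exact: derivableZ.
split=> // v; rewrite (_ : 'D_v _ = fun x => 'D_v c x *: w); first exact: IH.
apply/funext => x; rewrite derive_mx//; apply/matrixP => i j.
by rewrite !mxE E deriveZ// /GRing.scale/= mulrC.
Qed.

Lemma test_field_scale (c : V -> R) i : Cc c -> test_field (fun x => c x *: (delta_mx 0 i : V)).
Proof.
move=> [sc [N HN]]; split; first by move=> k; exact: Ck_scale.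
have cK : compact [set v : V | forall i, `[- N, N]%classic (v ord0 i)].
  by apply: (@rV_compact _ n (fun=> `[- N, N]%classic)) => j; exact: segment_compact.
have clK := compact_closed (@norm_hausdorff _ _) cK.
apply: (subclosed_compact (@closed_closure _ _) cK).
rewrite [X in _ `<=` X](closure_id _).1//; apply: closure_subset => x /= nz j.
rewrite /= in_itv/= -ler_norml leNgt; apply/negP => h; move: nz.
by rewrite (HN x j)// scale0r eqxx.
Qed.

Lemma enorm_delta (c : R) i : enorm (c *: (delta_mx 0 i : V)) = `|c|.
Proof.
rewrite /enorm /dotv (bigD1 i)//= big1 => [|j ji]; last by rewrite !mxE (negbTE ji) andbF mulr0 mul0r.
by rewrite !mxE !eqxx mulr1 addr0 -expr2 sqrtr_sqr.
Qed.

End compactly_supported.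

(** * The fractional divergence as a superposition of Gaussian gradients *)

Section fractional_operator.
Variables (R : realType) (n : nat).
Variable mu : {sigma_finite_measure set (Rn R n) -> \bar R}.
Hypothesis Hmu : is_lebesgue mu.
Local Notation X := (Rn R n).
Local Notation leb := (@lebesgue_measure R).
Local Notation RR := (measurableTypeR R).
Local Notation corr := (corr mu).
Local Notation conv := (conv mu).
Implicit Types (x y z w : 'rV[R]_n) (f h F u : X -> R).

Local Notation kt i t := (dil 2^-1 (gker mu i) t).

Lemma measurable_kernel_conv (k2 : RR -> X -> R) h : measurable_fun setT h ->
  measurable_fun setT (fun v => k2 v.1 v.2) ->
  measurable_fun setT (fun v : RR * X => conv (k2 v.1) h v.2).
Proof.
move=> mh mk; apply: (measurable_Rint2 mu (f := fun (u : RR * X) (y : X) => k2 u.1 (u.2 - y) * h y)).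
apply: measurable_funM; last exact: (measurableT_comp mh).
apply: (measurableT_comp mk (g := fun u : (RR * X) * X => (u.1.1, u.1.2 - u.2 : X))).
apply: measurable_fun_pair; first exact: (measurableT_comp measurable_fst measurable_fst).
by apply: measurable_subX => //; exact: (measurableT_comp measurable_snd measurable_fst).
Qed.

Lemma L1_sum_dom h : L1 mu h -> sum_dom mu h (fun x => `|h x|).
Proof.
by move=> Lh; split; [exact: L1_measurable Lh|exact: L1_norm|move=> x; rewrite lerDr].
Qed.

(** Associativity by adjointness, with k(x - .) in the role of the function being correlated. *)
Lemma conv_conv k M u M' h x : L1 mu k -> (forall x, `|k x| <= M) ->
  L1 mu u -> (forall x, `|u x| <= M') -> L1 mu h -> conv k (conv u h) x = conv (conv k u) h x.
Proof.
move=> Lk kM Lu uM Lh; have Lf := L1_refl Hmu x Lk.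
have [_ _ E] := corr_adjoint Hmu (L1_sum_dom Lf) Lu uM Lh.
transitivity (\int[mu]_z (k (x - z) * conv u h z)); first by [].
rewrite -E; apply: eq_RintX => y; congr (_ * _).
rewrite /corr -(Rint_shift Hmu y (f := fun z => k (x - z) * u (z - y))).
  by apply: eq_RintX => z; rewrite addrK opprD [- z - y]addrC addrA.
apply: measurable_funM; first exact: L1_measurable Lf.
exact: L1_measurable (L1_sub Hmu y Lu).
Qed.

Lemma gker_odd i z : gker mu i (- z) = - gker mu i z.
Proof. by rewrite /gker ge_even !mxE; ring. Qed.

Lemma dil_odd i t z : kt i t (- z) = - kt i t z.
Proof. by rewrite /dil scalerN gker_odd mulrN. Qed.

(** Size in t of a Gaussian gradient convolved with a tame function: cancellation gives 1, scaling
    gives t^(-1/2). *)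
Definition wm (t : R) : R := Num.min 1 (t `^ (- 2^-1)).

Lemma wm_ge0 t : 0 <= wm t.
Proof. by rewrite /wm le_min ler01 powR_ge0. Qed.

Lemma conv_gker_est i u H M : tame mu u H M -> exists C, 0 <= C /\ forall t, 0 < t ->
  (forall y, `|conv (kt i t) u y| <= C * wm t) /\ \int[mu]_y `|conv (kt i t) u y| <= C * wm t.
Proof.
move=> tu; have [H' [M' [tK LnH]]] := profile_gker Hmu i.
have [C1 [C10 h1]] := conv_dil_small Hmu 2^-1 tK LnH (Rint_gker Hmu i) tu.
have [C2 [C20 h2]] := conv_dil_large Hmu 2^-1 tK tu.
exists (C1 + C2); split; first exact: addr_ge0.
move=> t t0; have [a1 b1] := h1 t t0; have [a2 b2] := h2 t t0.
rewrite subrr powRr0 mulr1 in a1 b1.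
have key (v : R) : v <= C1 -> v <= C2 * t `^ (- 2^-1) -> v <= (C1 + C2) * wm t.
  move=> v1 v2; have e0 : 0 <= t `^ (- 2^-1) by exact: powR_ge0.
  rewrite /wm; case: (leP 1 (t `^ (- 2^-1))) => _; first by rewrite mulr1 (le_trans v1)// lerDl.
  by rewrite (le_trans v2)// ler_wpM2r// lerDr.
by split=> [y|]; exact: key.
Qed.

Section exponent.
Variable b : R.
Hypotheses (b0 : 0 < b) (b2 : b < 2^-1).

Lemma L1_pw_wm : L1 leb (fun t => pw b t * wm t).
Proof.
apply: (@L1_pw_dom R b (b - 2^-1) 1 1) => //; first by rewrite subr_lt0.
- apply: measurable_funM; first exact: measurable_pw.
  by apply: measurable_minr => //; exact: measurable_powR.
- by move=> t t0; rewrite pw_le0// mul0r.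
- move=> t t0 _; rewrite ger0_norm ?mulr_ge0 ?pw_ge0 ?wm_ge0// mul1r ler_piMr ?pw_ge0//.
  by rewrite /wm ge_min lexx.
- move=> t t1; rewrite ger0_norm ?mulr_ge0 ?pw_ge0 ?wm_ge0// mul1r -pwMpowR ler_wpM2l ?pw_ge0//.
  by rewrite /wm ge_min lexx orbT.
Qed.

(** Up to a constant, the i-th derivative of the Riesz potential of order 2b. With 2b = 1 - g it is
    a component of the gradient of order g; 0 < b < 1/2 is the range where the weight is integrable
    against [wm] at both ends. *)
Definition Tg i u x : R := \int[leb]_t (pw b t * conv (kt i t) u x).

Section fixed_function.
Variables (i : 'I_n) (u H : X -> R) (M : R).
Hypothesis tu : tame mu u H M.

Let Lkt t : 0 < t -> L1 mu (kt i t).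
Proof. by move=> t0; apply: dil_L1 => //; have [H' [M' [tK _]]] := profile_gker Hmu i; exact: tame_L1 tK. Qed.

Let bkt t : exists M', forall z, `|kt i t z| <= M'.
Proof.
have [H' [M' [tK _]]] := profile_gker Hmu i.
by exists (t `^ (- (2^-1 + n%:R / 2)) * M') => z; apply: dil_bound; exact: tame_bound tK.
Qed.

Let Lconv t : 0 < t -> L1 mu (conv (kt i t) u).
Proof. by move=> t0; have [M' KM] := bkt t; exact: L1_convol (Lkt t0) KM (tame_L1 tu). Qed.

Let mc : measurable_fun setT (fun v : RR * X => pw b v.1 * conv (kt i v.1) u v.2).
Proof.
apply: measurable_funM; first exact: (measurableT_comp (measurable_pw b)).
apply: (@measurable_kernel_conv (fun (t : RR) (z : X) => kt i t z)); first exact: tame_measurable tu.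
have [H' [M' [tK _]]] := profile_gker Hmu i.
exact: measurable_dil (tame_measurable tK).
Qed.

Lemma Tg_int : exists C, 0 <= C /\ forall x,
  L1 leb (fun t => pw b t * conv (kt i t) u x) /\ `|Tg i u x| <= C.
Proof.
have [C [C0 HC]] := conv_gker_est i tu.
exists (C * \int[leb]_t (pw b t * wm t)); split.
  by rewrite mulr_ge0// Rintegral_ge0// => t _; rewrite mulr_ge0 ?pw_ge0 ?wm_ge0.
move=> x; have D t : `|pw b t * conv (kt i t) u x| <= C * (pw b t * wm t).
  have [t0|t0] := leP t 0; first by rewrite pw_le0// !mul0r normr0 mulr0.
  by rewrite normrM (ger0_norm (pw_ge0 _ _)) mulrCA ler_wpM2l ?pw_ge0//; have [] := HC t t0.
have mx := measurable_sec2 (x : X) (f := fun (t : RR) (x : X) => pw b t * conv (kt i t) u x) mc.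
have L := L1Zl C L1_pw_wm.
split; first exact: (L1_dom mx L D).
rewrite -RintZl; last exact: L1_pw_wm.
exact: (Rint_norm_le mx L D).
Qed.

Lemma Tg_pair f F : sum_dom mu f F ->
  L1 mu (fun y => f y * Tg i u y) /\
  \int[mu]_y (f y * Tg i u y) = \int[leb]_t (pw b t * \int[mu]_y (f y * conv (kt i t) u y)).
Proof.
move=> fF; have [mf _ _] := fF; have [C [C0 HC]] := conv_gker_est i tu.
have IF0 : 0 <= \int[mu]_y `|F y| by exact: Rintegral_ge0.
pose G (t : RR) (y : X) := f y * (pw b t * conv (kt i t) u y).
have mG : measurable_fun setT (fun v => G v.1 v.2).
  by apply: measurable_funM; [exact: (measurableT_comp mf)|exact: mc].
have z t y : t <= 0 -> G t y = 0 by move=> t0; rewrite /G pw_le0// mul0r mulr0.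
have LGt t : L1 mu (G t) /\ \int[mu]_y `|G t y| <= pw b t * wm t * (C * (1 + \int[mu]_y `|F y|)).
  have [t0|t0] := leP t 0.
    split; first by apply: (eq_L1 _ (L10 mu)) => y; rewrite z.
    rewrite (@eq_RintX _ _ mu _ (fun=> 0)) ?Rint0//; last by move=> y; rewrite z// normr0.
    by rewrite pw_le0// !mul0r.
  have [B1 B2] := HC t t0; have Lc := Lconv t0.
  have [L B] := sum_dom_mul fF Lc B1.
  split; first by apply: (eq_L1 _ (L1Zl (pw b t) L)) => y; rewrite /G mulrCA.
  rewrite (@eq_RintX _ _ mu _ (fun y => pw b t * `|f y * conv (kt i t) u y|)); last first.
    by move=> y; rewrite /G mulrCA normrM (ger0_norm (pw_ge0 _ _)).
  rewrite RintZl; last exact: L1_norm.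
  rewrite -mulrA ler_wpM2l ?pw_ge0// (le_trans B)// mulrA [wm t * C]mulrC mulrDr mulr1 lerD2r.
  exact: B2.
have LG : L1 (leb \x mu)%E (fun v => G v.1 v.2).
  apply: (L1_prod (f := G) (b := fun t => pw b t * wm t * (C * (1 + \int[mu]_y `|F y|)))) => //.
  - by move=> t; have [] := LGt t.
  - by apply: L1Zr; exact: L1_pw_wm.
  - by move=> t; have [] := LGt t.
have [C' [_ HT]] := Tg_int.
have E y : \int[leb]_t G t y = f y * Tg i u y by rewrite /G RintZl//; exact: (HT y).1.
split; first by apply: (eq_L1 _ (L1_Rint2 (f := G) LG)) => y; rewrite E.
rewrite -(eq_RintX mu E) -(Rint_fubini (f := G) LG); apply: eq_Rint => t.
have [t0|t0] := leP t 0.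
  by rewrite pw_le0// mul0r (@eq_RintX _ _ mu _ (fun=> 0)) ?Rint0// => y; rewrite z.
have [B1 _] := HC t t0; have [L _] := sum_dom_mul fF (Lconv t0) B1.
by rewrite -RintZl//; apply: eq_RintX => y; rewrite /G mulrCA.
Qed.

Lemma Tg_L1 : L1 mu (Tg i u).
Proof. by have [L _] := Tg_pair (sum_dom1 mu); apply: (eq_L1 _ L) => y; rewrite mul1r. Qed.

Lemma conv_Tg h x : L1 mu h -> conv (Tg i u) h x = Tg i (conv u h) x.
Proof.
move=> Lh; have mT := L1_measurable Tg_L1; have mh := L1_measurable Lh.
rewrite convC//.
transitivity (\int[mu]_y (h (x - y) * Tg i u y)); first by [].
have [_ ->] := Tg_pair (L1_sum_dom (L1_refl Hmu x Lh)).
rewrite /Tg; apply: (@eq_Rint _ _ _ leb) => t.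
have [t0|t0] := leP t 0; first by rewrite (pw_le0 b t0) !mul0r.
congr (_ * _); have [M' KM] := bkt t.
rewrite (conv_conv x (Lkt t0) KM (tame_L1 tu) (tame_bound tu) Lh).
by rewrite [RHS]convC//; exact: L1_measurable (Lconv t0).
Qed.

End fixed_function.

(** By the semigroup law, convolving with the Gaussian at time m only shifts the time t to m + t. *)
Lemma Tg_gauss i m x : 0 < m ->
  Tg i (dil 0 (g0 mu) m) x = superk leb (pw b) 2^-1 m (gker mu i) x.
Proof.
move=> m0; apply: eq_Rint => t; have [t0|t0] := leP t 0; first by rewrite pw_le0// !mul0r.
by congr (_ * _); rewrite [LHS](conv_gker_g0 Hmu x t0 m0) addrC.
Qed.

End exponent.

Section representation.
Variable g : R.
Hypotheses (g_gt0 : 0 < g) (g_lt1 : g < 1).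
Let b := (1 - g) / 2.
Let N : R := n%:R + g + 1.
Let c : R := gI mu / (2 * gpc (N / 2)).

Let N0 : 0 < N / 2.
Proof. by rewrite /N divr_gt0// addr_gt0// ltr_wpDl. Qed.

(** This is [gauss_power] with exponent N/2 and x = |w|^2; the minus sign is that of the derivative
    in [gker]. At w = 0 both sides vanish with the coordinate. *)
Lemma frac_kernel i w :
  w 0 i / enorm w `^ N = - (c * \int[leb]_s (pw b s * kt i s w)).
Proof.
have gI0 := gI_gt0 Hmu; have gp0 := gpc_gt0 N0.
have E s : pw b s * kt i s w = - (2 / gI mu) * w 0 i * (pw (- (N / 2)) s * expR (- (sqn w / s))).
  have [s0|s0] := leP s 0; first by rewrite !pw_le0// !(mul0r, mulr0).
  rewrite gkerE// g0E// !pwE// (_ : - (N / 2) - 1 = (b - 1) + (- 1 + - (n%:R / 2))); last by rewrite /N /b; field.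
  rewrite !powRD_gt0// (powRN s 1) powRr1 ?(ltW s0)//; field.
  by rewrite !gt_eqF.
rewrite (@eq_Rint _ _ _ leb _ _ E).
have [w0|wn] := eqVneq (sqn w) 0.
  have -> : w 0 i = 0 by rewrite (sqn_eq0 w0) mxE.
  rewrite mul0r (@eq_Rint _ _ _ leb _ (fun=> 0)) ?Rint0 ?mulr0 ?oppr0// => s.
  by rewrite !(mulr0, mul0r).
have wp : 0 < sqn w by rewrite lt0r wn sqn_ge0.
have [L I] := gauss_power N0 wp.
rewrite RintZl// I powRN.
have -> : enorm w `^ N = sqn w `^ (N / 2).
  by rewrite /enorm -powR12_sqrt ?sqn_ge0// -powRrM mulrC.
by rewrite /c; field; rewrite !gt_eqF// powR_gt0.
Qed.

(** Absolute convergence, without a principal value: |u(y) - u(x)| <= 2M min(1, |y - x|) tames the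
    kernel on the diagonal and at infinity. After the exchange of integrals the term with u(x)
    disappears, since [gker] has mean zero. *)
Lemma frac_term i u H M x : tame mu u H M ->
  L1 mu (fun y : X => (y - x) 0 i / enorm (y - x) `^ N * (u y - u x)) /\
  \int[mu]_y ((y - x) 0 i / enorm (y - x) `^ N * (u y - u x)) = c * Tg b i u x.
Proof.
move=> tu; have [[mu_ _] _ uL HM _] := tu; have H0 := tame_ge0 tu.
have uM := tame_bound tu; have Lu := tame_L1 tu.
have M0 : 0 <= M by exact: le_trans (normr_ge0 _) (uM 0).
have [H' [M' [tK LnH]]] := profile_gker Hmu i.
have LK := tame_L1 tK; have mK := L1_measurable LK.
have b0 : 0 < b by rewrite divr_gt0// subr_gt0.
have b2 : b < 2^-1 by rewrite /b; have := g_gt0; lra.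
have LnK : L1 mu (fun z => nrm z * gker mu i z).
  apply: (L1_dom _ LnH); first by apply: measurable_funM => //; exact: measurable_nrm.
  move=> z; rewrite normrM (ger0_norm (nrm_ge0 z)) ler_wpM2l ?nrm_ge0//.
  by have [_ KH _ _ _] := tK.
pose A := \int[mu]_z `|gker mu i z|; pose A' := \int[mu]_z `|nrm z * gker mu i z|.
have A0 : 0 <= A by exact: Rintegral_ge0.
have A'0 : 0 <= A' by exact: Rintegral_ge0.
have ud y : `|u y - u x| <= Num.min 1 (nrm (y - x)) * (2 * M).
  have := uL x (y - x); rewrite [x + _]addrC subrK => h; apply: (le_trans h).
  rewrite ler_wpM2l ?le_min ?ler01 ?nrm_ge0//.
  by have := HM x; have := HM y; lra.
pose G (s : RR) (y : X) := pw b s * kt i s (y - x) * (u y - u x).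
have mG : measurable_fun setT (fun v => G v.1 v.2).
  apply: measurable_funM; last first.
    by apply: measurable_funB => //; exact: (measurableT_comp mu_).
  apply: measurable_funM; first exact: (measurableT_comp (measurable_pw b)).
  apply: (measurableT_comp (measurable_dil 2^-1 mK) (g := fun v : RR * X => (v.1, v.2 - x : X))).
  by apply: measurable_fun_pair => //; exact: measurable_subX.
have z s y : s <= 0 -> G s y = 0 by move=> s0; rewrite /G pw_le0// !mul0r.
have LGs s : L1 mu (G s) /\ \int[mu]_y `|G s y| <= pw b s * wm s * (2 * M * (A + A')).
  have [s0|s0] := leP s 0.
    split; first by apply: (eq_L1 _ (L10 mu)) => y; rewrite z.
    rewrite (@eq_RintX _ _ mu _ (fun=> 0)) ?Rint0//; last by move=> y; rewrite z// normr0.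
    by rewrite pw_le0// !mul0r.
  have Lk : L1 mu (kt i s) by exact: dil_L1.
  have L1' : L1 mu (fun z => nrm z * `|kt i s z|).
    apply: (eq_L1 _ (L1_norm (dil_L1 Hmu (2^-1 - 2^-1) s0 LnK))) => v.
    by rewrite -dil_nrm// [LHS]normrM (ger0_norm (nrm_ge0 v)).
  have I1 : \int[mu]_z `|kt i s z| = s `^ (- 2^-1) * A by rewrite dil_int_norm.
  have I2 : \int[mu]_z (nrm z * `|kt i s z|) = A'.
    have En v : nrm v * `|kt i s v| = `|dil (2^-1 - 2^-1) (fun z => nrm z * gker mu i z) s v|.
      by rewrite -dil_nrm// [RHS]normrM (ger0_norm (nrm_ge0 v)).
    by rewrite (eq_RintX mu En) dil_int_norm// subrr oppr0 powRr0 mul1r.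
  have mGs := measurable_sec1 s (f := G) mG.
  (* Two bounds on the same piece: [D1] uses the mass of the kernel and serves large s, [D2] its
     first moment and serves small s. Together they give [wm s]. *)
  have D1 y : `|G s y| <= pw b s * (2 * M) * `|kt i s (y - x)|.
    rewrite !normrM (ger0_norm (pw_ge0 _ _)) mulrAC ler_wpM2r// ler_wpM2l ?pw_ge0//.
    by rewrite (le_trans (ud y))// ler_piMl ?mulr_ge0// ge_min lexx.
  have D2 y : `|G s y| <= pw b s * (2 * M) * (nrm (y - x) * `|kt i s (y - x)|).
    rewrite [leRHS](_ : _ = pw b s * (2 * M * nrm (y - x)) * `|kt i s (y - x)|); last by ring.
    rewrite !normrM (ger0_norm (pw_ge0 _ _)) mulrAC ler_wpM2r// ler_wpM2l ?pw_ge0//.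
    by rewrite (le_trans (ud y))// mulrC ler_wpM2l ?mulr_ge0// ge_min lexx orbT.
  have La : L1 mu (fun y : X => pw b s * (2 * M) * `|kt i s (y - x)|).
    by apply: L1Zl; apply: L1_norm; exact: (L1_sub Hmu x Lk).
  have Lb : L1 mu (fun y : X => pw b s * (2 * M) * (nrm (y - x) * `|kt i s (y - x)|)).
    by apply: L1Zl; exact: (L1_sub Hmu x L1').
  have LG := L1_dom mGs La D1.
  split => //.
  have B1 := Rint_le (L1_norm LG) La D1; have B2 := Rint_le (L1_norm LG) Lb D2.
  rewrite RintZl ?(Rint_sub Hmu x (k := fun z => `|kt i s z|)) ?I1 in B1; last 2 first.
  - by apply: measurableT_comp => //; exact: L1_measurable Lk.
  - by apply: L1_norm; exact: (L1_sub Hmu x Lk).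
  rewrite RintZl ?(Rint_sub Hmu x (k := fun z => nrm z * `|kt i s z|)) ?I2 in B2; last 2 first.
  - exact: L1_measurable L1'.
  - exact: (L1_sub Hmu x L1').
  have p0 : 0 <= pw b s * (2 * M) by rewrite mulr_ge0 ?pw_ge0 ?mulr_ge0.
  rewrite (_ : pw b s * wm s * (2 * M * (A + A')) = pw b s * (2 * M) * (wm s * (A + A'))); last by ring.
  have e0 : 0 <= s `^ (- 2^-1) by exact: powR_ge0.
  rewrite /wm; case: (leP 1 (s `^ (- 2^-1))) => _.
    by rewrite (le_trans B2)// ler_wpM2l// mul1r lerDr.
  by rewrite (le_trans B1)// ler_wpM2l// ler_wpM2l// lerDl.
have LG : L1 (leb \x mu)%E (fun v => G v.1 v.2).
  apply: (L1_prod (f := G) (b := fun s => pw b s * wm s * (2 * M * (A + A')))) => //.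
  - by move=> s; have [] := LGs s.
  - by apply: L1Zr; exact: L1_pw_wm.
  - by move=> s; have [] := LGs s.
have Lk0 w : L1 leb (fun s => pw b s * kt i s w).
  have gI0 := gI_gt0 Hmu.
  have [w0|wn] := eqVneq (sqn w) 0.
    apply: (eq_L1 _ (L10 leb)) => s; have [s0|s0] := leP s 0; first by rewrite pw_le0// mul0r.
    by rewrite gkerE// (sqn_eq0 w0) mxE mulr0 mul0r oppr0 mul0r mulr0.
  have wp : 0 < sqn w by rewrite lt0r wn sqn_ge0.
  have [L _] := gauss_power N0 wp.
  apply: (eq_L1 _ (L1Zl (- (2 / gI mu) * w 0 i) L)) => s.
  have [s0|s0] := leP s 0; first by rewrite !pw_le0// !(mul0r, mulr0).
  rewrite gkerE// g0E// !pwE// (_ : - (N / 2) - 1 = (b - 1) + (- 1 + - (n%:R / 2))); last by rewrite /N /b; field.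
  rewrite !powRD_gt0// (powRN s 1) powRr1 ?(ltW s0)//; field.
  by rewrite !gt_eqF.
have E y : (y - x) 0 i / enorm (y - x) `^ N * (u y - u x) = - c * \int[leb]_s G s y.
  by rewrite frac_kernel /G RintZr// mulNr mulNr mulrA.
have LE := L1Zl (- c) (L1_Rint2 (f := G) LG).
split; first by apply: (eq_L1 _ LE) => y; rewrite E.
rewrite (eq_RintX mu E) RintZl; last exact: (L1_Rint2 (f := G) LG).
rewrite mulNr -mulrN; congr (_ * _).
rewrite -(Rint_fubini (f := G) LG) -RintN; last exact: (L1_Rint1 (f := G) LG).
apply: eq_Rint => s; have [s0|s0] := leP s 0.
  by rewrite pw_le0// mul0r (@eq_RintX _ _ mu _ (fun=> 0)) ?Rint0 ?oppr0// => y; rewrite z.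
have Lk : L1 mu (kt i s) by exact: dil_L1.
have Lks := L1_sub Hmu x Lk.
have Lku : L1 mu (fun y : X => kt i s (y - x) * u y) by exact: (L1M_bounded Lks mu_ uM).
have E2 y : G s y = pw b s * (kt i s (y - x) * u y - kt i s (y - x) * u x) by rewrite /G -mulrA mulrBr.
rewrite (eq_RintX mu E2) RintZl; last by apply: L1B => //; exact: L1Zr.
rewrite -mulrN; congr (_ * _).
rewrite RintB//; last exact: L1Zr.
rewrite RintZr// (Rint_sub Hmu x (L1_measurable Lk)) dil_int// Rint_gker// mulr0 mul0r subr0.
rewrite -RintN//; apply: eq_RintX => y.
by rewrite -[y - x]opprB dil_odd mulNr opprK.
Qed.

Definition frac_cst : R := mu_const n g * c.

Lemma frac_cst_gt0 : 0 < frac_cst.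
Proof.
rewrite /frac_cst mulr_gt0//; last by rewrite divr_gt0 ?gI_gt0// mulr_gt0// gpc_gt0.
rewrite /mu_const !mulr_gt0 ?powR_gt0 ?pi_gt0 ?invr_gt0 ?Gamma_gt0// divr_gt0 ?subr_gt0//.
Qed.

Lemma frac_divE (phi : 'rV[R]_n -> 'rV[R]_n) x :
  (forall i, exists H M, tame mu (fun y => phi y 0 i) H M) ->
  frac_div mu g phi x = frac_cst * \sum_i Tg b i (fun y => phi y 0 i) x.
Proof.
move=> tp.
have T i : L1 mu (fun y : X => (y - x) 0 i / enorm (y - x) `^ N * (phi y 0 i - phi x 0 i)) /\
    \int[mu]_y ((y - x) 0 i / enorm (y - x) `^ N * (phi y 0 i - phi x 0 i)) = c * Tg b i (fun y => phi y 0 i) x.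
  by have [H [M t]] := tp i; exact: frac_term t.
rewrite /frac_div /frac_cst -mulrA; congr (_ * _); rewrite mulr_sumr.
have E y : dotv (y - x) (phi y - phi x) / enorm (y - x) `^ N =
    \sum_(i < n) ((y - x) 0 i / enorm (y - x) `^ N * (phi y 0 i - phi x 0 i)).
  by rewrite /dotv mulr_suml; apply: eq_bigr => i _; rewrite !mxE mulrAC.
rewrite (eq_RintX mu E) Rint_sum; last by move=> i; have [] := T i.
by apply: eq_bigr => i _; have [] := T i.
Qed.

End representation.
End fractional_operator.

(** * Bounds on smoothed gradients from the variation, by duality *)

Section variation_bounds.
Variables (R : realType) (n : nat).
Variable mu : {sigma_finite_measure set (Rn R n) -> \bar R}.
Hypothesis Hmu : is_lebesgue mu.
Local Notation X := (Rn R n).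
Local Notation leb := (@lebesgue_measure R).
Local Notation RR := (measurableTypeR R).
Local Notation corr := (corr mu).
Local Notation conv := (conv mu).
Local Notation kt i t := (dil 2^-1 (gker mu i) t).
Local Notation Gm m := (dil 0 (g0 mu) m).
Local Notation cube k := (\1_(@cubeN R n k) : X -> R).
Implicit Types (x y z w : 'rV[R]_n) (f h F : X -> R).

Lemma cubeN_nd : nondecreasing_seq (@cubeN R n).
Proof.
move=> j k jk; apply/subsetPset => x H i; have := H i; rewrite !mxE => /andP[a b].
have jk' : j%:R <= k%:R :> R by rewrite ler_nat.
by apply/andP; split; lra.
Qed.

(** Reduces global L^1 bounds to cubes, on which compactly supported test functions and finite
    measure are available. *)
Lemma L1_cubes (v : X -> R) (B : R) : measurable_fun setT v ->
  (forall k, L1 mu (fun x => `|v x| * cube k x) /\ \int[mu]_x (`|v x| * cube k x) <= B) ->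
  L1 mu v /\ \int[mu]_x `|v x| <= B.
Proof.
move=> mv H; apply: L1_abs_bound => //; rewrite -(@cubeN_cover R n).
have mn : measurable_fun setT (fun x : X => `|v x|) by exact: measurableT_comp.
apply: integral_bigcup_le.
- exact: cubeN_nd.
- by move=> k; exact: measurable_cbox.
- exact/measurable_EFinP.
- by move=> x; rewrite lee_fin.
- move=> k; have [L b] := H k; rewrite integral_mkcond -lee_fin in b *.
  apply: le_trans b; rewrite EFin_Rint// le_eqVlt; apply/orP; left; apply/eqP.
  apply: eq_integral => x _; rewrite /patch indicE; case: ifP => _; first by rewrite mulr1.
  by rewrite mulr0.
Qed.

Lemma corr_bounded (k g : X -> R) (S : R) x : L1 mu k -> measurable_fun setT g -> (forall y, `|g y| <= S) ->
  `|corr k g x| <= S * \int[mu]_z `|k z|.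
Proof.
move=> Lk mg gS; have Lks := L1_sub Hmu x Lk.
have mk := L1_measurable Lk.
rewrite -(Rint_sub Hmu x (k := fun z => `|k z|)); last exact: measurableT_comp.
rewrite -RintZl; last exact: L1_norm.
apply: Rint_norm_le; [|exact/L1Zl/L1_norm|].
  by apply: measurable_funM => //; exact: L1_measurable Lks.
by move=> y; rewrite normrM ler_wpM2r.
Qed.

Lemma Gm_est m : 0 < m -> [/\ L1 mu (Gm m), \int[mu]_z `|Gm m z| = 1 &
  forall z, `|Gm m z| <= (gI mu)^-1 * m `^ (- (n%:R / 2))].
Proof.
move=> m0; have gI0 := gI_gt0 Hmu; have [H [M [tK _]]] := profile_g0 Hmu.
have g00 z : 0 <= g0 mu z by rewrite mulr_ge0 ?invr_ge0 ?ge_ge0// ltW.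
have LK := tame_L1 tK.
split; first exact: dil_L1.
  rewrite dil_int_norm// oppr0 powRr0 mul1r -[RHS](Rint_g0 Hmu).
  by apply: eq_RintX => z; rewrite ger0_norm.
move=> z; rewrite g0E// ger0_norm ?mulr_ge0 ?invr_ge0 ?powR_ge0 ?expR_ge0 ?(ltW gI0)//.
rewrite ler_piMr ?mulr_ge0 ?invr_ge0 ?powR_ge0 ?(ltW gI0)//.
by rewrite -expR0 ler_expR oppr_le0 divr_ge0 ?sqn_ge0// ltW.
Qed.

Section operator.
Variables (alpha b : R) (lam : {sigma_finite_measure set RR -> \bar R}) (om : RR -> R).
Hypotheses (Hw : is_weight b lam om) (b2 : b < 2^-1).

Local Notation Ks i m := (superk lam om 2^-1 m (gker mu i)).

(* T is the i-th component of the fractional gradient up to the constant kap. *)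
Definition bv_op i (kap : R) (T : (X -> R) -> X -> R) : Prop :=
  [/\ 0 < kap,
   forall rho, Cc rho -> [/\ L1 mu (T rho), exists M, forall x, `|T rho x| <= M,
     forall x, divg mu alpha (fun y => rho y *: (delta_mx 0 i : 'rV[R]_n)) x = kap * T rho x &
     forall h x, L1 mu h -> T (conv rho h) x = conv (T rho) h x] &
   forall m h x, 0 < m -> L1 mu h -> T (conv (Gm m) h) x = conv (Ks i m) h x].

Section bounds.
Variables (i : 'I_n) (kap : R) (T : (X -> R) -> X -> R).
Hypothesis HT : bv_op i kap T.
Variables (f F : X -> R).
Hypothesis fF : sum_dom mu f F.
Hypothesis BVf : forall phi, unit_test_field phi -> \int[mu]_x (f x * divg mu alpha phi x) <= 1.

(** Duality: the sign of the correlation, cut off to a cube and mollified by [rho], is an admissible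
    test function. As [T] commutes with convolution, testing [f] with it returns the L^1 norm on the
    cube, times [kap]. *)
Let mollified rho : Cc rho -> (forall x, 0 <= rho x) -> \int[mu]_x rho x = 1 ->
  L1 mu (corr (T rho) f) /\ \int[mu]_x `|corr (T rho) f x| <= kap^-1.
Proof.
move=> Cr r0 r1; have [kap0 hT _] := HT; have [LT [MT TM] dT cT] := hT rho Cr.
have mv : measurable_fun setT (corr (T rho) f : X -> R).
  by have [mf _ _] := fF; apply: measurable_corr => //; exact: L1_measurable LT.
have [_ _] := corr_bound Hmu 0 fF LT TM.
pose S := \int[mu]_y `|T rho y| + MT * \int[mu]_y `|F y|.
have vS x : `|corr (T rho) f x| <= S by have [] := corr_bound Hmu x fF LT TM.
apply: L1_cubes => // k.
pose h (x : X) := Num.sg (corr (T rho) f x) * cube k x.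
have msg : measurable_fun setT (fun x : X => Num.sg (corr (T rho) f x)).
  rewrite (_ : (fun _ => _) = (fun x : X => (0 < corr (T rho) f x)%R%:R - (corr (T rho) f x < 0)%R%:R)).
    by apply: measurable_funB; apply: measurable_lt01.
  apply/funext => x; case: (ltgtP 0 (corr (T rho) f x)) => [v0|v0|<-].
  - by rewrite gtr0_sg// subr0.
  - by rewrite ltr0_sg// sub0r.
  - by rewrite sgr0 subr0.
have mi : measurable_fun setT (cube k) by apply: measurable_indic; exact: measurable_cbox.
have sg1 x : `|Num.sg (corr (T rho) f x)| <= 1 by rewrite normr_sg; case: (_ != 0).
have Lc := L1_cube Hmu k.
have c1 x : `|cube k x| <= 1 by rewrite indicE; case: (_ \in _); rewrite ?normr1 ?normr0.
have Lh : L1 mu h.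
  by apply: (eq_L1 _ (L1M_bounded Lc msg sg1)) => x; rewrite mulrC.
have h1 x : `|h x| <= 1 by rewrite normrM mulr_ile1.
have hs x j : k%:R < `|x 0 j| -> h x = 0.
  move=> xj; rewrite /h indicE memNset ?mulr0//= => /(_ j); rewrite !mxE -ler_norml.
  by rewrite leNgt xj.
have Ev x : corr (T rho) f x * h x = `|corr (T rho) f x| * cube k x.
  by rewrite /h mulrA [_ * Num.sg _]mulrC -normrEsg.
have [LA LB E] := corr_adjoint Hmu fF LT TM Lh.
split; first by apply: (eq_L1 _ LA) => x; rewrite Ev.
rewrite -(eq_RintX mu Ev) E.
have Cch : Cc (conv rho h) by exact: (Cc_conv Hmu Cr Lh hs).
have [_ _ dTh _] := hT _ Cch.
(* Averaging a function bounded by 1 against the probability density [rho] keeps the bound 1. *)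
have tf : unit_test_field (fun y => conv rho h y *: (delta_mx 0 i : 'rV[R]_n)).
  split; first exact: test_field_scale.
  move=> x; rewrite enorm_delta.
  have [Hr [Mr tr]] := Cc_tame Hmu Cr.
  have Lr := tame_L1 tr.
  rewrite -r1 -(Rint_refl Hmu x (f := rho)); last exact: L1_measurable Lr.
  apply: Rint_norm_le; [|exact: (L1_refl Hmu x Lr)|].
    exact: L1_measurable (L1_conv_int Hmu x Lr (tame_bound tr) Lh).
  by move=> y; rewrite normrM (ger0_norm (r0 _)) ler_piMr.
have := BVf tf.
rewrite (@eq_RintX _ _ mu _ (fun x => kap * (f x * conv (T rho) h x))); last first.
  by move=> x; rewrite dTh cT// mulrCA.
by rewrite RintZl// -ler_pdivlMl// mulr1.
Qed.

Let g m : X -> R := corr (Ks i m) f.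

Let Kest m : 0 < m -> [/\ L1 mu (Ks i m), exists M, forall z, `|Ks i m z| <= M,
  measurable_fun setT (g m), exists S, forall x, `|g m x| <= S &
  exists L, 0 <= L /\ forall x z, `|g m (x + z) - g m x| <= L * nrm z].
Proof.
move=> m0; have [H [M [tK _]]] := profile_gker Hmu i.
have [H' [M' tKs]] := superk_is_tame Hmu Hw b2 m0 tK.
have LKs := tame_L1 tKs; have KM := tame_bound tKs; have [mf _ _] := fF.
split => //.
- by exists M'.
- by apply: measurable_corr => //; exact: L1_measurable LKs.
- by exists (\int[mu]_y `|Ks i m y| + M' * \int[mu]_y `|F y|) => x; have [] := corr_bound Hmu x fF LKs KM.
- have M'0 : 0 <= M' by exact: le_trans (normr_ge0 _) (KM 0).
  have I0 : 0 <= 2 * (\int[mu]_y H' y + M' * \int[mu]_y `|F y|).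
    rewrite mulr_ge0// addr_ge0 ?mulr_ge0 ?Rintegral_ge0// => y _; exact: (tame_ge0 tKs).
  exists (2 * (\int[mu]_y H' y + M' * \int[mu]_y `|F y|)); split => // x z.
  rewrite (le_trans (corr_tame Hmu x z fF tKs))// mulrC ler_wpM2l// ge_min lexx orbT//.
Qed.

Let S m : R := kap^-1 * ((gI mu)^-1 * m `^ (- (n%:R / 2))).

(** The witness is the average of [g m] against a narrow bump. Read with the kernels in the other
    order, it is a Gaussian average of a mollified correlation, and so inherits its bounds; the
    Lipschitz bound on [g m] gives the closeness. *)
Let approx m e : 0 < m -> 0 < e -> exists u : X -> R,
  [/\ L1 mu u, \int[mu]_x `|u x| <= kap^-1, forall x, `|u x| <= S m & forall x, `|u x - g m x| <= e].
Proof.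
move=> m0 e0; have [LK [MK KM] mg [Sg gS] [L [L0 gL]]] := Kest m0.
have [kap0 hT hG] := HT.
(* Width of the bump: an increment of l^1 length at most n d changes [g m] by at most e. *)
pose d := e / (L * n%:R + 1).
have Ln0 : 0 < L * n%:R + 1 by rewrite ltr_wpDl// mulr_ge0.
have d0 : 0 < d by rewrite divr_gt0.
have [rho [Cr r0 rs r1]] := bump_exists Hmu d0.
have [Hr [Mr tr]] := Cc_tame Hmu Cr; have Lr := tame_L1 tr; have rM := tame_bound tr.
have [LT [MT TM] _ cT] := hT rho Cr.
have [LG IG GM] := Gm_est m0.
have [Lv Bv] := mollified Cr r0 r1.
have E x : corr (Gm m) (corr (T rho) f) x = corr rho (g m) x.
  rewrite (corr_corr Hmu x fF LG GM LT TM) (corr_corr Hmu x fF Lr rM LK KM).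
  apply: eq_RintX => y; congr (_ * _).
  rewrite -cT// -hG//; congr (T _ _); apply/funext => z.
  exact: (convC Hmu z (L1_measurable Lr) (L1_measurable LG)).
have [Lc Bc] := corr_L1 Hmu Lv LG.
exists (corr rho (g m)); split.
- by apply: (eq_L1 _ Lc) => x; rewrite E.
- rewrite (@eq_RintX _ _ mu _ (fun x => `|corr (Gm m) (corr (T rho) f) x|)); last by move=> x; rewrite E.
  by rewrite (le_trans Bc)// IG mul1r.
- move=> x; rewrite -E.
  have I1 : `|corr (Gm m) (corr (T rho) f) x| <=
      \int[mu]_y ((gI mu)^-1 * m `^ (- (n%:R / 2)) * `|corr (T rho) f y|).
    apply: Rint_norm_le; [|exact/L1Zl/L1_norm|].
      apply: measurable_funM; first exact: L1_measurable Lv.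
      exact: L1_measurable (L1_sub Hmu x LG).
    by move=> y; rewrite normrM mulrC ler_wpM2r.
  rewrite (le_trans I1)// RintZl; last exact: L1_norm.
  rewrite /S mulrC ler_wpM2r// mulr_ge0 ?powR_ge0// invr_ge0 ltW//; exact: gI_gt0.
- move=> x; have Lrs := L1_sub Hmu x Lr.
  have -> : g m x = \int[mu]_y (g m x * rho (y - x)).
    by rewrite RintZl// (Rint_sub Hmu x (L1_measurable Lr)) r1 mulr1.
  have Lgr : L1 mu (fun y : X => g m y * rho (y - x)).
    by apply: (eq_L1 _ (L1M_bounded Lrs mg gS)) => y; rewrite mulrC.
  have LgB := L1B Lgr (L1Zl (g m x) Lrs).
  have -> : corr rho (g m) x - \int[mu]_y (g m x * rho (y - x)) =
      \int[mu]_y (g m y * rho (y - x) - g m x * rho (y - x)).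
    exact: (esym (RintB Lgr (L1Zl (g m x) Lrs))).
  apply: (@le_trans _ _ (\int[mu]_y (e * rho (y - x)))); last first.
    by rewrite RintZl// (Rint_sub Hmu x (L1_measurable Lr)) r1 mulr1.
  apply: Rint_norm_le; [exact: L1_measurable LgB|exact: L1Zl|].
  move=> y; rewrite -mulrBl normrM (ger0_norm (r0 _)).
  have [far|/forallNP near] := pselect (exists j, d < `|(y - x) 0 j|).
    by case: far => j yj; rewrite (rs (y - x) j)// !mulr0.
  rewrite ler_wpM2r//.
  have := gL x (y - x); rewrite [x + _]addrC subrK => h; apply: (le_trans h).
  have N : nrm (y - x) <= n%:R * d.
    rewrite -[n in n%:R]card_ord -sum1_card natr_sum mulr_suml; apply: ler_sum => j _.
    by rewrite mul1r leNgt; apply/negP; exact: near.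
  apply: (@le_trans _ _ (L * (n%:R * d))); first by rewrite ler_wpM2l.
  by rewrite mulrA /d mulrCA ler_piMr ?(ltW e0)// ler_pdivrMr// mul1r lerDl.
Qed.

(** Removes the mollifier. The uniform error passes to the sup norm at once, and to the L^1 norm on
    each cube because cubes have finite measure. *)
Lemma bv_bound m : 0 < m -> [/\ L1 mu (corr (Ks i m) f),
  \int[mu]_x `|corr (Ks i m) f x| <= kap^-1 &
  forall x, `|corr (Ks i m) f x| <= kap^-1 * ((gI mu)^-1 * m `^ (- (n%:R / 2)))].
Proof.
move=> m0; have [LK [MK KM] mg [Sg gS] _] := Kest m0.
have [L B] : L1 mu (g m) /\ \int[mu]_x `|g m x| <= kap^-1.
  apply: L1_cubes => // k; have Lc := L1_cube Hmu k.
  have mn : measurable_fun setT (fun x : X => `|g m x|) by exact: measurableT_comp.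
  have L : L1 mu (fun x => `|g m x| * cube k x).
    apply: (eq_L1 _ (L1M_bounded (M := Sg) Lc mn _)) => x; first by rewrite mulrC.
    by rewrite normr_id.
  split => //; apply/ler_addgt0Pr => e e0.
  pose I := \int[mu]_x cube k x.
  have I0 : 0 <= I by exact: Rintegral_ge0.
  have e'0 : 0 < e / (I + 1) by rewrite divr_gt0// ltr_wpDl.
  have [u [Lu u1 _ ug]] := approx m0 e'0.
  apply: (@le_trans _ _ (\int[mu]_x (`|u x| + e / (I + 1) * cube k x))).
    apply: Rint_le => //; first by apply: L1D; [exact: L1_norm|exact: L1Zl].
    move=> x; have := ug x; rewrite indicE; case: (_ \in _); rewrite ?mulr1 ?mulr0 ?addr0// => h.
    have : `|g m x| <= `|u x| + `|u x - g m x|.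
      by rewrite -[X in `|X| <= _](subKr (u x)) (le_trans (ler_normB _ _)).
    lra.
  rewrite RintD; [|exact: L1_norm|exact: L1Zl].
  rewrite lerD// RintZl// mulrAC ler_pdivrMr ?ltr_wpDl// ler_wpM2l ?(ltW e0)//.
  by rewrite lerDl.
split => // x; apply/ler_addgt0Pr => e e0; have [u [_ _ uS ug]] := approx m0 e0.
have : `|g m x| <= `|u x| + `|u x - g m x|.
  by rewrite -[X in `|X| <= _](subKr (u x)) (le_trans (ler_normB _ _)).
by have := ug x; have := uS x; rewrite /S /g; lra.
Qed.

End bounds.

(** Reflecting the kernel turns the convolution into a correlation, for which the exchange is
    known. *)
Lemma conv_superk d K M h r y : b < d -> 0 < r -> L1 mu K -> (forall z, `|K z| <= M) -> L1 mu h ->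
  L1 lam (fun t => om t * conv (dil d K (r + t)) h y) /\
  conv (superk lam om d r K) h y = \int[lam]_t (om t * conv (dil d K (r + t)) h y).
Proof.
move=> bd r0 LK KM Lh; have n0 : 0 <= n%:R / 2 :> R by rewrite divr_ge0.
have [A1 [_ H1]] := om_power Hw bd.
have bd' : b < d + n%:R / 2 by exact: ltr_wpDr.
have [A2 [_ H2]] := om_power Hw bd'.
have omr t : om t != 0 -> 0 < r + t by move=> oN; exact: lt_le_trans (om_pos Hw r0 oN).
pose K' (z : X) := K (- z).
have LK' : L1 mu K' by apply: (eq_L1 _ (L1_refl Hmu 0 LK)) => z; rewrite add0r.
have KM' z : `|K' z| <= M by exact: KM.
have Ed t z : dil d K' t z = dil d K t (- z) by rewrite /dil /K' scalerN.
have Es z : superk lam om d r K' z = superk lam om d r K (- z).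
  by apply: eq_Rint => t; rewrite Ed.
have Ec t : conv (dil d K t) h y = corr (dil d K' t) h y.
  by apply: eq_RintX => x; rewrite Ed opprB mulrC.
have [L E] := corr_superk Hmu (om_measurable Hw) (om_ge0 Hw) omr (H1 r r0).1 (H2 r r0).1
  (L1_sum_dom Lh) LK' KM' y.
split; first by apply: (eq_L1 _ L) => t; rewrite Ec.
have -> : conv (superk lam om d r K) h y = corr (superk lam om d r K') h y.
  by apply: eq_RintX => x; rewrite Es opprB mulrC.
by rewrite E; apply: eq_Rint => t; rewrite Ec.
Qed.

Let gkL i t : 0 < t -> L1 mu (kt i t).
Proof. by move=> t0; apply: dil_L1 => //; have [H [M [tK _]]] := profile_gker Hmu i; exact: tame_L1 tK. Qed.

Let gkM i t : exists M, forall z, `|kt i t z| <= M.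
Proof.
have [H [M [tK _]]] := profile_gker Hmu i.
by exists (t `^ (- (2^-1 + n%:R / 2)) * M) => z; apply: dil_bound; exact: tame_bound tK.
Qed.

(** The time is split as (m/2 + t) + m/2, one gradient going to each factor: the variation controls
    the superposed gradient at time m/2. *)
Lemma superk_lker m y : 0 < m -> superk lam om 1 m (lker mu) y =
  \sum_i conv (Ks i (m / 2)) (kt i (m / 2)) y.
Proof.
move=> m0; have h0 : 0 < m / 2 by rewrite divr_gt0.
have C i : L1 lam (fun t => om t * conv (kt i (m / 2 + t)) (kt i (m / 2)) y) /\
    conv (Ks i (m / 2)) (kt i (m / 2)) y = \int[lam]_t (om t * conv (kt i (m / 2 + t)) (kt i (m / 2)) y).
  have [H [M [tK _]]] := profile_gker Hmu i.
  exact: (conv_superk y b2 h0 (tame_L1 tK) (tame_bound tK) (gkL i h0)).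
rewrite (eq_bigr _ (fun i _ => (C i).2)) -Rint_sum; last by move=> i; exact: (C i).1.
apply: eq_Rint => t; rewrite -mulr_sumr.
have [z0|zN] := eqVneq (om t) 0; first by rewrite z0 !mul0r.
have t0 : 0 < m / 2 + t by exact: lt_le_trans (om_pos Hw h0 zN).
congr (_ * _); rewrite [RHS](conv_gker_gker Hmu y t0 h0).
by congr (dil _ _ _ _); field.
Qed.

(** Of the two derivatives in the Laplacian, one is paid by the variation, the other by the L^1 norm
    of order m^(-1/2) of a Gaussian gradient. The constants [c1] and [c2] come from halving the
    time. *)
Lemma lker_bound (kap : 'I_n -> R) (T : 'I_n -> (X -> R) -> X -> R) :
  (forall i, bv_op i (kap i) (T i)) -> exists C, 0 <= C /\ forall f F, sum_dom mu f F ->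
  (forall phi, unit_test_field phi -> \int[mu]_x (f x * divg mu alpha phi x) <= 1) ->
  forall m, 0 < m -> [/\ L1 mu (corr (superk lam om 1 m (lker mu)) f),
    \int[mu]_x `|corr (superk lam om 1 m (lker mu)) f x| <= C * m `^ (- 2^-1) &
    forall x, `|corr (superk lam om 1 m (lker mu)) f x| <= C * m `^ (- 2^-1 - n%:R / 2)].
Proof.
move=> HT.
pose A i := \int[mu]_z `|gker mu i z|.
have A0 i : 0 <= A i by exact: Rintegral_ge0.
have kap0 i : 0 <= (kap i)^-1 by rewrite invr_ge0; have [k0 _ _] := HT i; exact: ltW.
have gI0 : 0 <= (gI mu)^-1 by rewrite invr_ge0 ltW// gI_gt0.
pose c1 : R := 2^-1 `^ (- 2^-1); pose c2 : R := 2^-1 `^ (- (n%:R / 2)).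
pose C := \sum_i (A i * c1 * (kap i)^-1 * (1 + (gI mu)^-1 * c2)).
have C0 : 0 <= C by apply: sumr_ge0 => i _; rewrite !mulr_ge0 ?powR_ge0// addr_ge0// mulr_ge0 ?powR_ge0.
exists C; split => // f F fF BVf m m0; have h0 : 0 < m / 2 by rewrite divr_gt0.
pose g i := corr (Ks i (m / 2)) f.
have gb i := bv_bound (HT i) fF BVf h0.
have E x : corr (superk lam om 1 m (lker mu)) f x = \sum_i corr (kt i (m / 2)) (g i) x.
  have Lc i : L1 mu (fun y : X => f y * conv (Ks i (m / 2)) (kt i (m / 2)) (y - x)).
    have [H [M [tK _]]] := profile_gker Hmu i.
    have [H' [M' tKs]] := superk_is_tame Hmu Hw b2 h0 tK.
    have LKs := tame_L1 tKs; have KM := tame_bound tKs.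
    have [Mk kM] := gkM i (m / 2).
    apply: (corr_bound Hmu x fF (L1_convol Hmu LKs KM (gkL i h0)) _).1.
    by move=> y; exact: (conv_bound Hmu y LKs KM (gkL i h0)).
  rewrite /corr (@eq_RintX _ _ mu _ (fun y => \sum_i f y * conv (Ks i (m / 2)) (kt i (m / 2)) (y - x))); last first.
    by move=> y; rewrite superk_lker// mulr_sumr.
  rewrite Rint_sum//; apply: eq_bigr => i _.
  have [H [M [tK _]]] := profile_gker Hmu i.
  have [H' [M' tKs]] := superk_is_tame Hmu Hw b2 h0 tK.
  have [Mk kM] := gkM i (m / 2).
  by rewrite [RHS](corr_corr Hmu x fF (gkL i h0) kM (tame_L1 tKs) (tame_bound tKs)).
have mE (e : R) : (m / 2) `^ e = 2^-1 `^ e * m `^ e by rewrite mulrC powRM// ltW.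
have Ik i : \int[mu]_z `|kt i (m / 2) z| = A i * c1 * m `^ (- 2^-1).
  have [H [M [tK _]]] := profile_gker Hmu i.
  have LK := tame_L1 tK.
  by rewrite dil_int_norm// mE /c1 /A; ring.
have T1 i : L1 mu (corr (kt i (m / 2)) (g i)) /\
    \int[mu]_x `|corr (kt i (m / 2)) (g i) x| <= A i * c1 * (kap i)^-1 * m `^ (- 2^-1).
  have [Lg g1 _] := gb i; have [L B] := corr_L1 Hmu Lg (gkL i h0).
  split => //; rewrite (le_trans B)// Ik [leRHS]mulrAC ler_wpM2l//.
  by rewrite !mulr_ge0 ?powR_ge0.
have T2 i x : `|corr (kt i (m / 2)) (g i) x| <=
    A i * c1 * (kap i)^-1 * ((gI mu)^-1 * c2) * m `^ (- 2^-1 - n%:R / 2).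
  have [Lg _ gS] := gb i.
  rewrite (le_trans (corr_bounded x (gkL i h0) (L1_measurable Lg) gS))// Ik mE powRD_gt0//.
  by rewrite /c2 le_eqVlt; apply/orP; left; apply/eqP; ring.
have L : L1 mu (corr (superk lam om 1 m (lker mu)) f).
  apply: (eq_L1 _ (L1_sum (index_enum 'I_n) (fun i => (T1 i).1))) => x; by rewrite E.
split => //.
- apply: (@le_trans _ _ (\int[mu]_x \sum_i `|corr (kt i (m / 2)) (g i) x|)).
    apply: (Rint_le (L1_norm L) (L1_sum (index_enum 'I_n) (fun i => L1_norm (T1 i).1))) => x.
    by rewrite E; exact: ler_norm_sum.
  rewrite (Rint_sum (index_enum 'I_n) (fun i => L1_norm (T1 i).1)) /C mulr_suml.
  apply: ler_sum => i _; rewrite (le_trans (T1 i).2)// ler_wpM2r ?powR_ge0// ler_peMr//.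
    by rewrite !mulr_ge0 ?powR_ge0.
  by rewrite lerDl mulr_ge0 ?powR_ge0.
- move=> x; rewrite E (le_trans (ler_norm_sum _ _ _))// /C mulr_suml.
  apply: ler_sum => i _; rewrite (le_trans (T2 i x))// ler_wpM2r ?powR_ge0// ler_wpM2l//.
    by rewrite !mulr_ge0 ?powR_ge0.
  by rewrite lerDr.
Qed.

End operator.

Lemma bv_op_frac alpha i : 0 < alpha -> alpha < 1 ->
  bv_op alpha leb (pw ((1 - alpha) / 2)) i (frac_cst mu alpha) (Tg mu ((1 - alpha) / 2) i).
Proof.
move=> a0 a1.
have b0 : 0 < (1 - alpha) / 2 by rewrite divr_gt0// subr_gt0.
have b2 : (1 - alpha) / 2 < 2^-1 by lra.
split; first exact: frac_cst_gt0.
- move=> rho Cr; have [H [M tr]] := Cc_tame Hmu Cr; split.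
  + exact: (Tg_L1 Hmu b0 b2 i tr).
  + by have [C [_ HC]] := Tg_int Hmu b0 b2 i tr; exists C => x; have [] := HC x.
  + move=> x; rewrite /divg lt_eqF// frac_divE//.
      congr (_ * _); rewrite (bigD1 i)//= big1 ?addr0.
        rewrite (_ : (fun y => (rho y *: delta_mx 0 i) 0 i) = rho)//.
        by apply/funext => y; rewrite !mxE !eqxx mulr1.
      move=> j ji; rewrite /Tg (@eq_Rint _ _ _ leb _ (fun=> 0)) ?Rint0// => t.
      rewrite /conv (@eq_RintX _ _ mu _ (fun=> 0)) ?Rint0 ?mulr0// => y.
      by rewrite !mxE (negbTE ji) andbF mulr0 mulr0.
    move=> j; have [ji|ji] := eqVneq j i.
      exists H, M; rewrite (_ : (fun y => _) = rho)//; apply/funext => y.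
      by rewrite !mxE ji !eqxx mulr1.
    exists (fun=> 0), 0; rewrite (_ : (fun y => _) = fun=> 0); last first.
      by apply/funext => y; rewrite !mxE (negbTE ji) andbF mulr0.
    split => //; [by move=> x'; rewrite normr0|by move=> x' z; rewrite subrr normr0 addr0 mulr0|exact: L10].
  + by move=> h x' Lh; rewrite (conv_Tg Hmu b0 b2 i tr).
- move=> m h x m0 Lh.
  have [H [M [tg _]]] := profile_g0 Hmu.
  have tG := tame_dil Hmu 0 m0 tg.
  have E : Tg mu ((1 - alpha) / 2) i (Gm m) = superk leb (pw ((1 - alpha) / 2)) 2^-1 m (gker mu i).
    by apply/funext => z; exact: Tg_gauss.
  by rewrite -E; exact: (esym (conv_Tg Hmu b0 b2 i tG x Lh)).
Qed.

(** With the Dirac weight the superposed kernel reduces to the Gaussian gradient at time m. *)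
Lemma bv_op_classical i :
  bv_op 1 (\d_(0 : RR)) (fun t => (0 <= t)%R%:R) i 1 (fun u => 'D_(delta_mx 0 i : 'rV[R]_n) u).
Proof.
split => //.
- move=> rho Cr; have CD := Cc_deriv (delta_mx 0 i) Cr.
  have [H [M tD]] := Cc_tame Hmu CD.
  split; first exact: tame_L1 tD.
  + by exists M; exact: tame_bound tD.
  + move=> x; rewrite /divg eqxx mul1r /classical_div (bigD1 i)//= big1 ?addr0.
      congr ('D_ _ _ _); apply/funext => y; by rewrite !mxE !eqxx mulr1.
    move=> j ji; rewrite (_ : (fun y => _) = fun=> 0); first exact: derive_cst.
    by apply/funext => y; rewrite !mxE (negbTE ji) andbF mulr0.
  + by move=> h x Lh; exact: (@derive_val _ _ _ _ _ _ _ (Cc_conv_derive Hmu x (delta_mx 0 i) Cr Lh)).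
- move=> m h x m0 Lh.
  have [H [M [tg _]]] := profile_g0 Hmu; have tG := tame_dil Hmu 0 m0 tg.
  have [H' [M' [tk _]]] := profile_gker Hmu i; have tK := tame_dil Hmu 2^-1 m0 tk.
  have Es z : superk (\d_(0 : RR)) (fun t => (0 <= t)%R%:R) 2^-1 m (gker mu i) z = kt i m z.
    rewrite /superk /Rintegral integral_dirac//; last first.
      apply/measurable_EFinP; apply: measurable_funM; first exact: measurable_le01.
      apply: (measurableT_comp (measurable_dil 2^-1 (tame_measurable tk)) (g := fun t : RR => (m + t : RR, z : X))).
      by apply: measurable_fun_pair => //; exact: measurable_funD.
    by rewrite diracT mul1e /= lexx mul1r addr0.
  rewrite (_ : superk _ _ _ _ _ = kt i m); last exact/funext.
  have D y : is_derive y (delta_mx 0 i : 'rV[R]_n) (Gm m) (kt i m y).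
    have sqE (s : R) : sqn (s *: delta_mx 0 i + y) = sqn y + 2 * y 0 i * s + s * s.
      rewrite !sqnE (bigD1 i)//= [in RHS](bigD1 i)//= (eq_bigr (fun j => y 0 j ^+ 2)); last first.
        by move=> j ji; rewrite !mxE (negbTE ji) andbF mulr0 add0r.
      rewrite !mxE !eqxx mulr1; ring.
    have mn : m != 0 by rewrite gt_eqF.
    pose q (s : R) : R := - ((sqn y + 2 * y 0 i * s + s * s) / m).
    have D1 : is_derive (0 : R) 1 q (- (2 * y 0 i / m)).
      (* Along a line the exponent is an exact quadratic, so the remainder equals -s^2/m. *)
      apply: (@is_derive_bound _ _ q 0 1 _ m^-1) => s.
      have -> : q (s *: (1 : R) + 0) - q 0 - s * - (2 * y 0 i / m) = - (m^-1 * s ^+ 2).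
        by rewrite /q /GRing.scale/= mulr1 addr0; field.
      by rewrite normrN ger0_norm// mulr_ge0 ?sqr_ge0// invr_ge0 ltW.
    pose c := (gI mu)^-1 * m `^ (- (n%:R / 2)).
    have D2 := @is_deriveZ _ _ _ (expR \o q) c _ _ _ (is_derive1_comp (is_derive_expR (q 0)) D1).
    apply: is_derive_line0.
    rewrite (_ : (fun s : R => Gm m (s *: delta_mx 0 i + y)) = c \*: (expR \o q)).
      apply: (is_derive_eq D2); rewrite gkerE// g0E// /GRing.scale/= /c /q !mulr0 !addr0.
      ring.
    by apply/funext => s; rewrite g0E// sqE.
  set MG := _ * (_ * M) in tG; set MK := _ * (_ * M') in tK.
  have MK0 : 0 <= MK by exact: le_trans (normr_ge0 _) (tame_bound tK 0).
  apply: (@derive_val _ _ _ _ _ _ _ (@is_derive_conv _ _ _ Hmu _ _ (2 * MK) (Num.max MG MK) h x _ D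
    (tame_L1 tG) (tame_L1 tK) _ _ _ _ Lh)).
  + by move=> y; rewrite le_max (tame_bound tG).
  + by move=> y; rewrite le_max (tame_bound tK) orbT.
  + move=> y z; have [_ _ L HM _] := tK; rewrite (le_trans (L y z))// mulrC.
    have H0 := tame_ge0 tK.
    apply: ler_pM => //; [by rewrite addr_ge0|by rewrite le_min ler01 nrm_ge0| |by rewrite ge_min lexx orbT].
    by have := HM y; have := HM (y + z); lra.
  + by rewrite mulr_ge0.
Qed.

End variation_bounds.

(** Dominated convergence for sequences eventually constant at each point, the situation of the
    truncations in time and of the box cut-offs. *)
Lemma Rint_dominated (R : realType) d (T : measurableType d) (m : {measure set T -> \bar R})
    (f_ : nat -> T -> R) (f g : T -> R) :
  (forall k, measurable_fun setT (f_ k)) -> measurable_fun setT f -> L1 m g ->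
  (forall k (x : T), `|f_ k x| <= g x) ->
  (forall x : T, exists N, forall k, (N <= k)%N -> f_ k x = f x) ->
  forall e, 0 < e ->
  exists N, forall k, (N <= k)%N -> `|\int[m]_x f_ k x - \int[m]_x f x| <= e.
Proof.
move=> mf_ mf Lg D P e e0.
have Lf : L1 m f.
  by apply: (L1_dom mf Lg) => x; have [N HN] := P x; rewrite -(HN N).
have c1 : {ae m, forall x, setT x -> (f_ k x)%:E @[k --> \oo] --> (f x)%:E}.
  apply: aeW => x _; have [N HN] := P x; apply: cvg_near_cst.
  by exists N => // k /= Nk; rewrite HN.
have c2 : {ae m, forall x k, setT x -> (`|(f_ k x)%:E| <= (g x)%:E)%E}.
  by apply: aeW => x k _; rewrite lee_fin.
have [_ _ cv] := dominated_convergence measurableT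
  (fun k => proj2 (measurable_EFinP _ _) (mf_ k)) (proj2 (measurable_EFinP _ _) mf) c1 Lg c2.
rewrite -(EFin_Rint Lf) in cv.
have cf : \int[m]_x f_ k x @[k --> \oo] --> \int[m]_x f x by exact: fine_cvg cv.
move/cvgrPdist_le: cf => /(_ e e0) [N _ HN].
by exists N => k Nk; rewrite distrC; exact: HN.
Qed.

(** * Functions whose pairings vanish *)

Section null_functions.
Variables (R : realType) (n : nat).
Variable mu : {sigma_finite_measure set (Rn R n) -> \bar R}.
Hypothesis Hmu : is_lebesgue mu.
Local Notation X := (Rn R n).
Local Notation cube k := (\1_(@cubeN R n k) : X -> R).
Implicit Types (x y z w a b : 'rV[R]_n) (u v h : X -> R).

Lemma integral_indicM u A : measurable A ->
  (\int[mu]_(x in A) (u x)%:E = \int[mu]_x (u x * \1_A x)%:E)%E.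
Proof.
move=> mA; rewrite integral_mkcond; apply: eq_integral => x _.
by rewrite /patch indicE; case: ifP => _; rewrite ?mulr1 ?mulr0.
Qed.

Lemma density_measure u : measurable_fun setT u -> (forall x, 0 <= u x) ->
  exists nu : {measure set X -> \bar R}, forall A, nu A = (\int[mu]_(x in A) (u x)%:E)%E.
Proof.
move=> mu_ u0; pose dens (A : set X) : \bar R := (\int[mu]_(x in A) (u x)%:E)%E.
have d0 : dens set0 = 0%E by exact: integral_set0.
have dge A : (0 <= dens A)%E by apply: integral_ge0 => x _; rewrite lee_fin.
have dsa : semi_sigma_additive dens.
  move=> A mA tA mUA; rewrite /dens ge0_integral_bigcup//.
  - by apply: is_cvg_ereal_nneg_natsum_cond => k _ _; exact: dge.
  - by apply: measurable_funTS; exact/measurable_EFinP.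
  - by move=> x _; rewrite lee_fin.
pose nu : {measure set X -> \bar R} := HB.pack dens (isMeasure.Build _ _ _ dens d0 dge dsa).
by exists nu.
Qed.

Lemma cbox_cubeN a b : exists k, cbox a b `<=` @cubeN R n k.
Proof.
pose S := \sum_i (`|a 0 i| + `|b 0 i|).
exists (Num.truncn S).+1 => x xb i; rewrite !mxE.
have S1 : S <= (Num.truncn S).+1%:R by rewrite ltW// truncnS_gt.
have ai : `|a 0 i| + `|b 0 i| <= S by rewrite /S (bigD1 i)//= lerDl sumr_ge0// => j _; rewrite addr_ge0.
have /andP[x1 x2] := xb i; have bb := ler_norm (b 0 i).
have aa := ler_norm (- a 0 i); rewrite normrN in aa.
have a0 := normr_ge0 (a 0 i); have b0 := normr_ge0 (b 0 i).
by apply/andP; split; lra.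
Qed.

(** The positive and negative parts are densities of measures that agree on boxes, hence on Borel
    sets. On u > 0 the second measure is 0, on u < 0 the first is, so both parts vanish. *)
Lemma null_boxes u : measurable_fun setT u -> (forall k, L1 mu (fun x => u x * cube k x)) ->
  (forall a b, \int[mu]_x (u x * \1_(cbox a b) x) = 0) ->
  ae_eq mu setT u (cst 0).
Proof.
move=> mu_ Lu B.
pose up (x : X) : R := Num.max (u x) 0; pose um (x : X) : R := Num.max (- u x) 0.
have up0 x : 0 <= up x by rewrite /up le_max lexx orbT.
have um0 x : 0 <= um x by rewrite /um le_max lexx orbT.
have mup : measurable_fun setT (up : X -> R) by apply: measurable_maxr.
have mum : measurable_fun setT (um : X -> R).
  by apply: measurable_maxr => //; exact: measurableT_comp.
have uE x : up x - um x = u x.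
  by rewrite /up /um; case: (leP (u x) 0) => h1; case: (leP (- u x) 0) => h2; lra.
have upn x : up x <= `|u x| by rewrite /up ge_max ler_norm normr_ge0.
have umn x : um x <= `|u x| by rewrite /um ge_max normr_ge0 -normrN ler_norm.
have i1 (A : set X) x : 0 <= (\1_A x : R) by [].
have Lv v (A : set X) k : measurable_fun setT v -> (forall x, 0 <= v x) -> (forall x, v x <= `|u x|) ->
    measurable A -> A `<=` cubeN k -> L1 mu (fun x => v x * \1_A x).
  move=> mv v0 vu mA Ak; apply: (L1_dom _ (L1_norm (Lu k))).
    by apply: measurable_funM => //; exact: measurable_indic.
  move=> x; rewrite ger0_norm ?mulr_ge0// normrM (ger0_norm (i1 _ x)) !indicE.
  case: (boolP (x \in A)) => xA; last by rewrite mulr0 mulr_ge0.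
  have -> : x \in cubeN k by rewrite inE; apply: Ak; rewrite inE in xA.
  by rewrite !mulr1.
have [nu1 N1] := density_measure mup up0; have [nu2 N2] := density_measure mum um0.
have fin k : (nu1 (@cubeN R n k) < +oo)%E.
  rewrite N1 integral_indicM; last exact: measurable_cbox.
  by rewrite -(EFin_Rint (Lv up (cubeN k) k mup up0 upn (measurable_cbox _ _) (@subset_refl _ _))) ltry.
have box a b : (forall i, a 0 i <= b 0 i) -> nu1 (cbox a b) = nu2 (cbox a b).
  move=> ab; have [k Ak] := cbox_cubeN a b; have mA := measurable_cbox a b.
  have L1p := Lv up _ k mup up0 upn mA Ak; have L1m := Lv um _ k mum um0 umn mA Ak.
  have E : \int[mu]_x (up x * \1_(cbox a b) x - um x * \1_(cbox a b) x) = 0.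
    by rewrite -(B a b); apply: eq_RintX => x; rewrite -mulrBl uE.
  rewrite N1 N2 (integral_indicM up mA) (integral_indicM um mA) -(EFin_Rint L1p) -(EFin_Rint L1m).
  by congr EFin; apply/eqP; rewrite -subr_eq0 -(RintB L1p L1m) E eqxx.
have U := cbox_measure_unique fin box.
have mP : measurable [set x : X | 0 < u x].
  rewrite (_ : [set x | _] = setT `&` u @^-1` `]0, +oo[%classic); first exact: mu_.
  by apply/seteqP; split => x /=; rewrite in_itv/= andbT//; case.
have mN : measurable [set x : X | u x < 0].
  rewrite (_ : [set x | _] = setT `&` u @^-1` `]-oo, 0[%classic); first exact: mu_.
  by apply/seteqP; split => x /=; rewrite in_itv/=//; case.
have I1 : (\int[mu]_x (up x)%:E = 0)%E.
  transitivity (nu1 [set x : X | 0 < u x]).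
    rewrite N1 (integral_indicM up mP); apply: eq_integral => x _; congr EFin; rewrite indicE.
    case: (boolP (x \in _)); rewrite ?mulr1// notin_setE/= => /negP; rewrite -leNgt mulr0 => h.
    by rewrite /up; apply/max_idPr.
  rewrite (U _ mP) N2 (integral_indicM um mP); apply: integral0_eq => x _; congr EFin; rewrite indicE.
  case: (boolP (x \in _)); rewrite ?mulr0// inE/= mulr1 => h.
  by rewrite /um; apply/max_idPr; lra.
have I2 : (\int[mu]_x (um x)%:E = 0)%E.
  transitivity (nu2 [set x : X | u x < 0]).
    rewrite N2 (integral_indicM um mN); apply: eq_integral => x _; congr EFin; rewrite indicE.
    case: (boolP (x \in _)); rewrite ?mulr1// notin_setE/= => /negP; rewrite -leNgt mulr0 => h.
    by rewrite /um; apply/max_idPr; lra.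
  rewrite -(U _ mN) N1 (integral_indicM up mN); apply: integral0_eq => x _; congr EFin; rewrite indicE.
  case: (boolP (x \in _)); rewrite ?mulr0// inE/= mulr1 => h.
  by rewrite /up; apply/max_idPr; lra.
have I : (\int[mu]_x `|(u x)%:E| = 0)%E.
  transitivity (\int[mu]_x ((up x)%:E + (um x)%:E))%E.
    apply: eq_integral => x _; rewrite -EFinD/=; congr EFin; rewrite /up /um.
    by case: (leP (u x) 0) => h1; case: (leP (- u x) 0) => h2; rewrite ?(ger0_norm (ltW h1)) ?(ler0_norm h1); lra.
  rewrite ge0_integralD ?I1 ?I2 ?adde0//.
  - by move=> x _; rewrite lee_fin.
  - exact/measurable_EFinP.
  - by move=> x _; rewrite lee_fin.
  - exact/measurable_EFinP.
have [N [mN' N0 sN]] := (ae_eq_integral_abs mu measurableT (proj2 (measurable_EFinP _ _) mu_)).1 I.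
exists N; split => // x /= nu_; apply: sN => /= h; apply: nu_ => _.
have {}h : (u x)%:E = 0%E by exact: h.
by case: h.
Qed.

Lemma maxr0_lip (s t : R) : `|Num.max 0 s - Num.max 0 t| <= `|s - t|.
Proof.
have [s0|s0] := leP 0 s; have [t0|t0] := leP 0 t => //.
- by rewrite subr0 !ger0_norm; lra.
- by rewrite sub0r normrN ger0_norm// ler0_norm; lra.
- by rewrite subrr normr0.
Qed.

(** For ordered corners, the l^1 distance to the box. *)
Definition box_dist a b x : R := \sum_i (Num.max 0 (a 0 i - x 0 i) + Num.max 0 (x 0 i - b 0 i)).

Lemma box_dist_ge0 a b x : 0 <= box_dist a b x.
Proof. by apply: sumr_ge0 => i _; rewrite addr_ge0// le_max lexx. Qed.

Lemma box_dist_lip a b x z : `|box_dist a b (x + z) - box_dist a b x| <= 2 * nrm z.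
Proof.
rewrite /box_dist -sumrB /nrm mulr_sumr (le_trans (ler_norm_sum _ _ _))//; apply: ler_sum => i _.
have h1 := maxr0_lip (a 0 i - (x + z) 0 i) (a 0 i - x 0 i).
have h2 := maxr0_lip ((x + z) 0 i - b 0 i) (x 0 i - b 0 i).
rewrite (_ : a 0 i - (x + z) 0 i - (a 0 i - x 0 i) = - z 0 i) ?normrN in h1; last by rewrite mxE; ring.
rewrite (_ : (x + z) 0 i - b 0 i - (x 0 i - b 0 i) = z 0 i) in h2; last by rewrite mxE; ring.
rewrite (_ : _ - _ = (Num.max 0 (a 0 i - (x + z) 0 i) - Num.max 0 (a 0 i - x 0 i)) +
  (Num.max 0 ((x + z) 0 i - b 0 i) - Num.max 0 (x 0 i - b 0 i))); last by ring.
by rewrite (le_trans (ler_normD _ _))//; lra.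
Qed.

Lemma box_dist0 a b x : cbox a b x -> box_dist a b x = 0.
Proof.
move=> xb; apply: big1 => i _; have /andP[h1 h2] := xb i.
by rewrite (max_idPl _) ?(max_idPl _) ?addr0//; lra.
Qed.

Lemma box_dist_term a b x i :
  a 0 i - x 0 i <= box_dist a b x /\ x 0 i - b 0 i <= box_dist a b x.
Proof.
have H : Num.max 0 (a 0 i - x 0 i) + Num.max 0 (x 0 i - b 0 i) <= box_dist a b x.
  by rewrite /box_dist (bigD1 i)//= lerDl sumr_ge0// => j _; rewrite addr_ge0// le_max lexx.
have h1 : a 0 i - x 0 i <= Num.max 0 (a 0 i - x 0 i) by rewrite le_max lexx orbT.
have h2 : x 0 i - b 0 i <= Num.max 0 (x 0 i - b 0 i) by rewrite le_max lexx orbT.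
have h3 : 0 <= Num.max 0 (a 0 i - x 0 i) by rewrite le_max lexx.
have h4 : 0 <= Num.max 0 (x 0 i - b 0 i) by rewrite le_max lexx.
by split; lra.
Qed.

(** Equal to 1 on the box and to 0 once (k+1) times the distance reaches 1, hence eventually equal
    to the indicator at each point. *)
Definition box_fun a b (k : nat) x : R := Num.max 0 (1 - k.+1%:R * box_dist a b x).

Lemma box_fun_itv a b k x : 0 <= box_fun a b k x <= 1.
Proof.
rewrite /box_fun le_max lexx/= ge_max ler01/= gerBl mulr_ge0//; exact: box_dist_ge0.
Qed.

Lemma box_fun_lip a b k x z : `|box_fun a b k (x + z) - box_fun a b k x| <= k.+1%:R * 2 * nrm z.
Proof.
rewrite (le_trans (maxr0_lip _ _))// (_ : _ - _ = - (k.+1%:R * (box_dist a b (x + z) - box_dist a b x))); last by ring.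
by rewrite normrN normrM ger0_norm// -mulrA ler_wpM2l//; exact: box_dist_lip.
Qed.

Lemma box_fun_supp a b : exists N, forall k x, ~ @cubeN R n N x -> box_fun a b k x = 0.
Proof.
have [N HN] := cbox_cubeN (a - const_mx 1) (b + const_mx 1).
exists N => k x nx; rewrite /box_fun; apply/max_idPl; rewrite subr_le0.
have d1 : 1 <= box_dist a b x.
  rewrite leNgt; apply/negP => d1; apply: nx; apply: HN => i; rewrite !mxE.
  by have [h1 h2] := box_dist_term a b x i; apply/andP; split; lra.
by rewrite (le_trans d1)// ler_peMl ?(le_trans ler01 d1)// ler1n.
Qed.

(** Lipschitz cut-offs of boxes are tame, so tame functions already separate functions up to null
    sets. *)
Lemma null_tame u : measurable_fun setT u -> (forall k, L1 mu (fun x => u x * cube k x)) ->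
  (forall h H M, tame mu h H M -> \int[mu]_x (u x * h x) = 0) ->
  ae_eq mu setT u (cst 0).
Proof.
move=> mu_ Lu T; apply: null_boxes => // a b.
have [N HN] := box_fun_supp a b.
have mh k : measurable_fun setT (box_fun a b k : X -> R).
  by apply: continuous_measurable_Rn; exact: lipschitz_continuous (@box_fun_lip a b k).
have b1 k x : `|box_fun a b k x| <= 1.
  by have /andP[h0 h1] := box_fun_itv a b k x; rewrite ger0_norm.
have T0 k : \int[mu]_x (u x * box_fun a b k x) = 0.
  have [||||H [M t]] := @tame_lipschitz _ _ mu Hmu (box_fun a b k) N 1 (k.+1%:R * 2) (mh k) => //.
  - exact: HN.
  - exact: box_fun_lip.
  - exact: T t.
apply/eqP; rewrite -normr_le0; apply/ler_addgt0Pr => e e0; rewrite add0r.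
have [|||||K HK] := @Rint_dominated _ _ _ mu (fun k x => u x * box_fun a b k x)
  (fun x => u x * \1_(cbox a b) x) (fun x => `|u x * cube N x|) _ _ _ _ _ e e0.
- by move=> k; exact: measurable_funM.
- by apply: measurable_funM => //; apply: measurable_indic; exact: measurable_cbox.
- exact: L1_norm.
- move=> k x; rewrite !normrM ler_wpM2l// indicE; case: (boolP (x \in cubeN N)) => xN.
    by rewrite normr1.
  by rewrite HN ?normr0// => h; move/negP: xN; apply; rewrite inE.
- move=> x; rewrite indicE; case: (boolP (x \in cbox a b)) => xb.
    exists 0%N => k _; rewrite /box_fun box_dist0 ?mulr0 ?subr0; last by rewrite inE in xb.
    by rewrite (max_idPr ler01).
  have d0 : 0 < box_dist a b x.
    rewrite lt0r box_dist_ge0 andbT; apply/eqP => d0; move/negP: xb; apply; rewrite inE => i.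
    by have := box_dist_term a b x i; rewrite d0 => -[h1 h2]; apply/andP; split; lra.
  exists (Num.truncn (box_dist a b x)^-1) => k kN; congr (_ * _).
  rewrite /box_fun; apply/max_idPl; rewrite subr_le0 -ler_pdivrMr// mul1r ltW//.
  by rewrite (lt_le_trans (truncnS_gt _))// ler_nat ltnS.
by have := HK K (leqnn K); rewrite T0 sub0r normrN.
Qed.

End null_functions.

Lemma mul_diff (R : comRingType) (k u v a c : R) :
  a = k * u - k * v -> a * c = k * (u * c) - k * (v * c).
Proof. by move=> ->; rewrite mulrBl !mulrA. Qed.

(** * The embedding on the unit ball *)

Section embedding.
Variables (R : realType) (n : nat).
Variable mu : {sigma_finite_measure set (Rn R n) -> \bar R}.
Hypothesis Hmu : is_lebesgue mu.
Hypothesis n_gt0 : (0 < n)%N.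
Local Notation X := (Rn R n).
Local Notation leb := (@lebesgue_measure R).
Local Notation RR := (measurableTypeR R).
Local Notation corr := (corr mu).
Local Notation conv := (conv mu).
Local Notation kt i t := (dil 2^-1 (gker mu i) t).
Local Notation Gm m := (dil 0 (g0 mu) m).
Local Notation cube k := (\1_(@cubeN R n k) : X -> R).
Implicit Types (x y z w : 'rV[R]_n) (f h : X -> R).

Lemma Rint_lin2 (u v : X -> R) (c : R) : L1 mu u -> L1 mu v ->
  \int[mu]_y (c * u y - c * v y) = c * \int[mu]_y u y - c * \int[mu]_y v y.
Proof. by move=> Lu Lv; rewrite RintB ?RintZl//; exact: L1Zl. Qed.

(** The error budget of [psi_total]: P is the pairing at a late time, Q at an early one, and I its
    limit at time 0. *)
Lemma split_error (a I P Q c1 c2 e e' : R) : `|P| <= c1 * e' -> `|Q - I| <= c2 * e' ->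
  `|a - (4 * P - 4 * Q)| <= e / 2 -> e' * (4 * (c1 + c2) + 1) = e / 2 -> 0 <= e' ->
  `|a + 4 * I| <= e.
Proof.
move=> hP hQ ha ee e0.
have -> : a + 4 * I = (a - (4 * P - 4 * Q)) + 4 * P - 4 * (Q - I) by ring.
rewrite (le_trans (ler_normB _ _))// (le_trans (lerD (ler_normD _ _) (lexx _)))//.
rewrite [`|4 * P|]normrM [`|4 * (Q - I)|]normrM !(ger0_norm (ler0n R 4)); lra.
Qed.

Lemma powR_small (d e : R) (N : nat) : 0 < d -> 0 < e ->
  exists k, (N <= k)%N /\ k.+2%:R `^ (- d) <= e.
Proof.
move=> d0 e0; pose A := e `^ (- d^-1); have A0 : 0 < A by exact: powR_gt0.
exists (maxn N (Num.truncn A)); split; first exact: leq_maxl.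
have kA : A <= (maxn N (Num.truncn A)).+2%:R.
  rewrite ltW// (lt_le_trans (truncnS_gt A))// ler_nat ltnS ltnW// ltnS leq_maxr//.
apply: (@le_trans _ _ (A `^ (- d))); first by apply: powR_leN => //; rewrite oppr_le0 ltW.
by rewrite /A -powRrM mulrNN mulVf ?gt_eqF// powRr1// ltW.
Qed.

Section total.
Variables (p : R) (f h H : X -> R) (M : R).
Hypotheses (p1 : 1 <= p) (mf : measurable_fun setT f) (Lf : L1 mu (fun x => `|f x| `^ p)).
Hypotheses (f1 : \int[mu]_x `|f x| `^ p <= 1) (th : tame mu h H M).

Let sd := Lp_sum_dom p1 mf Lf.
Let Lh := tame_L1 th.
Let Phi t := \int[mu]_x (corr (Gm t) f x * h x).

Let Phi_large : exists C, forall t, 0 < t -> `|Phi t| <= C * t `^ (- (n%:R / (2 * p))).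
Proof.
pose A := 1 + (gI mu)^-1; have gI0 : 0 <= (gI mu)^-1 by rewrite invr_ge0 ltW// gI_gt0.
exists (2 * A * \int[mu]_x `|h x|) => t t0; have [LG IG GM] := Gm_est Hmu t0.
have [Lc _ _] := corr_adjoint Hmu sd LG GM Lh.
rewrite mulrAC -RintZl; last exact: L1_norm.
apply: Rint_norm_le; [exact: L1_measurable Lc|exact/L1Zl/L1_norm|].
move=> x; rewrite normrM ler_wpM2r// -[- (n%:R / _)]add0r.
apply: (corr_decay Hmu x p1 mf Lf f1 _ t0 LG).
- by rewrite addr_ge0.
- by rewrite IG powRr0 mulr1 lerDl.
- by move=> y; rewrite sub0r (le_trans (GM y))// ler_wpM2r ?powR_ge0// lerDr.
Qed.

Let Phi_small : exists C, forall t, 0 < t -> `|Phi t - \int[mu]_x (f x * h x)| <= C * t `^ 2^-1.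
Proof.
have [Hg [Mg [tg LnH]]] := profile_g0 Hmu; have Lg := tame_L1 tg.
have LnK : L1 mu (fun z => nrm z * g0 mu z).
  apply: (L1_dom _ LnH); first by apply: measurable_funM; [exact: measurable_nrm|exact: L1_measurable Lg].
  move=> z; rewrite normrM (ger0_norm (nrm_ge0 z)) ler_wpM2l ?nrm_ge0//.
  by have [_ KH _ _ _] := tg.
pose J := \int[mu]_z `|nrm z * g0 mu z|.
pose IF := \int[mu]_y `| `|f y| `^ p|.
have IF0 : 0 <= IF by exact: Rintegral_ge0.
exists (2 * \int[mu]_y H y * J + 2 * M * J * IF) => t t0.
have [LG IG GM] := Gm_est Hmu t0.
have L1' : L1 mu (fun z => nrm z * Gm t z).
  by apply: (eq_L1 _ (dil_L1 Hmu (0 - 2^-1) t0 LnK)) => z; rewrite dil_nrm.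
have JE : \int[mu]_z (nrm z * `|Gm t z|) = t `^ 2^-1 * J.
  have En z : nrm z * `|Gm t z| = `|dil (0 - 2^-1) (fun z => nrm z * g0 mu z) t z|.
    by rewrite -dil_nrm// [RHS]normrM (ger0_norm (nrm_ge0 z)).
  by rewrite (eq_RintX mu En) dil_int_norm// sub0r opprK.
have I1 : \int[mu]_z Gm t z = 1 by rewrite dil_int// oppr0 powRr0 mul1r Rint_g0.
have [B1 B2] := conv_approx Hmu LG (ex_intro _ _ GM) L1' th.
pose w y := conv (Gm t) h y - h y.
have wE y : conv (Gm t) h y - \int[mu]_z Gm t z * h y = w y by rewrite I1 mul1r.
have Lc := L1_convol Hmu LG GM Lh.
have Lw : L1 mu w by exact: L1B.
have wM y : `|w y| <= 2 * M * (t `^ 2^-1 * J) by rewrite -wE -JE.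
have w1 : \int[mu]_y `|w y| <= 2 * \int[mu]_y H y * (t `^ 2^-1 * J).
  by rewrite -JE -(eq_RintX mu (fun y => congr1 Num.norm (wE y))).
have [Lfw Bw] := sum_dom_mul sd Lw wM.
have [_ Lfc E] := corr_adjoint Hmu sd LG GM Lh.
have [Lfh _] := sum_dom_mul sd Lh (tame_bound th).
rewrite /Phi E -(RintB Lfc Lfh) (@eq_RintX _ _ mu _ (fun y => f y * w y)); last first.
  by move=> y; rewrite -mulrBr.
rewrite (le_trans (Rint_norm Lfw))// (le_trans Bw)//.
apply: (@le_trans _ _ (2 * \int[mu]_y H y * (t `^ 2^-1 * J) + 2 * M * (t `^ 2^-1 * J) * IF)).
  by rewrite lerD2r.
by rewrite le_eqVlt; apply/orP; left; apply/eqP; ring.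
Qed.

(** The indicator of [s, T] is treated as a weight, so [superk_pair] performs the exchange of
    integrals, and the kernel becomes a difference of two Gaussians by the heat equation. *)
Let FTC s T : 0 < s -> s < T ->
  \int[leb]_t (\1_(`[s, T]%classic) t * psi mu 1 (lker mu) f h t) = 4 * Phi T - 4 * Phi s.
Proof.
move=> s0 sT; have T0 : 0 < T by exact: lt_trans sT.
pose om : RR -> R := \1_(`[s, T]%classic).
have mom : measurable_fun setT om by apply: measurable_indic; exact: measurable_itv.
have om0 t : 0 <= om t by [].
have omI t : om t != 0 -> s <= t <= T.
  by rewrite /om indicE; case: (boolP (t \in _)); rewrite ?eqxx// inE/= in_itv.
have omr t : om t != 0 -> 0 < 0 + t by move/omI => /andP[h1 _]; rewrite add0r (lt_le_trans s0).
have Lom : L1 leb om.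
  apply: (L1_bound (M := T - s) _ _ _).1 => //.
  have fin : leb `[s, T]%classic = (T - s)%:E by rewrite lebesgue_measure_itv/= lte_fin sT -EFinB.
  have E : (\int[leb]_t (om t)%:E = leb (`[s, T]%classic `&` setT))%E by exact: integral_indic.
  by rewrite setIT fin in E; rewrite [X in (X <= _)%E]E.
have Lo e : 0 <= e -> L1 leb (fun t => om t * (0 + t) `^ (- e)).
  move=> e0; apply: (L1_dom _ (L1Zl (s `^ (- e)) Lom)).
    apply: measurable_funM => //; apply: (measurableT_comp (@measurable_powR R (- e))).
    exact: measurable_funD.
  move=> t; rewrite ger0_norm ?mulr_ge0 ?powR_ge0// mulrC add0r.
  have [->|/omI/andP[h1 _]] := eqVneq (om t) 0; first by rewrite !mulr0.
  by rewrite ler_wpM2r// powR_leN// oppr_le0.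
have [Hl [Ml [tl _]]] := profile_lker Hmu.
have nn : 0 <= 1 + n%:R / 2 :> R by rewrite addr_ge0// divr_ge0.
have [_ E] := superk_pair Hmu mom om0 omr (Lo _ ler01) (Lo _ nn) sd (tame_L1 tl) (tame_bound tl) Lh.
set K0 := superk _ om _ _ _ in E.
have Es z : K0 z = 4 * Gm T z - 4 * Gm s z.
  rewrite /K0 /superk /Rintegral -[RHS]/(fine (4 * Gm T z - 4 * Gm s z)%:E) -(gauss_FTC Hmu z s0 sT).
  congr fine; rewrite [RHS]integral_mkcond; apply: eq_integral => t _.
  by rewrite /patch /om indicE add0r; case: ifP => _; rewrite ?mul1r ?mul0r.
clearbody K0; have [LGT _ GMT] := Gm_est Hmu T0; have [LGs _ GMs] := Gm_est Hmu s0.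
have Ec x : corr K0 f x = 4 * corr (Gm T) f x - 4 * corr (Gm s) f x.
  have [LT _] := corr_bound Hmu x sd LGT GMT; have [Ls _] := corr_bound Hmu x sd LGs GMs.
  transitivity (\int[mu]_y (4 * (f y * Gm T (y - x)) - 4 * (f y * Gm s (y - x)))).
    rewrite /corr; apply: (@eq_RintX _ _ mu) => y; rewrite Es.
    move: (Gm T (y - x)) (Gm s (y - x)) => A B; ring.
  exact: (Rint_lin2 4 LT Ls).
transitivity (\int[leb]_t (om t * \int[mu]_x (corr (dil 1 (lker mu) (0 + t)) f x * h x))).
  by apply: eq_Rint => t; rewrite add0r.
have [LT _ _] := corr_adjoint Hmu sd LGT GMT Lh; have [Ls _ _] := corr_adjoint Hmu sd LGs GMs Lh.
rewrite -E.
have Eh x : corr K0 f x * h x = 4 * (corr (Gm T) f x * h x) - 4 * (corr (Gm s) f x * h x).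
  exact: (mul_diff (h x) (Ec x)).
rewrite (eq_RintX mu Eh).
exact: (Rint_lin2 4 LT Ls).
Qed.

(* The heat flow joins h at time 0 to 0 at time infinity. *)
Lemma psi_total : L1 leb (fun v => pw 1 v * psi mu 1 (lker mu) f h v) ->
  \int[leb]_v (pw 1 v * psi mu 1 (lker mu) f h v) = - (4 * \int[mu]_x (f x * h x)).
Proof.
move=> LP; have [C1 H1] := Phi_large; have [C2 H2] := Phi_small.
set a := Rintegral _ _ _; pose I := \int[mu]_x (f x * h x); rewrite -/I.
have p0 : 0 < p by exact: lt_le_trans p1.
(* The slower of the rates t^(1/2) at 0 and t^(-n/(2p)) at infinity serves both ends; n > 0 makes it
   positive. *)
pose d := Num.min 2^-1 (n%:R / (2 * p)).
have d0 : 0 < d by rewrite lt_min invr_gt0 ltr0n/= divr_gt0 ?ltr0n// mulr_gt0.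
have mps : measurable_fun setT (psi mu 1 (lker mu) f h : RR -> R).
  have [Hl [Ml [tl _]]] := profile_lker Hmu.
  by apply: measurable_psi => //; [exact: tame_measurable tl|exact: L1_measurable Lh].
pose s k : R := k.+2%:R^-1; pose T k : R := k.+2%:R.
have s0 k : 0 < s k by rewrite invr_gt0.
have sT k : s k < T k.
  apply: (@lt_le_trans _ _ 1); last by rewrite /T ler1n.
  by rewrite /s invf_lt1// ltr1n.
apply/eqP; rewrite -subr_eq0 opprK -normr_le0; apply/ler_addgt0Pr => e e0; rewrite add0r.
(* Chosen so that the errors 4 |C1| e' and 4 |C2| e' at the two ends use at most half of e. *)
pose e' := e / 2 / (4 * (`|C1| + `|C2|) + 1).
have den : 0 < 4 * (`|C1| + `|C2|) + 1 by rewrite ltr_wpDl// mulr_ge0// addr_ge0.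
have e'0 : 0 < e' by rewrite !divr_gt0.
have [||||||N HN] := @Rint_dominated _ _ _ leb (fun k t => \1_(`[s k, T k]%classic) t * psi mu 1 (lker mu) f h t)
  (fun t => pw 1 t * psi mu 1 (lker mu) f h t) (fun t => `|pw 1 t * psi mu 1 (lker mu) f h t|) _ _ _ _ _ (e / 2).
- by move=> k; apply: measurable_funM => //; apply: measurable_indic; exact: measurable_itv.
- exact: L1_measurable LP.
- exact: L1_norm.
- move=> k t; rewrite !normrM ler_wpM2r// indicE; case: (boolP (t \in _)); last by rewrite normr0.
  rewrite inE/= in_itv/= => /andP[h1 _].
  by rewrite pwE ?(lt_le_trans (s0 k))// subrr powRr0.
- move=> t; have [t0|t0] := leP t 0.
    exists 0%N => k _; rewrite pw_le0// indicE memNset ?mul0r//= in_itv/= => /andP[h1 _].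
    by have := lt_le_trans (s0 k) h1; rewrite ltNge t0.
  exists (maxn (Num.truncn t) (Num.truncn t^-1)) => k; rewrite geq_max => /andP[k1 k2].
  rewrite pwE// subrr powRr0 indicE mem_set//= in_itv/=; apply/andP; split.
    rewrite /s -[leRHS]invrK lef_pV2 ?posrE ?invr_gt0// ltW//.
    by rewrite (lt_le_trans (truncnS_gt _))// ler_nat ltnS ltnW.
  by rewrite ltW// (lt_le_trans (truncnS_gt _))// ler_nat ltnS ltnW.
- by rewrite divr_gt0.
have [k [Nk kd]] := powR_small N d0 e'0.
have := HN k Nk; rewrite FTC// => h3.
have T1 : 1 <= T k by rewrite /T ler1n.
have T0 : 0 < T k by exact: lt_le_trans T1.
have hT : `|Phi (T k)| <= `|C1| * e'.
  rewrite (le_trans (H1 _ T0))// (le_trans (ler_wpM2r (powR_ge0 _ _) (ler_norm C1)))//.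
  by rewrite ler_wpM2l// (le_trans _ kd)// ler_powR// lerN2 /d ge_min lexx orbT.
have hs : `|Phi (s k) - I| <= `|C2| * e'.
  rewrite (le_trans (H2 _ (s0 k)))// (le_trans (ler_wpM2r (powR_ge0 _ _) (ler_norm C2)))//.
  rewrite ler_wpM2l// (le_trans _ kd)// /s -powR_inv1// -powRrM mulN1r.
  by apply: ler_powR; [rewrite ler1n|rewrite lerN2 /d ge_min lexx].
have ee : e' * (4 * (`|C1| + `|C2|) + 1) = e / 2 by rewrite /e' divfK// gt_eqF.
rewrite distrC -/a in h3.
exact: (split_error hT hs h3 ee (ltW e'0)).
Qed.

End total.

Section normalised.
Variables (alpha beta p q : R).
Hypotheses (Hb0 : 0 < beta) (Hba : beta < alpha) (Ha1 : alpha <= 1).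
Hypotheses (p1 : 1 <= p) (pq : p <= q) (Hqn : q * (n%:R + beta - alpha) < n%:R).

Let b : R := (1 - alpha) / 2.
Let b2 : b < 2^-1.
Proof. by rewrite /b; have := Hb0; have := Hba; lra. Qed.
Let q1 : 1 <= q. Proof. exact: le_trans pq. Qed.

(** Both terms of the norm are normalised, which frees all constants from [f]; a general [f] is
    rescaled at the end. *)
Definition bv_unit f : Prop := [/\ measurable_fun setT f, L1 mu (fun x => `|f x| `^ p),
  \int[mu]_x `|f x| `^ p <= 1 &
  forall phi, unit_test_field phi -> \int[mu]_x (f x * divg mu alpha phi x) <= 1].

(** Brings alpha < 1 and alpha = 1 under one interface, with weight exponent b = (1 - alpha)/2 in
    both cases. *)
Let weight : exists (lam : {sigma_finite_measure set RR -> \bar R}) (om : RR -> R)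
  (kap : 'I_n -> R) (T : 'I_n -> (X -> R) -> X -> R),
  is_weight b lam om /\ forall i, bv_op mu alpha lam om i (kap i) (T i).
Proof.
have [a1|a1] := ltP alpha 1.
  exists leb, (pw b), (fun=> frac_cst mu alpha), (Tg mu b); split.
    by apply: weight_pw; rewrite divr_gt0// subr_gt0.
  by move=> i; apply: bv_op_frac => //; exact: lt_trans Hba.
have aE : alpha = 1 by apply/eqP; rewrite eq_le Ha1.
exists (\d_(0 : RR)), (fun t => (0 <= t)%R%:R), (fun=> 1), (fun i u => 'D_(delta_mx 0 i : 'rV[R]_n) u).
split; first by rewrite /b aE subrr mul0r; exact: weight_dirac.
by move=> i; rewrite aE; exact: bv_op_classical.
Qed.

Let np0 : 0 <= n%:R / (2 * p) :> R.
Proof. by rewrite divr_ge0// mulr_ge0// (le_trans ler01). Qed.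

(** The superposition with a = (alpha - beta)/2 complements b to a + b = (1 - beta)/2, the weight of
    the gradient of order beta. *)
Lemma gradient_component i : exists C, 0 <= C /\ forall f, bv_unit f -> exists G : X -> R,
  [/\ measurable_fun setT G, L1 mu (fun x => `|G x| `^ q), \int[mu]_x `|G x| `^ q <= C &
   forall h H M, tame mu h H M -> L1 mu (fun x => G x * h x) /\
   \int[mu]_x (G x * h x) = - frac_cst mu beta *
     \int[leb]_v (pw ((1 - beta) / 2) v * psi mu 2^-1 (gker mu i) f h v)].
Proof.
have [lam [om [kap [T [Hw HT]]]]] := weight.
have [H [M [tK LnH]]] := profile_gker Hmu i.
have a0 : 0 < (alpha - beta) / 2 by rewrite divr_gt0// subr_gt0.
have gI0 : 0 <= (gI mu)^-1 by rewrite invr_ge0 ltW// gI_gt0.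
have kap0 : 0 <= (kap i)^-1 by rewrite invr_ge0; have [k0 _ _] := HT i; exact: ltW.
pose C1 := (kap i)^-1 * (1 + (gI mu)^-1).
have C10 : 0 <= C1 by rewrite mulr_ge0// addr_ge0.
(* Exactly the hypothesis q(n + beta - alpha) < n, up to the factor 1/2. *)
have c1 : 0 < (alpha - beta) / 2 * q + (- (n%:R / 2) * (q - 1) + 0).
  by have := Hqn; lra.
(* Since b - 1/2 = -alpha/2, the first two terms sum to -beta q/2: convergence at infinity is due to
   beta > 0. *)
have c2 : (alpha - beta) / 2 * q + ((b - 2^-1) * q - n%:R / (2 * p) * (q - p)) < 0.
  have h1 : 0 <= n%:R / (2 * p) * (q - p) by rewrite mulr_ge0// subr_ge0.
  have h2 : 0 < beta * q by rewrite mulr_gt0// (lt_le_trans ltr01).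
  by rewrite /b; lra.
have c3 : 0 < (alpha - beta) / 2 + b + (2^-1 - 2^-1) by rewrite /b; have := Hba; have := Ha1; lra.
have c4 : (alpha - beta) / 2 + b + (- 2^-1 - n%:R / (2 * p)) < 0 by rewrite /b; have := np0; have := Hb0; lra.
have [C [B [C0 B0 HC]]] := superposed_family Hmu Hw b2 a0 p1 pq C10 tK LnH (Rint_gker Hmu i) c1 c2 c3 c4.
(* Divides out the Beta constant [B]; the minus sign is that of integration by parts. *)
pose c := - (frac_cst mu beta / B).
exists (`|c| `^ q * C); split; first by rewrite mulr_ge0 ?powR_ge0.
move=> f [mf Lf f1 BVf]; have sd := Lp_sum_dom p1 mf Lf.
have [|mF LF BF P] := HC f mf Lf f1.
  move=> r r0; have [L I S] := bv_bound Hmu Hw b2 (HT i) sd BVf r0.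
  split => //.
  - by rewrite powRr0 mulr1 (le_trans I)// ler_peMr// lerDl.
  - move=> x; rewrite (le_trans (S x))// /C1 -mulrA ler_wpM2l//.
    by rewrite ler_wpM2r ?powR_ge0// lerDr.
exists (fun x => c * superpose ((alpha - beta) / 2) (fam mu lam om 2^-1 (gker mu i) f) x); split.
- exact: measurable_funM.
- by apply: (eq_L1 _ (L1Zl (`|c| `^ q) LF)) => x; rewrite normrM powRM.
- rewrite (@eq_RintX _ _ mu _ (fun x => `|c| `^ q *
    `|superpose ((alpha - beta) / 2) (fam mu lam om 2^-1 (gker mu i) f) x| `^ q)); last first.
    by move=> x; rewrite normrM powRM.
  by rewrite RintZl// ler_wpM2l ?powR_ge0.
- move=> h Hh Mh th; have [L _ E] := P h Hh Mh th.
  split; first by apply: (eq_L1 _ (L1Zl c L)) => x; rewrite mulrA.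
  rewrite (@eq_RintX _ _ mu _ (fun x => c *
    (superpose ((alpha - beta) / 2) (fam mu lam om 2^-1 (gker mu i) f) x * h x))); last first.
    by move=> x; rewrite mulrA.
  rewrite RintZl// E /c (_ : (alpha - beta) / 2 + b = (1 - beta) / 2); last by rewrite /b; field.
  by field; rewrite gt_eqF.
Qed.

(** With a = (1 + alpha)/2 one has a + b = 1, so the superposition is a multiple of the plain time
    integral of the Laplacian flow, which recovers [f]. *)
Lemma higher_integrability : exists C, 0 <= C /\ forall f, bv_unit f ->
  L1 mu (fun x => `|f x| `^ q) /\ \int[mu]_x `|f x| `^ q <= C.
Proof.
(* For p = q the left side of [c2] below would be 0, while the claim holds with constant 1. *)
have [pE|pn] := eqVneq p q.
  by exists 1; split => // f [_ Lf f1 _]; rewrite -pE.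
have plq : p < q by rewrite lt_neqAle pn.
have [lam [om [kap [T [Hw HT]]]]] := weight.
have [H [M [tK LnH]]] := profile_lker Hmu.
have [C1 [C10 HC1]] := lker_bound Hmu Hw b2 HT.
have a0 : 0 < (1 + alpha) / 2 by have := Hb0; have := Hba; lra.
have b1 : b < 1 by have := b2; lra.
have p0 : 0 < p by exact: lt_le_trans p1.
have np : 0 < n%:R / (2 * p) :> R by rewrite divr_gt0 ?ltr0n// mulr_gt0.
(* Amounts to q(n - alpha) < n, which the hypothesis gives with beta q to spare. *)
have c1 : 0 < (1 + alpha) / 2 * q + ((- 2^-1 - n%:R / 2) * (q - 1) + - 2^-1).
  have h1 : 0 < beta * q by rewrite mulr_gt0// (lt_le_trans ltr01).
  by have := Hqn; lra.
have c2 : (1 + alpha) / 2 * q + ((b - 1) * q - n%:R / (2 * p) * (q - p)) < 0.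
  have h1 : 0 < n%:R / (2 * p) * (q - p) by rewrite mulr_gt0// subr_gt0.
  by rewrite /b; lra.
have c3 : 0 < (1 + alpha) / 2 + b + (2^-1 - 1) by rewrite /b; lra.
have c4 : (1 + alpha) / 2 + b + (- 1 - n%:R / (2 * p)) < 0 by rewrite /b; lra.
have [C [B [C0 B0 HC]]] := superposed_family Hmu Hw b1 a0 p1 pq C10 tK LnH (Rint_lker Hmu) c1 c2 c3 c4.
(* 4 from the heat equation, [B] from the composition of weights: weakly, the superposition equals
   -c f. *)
pose c := 4 * B; have c0 : 0 < c by rewrite mulr_gt0.
exists (c^-1 `^ q * C); split; first by rewrite mulr_ge0 ?powR_ge0.
move=> f [mf Lf f1 BVf]; have sd := Lp_sum_dom p1 mf Lf.
have [|mF LF BF P] := HC f mf Lf f1; first exact: HC1 sd BVf.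
set F := superpose _ _ in mF LF BF P.
pose u (x : X) := F x + c * f x.
have mu_ : measurable_fun setT u by apply: measurable_funD => //; exact: measurable_funM.
have Lcube (g : X -> R) (s : R) (k : nat) : 1 <= s -> measurable_fun setT g -> L1 mu (fun x => `|g x| `^ s) ->
    L1 mu (fun x => g x * cube k x).
  move=> s1 mg Lg; have c1' x : `|cube k x| <= 1 by rewrite indicE; case: (_ \in _); rewrite ?normr1 ?normr0.
  exact: (sum_dom_mul (Lp_sum_dom s1 mg Lg) (L1_cube Hmu k) c1').1.
have Lu k : L1 mu (fun x => u x * cube k x).
  apply: (eq_L1 _ (L1D (Lcube F q k q1 mF LF) (L1Zl c (Lcube f p k p1 mf Lf)))) => x.
  by rewrite /u mulrDl mulrA.
have Z : ae_eq mu setT u (cst 0).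
  apply: null_tame => // h Hh Mh th; have [LFh LP E] := P h Hh Mh th.
  have [Lfh _] := sum_dom_mul sd (tame_L1 th) (tame_bound th).
  rewrite (@eq_RintX _ _ mu _ (fun x => F x * h x + c * (f x * h x))); last first.
    by move=> x; rewrite /u mulrDl mulrA.
  have bE : (1 + alpha) / 2 + b = 1 by rewrite /b; field.
  rewrite RintD// ?RintZl//; last exact: L1Zl.
  rewrite E; rewrite bE in LP *.
  by rewrite (psi_total p1 mf Lf f1 th LP) /c; ring.
have mq (v : X -> R) : measurable_fun setT v -> measurable_fun setT (fun x : X => `|v x| `^ q).
  move=> mv; apply: (measurableT_comp (@measurable_powR R q)); exact: measurableT_comp.
have Z' : ae_eq mu setT (fun x => (`|f x| `^ q)%:E) (fun x => (c^-1 `^ q * `|F x| `^ q)%:E).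
  have [N [mN N0 sN]] := Z; exists N; split => // x /= nZ; apply: sN => /= hu; apply: nZ => _.
  congr EFin; have := hu I; rewrite /u => /eqP; rewrite addrC addr_eq0 => /eqP fE.
  have -> : f x = c^-1 * - F x by rewrite -fE mulKf// gt_eqF.
  by rewrite normrM normrN powRM// ger0_norm// invr_ge0 ltW.
have mqf := mq f mf; have mqF := mq F mF.
have IE : (\int[mu]_x (`|f x| `^ q)%:E = \int[mu]_x (c^-1 `^ q * `|F x| `^ q)%:E)%E.
  apply: ae_eq_integral => //; first exact/measurable_EFinP.
  by apply/measurable_EFinP; exact: measurable_funM.
apply: L1_bound => //.
by rewrite IE -(EFin_Rint (L1Zl _ LF)) lee_fin RintZl// ler_wpM2l ?powR_ge0.
Qed.

End normalised.
End embedding.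

(** * Extended L^p norms and real integrals *)

Section Lebesgue_norms.
Variables (R : realType) (n : nat).
Variable mu : {sigma_finite_measure set (Rn R n) -> \bar R}.
Local Notation X := (Rn R n).
Implicit Types (f : X -> R) (p : R).

Lemma LpnormE f p : L1 mu (fun x => `|f x| `^ p) ->
  Lpnorm mu p%:E f = ((\int[mu]_x `|f x| `^ p) `^ p^-1)%:E.
Proof. by move=> L; rewrite /Lpnorm unlock -poweR_EFin (EFin_Rint L). Qed.

Lemma Lpnorm_L1 f p : 0 < p -> measurable_fun setT f -> (Lpnorm mu p%:E f < +oo)%E ->
  L1 mu (fun x => `|f x| `^ p).
Proof.
move=> p0 mf; rewrite /Lpnorm unlock => h.
have mfp : measurable_fun setT (fun x : X => `|f x| `^ p).
  by apply: (measurableT_comp (@measurable_powR R p)); exact: measurableT_comp.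
have I0 : (0 <= \int[mu]_x (`|f x| `^ p)%:E)%E.
  by apply: integral_ge0 => x _; rewrite lee_fin powR_ge0.
have fin : (\int[mu]_x (`|f x| `^ p)%:E < +oo)%E.
  rewrite ltey; apply/eqP => E; move: h.
  rewrite (_ : (\int[mu]_x (`|(f x)%:E| `^ p))%E = (\int[mu]_x (`|f x| `^ p)%:E)%E)// E poweRyr ?ltxx//.
  by rewrite invr_eq0 gt_eqF.
apply: (L1_bound (M := fine (\int[mu]_x (`|f x| `^ p)%:E)%E) mfp _ _).1.
  by move=> x; exact: powR_ge0.
by rewrite fineK// ge0_fin_numE.
Qed.

Lemma Lpnorm_le f p A : 0 < p -> 0 <= A -> L1 mu (fun x => `|f x| `^ p) ->
  \int[mu]_x `|f x| `^ p <= A `^ p -> (Lpnorm mu p%:E f <= A%:E)%E.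
Proof.
move=> p0 A0 L h; rewrite LpnormE// lee_fin.
have -> : A = (A `^ p) `^ p^-1 by rewrite -powRrM mulfV ?gt_eqF// powRr1.
by apply: powR_le => //; [rewrite invr_ge0 ltW|apply: Rintegral_ge0 => x _; exact: powR_ge0].
Qed.

(** Each a_i is at most the p-th root of the sum of p-th powers; adding n such bounds gives the
    factor n^p. *)
Lemma sum_powR (a : 'I_n -> R) p : 0 < p -> (forall i, 0 <= a i) ->
  (\sum_i a i) `^ p <= n%:R `^ p * \sum_i a i `^ p.
Proof.
move=> p0 a0; set S := \sum_i a i `^ p.
have S0 : 0 <= S by apply: sumr_ge0 => i _; exact: powR_ge0.
have aS i : a i <= S `^ p^-1.
  have -> : a i = (a i `^ p) `^ p^-1 by rewrite -powRrM mulfV ?gt_eqF// powRr1.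
  apply: powR_le; [by rewrite invr_ge0 ltW|exact: powR_ge0|].
  by rewrite /S (bigD1 i)//= lerDl sumr_ge0// => j _; exact: powR_ge0.
have h : \sum_i a i <= n%:R * S `^ p^-1.
  rewrite -[n in n%:R]card_ord -sum1_card natr_sum mulr_suml; apply: ler_sum => i _.
  by rewrite mul1r.
have := powR_le (ltW p0) (sumr_ge0 _ (fun i _ => a0 i)) h.
by rewrite powRM ?powR_ge0// -powRrM mulVf ?gt_eqF// powRr1.
Qed.

Lemma enorm_le (v : 'rV[R]_n) : enorm v <= \sum_i `|v 0 i|.
Proof.
rewrite /enorm -[leRHS]ger0_norm ?sumr_ge0// -sqrtr_sqr ler_sqrt ?sqr_ge0//.
exact: sqn_le_nrm2.
Qed.

End Lebesgue_norms.

(** * The weak gradient, and rescaling from the unit ball *)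

Section main.
Variables (R : realType) (n : nat).
Variable mu : {sigma_finite_measure set (Rn R n) -> \bar R}.
Hypothesis Hmu : is_lebesgue mu.
Hypothesis n_gt0 : (0 < n)%N.
Local Notation X := (Rn R n).
Local Notation leb := (@lebesgue_measure R).
Implicit Types (x y z w : 'rV[R]_n) (f h : X -> R).

Lemma test_field_tame (phi : 'rV[R]_n -> 'rV[R]_n) i : test_field phi ->
  exists H M, tame mu (fun y => phi y 0 i) H M.
Proof. by move=> tp; apply: Cc_tame => //; exact: test_field_component. Qed.

(** Puts the left side of the weak gradient identity into the form in which [gradient_component]
    describes the pairing with its candidate. *)
Lemma frac_pairing g f F phi : 0 < g -> g < 1 -> sum_dom mu f F -> test_field phi ->
  L1 mu (fun x => f x * divg mu g phi x) /\
  \int[mu]_x (f x * divg mu g phi x) = frac_cst mu g *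
    \sum_i \int[leb]_v (pw ((1 - g) / 2) v * psi mu 2^-1 (gker mu i) f (fun y => phi y 0 i) v).
Proof.
move=> g0 g1 fF tp.
have b0 : 0 < (1 - g) / 2 by rewrite divr_gt0// subr_gt0.
have b2 : (1 - g) / 2 < 2^-1 by lra.
have P i : L1 mu (fun x => f x * Tg mu ((1 - g) / 2) i (fun y => phi y 0 i) x) /\
    \int[mu]_x (f x * Tg mu ((1 - g) / 2) i (fun y => phi y 0 i) x) =
    \int[leb]_v (pw ((1 - g) / 2) v * psi mu 2^-1 (gker mu i) f (fun y => phi y 0 i) v).
  have [H [M t]] := test_field_tame i tp.
  have [L E] := Tg_pair Hmu b0 b2 i t fF; split => //; rewrite E; apply: eq_Rint => v.
  have [v0|v0] := leP v 0; first by rewrite (pw_le0 _ v0) !mul0r.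
  congr (_ * _); have [H' [M' [tK _]]] := profile_gker Hmu i.
  have dM z := dil_bound 2^-1 v z (tame_bound tK).
  by have [_ _ /esym] := corr_adjoint Hmu fF (dil_L1 Hmu 2^-1 v0 (tame_L1 tK)) dM (tame_L1 t).
have E x : f x * divg mu g phi x = frac_cst mu g *
    \sum_(i < n) f x * Tg mu ((1 - g) / 2) i (fun y => phi y 0 i) x.
  rewrite /divg lt_eqF// (frac_divE Hmu g0 g1)//; last by move=> i; exact: test_field_tame.
  by rewrite mulrCA mulr_sumr.
have LS := L1_sum (index_enum 'I_n) (fun i => (P i).1).
split; first by apply: (eq_L1 _ (L1Zl (frac_cst mu g) LS)) => x; rewrite E.
rewrite (eq_RintX mu E) (RintZl _ LS) (Rint_sum (index_enum 'I_n) (fun i => (P i).1)).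
by congr (_ * _); apply: eq_bigr => i _; exact: (P i).2.
Qed.

Lemma divg_L1 g f F phi : 0 < g -> g <= 1 -> sum_dom mu f F -> test_field phi ->
  L1 mu (fun x => f x * divg mu g phi x).
Proof.
move=> g0; rewrite le_eqVlt => /predU1P[->|g1] fF tp; last exact: (frac_pairing g0 g1 fF tp).1.
have L i : L1 mu (fun x => f x * 'D_(delta_mx 0 i : 'rV[R]_n) (fun y => phi y 0 i) x).
  have CD := Cc_deriv (delta_mx 0 i) (test_field_component i tp).
  have [H [M t]] := Cc_tame Hmu CD.
  exact: (sum_dom_mul fF (tame_L1 t) (tame_bound t)).1.
apply: (eq_L1 _ (L1_sum (index_enum 'I_n) L)) => x.
by rewrite /divg eqxx /classical_div mulr_sumr.
Qed.

(** The zero field is admissible; it is built on one coordinate vector, which uses n > 0. *)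
Lemma frac_var_ge0 g f : (0 <= frac_var mu g f)%E.
Proof.
pose i0 := Ordinal n_gt0; pose phi (x : 'rV[R]_n) : 'rV[R]_n := (fun=> 0 : R) x *: delta_mx 0 i0.
have Cz : Cc (fun _ : 'rV[R]_n => 0 : R) by split; [exact: smooth_cst|exists 0].
have up : unit_test_field phi.
  by split; [exact: (test_field_scale i0 Cz)|move=> x; rewrite enorm_delta normr0].
have pz x i : phi x 0 i = 0 by rewrite /phi scale0r mxE.
clearbody phi.
have dz x : divg mu g phi x = 0.
  rewrite /divg; case: ifP => _.
    rewrite /classical_div big1// => i _; rewrite (_ : (fun y => _) = fun=> 0); first exact: derive_cst.
    by apply/funext => y; rewrite pz.
  rewrite /frac_div (@eq_RintX _ _ mu _ (fun=> 0)) ?Rint0 ?mulr0// => y.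
  by rewrite /dotv big1 ?mul0r// => i _; rewrite !mxE !pz subrr mulr0.
apply: ereal_sup_ubound; exists phi => //.
by rewrite (@eq_RintX _ _ mu _ (fun=> 0)) ?Rint0// => x; rewrite dz mulr0.
Qed.

Section exponents.
Variables (alpha beta p q : R).
Hypotheses (Hb0 : 0 < beta) (Hba : beta < alpha) (Ha1 : alpha <= 1).
Hypotheses (p1 : 1 <= p) (pq : p <= q) (Hqn : q * (n%:R + beta - alpha) < n%:R).

Let p0 : 0 < p. Proof. exact: lt_le_trans p1. Qed.
Let q1 : 1 <= q. Proof. exact: le_trans pq. Qed.
Let q0 : 0 < q. Proof. exact: lt_le_trans q1. Qed.
Let b1 : beta < 1. Proof. exact: lt_le_trans Ha1. Qed.
Let a0 : 0 < alpha. Proof. exact: lt_trans Hba. Qed.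

Lemma unit_embedding : exists C, 0 < C /\ forall f, bv_unit mu alpha p f ->
  [/\ L1 mu (fun x => `|f x| `^ q), \int[mu]_x `|f x| `^ q <= C & exists G : 'I_n -> X -> R,
   (forall i, [/\ measurable_fun setT (G i), L1 mu (fun x => `|G i x| `^ q) &
     \int[mu]_x `|G i x| `^ q <= C]) /\ forall phi, test_field phi ->
   (forall i, L1 mu (fun x => G i x * phi x 0 i)) /\
   \int[mu]_x (f x * divg mu beta phi x) = - \sum_i \int[mu]_x (G i x * phi x 0 i)].
Proof.
have [C0 [C00 H0]] := higher_integrability Hmu n_gt0 Hb0 Hba Ha1 p1 pq Hqn.
have [Ci HCi] := choice (gradient_component Hmu Hb0 Hba Ha1 p1 pq Hqn).
have Cs : 0 <= \sum_i Ci i by apply: sumr_ge0 => i _; have [] := HCi i.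
exists (C0 + \sum_i Ci i + 1); split; first by rewrite ltr_wpDl// addr_ge0.
move=> f bf; have [mf Lf f1 BVf] := bf; have sd := Lp_sum_dom p1 mf Lf.
have [Lq Bq] := H0 f bf.
have [G HG] := choice (fun i => (HCi i).2 f bf).
split => //; first by rewrite (le_trans Bq)// -addrA lerDl addr_ge0.
exists G; split.
  move=> i; have [mG LG BG _] := HG i; split => //; rewrite (le_trans BG)//.
  have : Ci i <= \sum_i Ci i.
    by rewrite (bigD1 i)//= lerDl sumr_ge0// => j _; have [] := HCi j.
  by have := C00; lra.
move=> phi tp.
have P i : L1 mu (fun x => G i x * phi x 0 i) /\ \int[mu]_x (G i x * phi x 0 i) =
    - frac_cst mu beta * \int[leb]_v (pw ((1 - beta) / 2) v * psi mu 2^-1 (gker mu i) f (fun y => phi y 0 i) v).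
  by have [H [M t]] := test_field_tame i tp; have [_ _ _ h] := HG i; exact: h t.
split; first by move=> i; have [] := P i.
rewrite (frac_pairing Hb0 b1 sd tp).2 (eq_bigr _ (fun i _ => (P i).2)) -mulr_sumr mulNr opprK//.
Qed.

Lemma sigma_finite_embedding : exists C : R, 0 < C /\
  forall f : 'rV[R]_n -> R, inBV mu alpha p%:E f ->
    inLp mu q%:E f /\ exists G : 'rV[R]_n -> 'rV[R]_n,
      weak_frac_grad mu beta q%:E f G /\
      (Snorm mu q%:E f G <= C%:E * BVnorm mu alpha p%:E f)%E.
Proof.
have [C [C0 HC]] := unit_embedding.
have nq0 : 0 <= n%:R `^ q * (n%:R * C) by rewrite mulr_ge0 ?powR_ge0// mulr_ge0// ltW.
(* q-th roots of the integral bounds for [f] and for its gradient; n^q (n C) comes from [sum_powR]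
   over n components, each bounded by C. *)
pose A1 := C `^ q^-1; pose A2 := (n%:R `^ q * (n%:R * C)) `^ q^-1.
have A10 : 0 < A1 by exact: powR_gt0.
have A20 : 0 <= A2 by exact: powR_ge0.
have A1q : A1 `^ q = C by rewrite /A1 -powRrM mulVf ?gt_eqF// powRr1// ltW.
have A2q : A2 `^ q = n%:R `^ q * (n%:R * C) by rewrite /A2 -powRrM mulVf ?gt_eqF// powRr1.
exists (A1 + A2); split; first by rewrite ltr_wpDr.
move=> f [[mf fp] fv]; have Lf := Lpnorm_L1 p0 mf fp.
pose a := (\int[mu]_x `|f x| `^ p) `^ p^-1.
have I0 : 0 <= \int[mu]_x `|f x| `^ p by apply: Rintegral_ge0 => x _; exact: powR_ge0.
have aE : Lpnorm mu p%:E f = a%:E by exact: LpnormE.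
have ap : a `^ p = \int[mu]_x `|f x| `^ p by rewrite /a -powRrM mulVf ?gt_eqF// powRr1.
have a_ge0 : 0 <= a by exact: powR_ge0.
have V0 := frac_var_ge0 alpha f.
pose V := fine (frac_var mu alpha f).
have VE : frac_var mu alpha f = V%:E by rewrite fineK// ge0_fin_numE.
have V_ge0 : 0 <= V by rewrite -lee_fin -VE.
have sd := Lp_sum_dom p1 mf Lf.
have VB phi : unit_test_field phi -> \int[mu]_x (f x * divg mu alpha phi x) <= V.
  by move=> up; rewrite -lee_fin -VE; apply: ereal_sup_ubound; exists phi.
have BE : BVnorm mu alpha p%:E f = (a + V)%:E by rewrite /BVnorm aE VE.
rewrite BE; have mq (v : X -> R) : measurable_fun setT v -> measurable_fun setT (fun x : X => `|v x| `^ q).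
  by move=> mv; apply: (measurableT_comp (@measurable_powR R q)); exact: measurableT_comp.
(* A zero norm cannot be scaled to 1, but it forces f = 0 almost everywhere, and G = 0 is then a
   weak gradient. *)
have [N0|NN] := eqVneq (a + V) 0.
  have az : a = 0 by apply/le_anti; rewrite a_ge0 andbT -N0 lerDl V_ge0.
  have Z : ae_eq mu setT f (cst 0).
    have mE : measurable_fun setT (EFin \o f : X -> \bar R) by exact/measurable_EFinP.
    have pE : (0 < p%:E)%E by rewrite lte_fin.
    have nE : Lnorm mu p%:E (EFin \o f) = 0%E by rewrite -[LHS]/(Lpnorm mu p%:E f) aE az.
    have [N [mN mN0 sN]] := Lnorm_eq0_eq0 mE pE nE; exists N; split => // x /= h; apply: sN => /= h'.
    apply: h => _; have {}h' : (f x)%:E = 0%E by exact: h'.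
    by case: h'.
  have Iq : (\int[mu]_x (`|f x| `^ q)%:E = 0)%E.
    rewrite -(integral0 mu setT); apply: ae_eq_integral => //.
      by apply/measurable_EFinP; exact: mq.
    have [N [mN mN0 sN]] := Z; exists N; split => // x /= h; apply: sN => /= h'.
    by apply: h => _; rewrite h'// normr0 powR0// gt_eqF.
  have [Lq Bq] : L1 mu (fun x => `|f x| `^ q) /\ \int[mu]_x `|f x| `^ q <= 0 `^ q.
    rewrite powR0 ?gt_eqF//; apply: L1_bound; [exact: mq|by move=> x; exact: powR_ge0|by rewrite Iq].
  have fq := Lpnorm_le q0 (lexx 0) Lq Bq.
  have ez : (fun x : 'rV[R]_n => enorm (0 : 'rV[R]_n)) = fun=> 0.
    by apply/funext => x; rewrite /enorm /dotv big1 ?sqrtr0// => i _; rewrite mxE mul0r.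
  have gz : Lpnorm mu q%:E (fun x : 'rV[R]_n => enorm (0 : 'rV[R]_n)) = 0%E.
    rewrite ez; apply: Lnorm0; by rewrite eqe gt_eqF.
  split; first by split => //; apply: le_lt_trans fq _; rewrite ltry.
  exists (fun=> 0); split; last by rewrite /Snorm gz adde0 N0 mule0.
  split; first by move=> i; exact: measurable_cst.
  split; first by rewrite gz ltry.
  move=> phi tp.
  rewrite (@eq_RintX _ _ mu (fun x => dotv 0 (phi x)) (fun=> 0)) ?Rint0 ?oppr0; last first.
    by move=> x; rewrite /dotv big1// => i _; rewrite mxE mul0r.
  rewrite -(Rint0 mu); apply: ae_eq_Rint => //.
    exact: L1_measurable (divg_L1 Hb0 (ltW b1) sd tp).
  have [N [mN mN0 sN]] := Z; exists N; split => // x /= h; apply: sN => /= h'.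
  by apply: h => _; rewrite h'// mul0r.
set N := a + V in NN *; have Np : 0 < N by rewrite lt0r NN addr_ge0.
have Ni : 0 <= N^-1 by rewrite invr_ge0 ltW.
pose f1 (x : X) := N^-1 * f x.
have mf1 : measurable_fun setT f1 by exact: measurable_funM.
have f1E s x : `|f1 x| `^ s = N^-1 `^ s * `|f x| `^ s by rewrite normrM powRM// ger0_norm.
have bf1 : bv_unit mu alpha p f1.
  split => //.
  - by apply: (eq_L1 _ (L1Zl (N^-1 `^ p) Lf)) => x; rewrite f1E.
  - rewrite (eq_RintX mu (f1E p)) RintZl// -ap -powRM// -[leRHS](powR_1 p).
    by apply: powR_le; [exact: ltW|rewrite mulr_ge0|rewrite mulrC ler_pdivrMr// mul1r lerDl].
  - move=> phi up; have [tp _] := up; have L := divg_L1 a0 Ha1 sd tp.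
    rewrite (@eq_RintX _ _ mu _ (fun x => N^-1 * (f x * divg mu alpha phi x))); last first.
      by move=> x; rewrite mulrA.
    rewrite RintZl// mulrC ler_pdivrMr// mul1r (le_trans (VB phi up))// lerDr//.
have [Lq1 Bq1 [G1 [HG1 PG1]]] := HC f1 bf1.
have Nf s : N `^ s * N^-1 `^ s = 1 by rewrite -powRM ?(ltW Np)// mulfV ?gt_eqF// powR_1.
have fE x : `|f x| `^ q = N `^ q * `|f1 x| `^ q by rewrite f1E mulrA Nf mul1r.
have Lq : L1 mu (fun x => `|f x| `^ q) by apply: (eq_L1 _ (L1Zl (N `^ q) Lq1)) => x; rewrite fE.
have Bq : \int[mu]_x `|f x| `^ q <= (N * A1) `^ q.
  rewrite (eq_RintX mu fE) RintZl// powRM ?(ltW Np) ?(ltW A10)// A1q.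
  by rewrite ler_wpM2l ?powR_ge0.
have NA1 : 0 <= N * A1 by rewrite mulr_ge0// ltW.
have fq := Lpnorm_le q0 NA1 Lq Bq.
pose G (x : 'rV[R]_n) : 'rV[R]_n := \row_i (N * G1 i x).
have mG i : measurable_fun setT (fun x : X => G x 0 i).
  have [mGi _ _] := HG1 i; rewrite (_ : (fun x : X => G x 0 i) = fun x => N * G1 i x); first exact: measurable_funM.
  by apply/funext => x; rewrite mxE.
have meG : measurable_fun setT (fun x : X => enorm (G x)).
  apply: (measurableT_comp (continuous_measurable_fun (@sqrt_continuous R))); apply: measurable_sum => i.
  exact: measurable_funM.
have e0 x : 0 <= enorm (G x) by exact: sqrtr_ge0.
have LS : L1 mu (fun x => \sum_i `|G1 i x| `^ q).
  by apply: (L1_sum (index_enum 'I_n)) => i; have [] := HG1 i.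
have De x : `|enorm (G x)| `^ q <= N `^ q * n%:R `^ q * \sum_i `|G1 i x| `^ q.
  rewrite ger0_norm//; apply: (@le_trans _ _ ((N * \sum_i `|G1 i x|) `^ q)).
    apply: powR_le => //; first exact: ltW.
    rewrite (le_trans (enorm_le _))// mulr_sumr; apply: ler_sum => i _.
    by rewrite mxE normrM ger0_norm// ltW.
  rewrite powRM ?(ltW Np) ?sumr_ge0// -mulrA ler_wpM2l ?powR_ge0//.
  exact: sum_powR.
have LG : L1 mu (fun x => `|enorm (G x)| `^ q).
  apply: (L1_dom (mq _ meG) (L1Zl (N `^ q * n%:R `^ q) LS)) => x.
  by rewrite ger0_norm ?powR_ge0.
have IS : \int[mu]_x (\sum_i `|G1 i x| `^ q) <= n%:R * C.
  rewrite (Rint_sum (index_enum 'I_n)); last by move=> i; have [] := HG1 i.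
  rewrite -[n in n%:R]card_ord -sum1_card natr_sum mulr_suml; apply: ler_sum => i _.
  by rewrite mul1r; have [] := HG1 i.
have BE2 : (N * A2) `^ q = N `^ q * n%:R `^ q * (n%:R * C).
  by rewrite powRM; [rewrite A2q mulrA|exact: ltW|exact: A20].
have BG : \int[mu]_x `|enorm (G x)| `^ q <= (N * A2) `^ q.
  apply: (le_trans (Rint_le LG (L1Zl (N `^ q * n%:R `^ q) LS) De)).
  rewrite BE2 (RintZl (N `^ q * n%:R `^ q) LS); apply: ler_wpM2l IS.
  by rewrite mulr_ge0 ?powR_ge0.
have NA2 : 0 <= N * A2 by rewrite mulr_ge0// ltW.
have Gq := Lpnorm_le q0 NA2 LG BG.
split; first by split => //; apply: le_lt_trans fq _; rewrite ltry.
exists G; split; last first.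
  by rewrite /Snorm -EFinM mulrDl [A1 * N]mulrC [A2 * N]mulrC EFinD; apply: leeD.
split => //; split; first by apply: le_lt_trans Gq _; rewrite ltry.
move=> phi tp; have [LGp E] := PG1 phi tp.
have Lb := divg_L1 Hb0 (ltW b1) (Lp_sum_dom p1 mf1 (let: And4 _ L _ _ := bf1 in L)) tp.
rewrite (@eq_RintX _ _ mu _ (fun x => N * (f1 x * divg mu beta phi x))); last first.
  by move=> x; rewrite /f1 !mulrA mulfV ?mul1r.
rewrite (RintZl N Lb) E mulrN; congr (- _).
rewrite (@eq_RintX _ _ mu _ (fun x => N * \sum_i G1 i x * phi x 0 i)); last first.
  by move=> x; rewrite /dotv mulr_sumr; apply: eq_bigr => i _; rewrite mxE mulrA.
have LGs := L1_sum (index_enum 'I_n) LGp.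
by rewrite (RintZl N LGs) (Rint_sum (index_enum 'I_n) LGp).
Qed.

End exponents.
End main.

Theorem theorem3p7 (R : realType) (n : nat)
  (mu : {measure set (Rn R n) -> \bar R}) (Hmu : is_lebesgue mu)
  (alpha beta : R) (p q : \bar R)
  (Hb0 : 0 < beta) (Hba : beta < alpha) (Ha1 : alpha <= 1)
  (Hp1 : (1 <= p)%E) (Hpq : (p <= q)%E)
  (Hqn : (q < (n%:R / (n%:R + beta - alpha))%:E)%E) :
  exists C : R, 0 < C /\
    forall f : 'rV[R]_n -> R, inBV mu alpha p f ->
      inLp mu q f /\
      exists G : 'rV[R]_n -> 'rV[R]_n,
        weak_frac_grad mu beta q f G /\
        (Snorm mu q f G <= C%:E * BVnorm mu alpha p f)%E.
Proof.
case: p q Hp1 Hpq Hqn => [p0| |]//; case=> [q0| |]// p1 pq qn.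
rewrite !lee_fin in p1 pq; rewrite lte_fin in qn.
have q_gt0 : 0 < q0 by apply: lt_le_trans ltr01 (le_trans p1 pq).
(* For n = 0 the bound on q would read q < 0. *)
have n0 : (0 < n)%N.
  by move: qn; case: (n) => // h; move: (lt_trans q_gt0 h); rewrite mul0r ltxx.
have d0 : 0 < n%:R + beta - alpha.
  have : 1 <= n%:R :> R by rewrite ler1n.
  by move: Hb0 Ha1; lra.
rewrite ltr_pdivlMr// in qn.
move: Hmu; case: mu => m cm Hm.
have sf := lebesgue_sigma_finite Hm.
(* Fubini requires a sigma-finite structure; the given measure obtains it from the exhausting
   cubes. *)
pose s : {sigma_finite_measure set (Rn R n) -> \bar R} :=
  HB.pack m cm (Measure_isSigmaFinite.Build _ _ _ _ sf).
exact: (@sigma_finite_embedding R n s Hm n0 alpha beta p0 q0 Hb0 Hba Ha1 p1 pq qn).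
Qed.
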